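(* Let $\mathbf{E}\in W^{1,\infty}_{\rm loc}(\mathbb{R}^d,\mathbb{R}^d)$ and $k>0$. Assume: (i) there are constants $\alpha,\alpha_2>0$, $\beta,\beta_2\in\mathbb{R}$ and exponents $1<\gamma\le\gamma_2\le 2$ such that for all $x\in\mathbb{R}^d$ $$\alpha|x|^{\gamma}-\beta\le x\cdot\mathbf{E}(x)\le \alpha_2|x|^{\gamma_2}+\beta_2;$$ (ii) there is $\beta_0\in\mathbb{R}$ such that $$-\mathrm{div}(\mathbf{E})(x)+k\,\frac{x}{1+|x|^2}\cdot\mathbf{E}(x)\ge\beta_0\qquad\text{for (a.e.) }x\in\mathbb{R}^d .$$ Then the Fokker--Planck equation $\partial_t f=\Delta f+\mathrm{div}(\mathbf{E}f)$ has a stationary solution. More precisely, there exists a unique strictly positive function $G\in L^2_k$ such that $$LG=0\quad\text{and}\quad\int_{\mathbb{R}^d}G(x)\,dx=1 .$$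
   Context: Write $\langle x\rangle=(1+|x|^2)^{1/2}$. $L^2_k=\{f\in L^2(\mathbb{R}^d):\int_{\mathbb{R}^d}|f(x)|^2\langle x\rangle^k\,dx<\infty\}$, with norm $\|f\|_{L^2_k}^2=\int_{\mathbb{R}^d} |f|^2\langle x\rangle^k\,dx$. The operator $L$ is $Lu=\mathrm{div}(\nabla u+\mathbf{E}u)=\Delta u+\mathrm{div}(\mathbf{E}u)$ (in the sense of distributions) with domain $D(L)=\{u\in L^2_k: Lu\in L^2_k\}$. *)

(* Defs.v *)
From HB Require Import structures.
From mathcomp Require Import all_boot all_order all_algebra.
From mathcomp Require Import all_classical all_reals all_analysis.

Set Implicit Arguments.
Unset Strict Implicit.
Unset Printing Implicit Defensive.
Import Order.TTheory GRing.Theory Num.Theory.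
Import numFieldNormedType.Exports.

Local Open Scope classical_set_scope.
Local Open Scope ring_scope.

Definition rV_display : measure_display.
Proof. exact: default_measure_display. Qed.

(* The product sigma-algebra of n copies of the Borel sigma-algebra of R, as
   for the library instance on n.-tuple T; it is the Borel sigma-algebra. *)
Section measurable_rV.
Context {R : realType} (n : nat).

Let coors : 'I_n -> 'rV[R]_n -> measurableTypeR R := fun i x => x ord0 i.

Let rV_set0 : g_sigma_preimage coors set0.
Proof. exact: sigma_algebra0. Qed.

Let rV_setC A : g_sigma_preimage coors A -> g_sigma_preimage coors (~` A).
Proof. exact: sigma_algebraC. Qed.

Let rV_bigcup (F : _^nat) : (forall i, g_sigma_preimage coors (F i)) ->
  g_sigma_preimage coors (\bigcup_i (F i)).
Proof. exact: sigma_algebra_bigcup. Qed.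

HB.instance Definition _ := @isMeasurable.Build rV_display
  'rV[R]_n (g_sigma_preimage coors) rV_set0 rV_setC rV_bigcup.

Lemma measurable_coord (i : 'I_n) :
  measurable_fun [set: 'rV[R]_n] (fun x => x ord0 i : measurableTypeR R).
Proof.
move=> _ Y mY; rewrite setTI; apply: sub_sigma_algebra => /=.
rewrite -bigcup_seq/=; exists i => /=; first by rewrite mem_index_enum.
by exists Y => //; rewrite setTI.
Qed.

Lemma measurable_fun_rV d (T : measurableType d) (f : T -> 'rV[R]_n) :
  (forall i, measurable_fun [set: T] (fun t => f t ord0 i : measurableTypeR R)) ->
  measurable_fun [set: T] f.
Proof.
move=> mf _ A mA; rewrite setTI; move: A mA.
suff : g_sigma_preimage coors `<=` [set A | measurable (f @^-1` A)] by [].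
apply: smallest_sub.
  split; rewrite /= ?preimage_set0//.
    by move=> A mA; rewrite setTD preimage_setC; exact: measurableC.
  by move=> F mF; rewrite preimage_bigcup; exact: bigcupT_measurable.
rewrite -bigcup_seq => A [i _ [B mB <-]] /=.
by rewrite setTI; have := mf i measurableT B mB; rewrite setTI.
Qed.

End measurable_rV.

Lemma product_sigma_finite d1 d2 (T1 : measurableType d1)
    (T2 : measurableType d2) (R : realType)
    (m1 : {sigma_finite_measure set T1 -> \bar R})
    (m2 : {sigma_finite_measure set T2 -> \bar R}) :
  sigma_finite setT (m1 \x m2)%E.
Proof.
have /sigma_finiteP[F [TF ndF Foo]] := sigma_finiteT m1.
have /sigma_finiteP[G [TG ndG Goo]] := sigma_finiteT m2.
exists (fun n => F n `*` G n).
  rewrite -setXTT TF TG predeqE => -[x y]; split.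
    move=> [/= [n _ Fnx] [k _ Gky]]; exists (maxn n k) => //; split.
    - by move: x Fnx; exact/subsetPset/ndF/leq_maxl.
    - by move: y Gky; exact/subsetPset/ndG/leq_maxr.
  by move=> [n _ []/= ? ?]; split; exists n.
move=> k; have [? ?] := Foo k; have [? ?] := Goo k.
split; first exact: measurableX.
by rewrite product_measure1E// lte_mul_pinfty// ge0_fin_numE.
Qed.

Lemma pushforward_sigma_finite d1 d2 (T1 : measurableType d1)
    (T2 : measurableType d2) (R : realType)
    (p : {measure set T1 -> \bar R}) (f : T1 -> T2) (g : T2 -> T1) :
  sigma_finite setT p ->
  measurable_fun setT f -> measurable_fun setT g -> cancel f g ->
  exists q : {sigma_finite_measure set T2 -> \bar R},
    q = pushforward p f :> (_ -> _).
Proof.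
move=> [F FT Foo] mf mg fK.
have [q qE] : exists q : {measure set T2 -> \bar R},
    q = pushforward p f :> (_ -> _).
  by unshelve refine (ex_intro _ (pushforward p f : {measure set _ -> \bar R}) _).
have qs : sigma_finite setT q.
  exists (fun k => g @^-1` F k); first by rewrite -preimage_bigcup -FT preimage_setT.
  move=> k; have [mF Fk] := Foo k; split.
    by rewrite -[X in measurable X]setTI; exact: mg.
  rewrite qE /pushforward -comp_preimage.
  by rewrite (_ : _ \o _ = id) //; apply/funext => x /=; exact: fK.
pose H1 := isSFinite.Build _ _ _ _ (sfinite_measure_sigma_finite qs).
pose H2 := isSigmaFinite.Build _ _ _ _ qs.
by exists (HB.pack_for (SigmaFiniteMeasure.type T2 R) (Measure.sort q) H1 H2).
Qed.

Section lebesgue_rV.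
Context {R : realType}.

Definition rV_cons n (p : measurableTypeR R * 'rV[R]_n) : 'rV[R]_n.+1 :=
  \row_i (if unlift ord0 i is Some j then p.2 ord0 j else p.1).

Definition rV_uncons n (x : 'rV[R]_n.+1) : measurableTypeR R * 'rV[R]_n :=
  (x ord0 ord0, \row_j x ord0 (lift ord0 j)).

Lemma rV_consK n : cancel (@rV_cons n) (@rV_uncons n).
Proof.
move=> [a y]; congr pair; first by rewrite mxE unlift_none.
by apply/rowP => j; rewrite !mxE liftK.
Qed.

Lemma measurable_rV_cons n : measurable_fun setT (@rV_cons n).
Proof.
apply: measurable_fun_rV => i; rewrite /rV_cons.
under eq_fun do rewrite mxE.
case: unliftP => [j _|_]; last exact: measurable_fst.
exact: (measurableT_comp (measurable_coord j) measurable_snd).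
Qed.

Lemma measurable_rV_uncons n : measurable_fun setT (@rV_uncons n).
Proof.
apply/measurable_fun_pairP; split; first exact: measurable_coord.
apply: measurable_fun_rV => i /=; under eq_fun do rewrite mxE.
exact: measurable_coord.
Qed.

(* Lebesgue measure on R^n, identifying R^(n+1) with R * R^n. *)
Fixpoint lebesgue_rV n : set 'rV[R]_n -> \bar R :=
  if n is m.+1
  then pushforward (lebesgue_measure \x @lebesgue_rV m)%E (@rV_cons m)
  else \d_ (0 : 'rV[R]_0).

Lemma lebesgue_rV_subproof n :
  exists m : {sigma_finite_measure set 'rV[R]_n -> \bar R},
    m = @lebesgue_rV n :> (_ -> _).
Proof.
elim: n => [|n [m mE]]; first by exists (\d_ (0 : 'rV[R]_0)).
have [q qE] := pushforward_sigma_finite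
  (product_sigma_finite (@lebesgue_measure R) m)
  (@measurable_rV_cons n) (@measurable_rV_uncons n) (@rV_consK n).
by exists q; rewrite qE /= -mE.
Qed.

Section lebesgue_rV_measure.
Local Open Scope ereal_scope.
Variable n : nat.
Notation mu := (@lebesgue_rV n).

Let mu0 : mu set0 = 0.
Proof. by have [m <-] := lebesgue_rV_subproof n. Qed.

Let mu_ge0 A : 0 <= mu A.
Proof. by have [m <-] := lebesgue_rV_subproof n. Qed.

Let mu_sigma_additive : semi_sigma_additive mu.
Proof.
have [m <-] := lebesgue_rV_subproof n; exact: measure_semi_sigma_additive.
Qed.

HB.instance Definition _ :=
  isMeasure.Build _ _ _ mu mu0 mu_ge0 mu_sigma_additive.

Let mu_sigma_finite : sigma_finite setT mu.
Proof. have [m <-] := lebesgue_rV_subproof n; exact: sigma_finiteT. Qed.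

HB.instance Definition _ :=
  Measure_isSigmaFinite.Build _ _ _ mu mu_sigma_finite.

End lebesgue_rV_measure.

Lemma lebesgue_rV_box n (a b : 'rV[R]_n) : (forall i, a ord0 i <= b ord0 i) ->
  lebesgue_rV [set x | forall i, a ord0 i <= x ord0 i <= b ord0 i] =
  (\prod_(i < n) (b ord0 i - a ord0 i))%:E.
Proof.
elim: n => [|n ih] in a b * => ab.
  rewrite big_ord0 /= diracE mem_set// => -[].
  by [].
set A := [set x | _].
set a' := (rV_uncons a).2; set b' := (rV_uncons b).2.
pose B := [set x : 'rV[R]_n | forall i, a' ord0 i <= x ord0 i <= b' ord0 i].
rewrite /= /pushforward.
have -> : @rV_cons n @^-1` A = `[a ord0 ord0, b ord0 ord0]%classic `*` B.
  apply/seteqP; split => [[t y] /= h|[t y] /= [h1 h2] i].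
    split; first by have := h ord0; rewrite mxE unlift_none in_itv.
    by move=> i; have := h (lift ord0 i); rewrite !mxE liftK.
  rewrite in_itv/= in h1; rewrite mxE.
  case: unliftP => [j ->|->]//.
  by have := h2 j; rewrite !mxE.
have mB : measurable B.
  rewrite (_ : B = \bigcap_(i in [set: 'I_n])
      ((fun x : 'rV[R]_n => x ord0 i : measurableTypeR R) @^-1`
       `[a' ord0 i, b' ord0 i]%classic)); last first.
    apply/seteqP; split => x /= h i; first by move=> _ /=; rewrite in_itv/=.
    by have := h i I; rewrite /= in_itv.
  apply: fin_bigcap_measurable => // i _; rewrite -[X in measurable X]setTI.
  exact: measurable_coord.
have BE : lebesgue_rV B = (\prod_(i < n) (b' ord0 i - a' ord0 i))%:E.
  by apply: ih => i; rewrite !mxE.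
have IE : lebesgue_measure `[a ord0 ord0, b ord0 ord0]%classic =
    (b ord0 ord0 - a ord0 ord0)%:E.
  rewrite lebesgue_measure_itv/= lte_fin.
  have := ab ord0; rewrite le_eqVlt => /predU1P[->|->//].
  by rewrite ltxx subrr.
rewrite (product_measure1E _ (@lebesgue_rV n))//.
rewrite [X in (X * _)%E]IE [X in (_ * X)%E]BE big_ord_recl -EFinM.
by congr (_ * _)%:E; apply: eq_bigr => i _; rewrite !mxE.
Qed.

End lebesgue_rV.
Arguments lebesgue_rV {R n}.

Section fokker_planck.
Context {R : realType} {d : nat}.
Notation V := 'rV[R]_d.
Notation mu := (@lebesgue_rV R d).
Implicit Types (u f g phi : V -> R) (E : V -> V).

Definition dotp (x y : V) : R := \sum_(i < d) x ord0 i * y ord0 i.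

(* The norm `|x| of the library on 'rV is the sup norm, hence this one. *)
Definition enorm (x : V) : R := Num.sqrt (dotp x x).

Definition bracket (x : V) : R := Num.sqrt (1 + enorm x ^+ 2).

Definition partial (i : 'I_d) f : V -> R :=
  fun x => 'D_(delta_mx ord0 i) f x.

Definition grad f (x : V) : V := \row_i partial i f x.

Definition laplacian f (x : V) : R := \sum_(i < d) partial i (partial i f) x.

(* Partial derivatives of all orders exist everywhere and are continuous; the
   list s is the multi-index, with repetitions. *)
Definition smooth f : Prop :=
  forall s : seq 'I_d, let g := foldr partial f s in
    continuous g /\ forall i x, derivable g x (delta_mx ord0 i).

Definition test_function phi : Prop :=
  smooth phi /\ compact (closure [set x | phi x != 0]).

Definition loc_integrable f : Prop :=
  measurable_fun setT f /\
  forall K : set V, compact K -> mu.-integrable K (EFin \o f).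

Definition loc_Linfty f : Prop :=
  measurable_fun setT f /\
  forall K : set V, compact K -> f \_ K \in Lfun mu +oo%E.

Definition weak_partial (i : 'I_d) f g : Prop :=
  forall phi, test_function phi ->
    \int[mu]_x (f x * partial i phi x) = - \int[mu]_x (g x * phi x).

Definition loc_W1infty E : Prop :=
  forall i, loc_Linfty (fun x => E x ord0 i) /\
    forall j, exists2 g, loc_Linfty g & weak_partial j (fun x => E x ord0 i) g.

Definition weak_divergence E g : Prop :=
  loc_integrable g /\
  forall phi, test_function phi ->
    \int[mu]_x (dotp (E x) (grad phi x)) = - \int[mu]_x (g x * phi x).

Definition L2k (k : R) f : Prop :=
  f \in Lfun mu 2%:E /\
  (\int[mu]_x (`|f x| ^+ 2 * bracket x `^ k)%:E < +oo)%E.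

(* div (grad u + u E) = f in the sense of distributions, all derivatives being
   moved to the test function. *)
Definition FP_distribution E u f : Prop :=
  forall phi, test_function phi ->
    \int[mu]_x (u x * (laplacian phi x - dotp (E x) (grad phi x))) =
    \int[mu]_x (f x * phi x).

(* The graph of the unbounded operator L in L^2_k: u belongs to D(L) and
   L u = f. *)
Definition FP_operator (k : R) E u f : Prop :=
  [/\ L2k k u, L2k k f & FP_distribution E u f].

End fokker_planck.

(* Main.v *)
(* Write L* phi = Lap phi - E . grad phi for the formal adjoint. By (i), E has a
   locally Lipschitz version F with x . F -> oo and x . F <= A (1 + |x|^2).

   Existence. V = (1 + |x|^2)^m satisfies L* V <= C - (1 + |x|^2)^(m-1), and at a
   minimum of t V + phi the function L* (t V + phi) is nonnegative; a maximal
   cone argument then yields a positive functional T on bounded functions with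
   T 1 = 1, T (L* phi) = 0 and bounded moments. Its mollifications u_e are smooth
   approximate solutions. Testing with u_e <x>^k chi^2, hypothesis (ii) cancels the
   drift terms, and Nash's inequality together with the moment bound gives a
   uniform bound of u_e in L^2(<x>^k). So T is bounded for a weighted L^2 norm and
   is represented by a density G in L^2_k.

   Positivity. For a nonnegative solution u, testing with 1 / (u_e + dl) bounds the
   gradient of log (u_e + dl) uniformly; if u vanished on a set of positive measure,
   dl -> 0 would force u = 0.

   Uniqueness. If w is the difference of two solutions of mass 1, Kato's inequality
   and the upper bound on x . F make |w| a solution, hence also |w| + w >= 0; it
   is 0 or positive almost everywhere, and w has mean zero, so w = 0. *)
Require Import Defs.
From HB Require Import structures.
From mathcomp Require Import all_boot all_order all_algebra.
From mathcomp Require Import all_classical all_reals all_analysis.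
From mathcomp Require Import measurable_realfun ess_sup_inf ring lra zify.
Import Order.TTheory GRing.Theory Num.Theory.
Import numFieldNormedType.Exports.
Local Open Scope classical_set_scope.
Local Open Scope ring_scope.
Set Implicit Arguments.
Unset Strict Implicit.
Unset Printing Implicit Defensive.


(** Two losses of regularity shape the proof. The candidate stationary state is at first only a
    finitely additive functional, and competing solutions are only square integrable, so every
    nonlinear test is made on a mollified equation. The price is the commutator of the drift with
    the mollifier: a local Lipschitz bound makes it O(e), and for a positive functional even O(e)
    times the mollified density itself. The one-sided bound (ii) survives mollification because
    averaging preserves inequalities. In the weighted L^2 estimate a cutoff bounds the energy on one
    region by the mass on a larger one, and no bound uniform in the radius is known beforehand.
    Nested sublevel sets r |x|^2 <= s, weighted by a power of 2 - s, resolve this: for each radius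
    and mollification parameter only the finiteness of the mass enters, and the final constant
    forgets its value. Finally T 1 = 1 does not by itself exclude mass at infinity. The moments keep
    a positive part of it in a cube, and the density is normalized at the end. *)

Section measure_basics.
Context {R : realType} {d : nat}.
Notation V := 'rV[R]_d.
Notation mu := (@lebesgue_rV R d).
Implicit Types (f g : V -> R) (x y z : V) (A : set V).

Definition basis_rV (i : 'I_d) : V := delta_mx ord0 i.

Lemma coord_le_norm x i : `|x ord0 i| <= `|x|.
Proof.
have /mapP[j Hj e] : `|x ord0 i| \in [seq `|x k.1 k.2| | k : 'I_1 * 'I_d].
  by apply/mapP; exists (ord0, i) => //=; rewrite mem_enum.
by rewrite [leRHS]/Num.norm /= mx_normrE e; apply/bigmax_geP; right => /=; exists j.
Qed.

Lemma norm_rV_le x M : 0 <= M -> (forall i, `|x ord0 i| <= M) -> `|x| <= M.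
Proof.
move=> M0 h; rewrite [leLHS]/Num.norm /= mx_normrE; apply/bigmax_leP; split=> //.
by move=> [i j] _ /=; rewrite (ord1 i).
Qed.

Lemma norm_basis_rV (i : 'I_d) : `|basis_rV i| <= 1.
Proof.
apply: norm_rV_le => // j; rewrite mxE /=; by case: (_ == _); rewrite ?normr1 ?normr0.
Qed.

Definition cube (M : R) : set V := [set x | `|x| <= M].

Lemma cubeE M : 0 <= M ->
  cube M = [set x | forall i, (- const_mx M : V) ord0 i <= x ord0 i <= (const_mx M : V) ord0 i].
Proof.
move=> M0; apply/seteqP; split => x /= h.
  by move=> i; rewrite !mxE -ler_norml (le_trans (coord_le_norm x i)).
by apply: norm_rV_le => // i; move: (h i); rewrite !mxE -ler_norml.
Qed.

Lemma measurable_box (a b : V) :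
  measurable [set x : V | forall i, a ord0 i <= x ord0 i <= b ord0 i].
Proof.
rewrite (_ : mkset _ = \bigcap_(i in [set: 'I_d])
    ((fun x : V => x ord0 i : measurableTypeR R) @^-1`
       `[a ord0 i, b ord0 i]%classic)); last first.
  apply/seteqP; split => x /= h i; first by move=> _ /=; rewrite in_itv/=.
  by have := h i I; rewrite /= in_itv.
apply: fin_bigcap_measurable => // i _; rewrite -[X in measurable X]setTI.
exact: measurable_coord.
Qed.

Lemma cube_neg M : M < 0 -> cube M = set0.
Proof.
move=> M0; apply/seteqP; split => x //= h.
by have := le_lt_trans h M0; rewrite ltNge normr_ge0.
Qed.

Lemma measurable_cube M : measurable (cube M).
Proof.
have [M0|M0] := ltP M 0; first by rewrite cube_neg.
rewrite cubeE//; exact: measurable_box.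
Qed.

Lemma cube_measureE M : 0 <= M -> mu (cube M) = ((2 * M) ^+ d)%:E.
Proof.
move=> M0; rewrite cubeE// lebesgue_rV_box => [|i]; last by rewrite !mxE; lra.
congr EFin; rewrite (eq_bigr (fun=> 2 * M)) => [|i _]; last by rewrite !mxE; lra.
by rewrite prodr_const card_ord.
Qed.

Lemma cube_measure_lty M : (mu (cube M) < +oo)%E.
Proof.
have [M0|M0] := ltP M 0; first by rewrite cube_neg// measure0.
by rewrite cube_measureE// ltry.
Qed.

Lemma compact_cube M : compact (cube M).
Proof.
apply: bounded_closed_compact.
  exists M; split; first exact: num_real.
  by move=> N MN x /= h; exact: (le_trans h (ltW MN)).
rewrite (_ : cube M = (fun x : V => `|x|) @^-1` [set r | r <= M]) //.
apply: closed_comp; last exact: closed_le.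
by move=> x _; exact: norm_continuous.
Qed.

Definition grid (n : nat) x : V :=
  \row_i ((Num.floor (n.+1%:R * x ord0 i))%:~R / n.+1%:R).

Lemma grid_near n x : `|grid n x - x| <= n.+1%:R^-1.
Proof.
apply: norm_rV_le => [|i]; first by rewrite invr_ge0.
rewrite !mxE; set t := n.+1%:R * _.
have n0 : 0 < n.+1%:R :> R by rewrite ltr0n.
have -> : x ord0 i = t / n.+1%:R by rewrite /t mulrC mulKf// gt_eqF.
rewrite -mulrBl normrM (@gtr0_norm _ n.+1%:R^-1) ?invr_gt0//.
rewrite ler_piMl ?invr_ge0// ler_norml.
have := floor_le t; have := floorD1_gt t.
rewrite intrD; lra.
Qed.

Lemma measurable_grid n : measurable_fun setT (grid n).
Proof.
apply: measurable_fun_rV => i; under eq_fun do rewrite mxE.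
have -> : (fun t : V => (Num.floor (n.+1%:R * t ord0 i))%:~R / n.+1%:R) =
  (fun r : R => (Num.floor (n.+1%:R * r))%:~R / n.+1%:R) \o (fun t : V => t ord0 i) by [].
apply: (measurableT_comp _ (measurable_coord i)).
apply: measurable_funM => //.
apply: nondecreasing_measurable => // a b ab.
by rewrite ler_int; apply: le_floor; rewrite ler_pM2l// ltr0n.
Qed.

End measure_basics.

(** * Borel measurability of continuous functions *)

Section continuous_measurable.
Context {R : realType} {d : nat}.
Notation V := 'rV[R]_d.
Notation mu := (@lebesgue_rV R d).
Implicit Types (f g : V -> R) (x y z : V) (A : set V).

Lemma cvg_grid x : (fun n => grid n x) @ \oo --> x.
Proof.
apply/cvgrPdist_lt => e e0; near=> n.
rewrite distrC; apply: le_lt_trans (grid_near n x) _.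
by near: n; exact: near_infty_natSinv_lt (PosNum e0).
Unshelve. all: by end_near. Qed.

Lemma measurable_fiber_grid n x : measurable [set y : V | grid n y = grid n x].
Proof.
rewrite (_ : mkset _ = [set y : V | forall i, grid n x ord0 i <= grid n y ord0 i <= grid n x ord0 i]).
  have := @measurable_grid R d n measurableT _ (measurable_box (grid n x) (grid n x)).
  by rewrite setTI.
apply/seteqP; split => y /=; first by move=> -> i; rewrite lexx.
by move=> h; apply/rowP => i; apply/esym/le_anti/h.
Qed.

(* A continuous function is the pointwise limit of its values at the nearest
   grid points, and those take countably many values. *)
Lemma measurable_comp_grid f n : measurable_fun setT (f \o grid n).
Proof.
move=> _ Y mY; rewrite setTI.
pose g (z : 'rV[int]_d) : V := \row_i ((z ord0 i)%:~R / n.+1%:R).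
pose F k := if unpickle k is Some z then
   if `[< Y (f (g z)) /\ exists x, grid n x = g z >] then [set y : V | grid n y = g z] else set0
   else set0.
rewrite (_ : _ @^-1` Y = \bigcup_k F k).
  apply: bigcupT_measurable => k; rewrite /F; case: (unpickle k) => [z|]; last exact: measurable0.
  case: ifP => [/asboolP[_ [x <-]]|_]; last exact: measurable0.
  exact: measurable_fiber_grid.
apply/seteqP; split => [x /= Yx|x [k _]].
  pose z : 'rV[int]_d := \row_i Num.floor (n.+1%:R * x ord0 i).
  have gz : grid n x = g z by apply/rowP => i; rewrite !mxE.
  exists (pickle z) => //; rewrite /F pickleK.
  by case: asboolP => // -[]; split; [rewrite -gz|exists x].
rewrite /F; case: (unpickle k) => [z|//].
by case: asboolP => //= -[Yz _] ->.
Qed.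

Lemma continuous_measurable_rV f : continuous f -> measurable_fun setT f.
Proof.
move=> cf; apply: (@measurable_fun_cvg _ _ _ _ (fun n => f \o grid n)) => [n|x _]; last first.
  by apply: (@continuous_cvg _ _ _ _ _ _ f); [exact: cf|exact: cvg_grid].
exact: measurable_comp_grid.
Qed.

End continuous_measurable.

(** * Translation invariance of Lebesgue measure *)

Section translation.
Context {R : realType}.

Lemma measurable_addr_rV n (a : 'rV[R]_n) : measurable_fun setT (fun x : 'rV[R]_n => x + a).
Proof.
apply: measurable_fun_rV => i; under eq_fun do rewrite mxE.
exact: (measurable_funD (measurable_coord i) (measurable_cst _)).
Qed.

(** Uniqueness of Lebesgue measure: the pushforward under the translation agrees with it on
    half-open intervals. *)
Lemma lebesgue_measure_addr (a : R) (A : set (measurableTypeR R)) : measurable A ->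
  lebesgue_measure ((fun r : measurableTypeR R => r + a) @^-1` A) = lebesgue_measure A.
Proof.
have mf : measurable_fun [set: measurableTypeR R] (fun r : measurableTypeR R => r + a).
  by apply: measurable_funD => //; exact: measurable_id.
have [q qE] : exists q : {measure set (measurableTypeR R) -> \bar R},
    q = pushforward lebesgue_measure (fun r : measurableTypeR R => r + a : measurableTypeR R) :> (_ -> _).
  by unshelve refine (ex_intro _ (pushforward lebesgue_measure
     (fun r : measurableTypeR R => r + a : measurableTypeR R) : {measure set _ -> \bar R}) _).
move=> mA; transitivity (q A); first by rewrite qE.
apply/esym/lebesgue_measure_unique => //= _ [[x y]] _ <-.
rewrite qE /pushforward.
have -> : (fun r : measurableTypeR R => r + a) @^-1` [set` `]x, y]] = [set` `]x - a, y - a]].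
  by apply/seteqP; split => t /=; rewrite !in_itv/=; move=> /andP[? ?]; apply/andP; split; lra.
rewrite !lebesgue_measure_itv/= !lte_fin ltrD2r.
by case: ifP => // _; congr EFin; ring.
Qed.

(** Induction on the dimension: under R^(n+1) = R x R^n the translation splits into one of the line
    and one of R^n, and a product measure is determined by its values on rectangles. *)
Lemma lebesgue_rV_addr n (a : 'rV[R]_n) (A : set 'rV[R]_n) : measurable A ->
  lebesgue_rV ((fun x => x + a) @^-1` A) = lebesgue_rV A.
Proof.
elim: n a A => [|n ih] a A mA.
  suff -> : (fun x => x + a) @^-1` A = A by [].
  have e (x : 'rV[R]_0) : x + a = x by apply/rowP => -[].
  by apply/seteqP; split => x /=; rewrite e.
set a' := (rV_uncons a).2; set a0 := a ord0 ord0.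
pose S (p : measurableTypeR R * 'rV[R]_n) : measurableTypeR R * 'rV[R]_n := (p.1 + a0, p.2 + a').
have mS : measurable_fun setT S.
  apply/measurable_fun_pairP; split.
    exact: (measurable_funD measurable_fst (measurable_cst _)).
  exact: (measurableT_comp (measurable_addr_rV a') measurable_snd).
have [q qE] : exists q : {measure set (measurableTypeR R * 'rV[R]_n) -> \bar R},
    q = pushforward (lebesgue_measure \x @lebesgue_rV R n)%E S :> (_ -> _).
  by unshelve refine (ex_intro _ (pushforward (lebesgue_measure \x @lebesgue_rV R n)%E S
     : {measure set _ -> \bar R}) _).
set X := @rV_cons R n @^-1` A.
have mX : measurable X by rewrite -[X in measurable X]setTI; exact: measurable_rV_cons.
rewrite /= /pushforward -/X.
have -> : @rV_cons R n @^-1` ((fun x => x + a) @^-1` A) = S @^-1` X.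
  have e p : rV_cons p + a = rV_cons (S p).
    apply/rowP => i; rewrite !mxE; case: unliftP => [j ->|->]//=.
    by rewrite !mxE.
  by apply/seteqP; split => p /=; rewrite /X /= e.
transitivity (q X); first by rewrite qE.
apply/esym/(@product_measure_unique _ _ _ _ _ lebesgue_measure (@lebesgue_rV R n)) => // B C mB mC.
rewrite qE /pushforward.
rewrite (_ : S @^-1` (B `*` C) = ((fun r : measurableTypeR R => r + a0) @^-1` B) `*` ((fun x => x + a') @^-1` C)) //.
rewrite (product_measure1E _ (@lebesgue_rV R n)).
- by congr (_ * _)%E; [exact: lebesgue_measure_addr|exact: ih].
- rewrite -[X in measurable X]setTI.
  have mf : measurable_fun [set: measurableTypeR R] (fun r : measurableTypeR R => r + a0).
    by apply: measurable_funD => //; exact: measurable_id.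
  exact: mf.
- by rewrite -[X in measurable X]setTI; exact: measurable_addr_rV.
Qed.

Context {d : nat}.
Notation V := 'rV[R]_d.
Notation mu := (@lebesgue_rV R d).

Lemma ge0_integral_addr (a : V) (f : V -> \bar R) : measurable_fun setT f ->
  (forall x, 0 <= f x)%E -> (\int[mu]_x f (x + a)%R = \int[mu]_x f x)%E.
Proof.
move=> mf f0.
have [q qE] : exists q : {measure set V -> \bar R}, q = pushforward mu (fun x => x + a) :> (_ -> _).
  have mS := measurable_addr_rV a.
  by unshelve refine (ex_intro _ (pushforward mu (fun x => x + a) : {measure set _ -> \bar R}) _).
have H := @ge0_integral_pushforward _ _ _ _ R _ (measurable_addr_rV a) mu setT f measurableT mf.
transitivity (\int[pushforward mu (fun x : V => x + a)%R]_x f x)%E.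
  by rewrite H// preimage_setT.
rewrite -qE; apply: eq_measure_integral => A mA _; rewrite qE.
exact: lebesgue_rV_addr.
Qed.

Lemma integral_addr (a : V) (f : V -> \bar R) : measurable_fun setT f ->
  (\int[mu]_x f (x + a)%R = \int[mu]_x f x)%E.
Proof.
move=> mf; rewrite integralE [RHS]integralE; congr (_ - _)%E.
  transitivity (\int[mu]_x (f^\+ (x + a)%R))%E; last first.
    by apply: ge0_integral_addr => //; exact: measurable_funepos.
  by apply: eq_integral => x _; rewrite /= !funeposE.
transitivity (\int[mu]_x (f^\- (x + a)%R))%E; last first.
  by apply: ge0_integral_addr => //; exact: measurable_funeneg.
by apply: eq_integral => x _; rewrite /= !funenegE.
Qed.

Lemma Rintegral_addr (a : V) (f : V -> R) : measurable_fun setT f ->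
  \int[mu]_x f (x + a) = \int[mu]_x f x.
Proof.
by move=> mf; congr fine; apply: (@integral_addr a (EFin \o f)); exact/measurable_EFinP.
Qed.

Lemma integrable_addr (a : V) (f : V -> R) : mu.-integrable setT (EFin \o f) ->
  mu.-integrable setT (EFin \o (fun x => f (x + a))).
Proof.
move=> /integrableP[mf foo]; apply/integrableP; split.
  exact: (measurableT_comp mf (measurable_addr_rV a)).
by rewrite (@integral_addr a (fun x => `|(EFin \o f) x|%E))//; exact: measurableT_comp.
Qed.

End translation.

(** * Real-valued integrals, local integrability and compact supports *)

Section integration.
Context {R : realType} {d : nat}.
Notation V := 'rV[R]_d.
Notation mu := (@lebesgue_rV R d).
Implicit Types (f g u v : V -> R) (x y z : V) (A : set V) (M C e : R).

Definition intg f := mu.-integrable setT (EFin \o f).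

Lemma intg_meas f : intg f -> measurable_fun setT f.
Proof. by move=> /integrableP[/measurable_EFinP]. Qed.

Lemma eq_intg f g : f =1 g -> intg f -> intg g.
Proof. by move=> /funext ->. Qed.

Lemma le_intg f g : measurable_fun setT f -> (forall x, `|f x| <= g x) -> intg g -> intg f.
Proof.
move=> mf fg; apply: le_integrable => //; first exact/measurable_EFinP.
by move=> x _; rewrite /= lee_fin (le_trans (fg x))// ler_norm.
Qed.

Lemma intgD f g : intg f -> intg g -> intg (fun x => f x + g x).
Proof. by move=> hf hg; exact: (integrableD measurableT hf hg). Qed.

Lemma intgN f : intg f -> intg (fun x => - f x).
Proof. by move=> hf; exact: (integrableN hf). Qed.

Lemma intgB f g : intg f -> intg g -> intg (fun x => f x - g x).
Proof. by move=> hf hg; apply: intgD => //; exact: intgN. Qed.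

Lemma intgZ c f : intg f -> intg (fun x => c * f x).
Proof. by move=> hf; exact: (integrableZl measurableT c hf). Qed.

Lemma intg_norm f : intg f -> intg (fun x => `|f x|).
Proof. exact: integrable_norm. Qed.

Lemma intg0 : intg (fun=> 0).
Proof. exact: integrable0. Qed.

Lemma intg_sum (J : Type) (s : seq J) (F : J -> V -> R) :
  (forall j, intg (F j)) -> intg (fun x => \sum_(j <- s) F j x).
Proof.
move=> h; elim: s => [|j s ih].
  by apply: eq_intg intg0 => x; rewrite big_nil.
by apply: eq_intg (intgD (h j) ih) => x; rewrite big_cons.
Qed.

Lemma IntD f g : intg f -> intg g ->
  \int[mu]_x (f x + g x) = \int[mu]_x f x + \int[mu]_x g x.
Proof. exact: RintegralD. Qed.

Lemma IntB f g : intg f -> intg g ->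
  \int[mu]_x (f x - g x) = \int[mu]_x f x - \int[mu]_x g x.
Proof. exact: RintegralB. Qed.

Lemma IntZ c f : intg f -> \int[mu]_x (c * f x) = c * \int[mu]_x f x.
Proof. exact: RintegralZl. Qed.

Lemma IntN f : intg f -> \int[mu]_x (- f x) = - \int[mu]_x f x.
Proof.
move=> hf; rewrite -mulN1r -IntZ//; apply: eq_Rintegral => x _; lra.
Qed.

Lemma Int0 : \int[mu]_x (0 : R) = 0.
Proof. by rewrite Rintegral_cst// mul0r. Qed.

Lemma Int_sum (J : Type) (s : seq J) (F : J -> V -> R) : (forall j, intg (F j)) ->
  \int[mu]_x (\sum_(j <- s) F j x) = \sum_(j <- s) \int[mu]_x F j x.
Proof.
move=> h; elim: s => [|j s ih].
  by rewrite big_nil -[RHS]Int0; apply: eq_Rintegral => x _; rewrite big_nil.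
rewrite big_cons -ih -IntD//; last exact: intg_sum.
by apply: eq_Rintegral => x _; rewrite big_cons.
Qed.

Lemma eq_Int f g : f =1 g -> \int[mu]_x f x = \int[mu]_x g x.
Proof. by move=> h; apply: eq_Rintegral => x _; exact: h. Qed.

Lemma le_Int f g : intg f -> intg g -> (forall x, f x <= g x) ->
  \int[mu]_x f x <= \int[mu]_x g x.
Proof. by move=> hf hg h; apply: le_Rintegral => // x _; exact: h. Qed.

Lemma Int_ge0 f : (forall x, 0 <= f x) -> 0 <= \int[mu]_x f x.
Proof. by move=> h; apply: Rintegral_ge0 => x _; exact: h. Qed.

Lemma norm_Int f : intg f -> `|\int[mu]_x f x| <= \int[mu]_x `|f x|.
Proof. exact: le_normr_Rintegral. Qed.

Lemma IntE f : intg f -> (\int[mu]_x (f x)%:E)%E = (\int[mu]_x f x)%:E.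
Proof. by move=> hf; rewrite /Rintegral fineK//; exact: integrable_fin_num. Qed.

Lemma Int_addr z f : measurable_fun setT f -> \int[mu]_x f (x + z) = \int[mu]_x f x.
Proof. exact: Rintegral_addr. Qed.

Lemma intg_addr z f : intg f -> intg (fun x => f (x + z)).
Proof. exact: integrable_addr. Qed.

(* Junk-free criterion: for f >= 0 the real integral vanishes also when the
   extended one is infinite, hence the integrability hypothesis. *)
Lemma Int_eq0_ae f : intg f -> (forall x, 0 <= f x) -> \int[mu]_x f x = 0 ->
  {ae mu, forall x, f x = 0}.
Proof.
move=> hf f0 h; have := IntE hf; rewrite h => e.
have mf : measurable_fun setT (EFin \o f) by case/integrableP : hf.
have := (ae_eq_integral_abs mu measurableT mf).1.
have -> : (\int[mu]_x `|(EFin \o f) x| = 0)%E.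
  by rewrite -[RHS]e; apply: eq_integral => x _ /=; rewrite ger0_norm.
by move=> /(_ erefl); apply: filterS => x /= /(_ I) [].
Qed.

Lemma eq_Int_ae f g : measurable_fun setT f -> measurable_fun setT g ->
  {ae mu, forall x, f x = g x} -> \int[mu]_x f x = \int[mu]_x g x.
Proof.
move=> mf mg h; congr fine; apply: ae_eq_integral => //; try exact/measurable_EFinP.
by apply: filterS h => x -> _.
Qed.

Lemma le_Int_ae f g : intg f -> intg g -> {ae mu, forall x, f x <= g x} ->
  \int[mu]_x f x <= \int[mu]_x g x.
Proof.
move=> hf hg h; rewrite -subr_ge0 -IntB//.
have hm : measurable_fun setT (fun x => Num.max (g x - f x) 0).
  apply: measurable_maxr => //; exact: (measurable_funB (intg_meas hg) (intg_meas hf)).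
rewrite (@eq_Int_ae _ (fun x => Num.max (g x - f x) 0))//.
- by apply: Int_ge0 => x; rewrite le_max lexx orbT.
- exact: intg_meas (intgB hg hf).
- by apply: filterS h => x h; rewrite max_l// subr_ge0.
Qed.

Lemma continuous_bounded_cube f M : continuous f ->
  exists2 C, 0 < C & forall x, `|x| <= M -> `|f x| <= C.
Proof.
move=> cf; have : compact (f @` cube M).
  apply: continuous_compact; last exact: compact_cube.
  by apply: continuous_subspaceT.
move=> /compact_bounded[N [_ hN]]; exists (`|N| + 1); first by rewrite ltr_wpDl.
move=> x xM; apply: (hN (`|N| + 1)); first by rewrite ltr_pwDr// ler_norm.
by exists x.
Qed.

(** Only [x] is confined to the cube, [y] may lie outside. Compactness is therefore used in its
    covering form, for the point [x] and the parameter [dl] together. *)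
Lemma unif_cont_cube f M e : continuous f -> 0 < e -> exists2 dl, 0 < dl &
  forall x y, `|x| <= M -> `|x - y| < dl -> `|f x - f y| < e.
Proof.
move=> cf e0.
have /compact_near_coveringP H := @compact_cube R d M.
have := H R (nbhs (0:R))
  (fun dl x => forall y, `|x - y| < dl -> `|f x - f y| < e).
case.
  move=> x _; have /cvgrPdist_lt/(_ (e / 2)) := cf x.
  rewrite divr_gt0// => /(_ isT) /nbhs_ballP[r /= r0 hr].
  exists (ball x (r / 2), ball 0 (r / 2)).
    by split; apply: nbhsx_ballx; rewrite divr_gt0.
  move=> [x' dl] /= []; rewrite -!ball_normE /= sub0r normrN => h1 h2 y h3.
  have a1 : `|f x - f x'| < e / 2 by apply: hr; rewrite -ball_normE/=; lra.
  have a2 : `|f x - f y| < e / 2.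
    apply: hr; rewrite -ball_normE/=; have := ler_distD x' x y.
    have := ler_norm dl; lra.
  by rewrite (le_lt_trans (ler_distD (f x) _ _))// (splitr e) ltrD// distrC.
move=> r /= r0 hr; exists (r / 2); first by rewrite divr_gt0.
move=> x y xM xy; apply: (hr (r / 2)) => //.
by rewrite /= sub0r normrN gtr0_norm ?divr_gt0//; lra.
Qed.

Lemma continuous_epsdelta f :
  (forall x e, 0 < e -> exists2 dl, 0 < dl & forall y, `|x - y| < dl -> `|f x - f y| < e) ->
  continuous f.
Proof.
move=> H x; suff h : forall e, 0 < e -> \forall y \near x, `|f x - f y| < e.
  exact: (proj2 (@cvgrPdist_lt _ _ _ _ _ _ _)) h.
move=> e e0; have [dl dl0 h] := H x e e0.
by apply/nbhs_ballP; exists dl => // y; rewrite -ball_normE /=; exact: h.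
Qed.

Definition Cc f := continuous f /\ exists M, forall x, M < `|x| -> f x = 0.

Lemma Cc_bounded f : Cc f -> exists2 C, 0 < C & forall x, `|f x| <= C.
Proof.
move=> [cf [M hM]]; have [C C0 hC] := continuous_bounded_cube M cf.
exists C => // x; have [/hC//|/hM ->] := lerP `|x| M; by rewrite normr0 ltW.
Qed.

Lemma Cc_unif_cont f e : Cc f -> 0 < e -> exists2 dl, 0 < dl &
  forall x y, `|x - y| < dl -> `|f x - f y| < e.
Proof.
move=> [cf [M hM]] e0; have [dl dl0 h] := unif_cont_cube M cf e0.
exists dl => // x y xy; have [xM|xM] := lerP `|x| M; first exact: h.
have [yM|yM] := lerP `|y| M; first by rewrite distrC; apply: h => //; rewrite distrC.
by rewrite !hM// subrr normr0.
Qed.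

Definition locL1 u := measurable_fun setT u /\
  forall M, intg (fun x => u x * \1_(cube M) x).

Lemma measurable_indic_cube M : measurable_fun setT (\1_(cube M) : V -> R).
Proof. by apply: measurable_indic; exact: measurable_cube. Qed.

Lemma intg_indic_cube M : intg (\1_(cube M)).
Proof.
apply/integrableP; split; first by apply/measurable_EFinP; exact: measurable_indic_cube.
under eq_integral do rewrite /= ger0_norm//.
rewrite integral_indic ?setIT//; last exact: measurable_cube.
exact: cube_measure_lty.
Qed.

Lemma locL1_bounded u f M C : locL1 u -> measurable_fun setT f ->
  (forall x, `|f x| <= C) -> (forall x, M < `|x| -> f x = 0) -> intg (fun x => u x * f x).
Proof.
move=> [mu1 hu] mf fC fM; apply: (@le_intg _ (fun x => C * `|u x * \1_(cube M) x|)).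
- exact: measurable_funM.
- move=> x; rewrite indicE; have [xM|xM] := lerP `|x| M.
    by rewrite mem_set// mulr1 normrM mulrC ler_wpM2r.
  rewrite memNset ?mulr0 ?normr0 ?mulr0; last by rewrite /cube/= leNgt xM.
  by rewrite fM// mulr0 normr0.
- exact/intgZ/intg_norm/hu.
Qed.

Lemma locL1_Cc u f : locL1 u -> Cc f -> intg (fun x => u x * f x).
Proof.
move=> hu hf; have [C _ hC] := Cc_bounded hf; have [cf [M hM]] := hf.
by apply: (locL1_bounded (M := M) (C := C)) => //; exact: continuous_measurable_rV.
Qed.

Lemma bounded_intg f M C : measurable_fun setT f ->
  (forall x, `|f x| <= C) -> (forall x, M < `|x| -> f x = 0) -> intg f.
Proof.
move=> mf fC fM; apply: (@le_intg _ (fun x => C * \1_(cube M) x)) => //.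
  move=> x; rewrite indicE; have [xM|xM] := lerP `|x| M.
    by rewrite mem_set// mulr1.
  by rewrite memNset ?mulr0 ?fM ?normr0// /cube/=; apply/negP; rewrite -ltNge.
exact/intgZ/intg_indic_cube.
Qed.

Lemma Cc_intg f : Cc f -> intg f.
Proof.
move=> hf; have [C _ hC] := Cc_bounded hf; have [cf [M hM]] := hf.
by apply: (bounded_intg (M := M) (C := C)) => //; exact: continuous_measurable_rV.
Qed.

Lemma indic_cube_out M x : M < `|x| -> \1_(cube M) x = 0 :> R.
Proof. by move=> h; rewrite indicE memNset// /cube/=; apply/negP; rewrite -ltNge. Qed.

Lemma indic_cube_in M x : `|x| <= M -> \1_(cube M) x = 1 :> R.
Proof. by move=> h; rewrite indicE mem_set. Qed.

Lemma indic_cube_le M M' x : M <= M' -> \1_(cube M) x <= \1_(cube M') x :> R.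
Proof.
move=> h; have [xM|xM] := lerP `|x| M; last by rewrite indic_cube_out.
by rewrite !indic_cube_in//; exact: le_trans h.
Qed.

Lemma continuous_locL1 f : continuous f -> locL1 f.
Proof.
move=> cf; have mf := continuous_measurable_rV cf; split => // M.
have [C C0 hC] := continuous_bounded_cube M cf.
apply: (bounded_intg (M := M) (C := C)).
- by apply: measurable_funM => //; exact: measurable_indic_cube.
- move=> x; have [xM|xM] := lerP `|x| M; first by rewrite indic_cube_in// mulr1 hC.
  by rewrite indic_cube_out// mulr0 normr0 ltW.
- by move=> x xM; rewrite indic_cube_out// mulr0.
Qed.

Lemma locL1_norm u : locL1 u -> locL1 (fun x => `|u x|).
Proof.
move=> [m h]; split; first exact: measurableT_comp.
move=> M; apply: eq_intg (intg_norm (h M)) => x.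
by rewrite normrM (ger0_norm (_ : 0 <= \1_(cube M) x)).
Qed.

Lemma locL1M u f : locL1 u -> continuous f -> locL1 (fun x => u x * f x).
Proof.
move=> hu cf; have mf := continuous_measurable_rV cf; split.
  by apply: measurable_funM => //; case: hu.
move=> M; have [C C0 hC] := continuous_bounded_cube M cf.
apply: (@eq_intg (fun x => u x * (f x * \1_(cube M) x))) => [x|]; first by rewrite mulrA.
apply: (locL1_bounded (M := M) (C := C)) => //.
- by apply: measurable_funM => //; exact: measurable_indic_cube.
- move=> x; have [xM|xM] := lerP `|x| M; first by rewrite indic_cube_in// mulr1 hC.
  by rewrite indic_cube_out// mulr0 normr0 ltW.
- by move=> x xM; rewrite indic_cube_out// mulr0.
Qed.

Lemma locL1D u v : locL1 u -> locL1 v -> locL1 (fun x => u x + v x).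
Proof.
move=> [m h] [m' h']; split; first exact: measurable_funD.
by move=> M; apply: eq_intg (intgD (h M) (h' M)) => x; rewrite mulrDl.
Qed.

Lemma locL1Z c u : locL1 u -> locL1 (fun x => c * u x).
Proof.
move=> [m h]; split; first exact: measurable_funM.
by move=> M; apply: eq_intg (intgZ c (h M)) => x; rewrite mulrA.
Qed.

Lemma intg_locL1 u : intg u -> locL1 u.
Proof.
move=> hu; have m := intg_meas hu; split => // M; apply: (le_intg _ _ (intg_norm hu)).
  by apply: measurable_funM => //; exact: measurable_indic_cube.
move=> x; have [xM|xM] := lerP `|x| M; first by rewrite indic_cube_in// mulr1.
by rewrite indic_cube_out// mulr0 normr0.
Qed.

End integration.

(** * Directional derivatives as derivatives along lines *)

Section line_derivatives.
Context {R : realType} {d : nat}.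
Notation V := 'rV[R]_d.
Implicit Types (f g : V -> R) (x v : V) (i : 'I_d) (l t : R).

(** Transfers a directional derivative to the line through [x], so that the one-variable chain rule
    and mean value theorem become available. *)
Lemma is_derive_lineP f x v l :
  is_derive x v f l <-> is_derive (0 : R) (1 : R) (fun h => f (h *: v + x)) l.
Proof.
have e : (fun h : R => h^-1 *: ((f \o shift x) (h *: v) - f x)) =
         (fun h : R => h^-1 *: (((fun h => f (h *: v + x)) \o shift 0) (h *: (1:R)) - f (0 *: v + x))).
  by apply/funext => h /=; rewrite addr0 scale0r add0r [_ *: 1]mulr1.
split => -[h1 h2].
  apply: DeriveDef; first exact/(derivable1P f x v).
  by rewrite -h2 /derive e.
apply: DeriveDef; first exact/(derivable1P f x v).
by rewrite -h2 /derive e.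
Qed.

Lemma is_derive_line f x v l t :
  is_derive (t *: v + x) v f l -> is_derive t (1 : R) (fun h => f (h *: v + x)) l.
Proof.
move=> /is_derive_lineP h.
have {}h : is_derive (t - t) (1:R) (fun h => f (h *: v + (t *: v + x))) l by rewrite subrr.
have := @is_derive1_comp R (fun s => f (s *: v + (t *: v + x))) (fun s => s - t) t l 1 h.
move=> H; rewrite (_ : (fun h => f (h *: v + x)) = (fun s => f (s *: v + (t *: v + x))) \o (fun s => s - t)).
  have -> : l = l * 1 by rewrite mulr1.
  apply: H; apply: is_derive_eq; by rewrite subr0.
by apply/funext => s /=; rewrite addrA -scalerDl subrK.
Qed.

Lemma is_derive_estimate (W : normedModType R) (f : W -> R) (x v : W) (l : R) :
  (forall e, 0 < e -> exists2 dl, 0 < dl &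
     forall t, `|t| < dl -> `|f (t *: v + x) - f x - t * l| <= e * `|t|) ->
  is_derive x v f l.
Proof.
move=> H.
have C : (fun h : R => h^-1 *: ((f \o shift x) (h *: v) - f x)) @ 0^' --> l.
  apply/cvgrPdist_le => e e0; have [dl dl0 hdl] := H e e0.
  near=> t.
  have t0 : t != 0 by near: t; exact: nbhs_dnbhs_neq.
  have tdl : `|t| < dl.
    near: t; apply: dnbhs0_lt => //.
  have := hdl t tdl => /=.
  rewrite -(ler_pM2l (_ : 0 < `|t^-1|)); last by rewrite normr_gt0 invr_eq0.
  rewrite -normrM [_ * (e * _)]mulrCA -[in X in _ <= X]normrM mulVf// normr1 mulr1.
  rewrite distrC; congr (_ <= _); congr `|_|.
  by rewrite mulrBr mulKf.
apply: DeriveDef; last exact: cvg_lim C.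
by apply/cvg_ex; exists l.
Unshelve. all: by end_near. Qed.

Lemma is_derive_chain f x v l (h : R -> R) h' :
  is_derive (f x) (1 : R) h h' -> is_derive x v f l -> is_derive x v (fun y => h (f y)) (h' * l).
Proof.
move=> dh /is_derive_lineP df; apply/is_derive_lineP.
apply: (@is_derive1_comp R h (fun s => f (s *: v + x))) => //.
by rewrite scale0r add0r.
Qed.

Lemma is_derive_mul f g x v a b : is_derive x v f a -> is_derive x v g b ->
  is_derive x v (fun y => f y * g y) (f x * b + g x * a).
Proof. by move=> df dg; exact: (is_derive_eq (is_deriveM df dg)). Qed.

Lemma is_derive_add f g x v a b : is_derive x v f a -> is_derive x v g b ->
  is_derive x v (fun y => f y + g y) (a + b).
Proof. by move=> df dg; exact: (is_derive_eq (is_deriveD df dg)). Qed.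

Lemma is_derive_scale f x v a c : is_derive x v f a ->
  is_derive x v (fun y => c * f y) (c * a).
Proof. by move=> df; exact: (is_derive_eq (is_deriveZ c df)). Qed.

Lemma is_derive_bigsum (J : Type) (s : seq J) (F : J -> V -> R) (a : J -> R) x v :
  (forall j, is_derive x v (F j) (a j)) ->
  is_derive x v (fun y => \sum_(j <- s) F j y) (\sum_(j <- s) a j).
Proof.
move=> h; elim: s => [|j s ih].
  rewrite big_nil (_ : (fun y => _) = cst 0); last by apply/funext => y; rewrite big_nil.
  exact: is_derive_cst.
rewrite big_cons (_ : (fun y => _) = (fun y => F j y + \sum_(j <- s) F j y)).
  exact: is_derive_add.
by apply/funext => y; rewrite big_cons.
Qed.

Lemma is_derive_coord x i j :
  is_derive x (delta_mx ord0 i : V) (fun y => y ord0 j) ((i == j)%:R).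
Proof.
apply: is_derive_estimate => e e0; exists 1 => // t _.
by rewrite !mxE /= [j == i]eq_sym addrK subrr normr0 mulr_ge0// ltW.
Qed.

Lemma is_derive_addr f x v l z : is_derive (x + z) v f l ->
  is_derive x v (fun y => f (y + z)) l.
Proof.
move=> /is_derive_lineP h; apply/is_derive_lineP.
by rewrite (_ : (fun h => f (h *: v + x + z)) = (fun h => f (h *: v + (x + z))))//; apply/funext => s; rewrite addrA.
Qed.

Lemma MVT_line f (f' : V -> R) x v t : 0 < t ->
  (forall y, is_derive y v f (f' y)) ->
  exists s, [/\ 0 < s, s < t & f (t *: v + x) - f x = t * f' (s *: v + x)].
Proof.
move=> t0 h.
have [|s] := @MVT R (fun s => f (s *: v + x)) (fun s => f' (s *: v + x)) 0 t t0 (fun s _ => is_derive_line (h _)).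
  apply: continuous_subspaceT => s.
  apply: differentiable_continuous; apply/derivable1_diffP.
  exact: (@ex_derive _ _ _ _ _ _ _ (is_derive_line (h _))).
rewrite in_itv /= => /andP[s0 st] e; exists s; split => //.
by move: e; rewrite scale0r add0r subr0 mulrC.
Qed.

Lemma MVT_line_norm f (f' : V -> R) x v t :
  (forall y, is_derive y v f (f' y)) ->
  exists2 s, `|s| <= `|t| & f (t *: v + x) - f x = t * f' (s *: v + x).
Proof.
move=> h; have [t0|t0|<-] := ltrgtP 0 t.
- have [s [s0 st e]] := MVT_line x t0 h; exists s => //.
  by rewrite !gtr0_norm// ltW.
(* For t < 0 the same segment is run backwards from its other endpoint. *)
- have mt0 : 0 < - t by lra.
  have [s [s0 st e]] := MVT_line (t *: v + x) mt0 h.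
  exists (s + t).
    by rewrite !ltr0_norm; lra.
  move: e; rewrite addrA -scalerDl addNr scale0r add0r addrA -scalerDl => e.
  by rewrite -opprB e mulNr opprK.
- by exists 0 => //; rewrite scale0r add0r subrr mul0r.
Qed.

(** If [f'' x] were negative it would stay so nearby; two mean value steps then give a negative [f']
    just after [x] and a value of [f] below the minimum. *)
Lemma min_line_derivatives f f' f'' x v : (forall y, f x <= f y) ->
  (forall y, is_derive y v f (f' y)) -> (forall y, is_derive y v f' (f'' y)) ->
  continuous f'' -> f' x = 0 /\ 0 <= f'' x.
Proof.
move=> xmin df df' cf''.
have c1 : {for x, continuous (fun y => f'' y)} by exact: cf''.
have f'0 : f' x = 0.
  have [_ <-] : is_derive (0:R) (1:R) (fun s => f (s *: v + x)) (f' x) by apply/is_derive_lineP.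
  have [||||_ ->//] := @derive1_at_min R (fun s => f (s *: v + x)) (-1) 1 0.
  - by lra.
  - by move=> t _; exact: (@ex_derive _ _ _ _ _ _ _ (is_derive_line (df _))).
  - by rewrite in_itv/=; lra.
  - by move=> t _; rewrite scale0r add0r.
split => //; rewrite leNgt; apply/negP => neg.
have : \forall y \near x, f'' y < 0 by apply: (cvgr_lt _ c1).
move=> /nbhs_ballP[r /= r0 hr].
pose t := r / (2 * (1 + `|v|)).
have v0 : 0 < 1 + `|v| by rewrite ltr_wpDr.
have t0 : 0 < t by rewrite divr_gt0// mulr_gt0.
have [s [s0 st e]] := MVT_line x t0 df.
have [q [q0 qs e']] := MVT_line x s0 df'.
have : f'' (q *: v + x) < 0.
  apply: hr; rewrite -ball_normE /= opprD addrC subrK normrN normrZ gtr0_norm//.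
  have : q * `|v| <= t * (1 + `|v|).
    by apply: ler_pM => //; [lra|lra|rewrite lerDr].
  have -> : t * (1 + `|v|) = r / 2.
    by rewrite /t; field; rewrite gt_eqF.
  by lra.
move: e'; rewrite f'0 subr0 => e' neg'.
have : f (t *: v + x) - f x < 0 by rewrite e e' pmulr_rlt0// pmulr_rlt0.
by have := xmin (t *: v + x); lra.
Qed.

End line_derivatives.

(** * Functions of class C^n and integration by parts *)

Section Ck_classes.
Context {R : realType} {d : nat}.
Notation V := 'rV[R]_d.
Notation mu := (@lebesgue_rV R d).
Notation e_ i := (delta_mx ord0 i : V).
Implicit Types (f g : V -> R) (x y z : V) (i j : 'I_d) (t M C e : R) (n : nat).

(** Class C^n through iterated derivatives along the coordinate axes. The recursion on [n] turns
    closure properties into inductions, and no Frechet derivative is involved. *)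
Fixpoint Ck n f : Prop := continuous f /\
  if n is m.+1 then forall i, (forall x, derivable f x (e_ i)) /\ Ck m (partial i f) else True.

Lemma Ck_cont n f : Ck n f -> continuous f.
Proof. by case: n => [|n] []. Qed.

Lemma Ck_partial n f i : Ck n.+1 f -> Ck n (partial i f).
Proof. by move=> [_ /(_ i)[]]. Qed.

Lemma Ck_derive n f i x (hf : Ck n.+1 f) : is_derive x (e_ i) f (partial i f x).
Proof. by move: hf => [_ /(_ i)[df _]]; exact: derivableP. Qed.

Lemma CkW n f : Ck n.+1 f -> Ck n f.
Proof.
elim: n f => [|n ih] f [cf h]; first by split.
split => // i; split; first by case: (h i).
by apply: ih; case: (h i).
Qed.

Lemma Ck_of_derive n f (f' : 'I_d -> V -> R) : continuous f ->
  (forall i x, is_derive x (e_ i) f (f' i x)) -> (forall i, Ck n (f' i)) -> Ck n.+1 f.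
Proof.
move=> cf df h; split => // i; split; first by move=> x; exact: ex_derive.
rewrite (_ : partial i f = f' i)//; apply/funext => x.
by rewrite /partial; apply: derive_val.
Qed.

Lemma partialE f i x l : is_derive x (e_ i) f l -> partial i f x = l.
Proof. by move=> h; rewrite /partial derive_val. Qed.

Lemma Ck_cst n c : Ck n (fun=> c).
Proof.
elim: n c => [|n ih] c; first by split => // x; exact: cst_continuous.
by apply: (@Ck_of_derive _ _ (fun _ _ => 0)) => [x|i]; [exact: cst_continuous|exact: ih].
Qed.

Lemma CkD n f g : Ck n f -> Ck n g -> Ck n (fun x => f x + g x).
Proof.
elim: n f g => [|n ih] f g hf hg.
  by split => // x; apply: continuousD; [exact: (Ck_cont hf)|exact: (Ck_cont hg)].
apply: (@Ck_of_derive _ _ (fun i x => partial i f x + partial i g x)) => [x|i x|i].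
- by apply: continuousD; [exact: (Ck_cont hf)|exact: (Ck_cont hg)].
- by apply: is_derive_add; [exact: Ck_derive hf|exact: Ck_derive hg].
- by apply: ih; exact: Ck_partial.
Qed.

Lemma CkM n f g : Ck n f -> Ck n g -> Ck n (fun x => f x * g x).
Proof.
elim: n f g => [|n ih] f g hf hg.
  by split => // x; apply: continuousM; [exact: (Ck_cont hf)|exact: (Ck_cont hg)].
apply: (@Ck_of_derive _ _ (fun i x => f x * partial i g x + g x * partial i f x)) => [x|i x|i].
- by apply: continuousM; [exact: (Ck_cont hf)|exact: (Ck_cont hg)].
- by apply: is_derive_mul; [exact: Ck_derive hf|exact: Ck_derive hg].
- by apply: CkD; apply: ih; (exact: Ck_partial) || exact: CkW.
Qed.

Lemma CkZ n c f : Ck n f -> Ck n (fun x => c * f x).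
Proof. by move=> hf; apply: CkM => //; exact: Ck_cst. Qed.

Lemma CkN n f : Ck n f -> Ck n (fun x => - f x).
Proof.
move=> hf; rewrite (_ : (fun x => _) = (fun x => -1 * f x)); first exact: CkZ.
by apply/funext => x; rewrite mulN1r.
Qed.

Lemma Ck_sum n (J : Type) (s : seq J) (F : J -> V -> R) : (forall k, Ck n (F k)) ->
  Ck n (fun x => \sum_(k <- s) F k x).
Proof.
move=> h; elim: s => [|q s ih].
  rewrite (_ : (fun x => _) = fun=> 0); first exact: Ck_cst.
  by apply/funext => x; rewrite big_nil.
rewrite (_ : (fun x => _) = fun x => F q x + \sum_(k <- s) F k x); first exact: CkD.
by apply/funext => x; rewrite big_cons.
Qed.

Lemma Ck_coord n j : Ck n (fun x => x ord0 j).
Proof.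
case: n => [|n]; first by split => // x; exact: coord_continuous.
apply: (@Ck_of_derive _ _ (fun i _ => (i == j)%:R)) => [x|i x|i].
- exact: coord_continuous.
- exact: is_derive_coord.
- exact: Ck_cst.
Qed.

Lemma Ck_comp1 f (h h' : R -> R) : (forall s, is_derive s (1:R) h (h' s)) ->
  continuous h -> continuous h' -> Ck 1 f -> Ck 1 (fun x => h (f x)).
Proof.
move=> dh ch ch' hf.
apply: (@Ck_of_derive _ _ (fun i x => h' (f x) * partial i f x)) => [x|i x|i].
- by apply: (@continuous_comp _ _ _ f h); [exact: (Ck_cont hf)|exact: ch].
- exact: (is_derive_chain (dh _) (Ck_derive _ _ hf)).
- apply: CkM; last exact: Ck_partial.
  by split => // x; apply: (@continuous_comp _ _ _ f h'); [exact: (Ck_cont hf)|exact: ch'].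
Qed.

Lemma smooth_Ck f : smooth f -> forall n, Ck n f.
Proof.
move=> sf n; have : forall s, Ck n (foldr (@partial R d) f s); last by move/(_ [::]).
elim: n => [|n ih] s; have [cf df] := sf s; first by split.
split => // i; split; first by move=> x; exact: df.
exact: (ih (i :: s)).
Qed.

Lemma Ck_smooth f : (forall n, Ck n f) -> smooth f.
Proof.
move=> h s; rewrite /=; suff H : forall n, Ck n (foldr (@partial R d) f s).
  by split => [|i x]; [exact: (Ck_cont (H 0%N))|by case: (Ck_derive i x (H 1%N))].
by elim: s => [//|j s ih] n /=; exact: Ck_partial.
Qed.

Lemma partial_out f M i x : (forall y, M < `|y| -> f y = 0) -> M < `|x| -> partial i f x = 0.
Proof.
move=> h xM; rewrite /partial (@near_eq_derive _ _ _ f (cst 0)) ?derive_cst//.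
have : \forall y \near x, M < `|y|.
  by apply: (cvgr_gt _ (@norm_continuous _ V x)).
by apply: filterS => y /h.
Qed.

Lemma smooth_test f M : smooth f -> (forall x, M < `|x| -> f x = 0) -> test_function f.
Proof.
move=> sf h; split => //.
apply: (subclosed_compact _ (@compact_cube R d M)); first exact: closed_closure.
have cM : closed (@cube R d M).
  rewrite (_ : @cube R d M = (fun x : V => `|x|) @^-1` [set r | r <= M]) //.
  by apply: closed_comp; [move=> x _; exact: norm_continuous|exact: closed_le].
rewrite [X in _ `<=` X](closure_id _).1//; apply: closure_subset => x /= fx.
by rewrite /cube /= leNgt; apply/negP => /h; exact/eqP.
Qed.

Lemma continuous_shift f z : continuous f -> continuous (fun x => f (x + z)).
Proof.
move=> cf x; apply: (@continuous_comp _ _ _ (fun x => x + z) f); last exact: cf.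
by apply: continuousD; [exact: id|exact: cst_continuous].
Qed.

Lemma Ck_shift n f z : Ck n f -> Ck n (fun x => f (x + z)).
Proof.
elim: n f => [|n ih] f hf; first by split => //; apply: continuous_shift; exact: Ck_cont hf.
apply: (@Ck_of_derive _ _ (fun i x => partial i f (x + z))).
- by apply: continuous_shift; exact: Ck_cont hf.
- by move=> i x; apply: is_derive_addr; exact: Ck_derive hf.
- by move=> i; apply: ih; exact: Ck_partial.
Qed.

(** The mean value theorem writes the error as [t] times an increment of the partial derivative,
    which is uniformly continuous near the cube. *)
Lemma quotient_unif f i M e : Ck 1 f -> 0 < e -> exists2 dl, 0 < dl &
  forall x t, `|x| <= M -> `|t| < dl ->
    `|f (t *: e_ i + x) - f x - t * partial i f x| <= e * `|t|.
Proof.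
move=> hf e0; have [dl dl0 h] := unif_cont_cube M (Ck_cont (Ck_partial i hf)) e0.
exists dl => // x t xM tdl.
have [s st ->] := MVT_line_norm x (v := e_ i) t (fun y => Ck_derive i y hf).
rewrite -mulrBr normrM mulrC ler_wpM2r//; apply: ltW; rewrite distrC; apply: h => //.
rewrite opprD addrC subrK normrN normrZ.
by rewrite (le_lt_trans _ tdl)// (le_trans _ st)// ler_piMr// norm_basis_rV.
Qed.

Lemma quotient_unif_Cc f i e : Ck 1 f -> Cc f -> 0 < e -> exists2 dl, 0 < dl &
  forall x t, `|t| < dl ->
    `|f (t *: e_ i + x) - f x - t * partial i f x| <= e * `|t|.
Proof.
move=> hf [_ [M hM]] e0; have [dl dl0 h] := quotient_unif i (M + 1) hf e0.
exists (Num.min dl 1); first by rewrite lt_min dl0 ltr01.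
move=> x t; rewrite lt_min => /andP[tdl t1].
have [xM|xM] := lerP `|x| (M + 1); first exact: h.
have n1 : `|t *: e_ i| <= 1.
  by rewrite normrZ mulr_ile1// ?norm_basis_rV// ltW.
rewrite !hM ?(partial_out _ hM); [|lra|lra|]; first by rewrite subrr mulr0 subrr normr0 mulr_ge0// ltW.
by have := ler_normB (t *: e_ i + x) (t *: e_ i); rewrite addrAC subrr add0r; lra.
Qed.

Lemma CcP f M : continuous f -> (forall x, M < `|x| -> f x = 0) -> Cc f.
Proof. by move=> cf h; split => //; exists M. Qed.

Lemma Cc_partial f i : Ck 1 f -> Cc f -> Cc (partial i f).
Proof.
move=> hf [_ [M hM]]; apply: (@CcP _ M); first exact: Ck_cont (Ck_partial i hf).
by move=> x; exact: partial_out.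
Qed.

Lemma CcMl f g : continuous f -> Cc g -> Cc (fun x => f x * g x).
Proof.
move=> cf [cg [M h]]; apply: (@CcP _ M); last by move=> x /h ->; rewrite mulr0.
by move=> x; apply: continuousM; [exact: cf|exact: cg].
Qed.

Lemma CcMr f g : Cc f -> continuous g -> Cc (fun x => f x * g x).
Proof.
move=> hf cg; rewrite (_ : (fun x => _) = fun x => g x * f x); first exact: CcMl.
by apply/funext => x; rewrite mulrC.
Qed.

Lemma CcD f g : Cc f -> Cc g -> Cc (fun x => f x + g x).
Proof.
move=> [cf [M h]] [cg [N k]]; apply: (@CcP _ (Num.max M N)).
  by move=> x; apply: continuousD; [exact: cf|exact: cg].
by move=> x; rewrite gt_max => /andP[/h -> /k ->]; rewrite addr0.
Qed.

Lemma CcZ c f : Cc f -> Cc (fun x => c * f x).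
Proof. by move=> hf; apply: CcMl => // x; exact: cst_continuous. Qed.

Lemma Cc_sum (J : Type) (s : seq J) (F : J -> V -> R) : (forall k, Cc (F k)) ->
  Cc (fun x => \sum_(k <- s) F k x).
Proof.
move=> h; elim: s => [|q s ih].
  apply: (@CcP _ 0) => [x|x _]; last by rewrite big_nil.
  rewrite (_ : (fun x => _) = fun=> 0); first exact: cst_continuous.
  by apply/funext => y; rewrite big_nil.
rewrite (_ : (fun x => _) = fun x => F q x + \sum_(k <- s) F k x); first exact: CcD.
by apply/funext => x; rewrite big_cons.
Qed.

Lemma Cc_shift f z : Cc f -> Cc (fun x => f (x + z)).
Proof.
move=> [cf [M h]]; apply: (@CcP _ (M + `|z|)); first exact: continuous_shift.
move=> x xM; apply: h; have := ler_normB (x + z) z; rewrite addrK; lra.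
Qed.

Lemma Int_indic_cube_ge0 M : 0 <= \int[mu]_x (\1_(cube M) x : R).
Proof. by apply: Int_ge0 => x; rewrite indicE. Qed.

(* The difference quotients have integral zero by translation invariance. *)
Lemma Int_partial f i : Ck 1 f -> Cc f -> \int[mu]_x partial i f x = 0.
Proof.
move=> hf cf; have cp := Cc_partial i hf cf.
have [M hM] := cf.2; set K := \int[mu]_x (\1_(@cube R d (M + 1)) x : R).
apply/eqP; rewrite -normr_eq0 eq_le normr_ge0 andbT; apply/ler_addgt0Pr => e e0.
have K0 : 0 < K + 1 by have := Int_indic_cube_ge0 (M + 1); rewrite -/K; lra.
have [dl dl0 h] := quotient_unif_Cc i hf cf (divr_gt0 e0 K0).
pose t := Num.min (dl / 2) 1; have t0 : 0 < t by rewrite lt_min ltr01 andbT divr_gt0.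
have tdl : `|t| < dl by rewrite gtr0_norm//; rewrite /t; have := ge_min (dl/2) (dl / 2) 1; rewrite lexx /=; lra.
have t1 : t <= 1 by rewrite /t ge_min lexx orbT.
have mf := continuous_measurable_rV cf.1.
pose g x := f (x + t *: e_ i) - f x.
have ig : intg g by apply: intgB; [apply: intg_addr|]; exact: Cc_intg.
have Ig : \int[mu]_x g x = 0.
  rewrite IntB; [|by apply: intg_addr; exact: Cc_intg|exact: Cc_intg].
  by rewrite Int_addr// subrr.
have : `|\int[mu]_x (g x - t * partial i f x)| <= t * e.
  have it : intg (fun x => t * partial i f x) by apply: intgZ; exact: Cc_intg.
  apply: le_trans (norm_Int (intgB ig it)) _.
  apply: (@le_trans _ _ (\int[mu]_x (e / (K + 1) * t * \1_(cube (M + 1)) x))).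
    apply: le_Int; [exact/intg_norm/intgB|exact/intgZ/intg_indic_cube|].
    move=> x; have [xM|xM] := lerP `|x| (M + 1).
      rewrite indic_cube_in// mulr1 -{2}(gtr0_norm t0) /g [x + _]addrC.
      exact: h.
    rewrite indic_cube_out// mulr0 /g !hM ?(partial_out _ hM) ?mulr0 ?subrr ?normr0//; [lra|lra|].
    have n1 : `|t *: e_ i| <= 1 by rewrite normrZ gtr0_norm// mulr_ile1// ?norm_basis_rV// ltW.
    by have := ler_normB (x + t *: e_ i) (t *: e_ i); rewrite addrK; lra.
  rewrite IntZ; last exact: intg_indic_cube.
  rewrite -/K mulrAC mulrC ler_pM2l// -mulrA ger_pMr//.
  by rewrite mulrC ler_pdivrMr// mul1r; lra.
rewrite IntB//; last by apply: intgZ; exact: Cc_intg.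
rewrite Ig sub0r normrN IntZ; last exact: Cc_intg.
by rewrite normrM gtr0_norm// ler_pM2l// add0r.
Qed.

Lemma Int_by_parts f g i : Ck 1 f -> Ck 1 g -> Cc g ->
  \int[mu]_x (f x * partial i g x) = - \int[mu]_x (partial i f x * g x).
Proof.
move=> hf hg cg.
have i1 : intg (fun x => f x * partial i g x).
  by apply: Cc_intg; apply: CcMl; [exact: Ck_cont hf|exact: Cc_partial].
have i2 : intg (fun x => partial i f x * g x).
  by apply: Cc_intg; apply: CcMl => //; exact: Ck_cont (Ck_partial i hf).
apply/eqP; rewrite -subr_eq0 opprK -IntD//; apply/eqP.
rewrite -(@Int_partial (fun x => f x * g x) i).
- apply: eq_Int => x; rewrite (partialE (is_derive_mul (Ck_derive i x hf) (Ck_derive i x hg))).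
  by rewrite (mulrC (g x)).
- exact: CkM.
- by apply: CcMl => //; exact: Ck_cont hf.
Qed.

End Ck_classes.

(** * A smooth function that is flat at the origin *)

Section flat_function.
Context {R : realType}.
Implicit Types (t s c : R) (n k : nat).

(* t^-n e^(-1/t) continued by 0 to t <= 0: the span of this family is closed
   under differentiation, which makes every member smooth. *)
Definition flat n t : R := if 0 < t then t^-1 ^+ n * expR (- t^-1) else 0.

Lemma flat_ge0 n t : 0 <= flat n t.
Proof.
by rewrite /flat; case: ifP => // t0; rewrite mulr_ge0 ?expR_ge0// exprn_ge0// invr_ge0 ltW.
Qed.

Lemma flat0_gt0 t : 0 < t -> 0 < flat 0 t.
Proof. by move=> t0; rewrite /flat t0 expr0 mul1r expR_gt0. Qed.

Lemma flat_le0 n t : t <= 0 -> flat n t = 0.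
Proof. by move=> t0; rewrite /flat ltNge t0. Qed.

(** With m = n + 2 and s = 1/t, exp s = (exp (s/m))^m >= (s/m)^m; this is the origin of the
    constant. The quadratic decay is what makes the derivative at 0 exist and vanish. *)
Lemma flat_sqr n t : flat n t <= (n.+2%:R ^+ n.+2) * t ^+ 2.
Proof.
rewrite /flat; case: ifP => t0; last by rewrite mulr_ge0 ?sqr_ge0 ?exprn_ge0.
set m := n.+2; set s := t^-1; have s0 : 0 < s by rewrite invr_gt0.
have m0 : 0 < m%:R :> R by rewrite ltr0n.
have le1 : (s / m%:R) ^+ m <= expR s.
  rewrite -[s in expR s](_ : m%:R * (s / m%:R) = s); last by field; rewrite gt_eqF.
  rewrite expRM_natl; apply: lerXn2r; rewrite ?nnegrE ?expR_ge0 ?divr_ge0 ?ltW//.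
  by have := expR_ge1Dx (s / m%:R); lra.
rewrite expRN -(ler_pM2r (expR_gt0 s)) divfK ?gt_eqF ?expR_gt0//.
have -> : s ^+ n = m%:R ^+ m * t ^+ 2 * (s / m%:R) ^+ m.
  rewrite expr_div_n /s /m !exprS; field.
  by rewrite expf_neq0 ?pnatr_eq0 ?(gt_eqF t0) ?andbT// -natrD pnatr_eq0.
by rewrite ler_wpM2l// mulr_ge0 ?sqr_ge0 ?exprn_ge0.
Qed.

Lemma is_derive_flat n t :
  is_derive t (1 : R) (flat n) (flat n.+2 t - n%:R * flat n.+1 t).
Proof.
have [t0|t0|<-] := ltrgtP 0 t.
- have D : is_derive t (1:R) (fun y : R => y^-1 ^+ n * expR (- y^-1))
     (flat n.+2 t - n%:R * flat n.+1 t).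
    have dV : is_derive t (1:R) (fun y : R => y^-1) (- t ^- 2 *: (1:R)).
      by apply: is_deriveV; rewrite gt_eqF.
    have dh : is_derive (t^-1) (1:R) (fun u : R => u ^+ n * expR (- u))
      (t^-1 ^+ n * (- expR (- t^-1)) + expR (- t^-1) * (n%:R * t^-1 ^+ n.-1)).
      have d1 : is_derive (t^-1) (1:R) (fun u : R => u ^+ n) (n%:R * t^-1 ^+ n.-1).
        apply: DeriveDef; first exact: exprn_derivable.
        by rewrite exp_derive [LHS]mulr1.
      have d2 : is_derive (t^-1) (1:R) (fun u : R => expR (- u)) (- expR (- t^-1)).
        have := @is_derive1_comp R expR (fun u => - u) (t^-1) _ _ (is_derive_expR _) (is_deriveN _).
        by move=> H; apply: is_derive_eq; rewrite mulrN1.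
      exact: (is_derive_eq (is_deriveM d1 d2)).
    have := @is_derive1_comp R (fun u : R => u ^+ n * expR (- u)) (fun y : R => y^-1) t _ _ dh dV.
    move=> H; apply: is_derive_eq.
    rewrite /flat t0 [_ *: 1]mulr1 -exprVn.
    by case: n {dh H} => [|n] /=; rewrite ?mulr0n ?mul0r ?subr0 ?exprS; ring.
  apply: near_eq_is_derive D.
  have : \forall y \near t, 0 < y by exact: lt_nbhsr.
  by apply: filterS => y y0; rewrite /flat y0.
- rewrite !flat_le0 ?(ltW t0)// mulr0 subr0.
  have D : is_derive t (1:R) (cst 0 : R -> R) 0 by exact: is_derive_cst.
  apply: near_eq_is_derive D.
  have : \forall y \near t, y < 0 by exact: lt_nbhsl.
  by apply: filterS => y y0; rewrite flat_le0// ltW.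
(* At 0 the difference quotient is at most a constant times |h|, by [flat_sqr]. *)
- rewrite !flat_le0// mulr0 subr0.
  have C : (fun h : R => h^-1 *: ((flat n \o shift 0) (h *: (1:R)) - flat n 0)) @ 0^' --> (0:R).
    apply/cvgrPdist_le => e e0; near=> h.
    have h0 : h != 0 by near: h; exact: nbhs_dnbhs_neq.
    rewrite sub0r normrN /= [h *: 1]mulr1 addr0 (flat_le0 n (lexx 0)) subr0.
    rewrite [_ *: _]/(_ * _) normrM normfV (ger0_norm (flat_ge0 _ _)) ler_pdivrMl ?normr_gt0//.
    apply: le_trans (flat_sqr n h) _.
    rewrite -[h ^+ 2]real_normK ?num_real// expr2 mulrCA ler_wpM2l//.
    have K0 : 0 < n.+2%:R ^+ n.+2 :> R by rewrite exprn_gt0// ltr0n.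
    rewrite mulrC -ler_pdivlMr//; apply: ltW.
    near: h; apply: dnbhs0_lt; exact: divr_gt0.
  apply: DeriveDef; last exact: cvg_lim C.
  by apply/cvg_ex; exists 0.
Unshelve. all: by end_near. Qed.

Lemma continuous_flat n : continuous (flat n).
Proof.
move=> t; apply: differentiable_continuous; apply/derivable1_diffP.
by case: (is_derive_flat n t).
Qed.

End flat_function.

(** * Mollifiers *)

Section mollifier.
Context {R : realType} {d : nat}.
Notation V := 'rV[R]_d.
Notation mu := (@lebesgue_rV R d).
Implicit Types (x y z : V) (e r c s : R).

Lemma Ck_flat k n c s (i : 'I_d) : Ck k (fun x : V => flat n (c + s * x ord0 i)).
Proof.
have cl x : {for x, continuous (fun x : V => c + s * x ord0 i)}.
  exact: (Ck_cont (CkD (@Ck_cst R d 0 c) (CkZ s (@Ck_coord R d 0 i)))).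
have cf m : continuous (fun x : V => flat m (c + s * x ord0 i)).
  by move=> x; apply: (@continuous_comp _ _ _ (fun x : V => c + s * x ord0 i) (flat m));
    [exact: cl|exact: continuous_flat].
elim: k n => [|k ih] n; first by split.
pose g m (x : V) := flat m (c + s * x ord0 i).
apply: (@Ck_of_derive _ _ _ _ (fun j x =>
   (g n.+2 x + (- n%:R) * g n.+1 x) * (s * (j == i)%:R))) => [|j x|j]; first exact: cf.
  have := is_derive_chain (@is_derive_flat R n (c + s * x ord0 i))
    (is_derive_add (is_derive_cst c x (delta_mx ord0 j : V)) (is_derive_scale s (is_derive_coord x j i))).
  by rewrite add0r /g mulNr.
apply: CkM; last exact: Ck_cst.
by apply: CkD; [exact: ih|apply: CkZ; exact: ih].
Qed.

Lemma Ck_prod k (J : Type) (q : seq J) (F : J -> V -> R) : (forall j, Ck k (F j)) ->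
  Ck k (fun x => \prod_(j <- q) F j x).
Proof.
move=> h; elim: q => [|j q ih].
  rewrite (_ : (fun x => _) = fun=> 1); first exact: Ck_cst.
  by apply/funext => x; rewrite big_nil.
rewrite (_ : (fun x => _) = fun x => F j x * \prod_(j <- q) F j x); first exact: CkM.
by apply/funext => x; rewrite big_cons.
Qed.

(** Supported in the sup-norm ball of radius [e] and even, which later makes mollification
    self-adjoint. The factors 1 and -1 put both arguments in the affine form of [Ck_flat]. *)
Definition bump e x : R := \prod_(i < d) (flat 0 (e + 1 * x ord0 i) * flat 0 (e + (-1) * x ord0 i)).

Lemma Ck_bump k e : Ck k (bump e).
Proof. by apply: Ck_prod => i; apply: CkM; exact: Ck_flat. Qed.

Lemma bump_ge0 e x : 0 <= bump e x.
Proof. by apply: prodr_ge0 => i _; rewrite mulr_ge0// flat_ge0. Qed.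

Lemma bump_gt0 e x : `|x| < e -> 0 < bump e x.
Proof.
move=> xe; apply: prodr_gt0 => i _; have := coord_le_norm x i; rewrite ler_norml => /andP[? ?].
by rewrite mulr_gt0// flat0_gt0//; lra.
Qed.

Lemma bump_out e x : 0 <= e -> e < `|x| -> bump e x = 0.
Proof.
move=> e0 ex; apply/eqP; apply/negP => /negP b0.
have : `|x| <= e; last by rewrite leNgt ex.
apply: norm_rV_le => // i; rewrite leNgt; apply/negP => xi.
move/negP: b0; apply; apply/eqP; rewrite /bump (bigD1 i)//=.
move: xi; rewrite lter_normr => /orP[xi|xi].
  by rewrite (@flat_le0 _ _ (e + -1 * _)) ?mulr0 ?mul0r//; lra.
by rewrite (@flat_le0 _ _ (e + 1 * _)) ?mul0r//; lra.
Qed.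

Lemma bumpN e x : bump e (- x) = bump e x.
Proof. by apply: eq_bigr => i _; rewrite mulrC !mxE !mulrN !mulNr !mul1r opprK. Qed.

(** A cube of positive radius has positive measure, so the exceptional null set cannot contain
    it. *)
Lemma ae_dense (P : V -> Prop) z r : {ae mu, forall x, P x} -> 0 < r ->
  exists2 x, `|x - z| <= r & P x.
Proof.
move=> [N [mN N0 hN]] r0; apply: contrapT => H.
pose a : V := z - const_mx r; pose b : V := z + const_mx r.
have := @lebesgue_rV_box R d a b.
have -> : (\prod_(i < d) (b ord0 i - a ord0 i)) = (2 * r) ^+ d.
  rewrite (eq_bigr (fun=> 2 * r)) => [|i _]; last by rewrite !mxE; lra.
  by rewrite prodr_const card_ord.
set B := mkset _ => BE.
have {}BE : mu B = ((2 * r) ^+ d)%:E by apply: BE => i; rewrite !mxE; lra.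
have : (mu B <= mu N)%E.
  apply: le_measure; rewrite ?inE//; first exact: measurable_box.
  move=> x Bx; apply: hN => /= Px; apply: H; exists x => //.
  apply: norm_rV_le => [|i]; first exact: ltW.
  by have := Bx i; rewrite !mxE ler_norml => /andP[? ?]; apply/andP; split; lra.
by rewrite BE N0 lee_fin leNgt exprn_gt0// mulr_gt0.
Qed.

Lemma Cc_bump e : 0 <= e -> Cc (bump e).
Proof.
move=> e0; apply: (@CcP _ _ _ e); first exact: (Ck_cont (Ck_bump 0 e)).
by move=> x; exact: bump_out.
Qed.

Lemma Int_bump_gt0 e : 0 < e -> 0 < \int[mu]_x bump e x.
Proof.
move=> e0; rewrite lt0r Int_ge0 ?andbT; last by move=> x; exact: bump_ge0.
apply/eqP => /(Int_eq0_ae (Cc_intg (Cc_bump (ltW e0))) (bump_ge0 e)) H.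
have e2 : 0 < e / 2 by rewrite divr_gt0.
have [x xe bx] := ae_dense 0 H e2.
have : 0 < bump e x by apply: bump_gt0; move: xe; rewrite subr0; lra.
by rewrite bx ltxx.
Qed.

Definition moll e x : R := (\int[mu]_x bump e x)^-1 * bump e x.

Lemma Ck_moll k e : Ck k (moll e).
Proof. by apply: CkZ; exact: Ck_bump. Qed.

Lemma moll_ge0 e x : 0 <= moll e x.
Proof.
by rewrite mulr_ge0 ?bump_ge0// invr_ge0; apply: Int_ge0 => y; exact: bump_ge0.
Qed.

Lemma moll_out e x : 0 <= e -> e < `|x| -> moll e x = 0.
Proof. by move=> e0 ex; rewrite /moll bump_out// mulr0. Qed.

Lemma mollN e x : moll e (- x) = moll e x.
Proof. by rewrite /moll bumpN. Qed.

Lemma Cc_moll e : 0 <= e -> Cc (moll e).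
Proof. by move=> e0; apply: CcZ; exact: Cc_bump. Qed.

Lemma Int_moll e : 0 < e -> \int[mu]_x moll e x = 1.
Proof.
move=> e0; rewrite IntZ; last exact: Cc_intg (Cc_bump (ltW e0)).
by rewrite mulVf// gt_eqF// Int_bump_gt0.
Qed.

Lemma test_moll e z : 0 <= e -> test_function (fun x => moll e (x - z)).
Proof.
move=> e0; apply: (@smooth_test _ _ _ (e + `|z|)).
  by apply: Ck_smooth => n; apply: Ck_shift; exact: Ck_moll.
move=> x xe; apply: moll_out => //; have := ler_normB (x - z) (- z).
rewrite opprK subrK normrN; lra.
Qed.

End mollifier.

(** * Mollification of functionals on compactly supported functions *)

Section local_functionals.
Context {R : realType} {d : nat}.
Notation V := 'rV[R]_d.
Notation mu := (@lebesgue_rV R d).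
Notation e_ i := (delta_mx ord0 i : V).
Implicit Types (f g u phi : V -> R) (x y z : V) (e r c s K M N : R) (T : (V -> R) -> R).

(** Signed Radon measures seen as functionals on [Cc]: linear, and bounded in the sup norm on the
    functions supported in any fixed cube. *)
Definition locfun T :=
  (forall a f g, Cc f -> Cc g -> T (fun x => a * f x + g x) = a * T f + T g) /\
  (forall M, exists2 C, 0 <= C & forall f K, Cc f -> (forall x, M < `|x| -> f x = 0) ->
     (forall x, `|f x| <= K) -> `|T f| <= C * K).

Lemma locfun0 T : locfun T -> T (fun=> 0) = 0.
Proof.
move=> [h _]; have c0 : Cc (fun _ : V => 0 : R) by apply: (@CcP _ _ _ 0) => // x; exact: cst_continuous.
have := h 1 _ _ c0 c0; rewrite !mul1r !addr0 => e; lra.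
Qed.

Lemma locfunZ T a f : locfun T -> Cc f -> T (fun x => a * f x) = a * T f.
Proof.
move=> hT hf; have c0 : Cc (fun _ : V => 0 : R) by apply: (@CcP _ _ _ 0) => // x; exact: cst_continuous.
have := hT.1 a f _ hf c0; rewrite locfun0// addr0 => <-; congr T.
by apply/funext => x; rewrite addr0.
Qed.

Lemma locfunD T f g : locfun T -> Cc f -> Cc g -> T (fun x => f x + g x) = T f + T g.
Proof.
move=> hT hf hg; have := hT.1 1 f g hf hg; rewrite mul1r => <-; congr T.
by apply/funext => x; rewrite mul1r.
Qed.

Lemma locfunB T f g : locfun T -> Cc f -> Cc g -> T (fun x => f x - g x) = T f - T g.
Proof.
move=> hT hf hg; have := hT.1 (-1) g f hg hf; rewrite mulN1r addrC => <-; congr T.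
by apply/funext => x; rewrite mulN1r addrC.
Qed.

Lemma locfun_sum T (J : Type) (q : seq J) (F : J -> V -> R) : locfun T -> (forall j, Cc (F j)) ->
  T (fun x => \sum_(j <- q) F j x) = \sum_(j <- q) T (F j).
Proof.
move=> hT hF; elim: q => [|j q ih].
  rewrite big_nil -[RHS](locfun0 hT); congr T.
  by apply/funext => x; rewrite big_nil.
rewrite big_cons -ih -locfunD//; last exact: Cc_sum.
by congr T; apply/funext => x; rewrite big_cons.
Qed.

Definition pairing u f := \int[mu]_x (u x * f x).

Lemma locfun_pairing u : locL1 u -> locfun (pairing u).
Proof.
move=> hu; split.
  move=> a f g hf hg; rewrite /pairing -IntZ; last exact: locL1_Cc.
  rewrite -IntD; [|exact/intgZ/locL1_Cc|exact: locL1_Cc].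
  by apply: eq_Int => x; ring.
move=> M; exists (\int[mu]_x `|u x * \1_(cube M) x|); first exact: Int_ge0.
move=> f K hf fM fK; apply: le_trans (norm_Int (locL1_Cc hu hf)) _.
rewrite mulrC -IntZ; last exact/intg_norm/hu.2.
apply: le_Int; [exact/intg_norm/locL1_Cc|exact/intgZ/intg_norm/hu.2|].
move=> x; have [xM|xM] := lerP `|x| M.
  by rewrite indic_cube_in// mulr1 normrM mulrC ler_wpM2r.
by rewrite fM// mulr0 normr0 indic_cube_out// mulr0 normr0 mulr0.
Qed.

(** For an even [phi] this is the usual convolution. As [x] enters with a minus sign,
    differentiating in [x] produces minus the value at the differentiated [phi]. *)
Definition conv T phi x := T (fun y => phi (y - x)).

Lemma out_shift phi M x N : (forall y, M < `|y| -> phi y = 0) -> `|x| <= N ->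
  forall y, M + N < `|y| -> phi (y - x) = 0.
Proof. by move=> h xz y hy; apply: h; have := ler_normB y x; have := lerB_dist y x; lra. Qed.

Lemma conv_continuous T phi : locfun T -> Cc phi -> continuous (conv T phi).
Proof.
move=> hT hphi; apply: continuous_epsdelta => x e e0; have [M hM] := hphi.2.
have [C C0 hC] := hT.2 (M + (`|x| + 1)).
have C1 : 0 < C + 1 by lra.
have [dl dl0 hdl] := Cc_unif_cont hphi (divr_gt0 e0 C1).
exists (Num.min dl 1); first by rewrite lt_min dl0 ltr01.
move=> x'; rewrite lt_min => /andP[xx' xx1].
rewrite /conv -locfunB//; try exact: Cc_shift.
have : `|x'| <= `|x| + 1 by have := ler_normB x (x - x'); rewrite opprB addrC subrK; lra.
move=> x'1; apply: (@le_lt_trans _ _ (C * (e / (C + 1)))); last first.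
  by rewrite mulrA ltr_pdivrMr//; nra.
apply: hC.
- by rewrite (_ : (fun y => _) = fun y => phi (y - x) + (-1) * phi (y - x'));
    [apply: CcD; [|apply: CcZ]; exact: Cc_shift|apply/funext => y; rewrite mulN1r].
- move=> y hy; rewrite (out_shift hM (_ : `|x| <= `|x| + 1)) ?lerDl//.
  by rewrite (out_shift hM x'1)// subrr.
- move=> y; apply: ltW; apply: hdl; rewrite opprB addrC addrA subrK distrC.
  exact: xx'.
Qed.

Lemma conv_derive T phi i x : locfun T -> Cc phi -> Ck 1 phi ->
  is_derive x (e_ i) (conv T phi) (- conv T (partial i phi) x).
Proof.
move=> hT cphi hphi; have [M hM] := cphi.2.
(* The cube of radius M + |x| + 1 contains the supports of all translates by x + t e_i with |t| < 1,
   so one constant serves the whole difference quotient. *)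
have [C C0 hC] := hT.2 (M + (`|x| + 1)).
have cp := Cc_partial i hphi cphi.
apply: is_derive_estimate => e e0.
have C1 : 0 < C + 1 by lra.
have [dl dl0 hdl] := quotient_unif_Cc i hphi cphi (divr_gt0 e0 C1).
exists (Num.min dl 1); first by rewrite lt_min dl0 ltr01.
move=> t; rewrite lt_min => /andP[tdl t1].
have n1 : `|t *: e_ i| <= 1 by rewrite normrZ mulr_ile1// ?norm_basis_rV// ltW.
rewrite /conv mulrN opprK -locfunB; [|by []|exact: Cc_shift|exact: Cc_shift].
have c1 : Cc (fun y => phi (y - (t *: e_ i + x)) - phi (y - x)).
  by rewrite (_ : (fun y => _) = fun y => phi (y - (t *: e_ i + x)) + (-1) * phi (y - x));
    [apply: CcD; [|apply: CcZ]; exact: Cc_shift|apply/funext => y; rewrite mulN1r].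
rewrite -locfunZ//; last exact: Cc_shift.
rewrite -locfunD//; last by apply: CcZ; exact: Cc_shift.
apply: (@le_trans _ _ (C * (e / (C + 1) * `|t|))); last first.
  rewrite mulrA ler_wpM2r// mulrA ler_pdivrMr//; nra.
have xt : `|t *: e_ i + x| <= `|x| + 1 by have := ler_normD (t *: e_ i) x; lra.
have x1 : `|x| <= `|x| + 1 by rewrite lerDl.
apply: hC.
- by apply: CcD => //; apply: CcZ; exact: Cc_shift.
- move=> y hy; rewrite (out_shift hM xt)// (out_shift hM x1)// subrr add0r.
  by rewrite (@partial_out _ _ phi M) ?mulr0//; have := lerB_dist y x; lra.
- move=> y; have := hdl (y - x) (- t); rewrite normrN => /(_ tdl).
  rewrite (_ : - t *: e_ i + (y - x) = y - (t *: e_ i + x)); last first.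
    by rewrite scaleNr opprD addrCA.
  by rewrite mulNr opprK.
Qed.

Lemma conv_partial T phi i : locfun T -> Cc phi -> Ck 1 phi ->
  partial i (conv T phi) = fun x => - conv T (partial i phi) x.
Proof. by move=> hT c h; apply/funext => x; apply: partialE; exact: conv_derive. Qed.

Lemma conv_partial2 T phi i : locfun T -> Cc phi -> Ck 2 phi ->
  partial i (partial i (conv T phi)) = conv T (partial i (partial i phi)).
Proof.
move=> hT c h; have h1 := CkW h; rewrite conv_partial//.
apply/funext => x; apply: partialE.
have := conv_derive i x hT (Cc_partial i h1 c) (Ck_partial i h).
move=> /(is_derive_scale (-1)); rewrite mulN1r opprK.
by rewrite (_ : (fun y => _) = fun y => - conv T (partial i phi) y)//; apply/funext => y; rewrite mulN1r.
Qed.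

Lemma Ck_conv n T phi : locfun T -> Cc phi -> (forall k, Ck k phi) -> Ck n (conv T phi).
Proof.
move=> hT; elim: n phi => [|n ih] phi c h; first by split => //; exact: conv_continuous.
apply: (@Ck_of_derive _ _ _ _ (fun i x => - conv T (partial i phi) x)).
- exact: conv_continuous.
- by move=> i x; exact: conv_derive.
- move=> i; apply: CkN; apply: ih; first exact: Cc_partial.
  by move=> k; exact: Ck_partial.
Qed.

Lemma grid_finite n M : exists q : seq V, uniq q /\ forall x, `|x| <= M -> grid n x \in q.
Proof.
pose N := (Num.bound (n.+1%:R * `|M|)).+1.
pose g (h : {ffun 'I_d -> 'I_(2 * N).+1}) : V := \row_i (((h i)%:Z - N%:Z)%:~R / n.+1%:R).
exists (undup [seq g h | h : {ffun 'I_d -> 'I_(2 * N).+1}]); split; first exact: undup_uniq.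
move=> x xM; rewrite mem_undup.
have bd i : (- N%:Z <= Num.floor (n.+1%:R * x ord0 i) <= N%:Z)%R.
  have xi : `|n.+1%:R * x ord0 i| <= n.+1%:R * `|M|.
    rewrite normrM ger0_norm// ler_wpM2l// (le_trans (coord_le_norm x i))//.
    by rewrite (le_trans xM)// ler_norm.
  have := archi_boundP (_ : 0 <= n.+1%:R * `|M|); rewrite mulr_ge0// => /(_ isT).
  move: xi; rewrite ler_norml => /andP[a1 a2] a3.
  have NE : N%:R = (Num.bound (n.+1%:R * `|M|))%:R + 1 :> R by rewrite /N -natr1.
  have b1 := floor_le (n.+1%:R * x ord0 i); have b2 := floorD1_gt (n.+1%:R * x ord0 i).
  rewrite intrD in b2.
  apply/andP; split; rewrite -(ler_int R) ?rmorphN /= -?pmulrn; lra.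
pose h : {ffun 'I_d -> 'I_(2 * N).+1} :=
  [ffun i => inord `|(Num.floor (n.+1%:R * x ord0 i) + N%:Z)%R|%N].
suff -> : grid n x = g h by apply/mapP; exists h => //; rewrite mem_enum.
apply/rowP => i; rewrite !mxE; congr (_ / _); congr _%:~R.
rewrite ffunE inordK; last first.
  by have := bd i => /andP[]; lia.
by have := bd i => /andP[]; lia.
Qed.

Lemma fraction_budget (C I e : R) : 0 <= C -> 0 <= I -> 0 < e ->
  C * (e / (2 * (C + 1) * (I + 1))) * I + C * (e / (2 * (C + 1) * (I + 1)) * I) <= e.
Proof.
move=> C0 I0 e0; have CI := mulr_ge0 C0 I0.
have D0 : 0 < 2 * (C + 1) * (I + 1) by apply: mulr_gt0; lra.
have -> : C * (e / (2 * (C + 1) * (I + 1))) * I + C * (e / (2 * (C + 1) * (I + 1)) * I) =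
  e * ((2 * (C * I)) / (2 * (C + 1) * (I + 1))).
  by field; rewrite !gt_eqF//; lra.
by rewrite ler_piMr ?(ltW e0)// ler_pdivrMr//; lra.
Qed.

(* The integral is a uniform limit of Riemann sums, on which T acts by linearity. *)
Lemma conv_Fubini T phi phi' f : locfun T -> Cc phi -> Cc phi' ->
  (forall x, phi' x = phi (- x)) -> Cc f ->
  \int[mu]_x (conv T phi x * f x) = T (conv (pairing f) phi').
Proof.
move=> hT cphi cphi' phiN cf; have [r hr] := cphi.2; have [M hM] := cf.2.
have lf : locL1 f by apply: continuous_locL1; exact: cf.1.
have hpf := locfun_pairing lf.
set M' := Num.max M 0.
have hM' x : M' < `|x| -> f x = 0 by rewrite gt_max => /andP[/hM].
have M'0 : 0 <= M' by rewrite le_max lexx orbT.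
have [C C0 hC] := hT.2 (r + (M' + 1)).
set I0 := \int[mu]_x `|f x|.
have I00 : 0 <= I0 by exact: Int_ge0.
apply/eqP; rewrite -subr_eq0 -normr_eq0 eq_le normr_ge0 andbT; apply/ler_addgt0Pr => e e0.
(* Each of the two Riemann sum errors is at most C I0 e1, and this choice keeps their sum below
   [e]. *)
pose e1 := e / (2 * (C + 1) * (I0 + 1)).
have D0 : 0 < 2 * (C + 1) * (I0 + 1) by apply: mulr_gt0; lra.
have e10 : 0 < e1 by rewrite divr_gt0.
have [dl dl0 hdl] := Cc_unif_cont cphi e10.
have [n hn] : exists n : nat, n.+1%:R^-1 < dl.
  exists (Num.bound dl^-1); rewrite invf_plt ?posrE//.
  apply: lt_trans (archi_boundP _) _; first by rewrite invr_ge0 ltW.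
  by rewrite ltr_nat.
have gx x : `|x - grid n x| < dl by rewrite distrC (le_lt_trans (grid_near n x)).
have gM x : `|x| <= M' -> `|grid n x| <= M' + 1.
  move=> xM; rewrite -[grid n x](subrK x) (le_trans (ler_normD _ _))// addrC lerD//.
  by rewrite (le_trans (grid_near n x))// invf_le1// ler1n.
have [q [uq hq]] := grid_finite n M'.
(* The integral of [f] over the lattice cell of [z], so that the sum of conv T phi z times w z over
   [q] is the Riemann sum. *)
pose w z := \int[mu]_x (f x * \1_[set y | grid n y = z] x).
have mf := continuous_measurable_rV cf.1.
have iw z : intg (fun x => f x * \1_[set y | grid n y = z] x).
  have mI : measurable [set y : V | grid n y = z].
    have [[x <-]|nx] := pselect (exists x, grid n x = z); first exact: measurable_fiber_grid.
    rewrite (_ : mkset _ = set0)//; apply/seteqP; split => // x /= xz; apply: nx.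
    by exists x.
  apply: le_intg (intg_norm (Cc_intg cf)); first by apply: measurable_funM => //; exact: measurable_indic.
  by move=> x; rewrite normrM ler_piMr// indicE; case: (_ \in _); rewrite ?normr0 ?normr1.
have split_f (F : V -> R) x : F (grid n x) * f x =
    \sum_(z <- q) F z * (f x * \1_[set y | grid n y = z] x).
  have [xM|xM] := lerP `|x| M'; last by rewrite hM'// mulr0 big1// => z _; rewrite mul0r mulr0.
  rewrite (bigD1_seq (grid n x))//=; last exact: hq.
  rewrite indicE mem_set// mulr1 big1 ?addr0// => z zx.
  by rewrite indicE memNset ?mulr0// => /= e'; rewrite e' eqxx in zx.
have sum_f (F : V -> R) : \int[mu]_x (F (grid n x) * f x) = \sum_(z <- q) F z * w z.
  under eq_Rintegral do rewrite split_f.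
  rewrite Int_sum; last by move=> z; exact: intgZ.
  by apply: eq_bigr => z _; rewrite IntZ.
have int_f (F : V -> R) : intg (fun x => F (grid n x) * f x).
  apply: (@eq_intg _ _ (fun x => \sum_(z <- q) F z * (f x * \1_[set y | grid n y = z] x))).
    by move=> x; rewrite split_f.
  by apply: intg_sum => z; exact: intgZ.
pose S := \sum_(z <- q) conv T phi z * w z.
have cw z : Cc (fun y => w z * phi (y - z)) by apply: CcZ; exact: Cc_shift.
have bnd1 : `|\int[mu]_x (conv T phi x * f x) - S| <= C * e1 * I0.
  have i1 : intg (fun x => conv T phi x * f x).
    by apply: Cc_intg; apply: CcMl => //; exact: conv_continuous.
  rewrite /S -sum_f -IntB//; apply: le_trans (norm_Int (intgB i1 (int_f _))) _.
  rewrite -IntZ; last exact: intg_norm (Cc_intg cf).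
  apply: le_Int; [exact: intg_norm (intgB _ _)|exact/intgZ/intg_norm/Cc_intg|].
  move=> x; rewrite -mulrBl normrM; have [xM|xM] := lerP `|x| M'; last first.
    by rewrite hM'// normr0 !mulr0.
  rewrite ler_wpM2r// /conv -locfunB//; try exact: Cc_shift.
  have x1 : `|x| <= M' + 1 by lra.
  apply: hC.
  - by rewrite (_ : (fun y => _) = fun y => phi (y - x) + (-1) * phi (y - grid n x));
      [apply: CcD; [|apply: CcZ]; exact: Cc_shift|apply/funext => y; rewrite mulN1r].
  - by move=> y hy; rewrite (out_shift hr x1)// (out_shift hr (gM _ xM))// subrr.
  - move=> y; apply: ltW; apply: hdl; rewrite opprB addrC addrA subrK distrC.
    exact: gx.
have SE : S = T (fun y => \sum_(z <- q) w z * phi (y - z)).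
  rewrite locfun_sum//; apply: eq_bigr => z _.
  have cz : Cc (fun y => phi (y - z)) by exact: Cc_shift.
  by rewrite (locfunZ (w z) hT cz) [RHS]mulrC.
have cc : Cc (conv (pairing f) phi').
  apply: (@CcP _ _ _ (M' + r)); first exact: conv_continuous.
  move=> y hy; rewrite /conv /pairing -[RHS](@Int0 R d); apply: eq_Int => x.
  have [xM|xM] := lerP `|x| M'; last by rewrite hM'// mul0r.
  by rewrite phiN hr ?mulr0// opprB; have := lerB_dist y x; lra.
(* Read inside [T], the same sum is uniformly close to the mollification of [f] and supported in a
   fixed cube, where [T] is bounded. *)
have bnd2 : `|S - T (conv (pairing f) phi')| <= C * (e1 * I0).
  rewrite SE -locfunB//; last exact: Cc_sum.
  apply: hC.
  - rewrite (_ : (fun y => _) = fun y => (\sum_(z <- q) w z * phi (y - z)) + (-1) * conv (pairing f) phi' y);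
      [apply: CcD; [exact: Cc_sum|exact: CcZ]|apply/funext => y; by rewrite mulN1r].
  - move=> y hy; rewrite (_ : \sum_(z <- q) _ = \int[mu]_x (phi (y - grid n x) * f x)); last first.
      by rewrite (sum_f (fun z => phi (y - z))); apply: eq_bigr => z _; rewrite mulrC.
    rewrite /conv /pairing -IntB; [|exact: (int_f (fun z => phi (y - z)))|].
      rewrite -[RHS](@Int0 R d); apply: eq_Int => x.
      have [xM|xM] := lerP `|x| M'; last by rewrite hM'// mulr0 mul0r subrr.
      rewrite (out_shift hr (gM x xM))// phiN opprB (out_shift hr (_ : `|x| <= M' + 1))//; last lra.
      by rewrite mul0r mulr0 subrr.
    by apply: locL1_Cc => //; exact: Cc_shift.
  - move=> y; rewrite (_ : \sum_(z <- q) _ = \int[mu]_x (phi (y - grid n x) * f x)); last first.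
      by rewrite (sum_f (fun z => phi (y - z))); apply: eq_bigr => z _; rewrite mulrC.
    have i1 := int_f (fun z => phi (y - z)).
    have i2 : intg (fun x => f x * phi' (x - y)) by apply: locL1_Cc => //; exact: Cc_shift.
    rewrite /conv /pairing -IntB//; apply: le_trans (norm_Int (intgB i1 i2)) _.
    rewrite -IntZ; last exact: intg_norm (Cc_intg cf).
    apply: le_Int; [exact: intg_norm (intgB _ _)|exact/intgZ/intg_norm/Cc_intg|].
    move=> x; rewrite [f x * _]mulrC -mulrBl normrM ler_wpM2r// phiN opprB.
    apply: ltW; apply: hdl; rewrite opprB addrC addrA subrK; exact: gx.
rewrite add0r; apply: le_trans (ler_distD S _ _) _.
apply: le_trans (lerD bnd1 bnd2) _.
exact: fraction_budget.
Qed.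

End local_functionals.

Import HBSimple.

(** * Approximation in L^1 by continuous functions *)

Section continuous_density.
Context {R : realType} {d : nat}.
Notation V := 'rV[R]_d.
Notation mu := (@lebesgue_rV R d).
Implicit Types (f g u phi : V -> R) (x y z : V) (e r c s M : R) (A B : set V).

Lemma cvg_eventually (F : nat -> R) l : (exists N, forall n, (N <= n)%N -> F n = l) -> F @ \oo --> l.
Proof.
move=> [N h]; apply/cvgrPdist_lt => e e0; exists N => // n /= Nn.
by rewrite h// subrr normr0.
Qed.

Lemma Int_dct (F : nat -> V -> R) f g : (forall n, measurable_fun setT (F n)) ->
  (forall x, F ^~ x @ \oo --> f x) -> (forall n x, `|F n x| <= g x) -> intg g ->
  intg f /\ (fun n => \int[mu]_x F n x) @ \oo --> \int[mu]_x f x.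
Proof.
move=> mF Ff Fg ig.
have mf : measurable_fun setT f by apply: (measurable_fun_cvg mF) => x _; exact: Ff.
have fg x : `|f x| <= g x.
  have H : (fun n => `|F n x|) @ \oo --> `|f x| by apply: cvg_norm; exact: Ff.
  apply: (cvgr_to_le H); exact: nearW.
have hf : intg f := le_intg mf fg ig.
split => //; have iF n : intg (F n) := le_intg (mF n) (Fg n) ig.
have mF' n : measurable_fun setT (EFin \o F n) by exact/measurable_EFinP.
have mf' : measurable_fun setT (EFin \o f) by exact/measurable_EFinP.
have Ff' : {ae mu, forall x, setT x -> (fun n => (EFin \o F n) x) @ \oo --> (EFin \o f) x}.
  by apply: aeW => x _; apply: cvg_EFin; [exact: nearW|exact: Ff].
have Fg' : {ae mu, forall x n, setT x -> (`|(EFin \o F n) x| <= (EFin \o g) x)%E}.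
  by apply: aeW => x n _; rewrite lee_fin.
have [_ _] := dominated_convergence measurableT mF' mf' Ff' ig Fg'.
rewrite (_ : [sequence _]_n = EFin \o (fun n => \int[mu]_x F n x)); last first.
  by apply/funext => n /=; rewrite -IntE.
rewrite (_ : (\int[mu]_(x in setT) (EFin \o f) x)%E = (\int[mu]_x f x)%:E); last by rewrite -IntE.
by move/fine_cvgP => [_].
Qed.

Definition clamp s : R := Num.max 0 (Num.min 1 s).

Lemma clamp01 s : 0 <= clamp s <= 1.
Proof. by rewrite /clamp le_max lexx /= ge_max ler01 ge_min lexx. Qed.

Lemma clamp_le0 s : s <= 0 -> clamp s = 0.
Proof. by move=> h; rewrite /clamp max_l// ge_min h orbT. Qed.

Lemma clamp_ge1 s : 1 <= s -> clamp s = 1.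
Proof. by move=> h; rewrite /clamp (min_l h) max_r. Qed.

Lemma continuous_clamp f : continuous f -> continuous (fun x => clamp (f x)).
Proof.
move=> cf x; apply: (@continuous_max _ _ (fun=> 0) (fun x => Num.min 1 (f x))).
  exact: cst_continuous.
by apply: (@continuous_min _ _ (fun=> 1) f); [exact: cst_continuous|exact: cf].
Qed.

(** Equal to 1 on the cube of radius M and to 0 beyond M + 1/n. For n = 0 it is the constant 1,
    which is why compact support is claimed for the index [n.+1] only. *)
Definition cutoff M (n : nat) x : R := clamp (1 + n%:R * (M - `|x|)).

Lemma continuous_cutoff M n : continuous (cutoff M n).
Proof.
apply: continuous_clamp.
have h : Ck 0 (fun x : V => `|x|) by split => //; exact: norm_continuous.
exact: (Ck_cont (CkD (@Ck_cst R d 0 1) (CkZ n%:R (CkD (@Ck_cst R d 0 M) (CkN h))))).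
Qed.

Lemma cutoff_in M n x : `|x| <= M -> cutoff M n x = 1.
Proof. by move=> h; apply: clamp_ge1; rewrite lerDl mulr_ge0// subr_ge0. Qed.

Lemma cutoff_out M n x : M + 1 < `|x| -> cutoff M n.+1 x = 0.
Proof.
move=> h; apply: clamp_le0; rewrite -natr1.
have : 0 <= n%:R * (`|x| - M) by rewrite mulr_ge0//; lra.
by rewrite mulrDl mul1r mulrBr mulrBr; lra.
Qed.

Lemma Cc_cutoff M n : Cc (cutoff M n.+1).
Proof. by apply: (@CcP _ _ _ (M + 1)); [exact: continuous_cutoff|exact: cutoff_out]. Qed.

Lemma cutoff01 M n x : 0 <= cutoff M n x <= 1.
Proof. exact: clamp01. Qed.

(** The sets approximable in L^1 of the cube by continuous functions with values in [0, 1]. They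
    form a sigma-algebra containing the half-spaces, hence include all measurable sets. *)
Let D M A := measurable A /\ forall e, 0 < e -> exists phi, [/\ continuous phi,
  forall x, 0 <= phi x <= 1 & \int[mu]_x (`|\1_A x - phi x| * \1_(cube M) x) <= e].

Let D_int M A phi : measurable A -> continuous phi -> intg (fun x => `|\1_A x - phi x| * \1_(cube M) x).
Proof.
move=> mA cphi.
have h : locL1 (fun x => \1_A x - phi x).
  have h1 : locL1 (\1_A : V -> R).
    split; first exact: measurable_indic.
    move=> N; apply: le_intg (@intg_indic_cube R d N).
      by apply: measurable_funM; [exact: measurable_indic|exact: measurable_indic_cube].
    by move=> x; rewrite !indicE; do 2 case: (_ \in _); rewrite ?mulr1 ?mulr0 ?normr0 ?normr1.
  have := locL1D h1 (continuous_locL1 (Ck_cont (CkN (conj cphi I : Ck 0 phi)))).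
  by [].
exact: (locL1_norm h).2.
Qed.

Let DC M A : D M A -> D M (~` A).
Proof.
move=> [mA h]; split; first exact: measurableC.
move=> e /h[phi [cphi phi01 he]]; exists (fun x => 1 - phi x); split.
- exact: (Ck_cont (CkD (@Ck_cst R d 0 1) (CkN (conj cphi I : Ck 0 phi)))).
- by move=> x; have := phi01 x; lra.
- rewrite (le_trans _ he)// le_eqVlt; apply/orP; left; apply/eqP; apply: eq_Int => x; congr (_ * _).
  rewrite -normrN; congr `|_|; rewrite !indicE in_setC.
  by case: (_ \in _) => /=; ring.
Qed.

Let DU M A B : D M A -> D M B -> D M (A `|` B).
Proof.
move=> [mA hA] [mB hB]; split; first exact: measurableU.
move=> e e0; have e2 : 0 < e / 2 by rewrite divr_gt0.
have [phi [cphi phi01 hphi]] := hA _ e2; have [psi [cpsi psi01 hpsi]] := hB _ e2.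
(* This combination stays in [0, 1], and its distance to the indicator of the union is at most the
   sum of the two given distances. *)
exists (fun x => phi x + psi x - phi x * psi x); split.
- exact: (Ck_cont (CkD (CkD (conj cphi I : Ck 0 phi) (conj cpsi I : Ck 0 psi))
    (CkN (CkM (conj cphi I : Ck 0 phi) (conj cpsi I : Ck 0 psi))))).
- by move=> x; have := phi01 x; have := psi01 x; nra.
have iA := D_int M mA cphi; have iB := D_int M mB cpsi.
apply: (@le_trans _ _ (e / 2 + e / 2)); last by rewrite -splitr.
apply: le_trans (lerD hphi hpsi); rewrite -IntD//.
apply: le_Int; [|exact: intgD|].
  apply: D_int; first exact: measurableU.
  exact: (Ck_cont (CkD (CkD (conj cphi I : Ck 0 phi) (conj cpsi I : Ck 0 psi))
    (CkN (CkM (conj cphi I : Ck 0 phi) (conj cpsi I : Ck 0 psi))))).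
move=> x; rewrite -mulrDl ler_wpM2r//.
have := phi01 x; have := psi01 x; rewrite !indicE in_setU => /andP[q0 q1] /andP[p0 p1].
have pq : 0 <= phi x * psi x by exact: mulr_ge0.
have pq1 : phi x * psi x <= phi x by rewrite ler_piMr.
have pq2 : phi x * psi x <= psi x by rewrite ler_piMl.
have pq3 : 0 <= (1 - phi x) * (1 - psi x) by apply: mulr_ge0; lra.
have n1 := ler_norm (1 - phi x); have n2 := ler_norm (1 - psi x).
have n3 := ler_norm (- (0 - phi x)); have n4 := ler_norm (- (0 - psi x)).
rewrite !normrN in n3 n4.
by case: (x \in A); case: (x \in B) => /=; rewrite ler_norml; apply/andP; split; lra.
Qed.

Let Dbig M (F : nat -> set V) : (forall n, D M (F n)) -> D M (\bigcup_n F n).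
Proof.
move=> hF; have mU : measurable (\bigcup_n F n) by apply: bigcupT_measurable => n; case: (hF n).
split => // e e0.
pose G n := \big[setU/set0]_(i < n) F i.
have hG n : D M (G n).
  elim: n => [|n ih]; last by rewrite /G big_ord_recr; exact: DU.
  rewrite /G big_ord0; split => // e' e'0; exists (fun=> 0); split => [x|x|].
  - exact: cst_continuous.
  - by rewrite lexx ler01.
  rewrite (@eq_Int _ _ _ (fun=> 0)) ?Int0 ?ltW// => x.
  by rewrite indic0 subrr normr0 mul0r.
have GP m x : G m x <-> exists2 i, (i < m)%N & F i x.
  rewrite /G; elim: m => [|m ih]; first by rewrite big_ord0; split => // -[].
  rewrite big_ord_recr /=; split.
    by move=> [/ih[i im Fi]|Fm]; [exists i => //; exact: ltnW|exists m].
  move=> [i]; rewrite ltnS leq_eqVlt => /orP[/eqP -> ?|im Fi]; first by right.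
  by left; apply/ih; exists i.
(* Dominated convergence reduces the countable union to a finite one. *)
have [_ H] : intg (fun _ : V => 0 : R) /\ (fun n => \int[mu]_x (`|\1_(\bigcup_n F n) x - \1_(G n) x| * \1_(cube M) x)) @ \oo --> \int[mu]_x (0 : R).
  apply: (@Int_dct _ (fun=> 0) (fun x => \1_(cube M) x)).
  - move=> n; apply: measurable_funM; last exact: measurable_indic_cube.
    apply: measurableT_comp => //; apply: measurable_funB; apply: measurable_indic => //.
    by case: (hG n).
  - move=> x; have [[n _ Fnx]|nU] := pselect ((\bigcup_n F n) x).
      apply: cvg_eventually; exists n.+1 => m nm.
      have e1 : \1_(\bigcup_n F n) x = 1 :> R by rewrite indicE mem_set//; exists n.
      have e2 : \1_(G m) x = 1 :> R by rewrite indicE mem_set//; apply/GP; exists n.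
      by rewrite e1 e2 subrr normr0 mul0r.
    apply: cvg_eventually; exists 0%N => m _.
    have e1 : \1_(\bigcup_n F n) x = 0 :> R by rewrite indicE memNset.
    have e2 : \1_(G m) x = 0 :> R.
      by rewrite indicE memNset// => /GP[i _ Fi]; apply: nU; exists i.
    by rewrite e1 e2 subrr normr0 mul0r.
  - move=> n x; rewrite normrM normr_id !indicE.
    by do 3 case: (_ \in _); rewrite ?subrr ?sub0r ?subr0 ?normrN ?normr1 ?normr0 ?mulr1 ?mulr0.
  - exact: intg_indic_cube.
rewrite Int0 in H; have e2 : 0 < e / 2 by rewrite divr_gt0.
have /cvgrPdist_lt/(_ _ e2)[n _ /(_ n (leqnn n))] := H.
rewrite sub0r normrN ger0_norm; last by apply: Int_ge0 => x; rewrite mulr_ge0.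
move=> hn; have [mGn /(_ _ e2)[phi [cphi phi01 hphi]]] := hG n.
exists phi; split => //.
apply: (@le_trans _ _ (e / 2 + e / 2)); last by rewrite -splitr.
apply: le_trans (lerD (ltW hn) hphi).
have i1 : intg (fun x => `|\1_(\bigcup_n F n) x - \1_(G n) x| * \1_(cube M) x).
  apply: le_intg (@intg_indic_cube R d M).
    apply: measurable_funM; last exact: measurable_indic_cube.
    by apply: measurableT_comp => //; apply: measurable_funB; exact: measurable_indic.
  move=> x; rewrite normrM normr_id !indicE.
  by do 3 case: (_ \in _); rewrite ?subrr ?sub0r ?subr0 ?normrN ?normr1 ?normr0 ?mulr1 ?mulr0.
rewrite -IntD//; last exact: D_int.
apply: le_Int; [exact: D_int|apply: intgD => //; exact: D_int|].
by move=> x; rewrite -mulrDl ler_wpM2r// ler_distD.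
Qed.

Let Dall M A : measurable A -> D M A.
Proof.
have DS : sigma_algebra setT (D M).
  split.
  - split => // e e0; exists (fun=> 0); split => [x|x|].
    + exact: cst_continuous.
    + by rewrite lexx ler01.
    + rewrite (@eq_Int _ _ _ (fun=> 0)) ?Int0 ?ltW// => x.
      by rewrite indic0 subrr normr0 mul0r.
  - by move=> B /DC; rewrite setTD.
  - exact: Dbig.
move: A; apply: smallest_sub => //.
rewrite -bigcup_seq => A [i _ [B mB <-]] /=; rewrite setTI.
have Dhalf a : D M ((fun x : V => x ord0 i) @^-1` `]a, +oo[).
  have mH : measurable ((fun x : V => x ord0 i) @^-1` `]a, +oo[).
    by rewrite -[X in measurable X]setTI; exact: measurable_coord.
  split => // e e0.
  (* Ramps of slope [n] that increase to the indicator of the half-space x_i > a. *)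
  pose phi n x := clamp (n%:R * (x ord0 i - a)).
  have cphi n : continuous (phi n).
    apply: continuous_clamp.
    exact: (Ck_cont (CkZ n%:R (CkD (@Ck_coord R d 0 i) (@Ck_cst R d 0 (- a))))).
  have [_ H] : intg (fun _ : V => 0 : R) /\ (fun n => \int[mu]_x (`|\1_((fun x : V => x ord0 i) @^-1` `]a, +oo[) x - phi n x| * \1_(cube M) x)) @ \oo --> \int[mu]_x (0 : R).
    apply: (@Int_dct _ (fun=> 0) (fun x => \1_(cube M) x)); last exact: intg_indic_cube.
    - by move=> n; exact: intg_meas (D_int M mH (cphi n)).
    - move=> x; apply: cvg_eventually.
      have [ax|xa] := ltP a (x ord0 i).
        exists (Num.bound (x ord0 i - a)^-1) => m hm.
        rewrite indicE mem_set/= ?in_itv/= ?ax// /phi clamp_ge1 ?subrr ?normr0 ?mul0r//.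
        have xa0 : 0 < x ord0 i - a by lra.
        rewrite -ler_pdivrMr// mul1r; apply: le_trans (ltW (archi_boundP _)) _.
          by rewrite invr_ge0 ltW.
        by rewrite ler_nat.
      exists 0%N => n _; rewrite indicE memNset/= ?in_itv/= ?andbT.
        by rewrite /phi clamp_le0 ?subrr ?normr0 ?mul0r// mulr_ge0_le0//; lra.
      by apply/negP; rewrite -leNgt.
    - move=> n x; rewrite normrM normr_id ger0_norm ?indicE// ler_piMl//.
      by have := clamp01 (n%:R * (x ord0 i - a)); rewrite -/(phi n x) ler_norml; case: (_ \in _) => /=; lra.
  rewrite Int0 in H; have /cvgrPdist_lt/(_ _ e0)[n _ /(_ n (leqnn n))] := H.
  rewrite sub0r normrN ger0_norm; last by apply: Int_ge0 => x; rewrite mulr_ge0.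
  move=> /ltW hn; exists (phi n); split => // x; exact: clamp01.
have DS' : sigma_algebra setT [set B : set R | D M ((fun x : V => x ord0 i) @^-1` B)].
  split => /=.
  - rewrite preimage_set0; by case: DS.
  - by move=> C /DC; rewrite setTD preimage_setC.
  - by move=> F hF; rewrite preimage_bigcup; exact: Dbig.
have : [set B : set R | D M ((fun x : V => x ord0 i) @^-1` B)] B; last by [].
move: B mB; apply: smallest_sub => // _ [[a b] _ <-] /=.
rewrite (_ : _ @^-1` _ = ~` ((~` ((fun x : V => x ord0 i) @^-1` `]a, +oo[)) `|` ((fun x : V => x ord0 i) @^-1` `]b, +oo[))).
  by apply: DC; apply: DU => //; exact: DC.
apply/seteqP; split => x /=; rewrite !in_itv/= !andbT.
  by move=> /andP[h1 h2] [//|]; rewrite ltNge h2.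
move=> h; apply/andP; split; first by apply: contrapT => h'; apply: h; left.
by rewrite leNgt; apply/negP => h'; apply: h; right.
Qed.

Definition L1_approx u := intg u /\ forall e, 0 < e -> exists2 phi, Cc phi &
  \int[mu]_x `|u x - phi x| <= e.

Lemma L1_approx_indic A M : measurable A -> L1_approx (fun x => \1_A x * \1_(cube M) x).
Proof.
move=> mA; split.
  apply: le_intg (@intg_indic_cube R d M).
    by apply: measurable_funM; [exact: measurable_indic|exact: measurable_indic_cube].
  by move=> x; rewrite !indicE; do 2 case: (_ \in _); rewrite ?mulr1 ?mulr0 ?normr0 ?normr1.
move=> e e0; have e2 : 0 < e / 2 by rewrite divr_gt0.
have [_ /(_ _ e2)[phi [cphi phi01 hphi]]] := @Dall M A mA.
have [_ H] : intg (fun _ : V => 0 : R) /\ (fun n => \int[mu]_x `|\1_(cube M) x - cutoff M n.+1 x|) @ \oo --> \int[mu]_x (0 : R).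
  apply: (@Int_dct _ (fun=> 0) (fun x => \1_(cube (M + 1)) x)); last exact: intg_indic_cube.
  - move=> n; apply: measurableT_comp => //; apply: measurable_funB; first exact: measurable_indic_cube.
    exact: (continuous_measurable_rV (@continuous_cutoff M n.+1)).
  - move=> x; apply: cvg_eventually.
    have [xM|xM] := lerP `|x| M.
      by exists 0%N => n _; rewrite indic_cube_in// cutoff_in// subrr normr0.
    exists (Num.bound (`|x| - M)^-1) => m hm.
    rewrite indic_cube_out// /cutoff clamp_le0 ?subrr ?normr0//.
    have xa0 : 0 < `|x| - M by lra.
    suff : 1 <= m.+1%:R * (`|x| - M) by rewrite !mulrBr; lra.
    rewrite -ler_pdivrMr// mul1r; apply: le_trans (ltW (archi_boundP _)) _.
      by rewrite invr_ge0 ltW.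
    by rewrite ler_nat (leq_trans hm).
  - move=> n x; rewrite normr_id; have [xM|xM] := lerP `|x| (M + 1).
      rewrite (indic_cube_in xM) indicE; have := cutoff01 M n.+1 x.
      by rewrite ler_norml; case: (_ \in _) => /=; lra.
    by rewrite cutoff_out// !indic_cube_out ?subrr ?normr0//; lra.
rewrite Int0 in H; have /cvgrPdist_lt/(_ _ e2)[n _ /(_ n (leqnn n))] := H.
rewrite sub0r normrN ger0_norm; last by apply: Int_ge0.
move=> /ltW hn; exists (fun x => phi x * cutoff M n.+1 x).
  by apply: CcMl => //; exact: Cc_cutoff.
apply: (@le_trans _ _ (e / 2 + e / 2)); last by rewrite -splitr.
apply: le_trans (lerD hphi hn).
have i1 := D_int M mA cphi.
have i2 : intg (fun x => `|\1_(cube M) x - cutoff M n.+1 x|).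
  apply/intg_norm/intgB; [exact: intg_indic_cube|exact/Cc_intg/Cc_cutoff].
rewrite -IntD//; apply: le_Int.
- apply/intg_norm/intgB; last by apply: Cc_intg; apply: CcMl => //; exact: Cc_cutoff.
  apply: le_intg (@intg_indic_cube R d M).
    by apply: measurable_funM; [exact: measurable_indic|exact: measurable_indic_cube].
  by move=> x; rewrite !indicE; do 2 case: (_ \in _); rewrite ?mulr1 ?mulr0 ?normr0 ?normr1.
- exact: intgD.
move=> x; have -> : \1_A x * \1_(cube M) x - phi x * cutoff M n.+1 x =
  (\1_A x - phi x) * \1_(cube M) x + phi x * (\1_(cube M) x - cutoff M n.+1 x) by ring.
apply: le_trans (ler_normD _ _) _; rewrite !normrM (@ger0_norm _ (\1_(cube M) x))// lerD2l.
by have := phi01 x => /andP[p0 p1]; rewrite ger0_norm// ler_piMl.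
Qed.

Lemma L1_approxD u v : L1_approx u -> L1_approx v -> L1_approx (fun x => u x + v x).
Proof.
move=> [iu hu] [iv hv]; split; first exact: intgD.
move=> e e0; have e2 : 0 < e / 2 by rewrite divr_gt0.
have [phi cphi hphi] := hu _ e2; have [psi cpsi hpsi] := hv _ e2.
exists (fun x => phi x + psi x); first exact: CcD.
apply: (@le_trans _ _ (e / 2 + e / 2)); last by rewrite -splitr.
apply: le_trans (lerD hphi hpsi).
have j1 := intgB iu (Cc_intg cphi); have j2 := intgB iv (Cc_intg cpsi).
rewrite -IntD; [|exact: intg_norm|exact: intg_norm].
apply: le_Int; [|by apply: intgD; exact: intg_norm|].
  by apply/intg_norm/intgB; [exact: intgD|apply: intgD; exact: Cc_intg].
by move=> x; rewrite opprD addrACA ler_normD.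
Qed.

Lemma L1_approxZ c u : L1_approx u -> L1_approx (fun x => c * u x).
Proof.
move=> [iu hu]; split; first exact: intgZ.
move=> e e0; have C0 : 0 < `|c| + 1 by rewrite ltr_wpDl.
have [phi cphi hphi] := hu _ (divr_gt0 e0 C0).
exists (fun x => c * phi x); first exact: CcZ.
under eq_Rintegral do rewrite -mulrBr normrM.
rewrite IntZ; last exact/intg_norm/intgB/Cc_intg.
apply: le_trans (ler_wpM2l (normr_ge0 c) hphi) _.
rewrite mulrCA ler_piMr ?(ltW e0)// ler_pdivrMr// mul1r; lra.
Qed.

Lemma L1_approx_closed u : intg u -> (forall e, 0 < e -> exists2 v, L1_approx v &
  \int[mu]_x `|u x - v x| <= e) -> L1_approx u.
Proof.
move=> iu h; split => // e e0; have e2 : 0 < e / 2 by rewrite divr_gt0.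
have [v [iv hv] uv] := h _ e2; have [phi cphi vphi] := hv _ e2.
exists phi => //; apply: (@le_trans _ _ (e / 2 + e / 2)); last by rewrite -splitr.
apply: le_trans (lerD uv vphi).
rewrite -IntD; [|exact/intg_norm/intgB|exact/intg_norm/intgB/Cc_intg].
apply: le_Int; [exact/intg_norm/intgB/Cc_intg|apply: intgD; [exact/intg_norm/intgB|exact/intg_norm/intgB/Cc_intg]|].
by move=> x; exact: ler_distD.
Qed.

(** Simple functions reduce the claim to indicators; truncating them to the cube only helps, since
    [u] vanishes outside. *)
Lemma L1_approx_intg u M : intg u -> (forall x, M < `|x| -> u x = 0) -> L1_approx u.
Proof.
move=> iu uM; apply: L1_approx_closed => // e e0.
have [g_ [ig _ H]] := approximation_sfun_integrable measurableT iu.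
have h1 n : intg (fun x => `|u x - g_ n x|) by exact/intg_norm/intgB/ig.
move: H; rewrite (_ : (fun n => _) = EFin \o (fun n => \int[mu]_x `|u x - g_ n x|)); last first.
  by apply/funext => n /=; rewrite -IntE.
move=> /fine_cvgP[_ H]; have /cvgrPdist_lt/(_ _ e0)[n _ /(_ n (leqnn n))] := H.
rewrite /= sub0r normrN ger0_norm; last by apply: Int_ge0.
move=> /ltW hn; exists (fun x => g_ n x * \1_(cube M) x).
  have [s hs] : exists s : seq R, forall x, g_ n x * \1_(cube M) x =
      \sum_(y <- s) y * (\1_(g_ n @^-1` [set y]) x * \1_(cube M) x).
    eexists => x; rewrite fimfunE fsbig_finite//= mulr_suml.
    by apply: eq_bigr => y _; rewrite mulrA.
  rewrite (_ : (fun x => _) = fun x => \sum_(y <- s) y * (\1_(g_ n @^-1` [set y]) x * \1_(cube M) x)); last exact/funext.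
  elim: {hs} s => [|y q ih].
    split; first by apply: eq_intg (@intg0 R d) => x; rewrite big_nil.
    move=> e' e'0; exists (fun=> 0).
      by apply: (@CcP _ _ _ 0) => // x; exact: cst_continuous.
    by rewrite (@eq_Int _ _ _ (fun=> 0)) ?Int0 ?ltW// => x; rewrite big_nil subrr normr0.
  rewrite (_ : (fun x => _) = fun x => y * (\1_(g_ n @^-1` [set y]) x * \1_(cube M) x) +
     \sum_(y <- q) y * (\1_(g_ n @^-1` [set y]) x * \1_(cube M) x)); last first.
    by apply/funext => x; rewrite big_cons.
  apply: L1_approxD => //; apply: L1_approxZ; apply: L1_approx_indic.
  exact: measurable_sfunP.
apply: le_trans hn; apply: le_Int => //.
  apply/intg_norm/intgB => //; apply: (le_intg _ _ (intg_norm (ig n))).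
    by apply: measurable_funM; [exact: intg_meas (ig n)|exact: measurable_indic_cube].
  move=> x; rewrite normrM ler_piMr// (ger0_norm (_ : 0 <= \1_(cube M) x))// indicE.
move=> x; have [xM|xM] := lerP `|x| M; first by rewrite indic_cube_in// mulr1.
by rewrite indic_cube_out// mulr0 uM// subrr normr0.
Qed.

End continuous_density.

(* Locked: unfolding it while comparing two of its values is very expensive. *)
HB.lock Definition mol {R : realType} {d : nat} (u : 'rV[R]_d -> R) (e : R) : 'rV[R]_d -> R :=
  conv (pairing u) (moll e).

(** * Mollification of locally integrable functions *)

Section mollification.
Context {R : realType} {d : nat}.
Notation V := 'rV[R]_d.
Notation mu := (@lebesgue_rV R d).
Implicit Types (f g u v h phi : V -> R) (x y z : V) (e r c s M : R).

Lemma molE u e x : mol u e x = \int[mu]_y (u y * moll e (y - x)).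
Proof. by rewrite mol.unlock. Qed.

Lemma Cc_moll_shift e x : 0 <= e -> Cc (fun y => moll e (y - x)).
Proof. by move=> e0; apply: Cc_shift; exact: Cc_moll. Qed.

Lemma intg_mol u e x : 0 <= e -> locL1 u -> intg (fun y => u y * moll e (y - x)).
Proof. by move=> e0 hu; apply: locL1_Cc => //; exact: Cc_moll_shift. Qed.

Lemma Int_moll_shift e x : 0 < e -> \int[mu]_y moll e (y - x) = 1.
Proof.
move=> e0; rewrite (@Int_addr R d (- x) (moll e)) ?Int_moll//.
exact: continuous_measurable_rV (Ck_cont (Ck_moll 0 e)).
Qed.

Lemma Ck_mol n u e : 0 <= e -> locL1 u -> Ck n (mol u e).
Proof.
move=> e0 hu; rewrite mol.unlock; apply: Ck_conv; [exact: locfun_pairing|exact: Cc_moll|by move=> k; exact: Ck_moll].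
Qed.

Lemma mol_continuous u e : 0 <= e -> locL1 u -> continuous (mol u e).
Proof. by move=> e0 hu; exact: (Ck_cont (Ck_mol 0 e0 hu)). Qed.

Lemma le_mol u v e x : 0 <= e -> locL1 u -> locL1 v ->
  (forall y, `|y - x| <= e -> u y <= v y) -> mol u e x <= mol v e x.
Proof.
move=> e0 hu hv uv; rewrite !molE; apply: le_Int; [exact: intg_mol|exact: intg_mol|].
move=> y; have [yx|yx] := lerP `|y - x| e; first by rewrite ler_wpM2r ?moll_ge0 ?uv.
by rewrite moll_out// !mulr0.
Qed.

Lemma eq_mol u v e x : 0 <= e -> (forall y, `|y - x| <= e -> u y = v y) -> mol u e x = mol v e x.
Proof.
move=> e0 uv; rewrite !molE; apply: eq_Int => y; have [yx|yx] := lerP `|y - x| e; first by rewrite uv.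
by rewrite moll_out// !mulr0.
Qed.

Lemma mol_cst c e x : 0 < e -> mol (fun=> c) e x = c.
Proof.
by move=> e0; rewrite molE IntZ ?Int_moll_shift ?mulr1//; exact/Cc_intg/Cc_moll_shift/ltW.
Qed.

Lemma molD u v e x : 0 <= e -> locL1 u -> locL1 v ->
  mol (fun y => u y + v y) e x = mol u e x + mol v e x.
Proof.
move=> e0 hu hv; rewrite !molE -IntD; [|exact: intg_mol|exact: intg_mol].
by apply: eq_Int => y; rewrite mulrDl.
Qed.

Lemma molZ c u e x : 0 <= e -> locL1 u -> mol (fun y => c * u y) e x = c * mol u e x.
Proof.
move=> e0 hu; rewrite !molE -IntZ; last exact: intg_mol.
by apply: eq_Int => y; rewrite mulrA.
Qed.

Lemma norm_mol u e x : 0 <= e -> locL1 u -> `|mol u e x| <= mol (fun y => `|u y|) e x.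
Proof.
move=> e0 hu; rewrite !molE; apply: le_trans (norm_Int (intg_mol _ e0 hu)) _.
apply: le_Int; [exact/intg_norm/intg_mol|exact/intg_mol/locL1_norm|].
by move=> y; rewrite normrM (ger0_norm (moll_ge0 _ _)).
Qed.

Lemma mol_ge0 u e x : (forall y, 0 <= u y) -> 0 <= mol u e x.
Proof. by move=> h; rewrite molE; apply: Int_ge0 => y; rewrite mulr_ge0// moll_ge0. Qed.

Lemma mol_near u e x c : 0 < e -> locL1 u -> (forall y, `|y - x| <= e -> `|u y - u x| <= c) ->
  `|mol u e x - u x| <= c.
Proof.
move=> e0 hu h; have h1 : locL1 (fun y => u y - u x).
  by have := locL1D hu (continuous_locL1 (Ck_cont (@Ck_cst R d 0 (- u x)))).
have -> : mol u e x - u x = mol (fun y => u y - u x) e x.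
  have hc : locL1 (fun _ : V => - u x) by exact: continuous_locL1 (Ck_cont (@Ck_cst R d 0 (- u x))).
  by rewrite (molD x (ltW e0) hu hc) mol_cst.
apply: le_trans (norm_mol _ (ltW e0) h1) _.
rewrite -[leRHS](mol_cst c x e0); apply: le_mol => //; [exact: ltW|exact: locL1_norm|].
exact: continuous_locL1 (Ck_cont (@Ck_cst R d 0 c)).
Qed.

Lemma mol_cvg_unif f M c : continuous f -> 0 < c -> exists2 e0, 0 < e0 &
  forall e x, 0 < e -> e < e0 -> `|x| <= M -> `|mol f e x - f x| <= c.
Proof.
move=> cf c0; have [dl dl0 h] := unif_cont_cube M cf c0.
exists dl => // e x e0 edl xM; apply: mol_near => //; first exact: continuous_locL1.
by move=> y yx; rewrite distrC; apply: ltW; apply: h => //; rewrite distrC; exact: le_lt_trans edl.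
Qed.

(** Mollification is self-adjoint because the mollifier is even; this is [conv_Fubini] for the
    pairing with [u]. *)
Lemma Int_mol_Cc u e f : 0 <= e -> locL1 u -> Cc f ->
  \int[mu]_x (mol u e x * f x) = \int[mu]_x (u x * mol f e x).
Proof.
move=> e0 hu cf; rewrite mol.unlock; apply: (conv_Fubini (locfun_pairing hu) (Cc_moll e0) (Cc_moll e0)) => //.
by move=> x; rewrite mollN.
Qed.

Lemma Cc_mol f e : 0 <= e -> Cc f -> Cc (mol f e).
Proof.
move=> e0 [cf [M hM]]; apply: (@CcP _ _ _ (M + e)).
  by apply: mol_continuous => //; exact: continuous_locL1.
move=> x xM; rewrite molE -[RHS](@Int0 R d); apply: eq_Int => y.
have [yM|yM] := lerP `|y| M; last by rewrite hM// mul0r.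
by rewrite moll_out ?mulr0//; have := lerB_dist x y; rewrite distrC; lra.
Qed.

(** Self-adjointness moves the mollification onto a cutoff, which stays at most 1. *)
Lemma Int_norm_mol_le u e M : 0 < e -> intg u ->
  \int[mu]_x (`|mol u e x| * \1_(cube M) x) <= \int[mu]_x `|u x|.
Proof.
move=> e0 iu; have hu := intg_locL1 iu; have hn := locL1_norm hu.
have e0' := ltW e0.
apply: (@le_trans _ _ (\int[mu]_x (mol (fun y => `|u y|) e x * cutoff M 1 x))).
  apply: le_Int.
  - exact: (locL1_norm (continuous_locL1 (mol_continuous e0' hu))).2.
  - by apply: Cc_intg; apply: CcMl; [exact: mol_continuous|exact: Cc_cutoff].
  - move=> x; apply: ler_pM => //; first exact: norm_mol.
    have [xM|xM] := lerP `|x| M; first by rewrite indic_cube_in// cutoff_in.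
    by rewrite indic_cube_out//; case/andP: (cutoff01 M 1 x).
rewrite Int_mol_Cc//; last exact: Cc_cutoff.
apply: le_Int; [|exact: intg_norm|].
  by apply: locL1_Cc => //; apply: Cc_mol => //; exact: Cc_cutoff.
move=> x; rewrite ler_piMr// -[leRHS](mol_cst 1 x e0); apply: le_mol => //.
- exact: continuous_locL1 (@continuous_cutoff R d M 1).
- exact: continuous_locL1 (Ck_cont (@Ck_cst R d 0 1)).
- by move=> y _; case/andP: (cutoff01 M 1 y).
Qed.

Lemma mol_cvg_L1 u M c : locL1 u -> 0 < c -> exists2 e0, 0 < e0 &
  forall e, 0 < e -> e < e0 -> \int[mu]_x (`|mol u e x - u x| * \1_(cube M) x) <= c.
Proof.
move=> hu c0; have [mu_ hu2] := hu.
(* For e < 1 the mollification on the cube of radius M sees [u] only on the cube of radius M + 1. *)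
pose v x := u x * \1_(cube (M + 1)) x.
have iv : intg v by exact: hu2.
have hv := intg_locL1 iv.
have [|_ happ] := @L1_approx_intg R d v (M + 1) iv.
  by move=> x xM; rewrite /v indic_cube_out// mulr0.
have c3 : 0 < c / 3 by rewrite divr_gt0.
have [phi cphi hphi] := happ _ c3.
set K := \int[mu]_x (\1_(@cube R d M) x : R).
have K0 : 0 <= K by exact: Int_indic_cube_ge0.
have K1 : 0 < K + 1 by lra.
have [e1 e10 he1] := mol_cvg_unif M cphi.1 (divr_gt0 c3 K1).
exists (Num.min e1 1); first by rewrite lt_min e10 ltr01.
move=> e e0; rewrite lt_min => /andP[ee1 e_1]; have e0' := ltW e0.
have ip := Cc_intg cphi; have iw := intgB iv ip.
have hlw := intg_locL1 iw; have hlp := continuous_locL1 cphi.1.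
pose F1 x := `|mol (fun y => v y - phi y) e x| * \1_(cube M) x.
have i1 : intg F1 by exact: (locL1_norm (continuous_locL1 (mol_continuous e0' hlw))).2.
pose F2 x := c / 3 / (K + 1) * \1_(cube M) x.
have i2 : intg F2 by exact/intgZ/intg_indic_cube.
pose F3 x := `|v x - phi x|.
have i3 : intg F3 by exact: intg_norm.
apply: (@le_trans _ _ (\int[mu]_x (F1 x + F2 x + F3 x))).
  apply: le_Int; [|by apply: intgD => //; exact: intgD|].
    have hm := continuous_locL1 (mol_continuous e0' hu).
    have h1 : locL1 (fun x => mol u e x - u x).
      have h := locL1D hm (locL1Z (-1) hu).
      by rewrite (_ : (fun x => _) = fun x => mol u e x + -1 * u x)//; apply/funext => x; rewrite mulN1r.
    exact: (locL1_norm h1).2.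
  move=> x; have [xM|xM] := lerP `|x| M; last first.
    by rewrite indic_cube_out// mulr0 /F1 /F2 indic_cube_out// !mulr0 !add0r /F3 normr_ge0.
  rewrite /F1 /F2 indic_cube_in// !mulr1.
  have ux : u x = v x by rewrite /v indic_cube_in ?mulr1//; lra.
  have -> : mol u e x = mol v e x.
    apply: eq_mol => // y yx; rewrite /v indic_cube_in ?mulr1//.
    by have := lerB_dist y x; lra.
  have -> : mol (fun y => v y - phi y) e x = mol v e x - mol phi e x.
    have h := molD x e0' hv (locL1Z (-1) hlp).
    rewrite molZ// mulN1r in h; rewrite -h; congr (mol _ e x).
    by apply/funext => y; rewrite mulN1r.
  have h2 := he1 e x e0 ee1 xM; rewrite ux /F3.
  have -> : mol v e x - v x = (mol v e x - mol phi e x) + (mol phi e x - phi x) + (phi x - v x) by ring.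
  apply: le_trans (ler_normD _ _) _; rewrite (distrC (phi x)) lerD2r.
  by apply: le_trans (ler_normD _ _) _; rewrite lerD2l.
rewrite IntD//; last exact: intgD.
rewrite IntD//.
have b1 : \int[mu]_x F1 x <= c / 3 := le_trans (Int_norm_mol_le M e0 iw) hphi.
have b2 : \int[mu]_x F2 x <= c / 3.
  rewrite IntZ; last exact: intg_indic_cube.
  by rewrite -/K -mulrA ger_pMr// mulrC ler_pdivrMr// mul1r; lra.
have b3 : \int[mu]_x F3 x <= c / 3 := hphi.
lra.
Qed.

Lemma mol_partial u e i x : 0 <= e -> locL1 u ->
  partial i (mol u e) x = - \int[mu]_y (u y * partial i (moll e) (y - x)).
Proof.
move=> e0 hu; rewrite mol.unlock (conv_partial i (locfun_pairing hu))//; first exact: Cc_moll.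
exact: Ck_moll.
Qed.

Lemma partial_moll_shift i e x y :
  partial i (fun y => moll e (y - x)) y = partial i (moll e) (y - x).
Proof. by apply: partialE; apply: is_derive_addr; exact: (Ck_derive i _ (Ck_moll 1 e)). Qed.

End mollification.

(** * Locally Lipschitz versions of functions with bounded weak gradient *)

Section bounded_weak_gradient.
Context {R : realType} {d : nat}.
Notation V := 'rV[R]_d.
Notation mu := (@lebesgue_rV R d).
Notation e_ i := (delta_mx ord0 i : V).
Implicit Types (f g u w phi : V -> R) (x y z v : V) (e r c s t M L C : R).

Definition locbdd f := measurable_fun setT f /\ forall M, exists2 C, 0 <= C &
  {ae mu, forall x, `|x| <= M -> `|f x| <= C}.

Lemma loc_Linfty_locbdd f : loc_Linfty f -> locbdd f.
Proof.
move=> [mf h]; split => // M.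
(* The L^oo norm unfolds to an essential supremum only on a space of positive measure. *)
have muT : (0 < mu setT)%E.
  apply: (@lt_le_trans _ _ (mu (cube 1))).
    by rewrite cube_measureE// lte_fin mulr1 exprn_gt0.
  by apply: le_measure => //; rewrite inE//; exact: measurable_cube.
have := h _ (@compact_cube R d M).
move=> /sub_Lfun_finLfun; rewrite inE /= /finite_norm unlock muT => fin.
have H := @ess_sup_ge _ _ R mu (abse \o (EFin \o f \_ (cube M))).
have e0 : (0 <= ess_sup mu (abse \o (EFin \o f \_ (cube M))))%E.
  by apply: ess_sup_gee => //; apply: aeW => x /=; rewrite lee_fin.
exists (fine (ess_sup mu (abse \o (EFin \o f \_ (cube M))))); first exact: fine_ge0.
apply: filterS H => x /= hx xM.
rewrite -lee_fin fineK; last by rewrite ge0_fin_numE.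
apply: le_trans hx; rewrite lee_fin patchE mem_set//.
Qed.

Lemma locbdd_locL1 f : locbdd f -> locL1 f.
Proof.
move=> [mf h]; split => // M; have [C C0 hC] := h M.
have mF : measurable_fun setT (fun x => f x * \1_(cube M) x).
  by apply: measurable_funM => //; exact: measurable_indic_cube.
apply/integrableP; split; first exact/measurable_EFinP.
apply: (@le_lt_trans _ _ (\int[mu]_x (C * \1_(cube M) x)%:E)%E); last first.
  have := @intgZ R d C _ (@intg_indic_cube R d M) => /integrableP[_].
  apply: le_lt_trans; rewrite le_eqVlt; apply/orP; left; apply/eqP; apply: eq_integral => x _ /=.
  by rewrite ger0_norm// mulr_ge0.
apply: ae_ge0_le_integral => //.
- by do 2 apply: measurableT_comp => //.
- by move=> x _; rewrite lee_fin mulr_ge0.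
- apply/measurable_EFinP; apply: measurable_funM => //; exact: measurable_indic_cube.
- apply: filterS hC => x hx _ /=; rewrite lee_fin normrM.
  have [xM|xM] := lerP `|x| M; first by rewrite indic_cube_in// normr1 !mulr1 hx.
  by rewrite indic_cube_out// normr0 !mulr0.
Qed.

(** The corners of a path from [x] to [y] that changes one coordinate at a time; the path stays in
    every cube that contains both ends. *)
Definition coord_mix (n : nat) x y : V := \row_i (if (i < n)%N then y ord0 i else x ord0 i).

Lemma coord_mix0 x y : coord_mix 0 x y = x.
Proof. by apply/rowP => i; rewrite mxE. Qed.

Lemma coord_mix_all x y : coord_mix d x y = y.
Proof. by apply/rowP => i; rewrite mxE ltn_ord. Qed.

Lemma coord_mixS (i : 'I_d) x y :
  coord_mix i.+1 x y = (y ord0 i - x ord0 i) *: e_ i + coord_mix i x y.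
Proof.
apply/rowP => j; rewrite !mxE /= ltnS leq_eqVlt.
have [->|ji] := eqVneq j i; first by rewrite !eqxx ltnn /= mulr1 subrK.
by rewrite (negbTE (ji : val j != val i)) /= mulr0 add0r.
Qed.

Lemma coord_mix_cube n x y M : `|x| <= M -> `|y| <= M -> `|coord_mix n x y| <= M.
Proof.
move=> xM yM; apply: norm_rV_le => [|i]; first exact: le_trans xM.
by rewrite mxE; case: ifP => _; [apply: le_trans yM|apply: le_trans xM]; exact: coord_le_norm.
Qed.

Lemma telescope_coord (F : V -> R) x y :
  F y - F x = \sum_(i < d) (F (coord_mix i.+1 x y) - F (coord_mix i x y)).
Proof.
have := telescope_sumr (fun n => F (coord_mix n x y)) (leq0n d).
by rewrite coord_mix0 coord_mix_all => <-; rewrite big_mkord.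
Qed.

Lemma MVT_line_theta f (f' : V -> R) x v t : (forall y, is_derive y v f (f' y)) ->
  exists2 th, 0 <= th <= 1 & f (t *: v + x) - f x = t * f' ((th * t) *: v + x).
Proof.
move=> h; have [t0|t0|<-] := ltrgtP 0 t.
- have [s [s0 st e]] := MVT_line x t0 h; exists (s / t).
    by rewrite divr_ge0 ?(ltW s0) ?(ltW t0)//= ler_pdivrMr// mul1r ltW.
  by rewrite divfK// gt_eqF.
- have mt0 : 0 < - t by lra.
  have [s [s0 st e]] := MVT_line (t *: v + x) mt0 h.
  have ne : t != 0 by rewrite lt_eqF.
  exists ((s + t) / t).
    have -> : (s + t) / t = 1 - s / (- t) by field.
    have h1 : 0 <= s / (- t) by rewrite divr_ge0 ?ltW.
    have h2 : s / (- t) <= 1 by rewrite ler_pdivrMr// mul1r ltW.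
    lra.
  rewrite divfK//; move: e; rewrite addrA -scalerDl addNr scale0r add0r addrA -scalerDl => e.
  by rewrite -opprB e mulNr opprK.
- by exists 0; rewrite ?lexx ?ler01// mulr0 scale0r add0r subrr mul0r.
Qed.

Lemma segment_cube z v M : `|z| <= M -> `|v + z| <= M -> forall th, 0 <= th <= 1 ->
  `|th *: v + z| <= M.
Proof.
move=> zM vM s /andP[s0 s1]; have -> : s *: v + z = s *: (v + z) + (1 - s) *: z.
  by rewrite scalerDr -addrA -scalerDl subrKC scale1r.
apply: le_trans (ler_normD _ _) _; rewrite !normrZ (ger0_norm s0) ger0_norm; last lra.
have h1 : s * `|v + z| <= s * M by rewrite ler_wpM2l.
have h2 : (1 - s) * `|z| <= (1 - s) * M by rewrite ler_wpM2l//; lra.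
lra.
Qed.

Lemma lipschitz_of_partials f M C : Ck 1 f ->
  (forall i x, `|x| <= M -> `|partial i f x| <= C) ->
  forall x y, `|x| <= M -> `|y| <= M -> `|f x - f y| <= d%:R * C * `|x - y|.
Proof.
move=> hf hC x y xM yM; rewrite distrC telescope_coord.
apply: le_trans (ler_norm_sum _ _ _) _.
apply: (@le_trans _ _ (\sum_(i < d) C * `|x - y|)); last first.
  by rewrite sumr_const card_ord -[leLHS]mulr_natl mulrA.
apply: ler_sum => i _; rewrite coord_mixS.
set z := coord_mix i x y; set t := y ord0 i - x ord0 i.
have zM : `|z| <= M by exact: coord_mix_cube.
have zM' : `|t *: e_ i + z| <= M by rewrite -coord_mixS; exact: coord_mix_cube.
have tb : `|t| <= `|x - y| by rewrite (distrC x) (_ : t = (y - x) ord0 i) ?coord_le_norm// !mxE.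
have C0 : 0 <= C by apply: le_trans (hC i x xM).
have [th th01 ->] := MVT_line_theta z t (fun y => Ck_derive i y hf).
rewrite normrM mulrC ler_pM//; apply: hC; rewrite -scalerA; exact: segment_cube.
Qed.

Definition liploc f := forall M, exists2 L, 0 <= L &
  forall x y, `|x| <= M -> `|y| <= M -> `|f x - f y| <= L * `|x - y|.

Lemma liploc_continuous f : liploc f -> continuous f.
Proof.
move=> h; apply: continuous_epsdelta => x e e0; have [L L0 hL] := h (`|x| + 1).
have L1 : 0 < L + 1 by lra.
exists (Num.min 1 (e / (L + 1))); first by rewrite lt_min ltr01 divr_gt0.
move=> y; rewrite lt_min => /andP[xy1 xye].
apply: (@le_lt_trans _ _ (L * `|x - y|)).
  apply: hL; first by rewrite lerDl.
  by have := lerB_dist y x; rewrite distrC; lra.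
move: xye; rewrite ltr_pdivlMr// => h1; apply: le_lt_trans h1; rewrite mulrC ler_wpM2l//; lra.
Qed.

Lemma mol_abs_le f e x M C : 0 < e -> e <= 1 -> locL1 f ->
  {ae mu, forall x, `|x| <= M + 1 -> `|f x| <= C} -> `|x| <= M -> `|mol f e x| <= C.
Proof.
move=> e0 e1 hf hC xM; rewrite molE; apply: le_trans (norm_Int (intg_mol x (ltW e0) hf)) _.
rewrite -[leRHS](@mol_cst R d C e x e0) molE.
have cC := Cc_intg (Cc_moll_shift x (ltW e0)).
apply: le_Int_ae; [exact: intg_norm (intg_mol x (ltW e0) hf)|exact: intgZ|].
apply: filterS hC => y hy; rewrite normrM (ger0_norm (moll_ge0 _ _)).
have [yx|yx] := lerP `|y - x| e; last by rewrite moll_out ?mulr0// ltW.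
by rewrite ler_wpM2r ?moll_ge0// hy//; have := lerB_dist y x; lra.
Qed.

(** The weak derivative is tested with a translate of the mollifier. The second alternative stands
    in for a hypothesis of local integrability and is ruled out where the lemma is applied. *)
Lemma weak_partial_mol j w g e x : 0 < e -> weak_partial j w g ->
  partial j (mol w e) x = mol g e x \/ ~ locL1 w.
Proof.
move=> e0 h; have [hw|] := pselect (locL1 w); last by right.
left; rewrite mol_partial ?ltW// molE; have H := h _ (test_moll x (ltW e0)).
transitivity (- \int[mu]_y (w y * partial j (fun y => moll e (y - x)) y)); last by rewrite H opprK.
apply: (congr1 -%R).
apply: eq_Int => y.
apply: (congr1 (fun r => w y * r)).
exact: (esym (partial_moll_shift j e x y)).
Qed.

(* The mollifications of w are locally equi-Lipschitz. *)
Lemma lipschitz_version w (g : 'I_d -> V -> R) : locbdd w -> (forall j, locbdd (g j)) ->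
  (forall j, weak_partial j w (g j)) ->
  exists w', [/\ liploc w', {ae mu, forall x, w x = w' x} & 
   forall M c, 0 < c -> exists2 e0, 0 < e0 & forall e x, 0 < e -> e < e0 -> `|x| <= M ->
      `|w' x - mol w e x| <= c].
Proof.
move=> bw bg hg; have lw := locbdd_locL1 bw.
have lip M : exists2 L, 0 <= L & forall e x y, 0 < e -> e <= 1 -> `|x| <= M -> `|y| <= M ->
    `|mol w e x - mol w e y| <= L * `|x - y|.
  have hC j := (bg j).2 (M + 1); have [C hCj] := choice (fun j => let: ex_intro2 C C0 h := hC j in ex_intro _ C (conj C0 h)).
  exists (d%:R * \sum_j C j); first by rewrite mulr_ge0// sumr_ge0// => j _; case: (hCj j).
  move=> e x y e0 e1; apply: lipschitz_of_partials; first exact: Ck_mol (ltW e0) lw.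
  move=> j z zM; have [->|//] := weak_partial_mol z e0 (hg j).
  apply: (@le_trans _ _ (C j)); last first.
    by rewrite (bigD1 j)//= lerDl sumr_ge0// => i _; case: (hCj i).
  by apply: (mol_abs_le e0 e1 (locbdd_locL1 (bg j)) _ zM); case: (hCj j).
(* The lower limit of the mollifications as [e] tends to 0, in a form defined for every [x];
   convergence is proved afterwards. *)
pose w' x := sup [set t | exists2 e0, 0 < e0 & forall e, 0 < e -> e < e0 -> t <= mol w e x].
(* Cauchy property through the double mollification: it differs from [mol w e x] by at most L dl, by
   the Lipschitz bound, and from [mol w dl x] by a bound of the kernel times an L^1 distance that
   tends to 0 with [e]. *)
have conv M c : 0 < c -> exists2 e0, 0 < e0 & forall dl x, 0 < dl -> dl < e0 -> `|x| <= M ->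
    exists2 e1, 0 < e1 & forall e, 0 < e -> e < e1 -> `|mol w e x - mol w dl x| <= c.
  move=> c0; have [L L0 hL] := lip (M + 1).
  have L1 : 0 < L + 1 by lra.
  have c2 : 0 < c / 2 by rewrite divr_gt0.
  exists (Num.min 1 (c / 2 / (L + 1))); first by rewrite lt_min ltr01 divr_gt0.
  move=> dl x dl0; rewrite lt_min => /andP[dl1 dlc] xM.
  have [B B0 hB] := Cc_bounded (@Cc_moll R d dl (ltW dl0)).
  have B1 : 0 < B + 1 by lra.
  have [e1 e10 he1] := mol_cvg_L1 (M + 1) lw (divr_gt0 c2 B1).
  exists (Num.min 1 e1); first by rewrite lt_min ltr01.
  move=> e e0; rewrite lt_min => /andP[e_1 ee1].
  have lm := continuous_locL1 (mol_continuous (ltW e0) lw).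
  have a1 : `|mol (mol w e) dl x - mol w e x| <= L * dl.
    apply: mol_near => // y yx; apply: le_trans (hL e y x e0 (ltW e_1) _ _) _.
    - by have := lerB_dist y x; lra.
    - lra.
    - by rewrite ler_wpM2l.
  have a2 : `|mol (mol w e) dl x - mol w dl x| <= B * (c / 2 / (B + 1)).
    rewrite !molE -IntB; [|exact: intg_mol (ltW dl0) lm|exact: intg_mol (ltW dl0) lw].
    have i1 := intgB (intg_mol x (ltW dl0) lm) (intg_mol x (ltW dl0) lw).
    apply: le_trans (norm_Int i1) _.
    have lD : locL1 (fun y => mol w e y - w y).
      have h := locL1D lm (locL1Z (-1) lw).
      by rewrite (_ : (fun x => _) = fun x => mol w e x + -1 * w x)//; apply/funext => y; rewrite mulN1r.
    apply: (@le_trans _ _ (\int[mu]_y (B * (`|mol w e y - w y| * \1_(cube (M + 1)) y)))).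
      apply: le_Int; [exact: intg_norm|exact/intgZ/(locL1_norm lD).2|].
      move=> y; rewrite -mulrBl normrM mulrC.
      have [yM|yM] := lerP `|y| (M + 1).
        by rewrite indic_cube_in// mulr1 ler_wpM2r// hB.
      rewrite moll_out ?normr0 ?mul0r ?(ltW dl0)//; last by have := lerB_dist y x; lra.
      by rewrite mulr_ge0 ?(ltW B0)// mulr_ge0.
    rewrite IntZ; last exact: (locL1_norm lD).2.
    by rewrite ler_wpM2l ?(ltW B0)//; exact: he1.
  have a3 : L * dl <= c / 2.
    have h : dl * (L + 1) <= c / 2 by rewrite -ler_pdivlMr// ltW.
    by apply: le_trans h; rewrite mulrC ler_wpM2l ?(ltW dl0)//; rewrite lerDl.
  have a4 : B * (c / 2 / (B + 1)) <= c / 2.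
    by rewrite mulrCA ger_pMr// ler_pdivrMr// mul1r lerDl.
  apply: le_trans (ler_distD (mol (mol w e) dl x) _ _) _; rewrite (splitr c); apply: lerD.
    by rewrite distrC; exact: le_trans a1 a3.
  exact: le_trans a2 a4.
have near M c : 0 < c -> exists2 e0, 0 < e0 & forall e x, 0 < e -> e < e0 -> `|x| <= M ->
      `|w' x - mol w e x| <= c.
  move=> c0; have [e0 e00 he0] := conv M c c0; exists e0 => // dl x dl0 dle0 xM.
  have [e1 e10 he1] := he0 dl x dl0 dle0 xM.
  set S := [set t | exists2 e0, 0 < e0 & forall e, 0 < e -> e < e0 -> t <= mol w e x].
  have Sb : S (mol w dl x - c).
    by exists e1 => // e h1 h2; have := he1 e h1 h2; rewrite ler_norml lerBrDr addrC => /andP[].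
  have ubS : ubound S (mol w dl x + c).
    move=> t [e2 e20 he2]; pose e := Num.min e1 e2 / 2.
    have m0 : 0 < Num.min e1 e2 by rewrite lt_min e10.
    have h0 : 0 < e by rewrite divr_gt0.
    have hm : e < Num.min e1 e2 by rewrite /e; lra.
    have := hm; rewrite lt_min => /andP[h1 h2].
    apply: le_trans (he2 e h0 h2) _.
    by have := he1 e h0 h1; rewrite ler_norml lerBlDl => /andP[].
  have s1 : mol w dl x - c <= sup S by apply: ub_le_sup => //; exists (mol w dl x + c).
  have s2 : sup S <= mol w dl x + c by apply: ge_sup => //; exists (mol w dl x - c).
  by rewrite /w' -/S ler_norml lerBlDl s2 andbT lerBrDr addrC.
clearbody w'.
have lip' : liploc w'.
  move=> M; have [L L0 hL] := lip M; exists L => // x y xM yM.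
  apply/ler_addgt0Pr => c c0; have c2 : 0 < c / 2 by rewrite divr_gt0.
  have [e0 e00 he0] := near M (c / 2) c2.
  pose e := Num.min 1 e0 / 2.
  have m0 : 0 < Num.min 1 e0 by rewrite lt_min ltr01.
  have h0 : 0 < e by rewrite divr_gt0.
  have hm : e < Num.min 1 e0 by rewrite /e; lra.
  have := hm; rewrite lt_min => /andP[h1 h2].
  have a1 := he0 e x h0 h2 xM; have a2 := he0 e y h0 h2 yM.
  have a3 := hL e x y h0 (ltW h1) xM yM.
  have -> : w' x - w' y = (w' x - mol w e x) + (mol w e x - mol w e y) - (w' y - mol w e y) by ring.
  apply: le_trans (ler_normB _ _) _; apply: le_trans (lerD (ler_normD _ _) (lexx _)) _.
  by rewrite (splitr c) addrA; apply: lerD => //; rewrite addrC; apply: lerD.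
exists w'; split => //.
have cw' := liploc_continuous lip'.
have lD : locL1 (fun y => w y - w' y).
  have h := locL1D lw (locL1Z (-1) (continuous_locL1 cw')).
  by rewrite (_ : (fun x => _) = fun x => w x + -1 * w' x)//; apply/funext => y; rewrite mulN1r.
(* Both [w] and [w'] are limits of the mollifications on the cube, one in L^1 and the other
   uniformly. *)
have Z M : \int[mu]_x (`|w x - w' x| * \1_(cube M) x) = 0.
  apply/eqP; rewrite eq_le Int_ge0 ?andbT; last by move=> x; rewrite mulr_ge0.
  apply/ler_addgt0Pr => c c0; have c2 : 0 < c / 2 by rewrite divr_gt0.
  set K := \int[mu]_x (\1_(@cube R d M) x : R).
  have K0 : 0 <= K by exact: Int_indic_cube_ge0.
  have K1 : 0 < K + 1 by lra.
  have [e1 e10 he1] := near M _ (divr_gt0 c2 K1).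
  have [e2 e20 he2] := mol_cvg_L1 M lw c2.
  pose e := Num.min e1 e2 / 2.
  have m0 : 0 < Num.min e1 e2 by rewrite lt_min e10.
  have h0 : 0 < e by rewrite divr_gt0.
  have hm : e < Num.min e1 e2 by rewrite /e; lra.
  have := hm; rewrite lt_min => /andP[h1 h2].
  have lm := continuous_locL1 (mol_continuous (ltW h0) lw).
  have lD' : locL1 (fun y => mol w e y - w y).
    have h := locL1D lm (locL1Z (-1) lw).
    by rewrite (_ : (fun x => _) = fun x => mol w e x + -1 * w x)//; apply/funext => y; rewrite mulN1r.
  have i1 := (locL1_norm lD').2 M.
  have i2 := intgZ (c / 2 / (K + 1)) (@intg_indic_cube R d M).
  apply: (@le_trans _ _ (\int[mu]_x (`|mol w e x - w x| * \1_(cube M) x + c / 2 / (K + 1) * \1_(cube M) x))).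
    apply: le_Int; [exact: (locL1_norm lD).2|exact: intgD|].
    move=> x; have [xM|xM] := lerP `|x| M; last by rewrite indic_cube_out// !mulr0 addr0.
    rewrite indic_cube_in// !mulr1; apply: le_trans (ler_distD (mol w e x) _ _) _.
    by rewrite (distrC (w x)) lerD2l distrC; exact: he1.
  rewrite IntD// IntZ; last exact: intg_indic_cube.
  rewrite add0r [leRHS]splitr; apply: lerD; first exact: he2.
  rewrite -/K; apply: (@le_trans _ _ (c / 2 * ((K + 1)^-1 * K))); first by rewrite mulrA.
  by rewrite ger_pMr// mulrC ler_pdivrMr// mul1r lerDl.
have A n : {ae mu, forall x, `|x| <= n%:R -> w x = w' x}.
  have := Int_eq0_ae ((locL1_norm lD).2 n%:R) (fun x => mulr_ge0 (normr_ge0 _) _) (Z _).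
  move=> H; apply: filterS (H _) => [x hx xn|x].
    by move: hx; rewrite indic_cube_in// mulr1 => /eqP; rewrite normr_eq0 subr_eq0 => /eqP.
  by rewrite indicE.
have /ae_foralln B : forall n, {ae mu, forall x, `|x| <= n%:R -> w x = w' x} by exact: A.
by apply: filterS B => x /(_ (Num.bound `|x|)); apply; exact: ltW (archi_boundP _).
Qed.

End bounded_weak_gradient.

(** * The drift and its continuous version *)

Section drift.
Context {R : realType} {d : nat}.
Notation V := 'rV[R]_d.
Notation mu := (@lebesgue_rV R d).
Notation e_ i := (delta_mx ord0 i : V).
Implicit Types (f g u w phi : V -> R) (x y z v : V) (e r c s t M L C : R) (F : 'I_d -> V -> R).

Definition nsq x : R := dotp x x.

Lemma nsq_ge0 x : 0 <= nsq x.
Proof. by apply: sumr_ge0 => i _; rewrite -expr2 sqr_ge0. Qed.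

Lemma enorm_sqr x : enorm x ^+ 2 = nsq x.
Proof. by rewrite /enorm sqr_sqrtr// nsq_ge0. Qed.

Lemma enorm_ge0 x : 0 <= enorm x.
Proof. exact: sqrtr_ge0. Qed.

Lemma coord_sqr_le x i : x ord0 i ^+ 2 <= nsq x.
Proof.
rewrite /nsq /dotp (bigD1 i)//= -expr2 lerDl sumr_ge0// => j _.
by rewrite -expr2 sqr_ge0.
Qed.

Lemma norm_le_enorm x : `|x| <= enorm x.
Proof.
apply: norm_rV_le => [|i]; first exact: enorm_ge0.
by rewrite -sqrtr_sqr ler_wsqrtr// coord_sqr_le.
Qed.

Lemma norm_sqr_le x : `|x| ^+ 2 <= nsq x.
Proof. by rewrite -enorm_sqr lerXn2r ?nnegrE ?enorm_ge0 ?norm_le_enorm. Qed.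

Lemma nsq_le x : nsq x <= d%:R * `|x| ^+ 2.
Proof.
rewrite /nsq /dotp; apply: (@le_trans _ _ (\sum_(i < d) `|x| ^+ 2)).
  by apply: ler_sum => i _; rewrite -expr2 -real_normK ?num_real// lerXn2r ?nnegrE ?coord_le_norm.
by rewrite sumr_const card_ord -[leLHS]mulr_natl.
Qed.

Lemma Ck_nsq n : Ck n nsq.
Proof. by apply: Ck_sum => i; apply: CkM; exact: Ck_coord. Qed.

Lemma is_derive_nsq x i : is_derive x (e_ i) nsq (2 * x ord0 i).
Proof.
have H := is_derive_bigsum (index_enum 'I_d)
  (fun j => is_derive_mul (is_derive_coord x i j) (is_derive_coord x i j)).
apply: is_derive_eq; rewrite (bigD1 i)//= eqxx big1 ?addr0 => [|j ji].
  by rewrite !mulr1 mulr_natl mulr2n.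
by rewrite eq_sym (negbTE ji) !mulr0 addr0.
Qed.

Lemma nsq1_gt0 x : 0 < 1 + nsq x.
Proof. by rewrite ltr_wpDr// nsq_ge0. Qed.

Definition radial F x : R := \sum_(i < d) x ord0 i * F i x.

(* All that is used of the drift. The last clause is hypothesis (ii); it is
   stated for the mollifications, whose divergence is a function. *)
Definition admissible_drift k B0 A F : Prop :=
  [/\ forall i, liploc (F i),
      forall x, radial F x <= A * (1 + nsq x),
      forall K, exists rho, forall x, rho <= `|x| -> K <= radial F x &
      forall M eta, 0 < eta -> exists2 e0, 0 < e0 & forall e x, 0 < e -> e < e0 -> `|x| <= M ->
        \sum_(i < d) partial i (mol (F i) e) x <= k * (radial F x / (1 + nsq x)) + B0 + eta].

Lemma continuous_radial F : (forall i, continuous (F i)) -> continuous (radial F).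
Proof.
move=> cF; have h i : Ck 0 (F i) by split => //; exact: cF.
by apply: (@Ck_cont _ _ 0); apply: Ck_sum => i; apply: CkM; [exact: Ck_coord|].
Qed.

(** The inequality holds at points arbitrarily close to any [x], and both sides are continuous
    there. *)
Lemma ae_le_continuous f g : continuous f -> continuous g ->
  {ae mu, forall x, f x <= g x} -> forall x, f x <= g x.
Proof.
move=> cf cg h x; apply/ler_addgt0Pr => c c0; have c2 : 0 < c / 2 by rewrite divr_gt0.
have [d1 d10 h1] := unif_cont_cube `|x| cf c2; have [d2 d20 h2] := unif_cont_cube `|x| cg c2.
have m0 : 0 < Num.min d1 d2 by rewrite lt_min d10.
have r0 : 0 < Num.min d1 d2 / 2 by rewrite divr_gt0.
have [y yx fy] := ae_dense x h r0.
have : `|x - y| < Num.min d1 d2 by rewrite distrC; apply: le_lt_trans yx _; lra.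
rewrite lt_min => /andP[/(h1 x y (lexx _)) a1 /(h2 x y (lexx _)) a2].
move: a1 a2; rewrite !ltr_norml => /andP[_ a1] /andP[a2 _].
lra.
Qed.

Lemma loc_integrable_locL1 f : loc_integrable f -> locL1 f.
Proof.
move=> [mf h]; split => // M; have := h _ (@compact_cube R d M).
move=> /(integrable_mkcond (D := cube M) (EFin \o f) (measurable_cube M)).1 H.
apply: eq_integrable H => // x _ /=; rewrite patchE.
have [xM|xM] := lerP `|x| M.
  by rewrite mem_set// indic_cube_in// mulr1.
by rewrite memNset ?indic_cube_out ?mulr0// /cube /=; apply/negP; rewrite -ltNge.
Qed.

Lemma mol_ae u w e x : 0 <= e -> locL1 u -> locL1 w -> {ae mu, forall y, u y = w y} ->
  mol u e x = mol w e x.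
Proof.
move=> e0 hu hw h; rewrite !molE; apply: eq_Int_ae.
- exact: intg_meas (intg_mol x e0 hu).
- exact: intg_meas (intg_mol x e0 hw).
- by apply: filterS h => y ->.
Qed.

Lemma powR_le_sqr1 (a g : R) : 0 <= a -> 0 <= g -> g <= 2 -> a `^ g <= 1 + a ^+ 2.
Proof.
move=> a0 g0 g2; have [a1|a1] := leP a 1.
  apply: (@le_trans _ _ 1); last by rewrite lerDl sqr_ge0.
  by have := @ge0_ler_powR _ g g0 a 1; rewrite !nnegrE powR1; apply.
apply: (@le_trans _ _ (a `^ 2)); first by apply: ler_powR => //; exact: ltW.
by rewrite powR_mulrn// lerDr.
Qed.

(** Only linear growth is extracted from the exponent gamma > 1; it already makes the radial part of
    the drift tend to infinity. *)
Lemma powR_ge_linear (a g : R) : 0 <= a -> 1 <= g -> a - 1 <= a `^ g.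
Proof.
move=> a0 g1; have [a1|a1] := leP a 1.
  by apply: (@le_trans _ _ 0); [lra|exact: powR_ge0].
by apply: (@le_trans _ _ (a `^ 1)); [rewrite powRr1//; lra|apply: ler_powR => //; exact: ltW].
Qed.

(** The growth bounds pass to the Lipschitz version of [E] by continuity. For (ii), the divergence
    of the mollified drift is the mollified [divE], hence at most the mollification of a continuous
    upper bound, which is locally uniformly close to that bound. *)
Lemma drift_version (E : V -> V) (divE : V -> R) (k alpha alpha2 beta beta2 gamma gamma2 beta0 : R)
    (E_W1infty : loc_W1infty E)
    (divE_div : weak_divergence E divE)
    (k_gt0 : 0 < k)
    (alpha_gt0 : 0 < alpha) (alpha2_gt0 : 0 < alpha2)
    (gamma_gt1 : 1 < gamma) (gamma_le : gamma <= gamma2) (gamma2_le2 : gamma2 <= 2)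
    (E_growth : forall x, alpha * enorm x `^ gamma - beta <= dotp x (E x)
                       /\ dotp x (E x) <= alpha2 * enorm x `^ gamma2 + beta2)
    (divE_bound : {ae mu, forall x,
       beta0 <= - divE x + k * dotp ((1 + enorm x ^+ 2)^-1 *: x) (E x)}) :
  exists A F, [/\ 0 <= A, admissible_drift k (- beta0) A F &
    {ae mu, forall x, forall i, E x ord0 i = F i x}].
Proof.
have bE i := loc_Linfty_locbdd (E_W1infty i).1.
have lE i := locbdd_locL1 (bE i).
have HF i : exists w', [/\ liploc w', {ae mu, forall x, E x ord0 i = w' x} &
   forall M c, 0 < c -> exists2 e0, 0 < e0 & forall e x, 0 < e -> e < e0 -> `|x| <= M ->
      `|w' x - mol (fun x => E x ord0 i) e x| <= c].
  have h j : exists g, locbdd g /\ weak_partial j (fun x => E x ord0 i) g.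
    by have [g hg wg] := (E_W1infty i).2 j; exists g; split => //; exact: loc_Linfty_locbdd.
  have [g hg] := choice h.
  by apply: (@lipschitz_version _ _ _ g (bE i)) => j; case: (hg j).
have [F hF] := choice HF.
have lipF i : liploc (F i) by case: (hF i).
have cF i := liploc_continuous (lipF i).
have aeF : {ae mu, forall x, forall i, E x ord0 i = F i x}.
  have h i : {ae mu, forall x, E x ord0 i = F i x} by case: (hF i).
  exact: filter_forall h.
have aeR : {ae mu, forall x, dotp x (E x) = radial F x}.
  by apply: filterS aeF => x hx; apply: eq_bigr => i _; rewrite hx.
have cR := continuous_radial cF.
have cN : continuous (fun x : V => 1 + nsq x).
  exact: (Ck_cont (CkD (@Ck_cst R d 0 1) (Ck_nsq 0))).
exists (alpha2 + `|beta2|), F; split => //; first by rewrite addr_ge0// ltW.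
split => //.
- apply: ae_le_continuous => //.
    exact: (Ck_cont (CkZ (alpha2 + `|beta2|) (CkD (@Ck_cst R d 0 1) (Ck_nsq 0)))).
  apply: filterS aeR => x <-; have [_ h] := E_growth x; apply: le_trans h _.
  rewrite mulrDl; apply: lerD.
    rewrite ler_wpM2l ?(ltW alpha2_gt0)// -enorm_sqr.
    by apply: powR_le_sqr1 => //; [exact: enorm_ge0|lra].
  by apply: le_trans (ler_norm _) _; rewrite ler_peMr// lerDl nsq_ge0.
(* Read off from radial F x >= alpha (|x| - 1) - beta. *)
- move=> K; exists ((K + alpha + beta) / alpha) => x xr.
  have : alpha * `|x| + (- alpha - beta) <= radial F x; last first.
    by move: xr; rewrite ler_pdivrMr// mulrC; lra.
  move: x {xr}; apply: ae_le_continuous => //.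
    have h : Ck 0 (fun x : V => `|x|) by split => //; exact: norm_continuous.
    exact: (Ck_cont (CkD (CkZ alpha h) (@Ck_cst R d 0 (- alpha - beta)))).
  apply: filterS aeR => x <-; have [h _] := E_growth x; apply: le_trans h.
  have h1 := powR_ge_linear (enorm_ge0 x) (ltW gamma_gt1).
  have h2 := norm_le_enorm x.
  have : alpha * (`|x| - 1) <= alpha * enorm x `^ gamma by rewrite ler_wpM2l ?(ltW alpha_gt0)//; apply: le_trans h1; rewrite lerB.
  by rewrite mulrBr mulr1; lra.
- move=> M eta eta0.
  pose H x := k * (radial F x / (1 + nsq x)) + - beta0.
  have cH : continuous H.
    have hI : Ck 0 (fun x : V => (1 + nsq x)^-1).
      split => // x; apply: (@continuousV _ _ (fun x => 1 + nsq x)); last exact: cN.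
      by rewrite gt_eqF// nsq1_gt0.
    have hR : Ck 0 (radial F) by split.
    exact: (Ck_cont (CkD (CkZ k (CkM hR hI)) (@Ck_cst R d 0 (- beta0)))).
  have [e0 e00 he0] := mol_cvg_unif M cH eta0.
  have ld := loc_integrable_locL1 divE_div.1.
  have lH := continuous_locL1 cH.
  exists e0 => // e x e_0 ee0 xM; have e_0' := ltW e_0.
  have dH : {ae mu, forall y, divE y <= H y}.
    apply: filterS2 divE_bound aeR => y hy ry.
    have -> : H y = k * dotp ((1 + enorm y ^+ 2)^-1 *: y) (E y) - beta0; last by lra.
    rewrite /H -ry enorm_sqr; congr (k * _ + _); rewrite mulrC /dotp mulr_sumr.
    by apply: eq_bigr => i _; rewrite !mxE mulrA.
  have -> : \sum_(i < d) partial i (mol (F i) e) x = mol divE e x.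
    have H1 := divE_div.2 _ (test_moll x e_0').
    rewrite molE; transitivity (- \int[mu]_y dotp (E y) (grad (fun y => moll e (y - x)) y)).
      have ii i : intg (fun y => E y ord0 i * partial i (moll e) (y - x)).
        apply: locL1_Cc => //; apply: Cc_shift; apply: Cc_partial; [exact: Ck_moll|exact: Cc_moll].
      have -> : \int[mu]_y dotp (E y) (grad (fun y => moll e (y - x)) y) =
          \sum_(i < d) \int[mu]_y (E y ord0 i * partial i (moll e) (y - x)).
        rewrite -Int_sum//; apply: eq_Int => y; apply: eq_bigr => i _.
        by rewrite mxE -(partial_moll_shift i e x y).
      rewrite -sumrN; apply: eq_bigr => i _.
      have <- : mol (fun y => E y ord0 i) e = mol (F i) e.
        apply/funext => z; apply: mol_ae => //; first exact: continuous_locL1.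
        by case: (hF i).
      exact: mol_partial.
    by rewrite H1 opprK.
  apply: (@le_trans _ _ (mol H e x)).
    rewrite !molE; apply: le_Int_ae; [exact: intg_mol|exact: intg_mol|].
    by apply: filterS dH => y hy; rewrite ler_wpM2r ?moll_ge0.
  have := he0 e x e_0 ee0 xM; rewrite ler_norml => /andP[_].
  by rewrite lerBlDl.
Qed.

End drift.

(** * The mollified equation, translation estimates and Nash's inequality *)

Section translation_estimates.
Context {R : realType} {d : nat}.
Notation V := 'rV[R]_d.
Notation mu := (@lebesgue_rV R d).
Notation e_ i := (delta_mx ord0 i : V).
Implicit Types (f g h u w phi psi : V -> R) (x y z v : V) (e r c s t M L C : R).

(* The equation div (grad T + S) = 0 in the weak sense. Taking functionals
   instead of functions covers both a density u, with S i = u F_i, and the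
   functional from which the stationary density is extracted. *)
Definition fp_functional (T : (V -> R) -> R) (S : 'I_d -> (V -> R) -> R) : Prop :=
  [/\ locfun T, forall i, locfun (S i) &
   forall phi, test_function phi -> T (laplacian phi) = \sum_(i < d) S i (partial i phi)].

(** Testing the equation with translates of the mollifier shows that the mollified field has zero
    divergence at every point; one integration by parts then admits test functions that are merely
    C^1. *)
Lemma weak_mollified T S e psi : fp_functional T S -> 0 <= e -> Ck 1 psi -> Cc psi ->
  \sum_(i < d) \int[mu]_x ((partial i (conv T (moll e)) x + conv (S i) (moll e) x) * partial i psi x) = 0.
Proof.
move=> [hT hS eqn] e0 hpsi cpsi.
have cm : Cc (@moll R d e) by exact: Cc_moll.
have km k : Ck k (@moll R d e) by exact: Ck_moll.
pose b i x := partial i (conv T (moll e)) x + conv (S i) (moll e) x.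
have hb i : Ck 1 (b i).
  by apply: CkD; [apply: Ck_partial; exact: Ck_conv|exact: Ck_conv].
have -> : \sum_(i < d) \int[mu]_x (b i x * partial i psi x) =
    - \int[mu]_x ((\sum_(i < d) partial i (b i) x) * psi x).
  rewrite -IntN; last first.
    apply: Cc_intg; apply: CcMl => //; apply: (@Ck_cont _ _ 0).
    by apply: Ck_sum => i; apply: Ck_partial.
  transitivity (\sum_(i < d) \int[mu]_x (- (partial i (b i) x * psi x))).
    apply: eq_bigr => i _; rewrite (Int_by_parts i (hb i) hpsi cpsi) IntN//.
    by apply: Cc_intg; apply: CcMl => //; exact: Ck_cont (Ck_partial i (hb i)).
  rewrite -Int_sum.
    by apply: eq_Int => x; rewrite sumrN mulr_suml.
  move=> i; apply: intgN; apply: Cc_intg; apply: CcMl => //; exact: Ck_cont (Ck_partial i (hb i)).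
suff h x : \sum_(i < d) partial i (b i) x = 0.
  by rewrite (@eq_Int _ _ _ (fun=> 0)) ?Int0 ?oppr0// => x; rewrite h mul0r.
have cp i : Cc (partial i (@moll R d e)) by apply: Cc_partial.
have cpp i : Cc (partial i (partial i (@moll R d e))).
  by apply: Cc_partial => //; apply: Ck_partial.
have pb i : partial i (b i) x = conv T (partial i (partial i (moll e))) x - conv (S i) (partial i (moll e)) x.
  rewrite (partialE (is_derive_add (Ck_derive i x (Ck_partial i (Ck_conv 2 hT cm km)))
    (Ck_derive i x (Ck_conv 1 (hS i) cm km)))).
  by rewrite (conv_partial2 i hT cm (km 2%N)) (conv_partial i (hS i) cm (km 1%N)).
rewrite (eq_bigr _ (fun i _ => pb i)) sumrB.
have := eqn _ (test_moll x e0).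
have lap : laplacian (fun y => moll e (y - x)) = fun y => \sum_(i < d) partial i (partial i (moll e)) (y - x).
  apply/funext => y; apply: eq_bigr => i _.
  have -> : partial i (fun y => moll e (y - x)) = fun y => partial i (moll e) (y - x).
    by apply/funext => z; exact: partial_moll_shift.
  by apply: partialE; apply: is_derive_addr; exact: (Ck_derive i _ (Ck_partial i (km 2%N))).
rewrite lap (@locfun_sum R d T _ _ (fun i y => partial i (partial i (moll e)) (y - x)) hT); last first.
  by move=> i; exact: Cc_shift (cpp i).
move=> H; apply/eqP; rewrite subr_eq0; apply/eqP; apply: (etrans H).
apply: eq_bigr => i _; apply: (congr1 (S i)).
by apply/funext => z; exact: partial_moll_shift.
Qed.

(** Restricts an increment to pairs with both ends in the cube; by convexity every intermediate
    point of the segment is then in the cube too. *)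
Definition window M z x : R := \1_(cube M) x * \1_(cube M) (x + z).

Lemma window01 M z x : 0 <= window M z x <= 1.
Proof. by rewrite /window !indicE; do 2 case: (_ \in _); rewrite ?mulr1 ?mulr0 ?lexx ?ler01. Qed.

Lemma window_ge0 M z x : 0 <= window M z x.
Proof. by case/andP: (window01 M z x). Qed.

Lemma window_out M z x : M < `|x| -> window M z x = 0.
Proof. by move=> h; rewrite /window indic_cube_out// mul0r. Qed.

Lemma measurable_window M z : measurable_fun setT (window M z).
Proof.
apply: measurable_funM; first exact: measurable_indic_cube.
exact: (measurableT_comp (measurable_indic_cube M) (measurable_addr_rV z)).
Qed.

Lemma intg_window h M z : locL1 h -> intg (fun x => h x * window M z x).
Proof.
move=> hh; apply: (@locL1_bounded _ _ _ _ M 1) => //.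
- exact: measurable_window.
- by move=> x; have /andP[a b] := window01 M z x; rewrite ger0_norm.
- by move=> x; exact: window_out.
Qed.

Lemma Ck_diff_sqr n f z : Ck n f -> Ck n (fun x => (f (x + z) - f x) ^+ 2).
Proof.
by move=> hf; have h := CkD (Ck_shift z hf) (CkN hf); exact: (CkM h h).
Qed.

Lemma intg_diff_sqr f M z : continuous f -> intg (fun x => (f (x + z) - f x) ^+ 2 * window M z x).
Proof.
move=> cf; apply: intg_window; apply: continuous_locL1.
by apply: (@Ck_cont _ _ 0); apply: Ck_diff_sqr.
Qed.

Lemma sqr_sum_le (n : nat) (a : 'I_n -> R) : (\sum_(j < n) a j) ^+ 2 <= n%:R * \sum_(j < n) a j ^+ 2.
Proof.
elim: n a => [|n ih] a; first by rewrite !big_ord0 expr0n mul0r.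
rewrite !big_ord_recl; set A := \sum_(i < n) _; set B := \sum_(i < n) _ ^+ 2.
have hA : A ^+ 2 <= n%:R * B := ih (fun i => a (lift ord0 i)).
have B0 : 0 <= B by apply: sumr_ge0 => i _; exact: sqr_ge0.
have [n0|n0] := posnP n.
  subst n; rewrite /A /B !big_ord0 !addr0 mul1r//.
have n0' : 0 < n%:R :> R by rewrite ltr0n.
set t := a ord0.
have h : 2 * t * A <= n%:R * t ^+ 2 + B.
  have h1 : 0 <= (n%:R * t - A) ^+ 2 by exact: sqr_ge0.
  have h2 : 2 * t * A * n%:R <= (n%:R * t ^+ 2) * n%:R + B * n%:R.
    have : (n%:R * t - A) ^+ 2 = n%:R * t ^+ 2 * n%:R - 2 * t * A * n%:R + A ^+ 2 by ring.
    by move: h1 hA; rewrite [B * _]mulrC; lra.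
  by move: h2; rewrite -mulrDl ler_pM2r.
rewrite -natr1 sqrrD mulrDl mul1r mulrDr.
have : (t * A) *+ 2 = 2 * t * A by rewrite -mulr_natl mulrA.
by move: hA h => + + ->; lra.
Qed.

(** The increment is cut into n + 1 equal ones. Cauchy-Schwarz costs one factor n + 1; by
    translation invariance the n + 1 resulting integrals coincide, which gives the other. *)
Lemma axis_step f i t M : Ck 1 f ->
  forall n, \int[mu]_x ((f (x + t *: e_ i) - f x) ^+ 2 * window M (t *: e_ i) x) <=
   n.+1%:R ^+ 2 * \int[mu]_x ((f (x + (t / n.+1%:R) *: e_ i) - f x) ^+ 2 * window M ((t / n.+1%:R) *: e_ i) x).
Proof.
move=> hf n; have cf := Ck_cont hf.
set h := t / n.+1%:R; have n0 : 0 < n.+1%:R :> R by rewrite ltr0n.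
pose F x := (f (x + h *: e_ i) - f x) ^+ 2 * window M (h *: e_ i) x.
have iF : intg F by exact: intg_diff_sqr.
have mF := intg_meas iF.
apply: (@le_trans _ _ (\int[mu]_x (n.+1%:R * \sum_(j < n.+1) F (x + (j%:R * h) *: e_ i)))).
  apply: le_Int; [exact: intg_diff_sqr|by apply: intgZ; apply: intg_sum => j; exact: intg_addr|].
  move=> x; have [xM|xM] := lerP `|x| M; last first.
    rewrite window_out// mulr0 mulr_ge0// sumr_ge0// => j _.
    by rewrite /F mulr_ge0 ?sqr_ge0 ?window_ge0.
  have [yM|yM] := lerP `|x + t *: e_ i| M; last first.
    rewrite /window (indic_cube_out yM) !mulr0 mulr_ge0// sumr_ge0// => j _.
    by rewrite /F mulr_ge0 ?sqr_ge0 ?window_ge0.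
  rewrite /window !indic_cube_in// !mulr1.
  have th : t = n.+1%:R * h by rewrite /h mulrC divfK// gt_eqF.
  have -> : f (x + t *: e_ i) - f x =
      \sum_(j < n.+1) (f (x + (j%:R * h) *: e_ i + h *: e_ i) - f (x + (j%:R * h) *: e_ i)).
    have := telescope_sumr (fun j => f (x + (j%:R * h) *: e_ i)) (leq0n n.+1).
    rewrite mul0r scale0r addr0 -th => <-; rewrite big_mkord; apply: eq_bigr => j _.
    by rewrite -addrA -scalerDl -natr1 mulrDl mul1r.
  apply: le_trans (sqr_sum_le _) _; rewrite ler_pM2l//; apply: ler_sum => j _.
  have seg (k : nat) : (k <= n.+1)%N -> `|x + (k%:R * h) *: e_ i| <= M.
    move=> kn; have -> : (k%:R * h) *: e_ i = (k%:R / n.+1%:R) *: (t *: e_ i).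
      by rewrite scalerA /h mulrA mulrAC.
    rewrite addrC; apply: segment_cube => //; first by rewrite addrC.
    by rewrite divr_ge0//= ler_pdivrMr// mul1r ler_nat.
  rewrite /F /window (indic_cube_in (seg j (ltnW (ltn_ord j)))) mul1r.
  rewrite indic_cube_in ?mulr1// -addrA -scalerDl.
  have -> : j%:R * h + h = j.+1%:R * h by rewrite -natr1 mulrDl mul1r.
  exact: seg.
rewrite IntZ; last by apply: intg_sum => j; exact: intg_addr.
rewrite Int_sum; last by move=> j; exact: intg_addr.
rewrite (eq_bigr (fun=> \int[mu]_x F x)); last by move=> j _; exact: Int_addr.
by rewrite sumr_const card_ord -[X in _ * X]mulr_natl mulrA expr2.
Qed.

(** After [axis_step] the step is so small that the difference quotient is uniformly close to the
    partial derivative. This replaces integration along the segment and the exchange of integrals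
    that it would require. *)
Lemma axis_translation f i t M : Ck 1 f ->
  \int[mu]_x ((f (x + t *: e_ i) - f x) ^+ 2 * window M (t *: e_ i) x) <=
  t ^+ 2 * \int[mu]_x (partial i f x ^+ 2 * \1_(cube M) x).
Proof.
move=> hf; have cf := Ck_cont hf; have cp := Ck_cont (Ck_partial i hf).
have hp : Ck 0 (partial i f) := Ck_partial i hf.
have l1 := continuous_locL1 (Ck_cont (CkM hp hp)).
have l2 := locL1_norm (continuous_locL1 cp).
set D := \int[mu]_x (partial i f x ^+ 2 * \1_(cube M) x).
set N := \int[mu]_x (`|partial i f x| * \1_(cube M) x).
set K := \int[mu]_x (\1_(@cube R d M) x : R).
have N0 : 0 <= N by apply: Int_ge0 => x; rewrite mulr_ge0.
have K0 : 0 <= K by exact: Int_indic_cube_ge0.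
(* An error eta in the quotient gives (|f'| + eta)^2 <= f'^2 + eta (2 |f'| + 1) for eta <= 1, whence
   [N] and [K]. *)
suff H eta : 0 < eta -> eta <= 1 ->
    \int[mu]_x ((f (x + t *: e_ i) - f x) ^+ 2 * window M (t *: e_ i) x) <=
    t ^+ 2 * (D + eta * (2 * N + K)).
  apply/ler_addgt0Pr => c c0; pose B := t ^+ 2 * (2 * N + K).
  have B0 : 0 <= B by rewrite mulr_ge0 ?sqr_ge0// addr_ge0// mulr_ge0.
  have B1 : 0 < B + 1 by lra.
  pose eta := Num.min 1 (c / (B + 1)).
  have e0 : 0 < eta by rewrite lt_min ltr01 divr_gt0.
  have e1 : eta <= 1 by rewrite ge_min lexx.
  apply: le_trans (H eta e0 e1) _; rewrite mulrDr lerD2l mulrCA -/B.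
  apply: (@le_trans _ _ (c / (B + 1) * B)); first by rewrite ler_wpM2r// ge_min lexx orbT.
  by rewrite mulrAC ler_pdivrMr// ler_pM2l// lerDl.
move=> eta0 eta1; have [dl dl0 hdl] := quotient_unif i M hf eta0.
have [n hn] : exists n : nat, `|t / n.+1%:R| < dl.
  exists (Num.bound (`|t| / dl)); rewrite normrM normfV (@ger0_norm _ _%:R)//.
  rewrite ltr_pdivrMr ?ltr0n// mulrC -ltr_pdivrMr//.
  apply: lt_trans (archi_boundP _) _; first by rewrite divr_ge0// ltW.
  by rewrite ltr_nat.
apply: le_trans (axis_step i t M hf n) _.
set h := t / _; have n0 : 0 < n.+1%:R :> R by rewrite ltr0n.
have th : t = n.+1%:R * h by rewrite /h mulrC divfK// gt_eqF.
rewrite [in X in _ <= X]th exprMn -[X in _ <= X]mulrA ler_pM2l ?exprn_gt0//.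
pose G x := h ^+ 2 * (partial i f x ^+ 2 * \1_(cube M) x + eta * (2 * (`|partial i f x| * \1_(cube M) x) + \1_(cube M) x)).
have i1 : intg (fun x => partial i f x ^+ 2 * \1_(cube M) x) := l1.2 M.
have i2 : intg (fun x => `|partial i f x| * \1_(cube M) x) := l2.2 M.
have i3 : intg (fun x => 2 * (`|partial i f x| * \1_(cube M) x) + \1_(cube M) x).
  by apply: intgD; [exact: intgZ|exact: intg_indic_cube].
apply: (@le_trans _ _ (\int[mu]_x G x)).
  apply: le_Int; [exact: intg_diff_sqr|by apply: intgZ; apply: intgD => //; exact: intgZ|].
  move=> x; have [xM|xM] := lerP `|x| M; last first.
    by rewrite window_out// mulr0 /G indic_cube_out// !(mulr0, addr0).
  rewrite /G indic_cube_in// !mulr1.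
  apply: (@le_trans _ _ ((f (x + h *: e_ i) - f x) ^+ 2)).
    by rewrite ler_piMr ?sqr_ge0//; case/andP: (window01 M (h *: e_ i) x).
  have a1 : `|f (x + h *: e_ i) - f x| <= `|h| * (`|partial i f x| + eta).
    have := hdl x h xM hn; rewrite [h *: _ + x]addrC => a1.
    rewrite -[f (x + h *: e_ i) - f x](subrK (h * partial i f x)).
    apply: le_trans (ler_normD _ _) _; rewrite normrM mulrDr addrC lerD2l.
    by rewrite [leRHS]mulrC.
  rewrite -real_normK ?num_real//.
  apply: (@le_trans _ _ ((`|h| * (`|partial i f x| + eta)) ^+ 2)).
    by rewrite lerXn2r ?nnegrE// mulr_ge0// addr_ge0// ltW.
  rewrite exprMn real_normK ?num_real//; apply: ler_wpM2l; first exact: sqr_ge0.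
  rewrite sqrrD real_normK ?num_real// -addrA lerD2l.
  have : eta ^+ 2 <= eta by rewrite expr2 ger_pMr.
  by rewrite -mulr_natl; lra.
rewrite IntZ; last by apply: intgD => //; exact: intgZ.
rewrite IntD//; last exact: intgZ.
rewrite IntZ// IntD; [|exact: intgZ|exact: intg_indic_cube].
by rewrite IntZ.
Qed.

Definition energy f M : R := \int[mu]_x (\sum_(i < d) partial i f x ^+ 2 * \1_(cube M) x).

Lemma energyE f M : Ck 1 f -> energy f M = \sum_(i < d) \int[mu]_x (partial i f x ^+ 2 * \1_(cube M) x).
Proof.
move=> hf; apply: Int_sum => i; have hp : Ck 0 (partial i f) := Ck_partial i hf.
exact: (continuous_locL1 (Ck_cont (CkM hp hp))).2.
Qed.

Lemma energy_ge0 f M : 0 <= energy f M.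
Proof. by apply: Int_ge0 => x; apply: sumr_ge0 => i _; rewrite mulr_ge0// sqr_ge0. Qed.

Lemma coord_mix_shift n x z : coord_mix n x (x + z) = x + coord_mix n 0 z.
Proof. by apply/rowP => i; rewrite !mxE; case: ifP => _; rewrite ?addr0. Qed.

(** The shift is made along one axis after another; the factor [d] is Cauchy-Schwarz for a sum of
    [d] increments. *)
Lemma translation_estimate f z r M : Ck 1 f -> `|z| <= r ->
  \int[mu]_x ((f (x + z) - f x) ^+ 2 * window M z x) <= d%:R * r ^+ 2 * energy f M.
Proof.
move=> hf zr; have cf := Ck_cont hf.
pose c n : V := coord_mix n 0 z.
have cS (i : 'I_d) : c i.+1 = c i + z ord0 i *: e_ i.
  by rewrite /c coord_mixS mxE subr0 addrC.
pose F (i : 'I_d) x := (f (x + z ord0 i *: e_ i) - f x) ^+ 2 * window M (z ord0 i *: e_ i) x.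
have iF i : intg (F i) by exact: intg_diff_sqr.
apply: (@le_trans _ _ (\int[mu]_x (d%:R * \sum_(i < d) F i (x + c i)))).
  apply: le_Int; [exact: intg_diff_sqr|by apply: intgZ; apply: intg_sum => i; exact: intg_addr|].
  move=> x; have [xM|xM] := lerP `|x| M; last first.
    rewrite window_out// mulr0 mulr_ge0// sumr_ge0// => j _.
    by rewrite /F mulr_ge0 ?sqr_ge0 ?window_ge0.
  have [yM|yM] := lerP `|x + z| M; last first.
    rewrite /window (indic_cube_out yM) !mulr0 mulr_ge0// sumr_ge0// => j _.
    by rewrite /F mulr_ge0 ?sqr_ge0 ?window_ge0.
  rewrite /window !indic_cube_in// !mulr1 telescope_coord.
  apply: le_trans (sqr_sum_le _) _; rewrite ler_wpM2l//; apply: ler_sum => i _.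
  have inM n : `|x + c n| <= M by rewrite /c -coord_mix_shift; exact: coord_mix_cube.
  have -> : coord_mix i.+1 x (x + z) = x + c i + z ord0 i *: e_ i.
    by rewrite coord_mix_shift -/(c _) cS addrA.
  rewrite (coord_mix_shift i) -/(c _) /F /window (indic_cube_in (inM i)) mul1r.
  by rewrite indic_cube_in ?mulr1// -addrA -cS.
rewrite IntZ; last by apply: intg_sum => j; exact: intg_addr.
rewrite -mulrA ler_wpM2l// Int_sum; last by move=> j; exact: intg_addr.
rewrite energyE// mulr_sumr; apply: ler_sum => i _.
rewrite Int_addr; last exact: intg_meas (iF i).
apply: le_trans (axis_translation i (z ord0 i) M hf) _.
rewrite ler_wpM2r//; first by apply: Int_ge0 => x; rewrite mulr_ge0// sqr_ge0.
by rewrite -real_normK ?num_real// lerXn2r ?nnegrE// ?(le_trans _ zr)// coord_le_norm.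
Qed.

Lemma Cc_opp g : Cc g -> Cc (fun x => g (- x)).
Proof.
move=> [cg [M hM]]; apply: (@CcP _ _ _ M); last by move=> x xM; rewrite hM// normrN.
apply: continuous_epsdelta => x e e0; have [dl dl0 h] := unif_cont_cube `|x| cg e0.
by exists dl => // y xy; apply: h; rewrite ?normrN// -opprD normrN.
Qed.

(* Both sides are translation invariant and agree on the even mollifiers. *)
Lemma int_reflect g : Cc g -> \int[mu]_x g (- x) = \int[mu]_x g x.
Proof.
move=> cg; pose T h := \int[mu]_x h (- x).
have hT : locfun T.
  split.
    move=> a f h cf ch; rewrite /T -IntZ; last exact: Cc_intg (Cc_opp cf).
    by rewrite -IntD//; [apply: intgZ|]; exact: Cc_intg (Cc_opp _).
  move=> M; exists (\int[mu]_x (\1_(@cube R d M) x : R)); first exact: Int_indic_cube_ge0.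
  move=> f K cf fM fK; apply: le_trans (norm_Int (Cc_intg (Cc_opp cf))) _.
  rewrite mulrC -IntZ; last exact: intg_indic_cube.
  apply: le_Int; [exact: intg_norm (Cc_intg (Cc_opp cf))|exact/intgZ/intg_indic_cube|].
  move=> x; have [xM|xM] := lerP `|x| M; first by rewrite indic_cube_in// mulr1.
  by rewrite fM ?normrN// normr0 indic_cube_out// mulr0.
have [M hM] := cg.2; have [C C0 hC] := hT.2 (M + 1).
have lg := continuous_locL1 cg.1.
rewrite -/(T g); apply/eqP; rewrite -subr_eq0 -normr_eq0 eq_le normr_ge0 andbT.
apply/ler_addgt0Pr => c c0; have C1 : 0 < C + 1 by lra.
have [dl dl0 hdl] := Cc_unif_cont cg (divr_gt0 c0 C1).
pose e := Num.min dl 1 / 2.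
have m0 : 0 < Num.min dl 1 by rewrite lt_min dl0 ltr01.
have e0 : 0 < e by rewrite divr_gt0.
have : e < Num.min dl 1 by rewrite /e; lra.
rewrite lt_min => /andP[edl e1].
have e0' := ltW e0.
have key : T (mol g e) = \int[mu]_x g x.
  have H := conv_Fubini hT (Cc_moll e0') (Cc_moll e0') (fun x => esym (mollN e x)) cg.
  rewrite mol.unlock; apply: (etrans (esym H)); apply: eq_Int => x.
  suff -> : conv T (moll e) x = 1 by rewrite mul1r.
  rewrite /conv /T -(Int_moll_shift (- x) e0); apply: eq_Int => y.
  by rewrite -mollN opprB opprK addrC opprK.
rewrite -key -locfunB//; last exact: Cc_mol.
apply: (@le_trans _ _ (C * (c / (C + 1)))); last first.
  by rewrite add0r mulrCA ger_pMr// ler_pdivrMr// mul1r lerDl.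
apply: hC.
- rewrite (_ : (fun x => _) = fun x => g x + (-1) * mol g e x).
    by apply: CcD => //; apply: CcZ; exact: Cc_mol.
  by apply/funext => x; rewrite mulN1r.
- move=> x xM; rewrite hM; last lra.
  rewrite (eq_mol (v := fun=> 0) e0') ?mol_cst ?subrr// => y yx.
  by rewrite hM//; have := lerB_dist x y; rewrite distrC; lra.
- move=> x; rewrite distrC; apply: mol_near => // y yx; rewrite distrC; apply: ltW; apply: hdl.
  by rewrite distrC; exact: le_lt_trans edl.
Qed.

(* Average over z the polarization
   int g^2 = int g g(.+z) + 1/2 int (g(.+z) - g)^2. *)
Lemma nash g r M : Ck 1 g -> (forall x, 0 <= g x) -> (forall x, M - r < `|x| -> g x = 0) ->
  0 < r -> \int[mu]_x g x ^+ 2 <=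
     d%:R * r ^+ 2 / 2 * energy g M + (r ^+ d)^-1 * (\int[mu]_x g x) ^+ 2.
Proof.
move=> hg g0 gM r0; have cg := Ck_cont hg; have ccg : Cc g by apply: CcP gM.
have ccg2 : Cc (fun x => g x * g x) by apply: CcMl.
set A := energy g M; have A0 : 0 <= A by exact: energy_ge0.
set I2 := \int[mu]_x g x ^+ 2; set I1 := \int[mu]_x g x.
(* The density for averaging over shifts: 1 for |z| <= r/2 and 0 for |z| > r, so its integral is at
   least r^d, the volume of the inner cube. *)
pose f x := clamp (2 - 2 / r * `|x|).
have f01 x : 0 <= f x <= 1 by exact: clamp01.
have fr x : r < `|x| -> f x = 0.
  move=> h; apply: clamp_le0; rewrite mulrAC subr_le0 ler_pdivlMr// ler_pM2l//; exact: ltW.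
have ccf : Cc f.
  apply: CcP fr; apply: continuous_clamp.
  have h : Ck 0 (fun x : V => `|x|) by split => //; exact: norm_continuous.
  exact: (Ck_cont (CkD (@Ck_cst R d 0 2) (CkN (CkZ (2 / r) h)))).
have If : r ^+ d <= \int[mu]_x f x.
  have r2 : 0 <= r / 2 by rewrite divr_ge0// ltW.
  have -> : r ^+ d = \int[mu]_x (\1_(@cube R d (r / 2)) x : R).
    have e : (\int[mu]_x (\1_(@cube R d (r / 2)) x)%:E = ((2 * (r / 2)) ^+ d)%:E)%E.
      rewrite integral_indic ?setIT//; last exact: measurable_cube.
      exact: cube_measureE.
    by rewrite /Rintegral e /= mulrC divfK.
  apply: le_Int; [exact: intg_indic_cube|exact: Cc_intg|].
  move=> x; have [xr|xr] := lerP `|x| (r / 2).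
    rewrite indic_cube_in// /f clamp_ge1//.
    have : 2 / r * `|x| <= 2 / r * (r / 2) by rewrite ler_wpM2l// divr_ge0// ltW.
    rewrite (_ : 2 / r * (r / 2) = 1); last by field; rewrite gt_eqF.
    lra.
  by rewrite indic_cube_out//; case/andP: (f01 x).
(* The autocorrelation of [g]. *)
pose B z := conv (pairing g) g z.
have BE z : `|z| <= r -> I2 - B z <= d%:R * r ^+ 2 / 2 * A.
  move=> zr; have := translation_estimate M hg zr.
  have e1 : \int[mu]_x ((g (x + z) - g x) ^+ 2 * window M z x) = 2 * (I2 - B z).
    have iz : intg (fun x => g (x + z) ^+ 2).
      by apply: (@intg_addr R d z (fun x => g x ^+ 2)); exact: (Cc_intg ccg2).
    have ip : intg (fun x => g (x + z) * g x).
      by apply: Cc_intg; apply: CcMl => //; exact: continuous_shift.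
    transitivity (\int[mu]_x (g (x + z) ^+ 2 + (g x ^+ 2 - 2 * (g (x + z) * g x)))).
      apply: eq_Int => x.
      (* As [g] vanishes beyond M - r and |z| <= r, both g x and g (x + z) are 0 wherever the window
         is, so the window may be dropped. *)
      have [xM|xM] := lerP `|x| M; last first.
        rewrite window_out// mulr0 (gM x) ?(gM (x + z)); [ring| |lra].
        by have := ler_normB (x + z) z; rewrite addrK; lra.
      have [yM|yM] := lerP `|x + z| M; last first.
        rewrite /window (indic_cube_out yM) !mulr0 (gM (x + z)) ?(gM x); [ring| |lra].
        by have := ler_normD x z; lra.
      by rewrite /window !indic_cube_in//; ring.
    rewrite IntD//; last by apply: intgB; [exact: (Cc_intg ccg2)|exact: intgZ].
    rewrite IntB; [|exact: (Cc_intg ccg2)|exact: intgZ].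
    rewrite IntZ// (@Int_addr R d z (fun x => g x ^+ 2)); last exact: (intg_meas (Cc_intg ccg2)).
    have -> : B z = \int[mu]_x (g (x + z) * g x).
      rewrite /B /conv /pairing -(@Int_addr R d z (fun y => g y * g (y - z))).
        by apply: eq_Int => x; rewrite addrK.
      by apply: intg_meas; apply: Cc_intg; apply: CcMl => //; exact: Cc_shift.
    rewrite -/I2; ring.
  rewrite e1 -ler_pdivlMl// => /le_trans; apply; rewrite -/A.
  by rewrite le_eqVlt; apply/orP; left; apply/eqP; field.
have cB : continuous B by apply: conv_continuous => //; exact/locfun_pairing/continuous_locL1.
have iBf : intg (fun z => B z * f z) by apply: Cc_intg; exact: CcMl.
(* Exchanging the integrals and using f <= 1 bounds the integrated autocorrelation by the squared
   mass. *)
have h1 : \int[mu]_z (B z * f z) <= I1 ^+ 2.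
  rewrite (conv_Fubini (locfun_pairing (continuous_locL1 cg)) ccg (Cc_opp ccg))//.
  rewrite /pairing expr2 -IntZ; last exact: Cc_intg.
  have hf : locL1 f by apply: continuous_locL1; exact: ccf.1.
  have h2 y : conv (pairing f) (fun x => g (- x)) y <= I1.
    have i1 : intg (fun x => g (y - x)).
      apply: Cc_intg; have := Cc_shift (- y) (Cc_opp ccg).
      by rewrite (_ : (fun x => _) = fun x => g (y - x))//; apply/funext => x; rewrite opprB.
    have -> : I1 = \int[mu]_x g (y - x).
      rewrite /I1 -(int_reflect ccg) -(@Int_addr R d (- y) (fun x => g (- x))).
        by apply: eq_Int => x; rewrite opprB.
      exact: intg_meas (Cc_intg (Cc_opp ccg)).
    rewrite /conv /pairing; apply: le_Int => //.
      by apply: locL1_Cc => //; exact: (Cc_shift (- y) (Cc_opp ccg)).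
    by move=> x; rewrite opprB ler_piMl//; case/andP: (f01 x).
  apply: le_Int; [|exact/intgZ/Cc_intg|].
    apply: (@eq_intg _ _ (fun x => conv (pairing f) (fun x => g (- x)) x * g x)).
      by move=> x; rewrite mulrC.
    apply: Cc_intg; apply: CcMl => //.
    exact: (conv_continuous (locfun_pairing hf) (Cc_opp ccg)).
  by move=> y; rewrite mulrC ler_wpM2r.
have iff : intg f := Cc_intg ccf.
have h3 : \int[mu]_z ((I2 - B z) * f z) <= d%:R * r ^+ 2 / 2 * A * \int[mu]_x f x.
  rewrite -IntZ//; apply: le_Int; [|exact: intgZ|].
    apply: (@eq_intg _ _ (fun z => I2 * f z - B z * f z)); first by move=> z; rewrite mulrBl.
    by apply: intgB => //; exact: intgZ.
  move=> z; have [zr|zr] := lerP `|z| r; last by rewrite fr// !mulr0.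
  by rewrite ler_wpM2r ?BE//; case/andP: (f01 z).
have h4 : \int[mu]_z ((I2 - B z) * f z) = I2 * \int[mu]_x f x - \int[mu]_z (B z * f z).
  rewrite -IntZ// -IntB//; last exact: intgZ.
  by apply: eq_Int => z; rewrite mulrBl.
set Q := \int[mu]_x f x in If h3 h4 *.
have Q0 : 0 < Q by apply: lt_le_trans If; rewrite exprn_gt0.
have key : I2 * Q <= d%:R * r ^+ 2 / 2 * A * Q + I1 ^+ 2 by rewrite h4 in h3; lra.
have I10 : 0 <= I1 ^+ 2 by exact: sqr_ge0.
have : I1 ^+ 2 <= (r ^+ d)^-1 * I1 ^+ 2 * Q.
  rewrite mulrAC ler_peMl// mulrC ler_pdivlMr ?mul1r//; exact: exprn_gt0.
by move=> h5; rewrite -(ler_pM2r Q0) mulrDl; lra.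
Qed.

End translation_estimates.

(** * Logarithmic energy estimate *)

Section positivity.
Context {R : realType} {d : nat}.
Notation V := 'rV[R]_d.
Notation mu := (@lebesgue_rV R d).
Notation e_ i := (delta_mx ord0 i : V).
Implicit Types (f g h u w phi psi : V -> R) (x y z v : V) (e r c s t M N L C : R) (A B : set V).

Lemma smooth_cutoff N : exists th, [/\ forall k, Ck k th, forall x, 0 <= th x <= 1,
  forall x, `|x| <= N -> th x = 1 & forall x, N + 3 < `|x| -> th x = 0].
Proof.
have lc : locL1 (@cutoff R d (N + 1) 1) by apply: continuous_locL1; exact: continuous_cutoff.
exists (mol (cutoff (N + 1) 1) 1); split.
- by move=> k; exact: Ck_mol.
- move=> x; apply/andP; split.
    by apply: mol_ge0 => y; case/andP: (cutoff01 (N + 1) 1 y).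
  rewrite -[leRHS](mol_cst 1 x ltr01); apply: le_mol => //.
    exact: continuous_locL1 (Ck_cont (@Ck_cst R d 0 1)).
  by move=> y _; case/andP: (cutoff01 (N + 1) 1 y).
- move=> x xN; rewrite (eq_mol (v := fun=> 1)) ?mol_cst// => y yx.
  by rewrite cutoff_in//; have := lerB_dist y x; lra.
- move=> x xN; rewrite (eq_mol (v := fun=> 0)) ?mol_cst// => y yx.
  by rewrite cutoff_out//; have := lerB_dist x y; rewrite distrC; lra.
Qed.

Lemma is_derive_invf f x v l : f x != 0 -> is_derive x v f l ->
  is_derive x v (fun y => (f y)^-1) (- ((f x)^-1 * (f x)^-1) * l).
Proof.
move=> fx df; have H : is_derive (f x) (1 : R) (fun y : R => y^-1) (- (f x) ^- 2 *: (1 : R)).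
  by apply: is_deriveV.
have H' : is_derive (f x) (1 : R) (fun y : R => y^-1) (- ((f x)^-1 * (f x)^-1)).
  by apply: is_derive_eq; rewrite [_ *: 1]mulr1 expr2 invfM.
exact: is_derive_chain H' df.
Qed.

Lemma Ck_inv n f : (forall x, 0 < f x) -> Ck n f -> Ck n (fun x => (f x)^-1).
Proof.
elim: n f => [|n ih] f f0 hf.
  have cf := Ck_cont hf.
  split => // x; apply: (@continuousV _ _ f); last exact: cf.
  by rewrite gt_eqF.
have hi : Ck n (fun x => (f x)^-1) by apply: ih => //; exact: CkW.
apply: (@Ck_of_derive _ _ _ _ (fun i x => (- ((f x)^-1 * (f x)^-1)) * partial i f x)).
- exact: Ck_cont hi.
- by move=> i x; apply: is_derive_invf; [rewrite gt_eqF|exact: Ck_derive hf].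
- by move=> i; apply: CkM; [apply: CkN; exact: CkM|exact: Ck_partial].
Qed.

Lemma Ck_ln f : (forall x, 0 < f x) -> Ck 1 f ->
  Ck 1 (fun x => ln (f x)) /\ forall i x, partial i (fun x => ln (f x)) x = partial i f x / f x.
Proof.
move=> f0 hf.
have D i x : is_derive x (e_ i) (fun x => ln (f x)) (partial i f x / f x).
  rewrite mulrC; exact: is_derive_chain (is_derive1_ln (f0 x)) (Ck_derive i x hf).
split; last by move=> i x; apply: partialE; exact: D.
apply: (@Ck_of_derive _ _ _ _ (fun i x => partial i f x * (f x)^-1)) => //.
  have cf := Ck_cont hf.
  move=> x; apply: (@continuous_comp _ _ _ f (@ln R)); first exact: cf.
  exact: continuous_ln.
by move=> i; apply: CkM; [exact: Ck_partial|apply: CkW; exact: Ck_inv].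
Qed.

(** Here p is the logarithmic derivative of U, c the mollified drift term over U, and q the
    derivative of the cutoff th. The left side is the mollified field times the derivative of th^2 /
    U. Completing three squares leaves half of th^2 p^2. *)
Lemma log_energy_pointwise (th q p c : R) :
  (p + c) * (2 * th * q - th ^+ 2 * p) <= - (th ^+ 2 * p ^+ 2) / 2 + (5 * q ^+ 2 + 2 * (th ^+ 2 * c ^+ 2)).
Proof.
have h1 : 0 <= (th * p / 2 - 2 * q) ^+ 2 by exact: sqr_ge0.
have h2 : 0 <= (th * p / 2 + th * c) ^+ 2 by exact: sqr_ge0.
have h3 : 0 <= (q - th * c) ^+ 2 by exact: sqr_ge0.
have e1 : (th * p / 2 - 2 * q) ^+ 2 = th ^+ 2 * p ^+ 2 / 4 - 2 * th * p * q + 4 * q ^+ 2 by field.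
have e2 : (th * p / 2 + th * c) ^+ 2 = th ^+ 2 * p ^+ 2 / 4 + th ^+ 2 * p * c + th ^+ 2 * c ^+ 2 by field.
have e3 : (q - th * c) ^+ 2 = q ^+ 2 - 2 * th * q * c + th ^+ 2 * c ^+ 2 by ring.
have e4 : (p + c) * (2 * th * q - th ^+ 2 * p) = 2 * th * p * q - th ^+ 2 * p ^+ 2 + 2 * th * q * c - th ^+ 2 * p * c by ring.
rewrite e4; lra.
Qed.

Variables (u : V -> R) (F : 'I_d -> V -> R).
Hypotheses (hu : locL1 u) (u0 : forall x, 0 <= u x) (cF : forall i, continuous (F i)).
Hypothesis eqn : fp_functional (pairing u) (fun i => pairing (fun x => u x * F i x)).

Let drift_bound N : exists2 C, 0 <= C & forall i x, `|x| <= N -> `|F i x| <= C.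
Proof.
have h i : exists C, 0 < C /\ forall x, `|x| <= N -> `|F i x| <= C.
  by have [C C0 hC] := continuous_bounded_cube N (@cF i); exists C.
have [C hC] := choice h; exists (\sum_i C i).
  by apply: sumr_ge0 => i _; apply: ltW; case: (hC i).
move=> i x xN; apply: le_trans (_ : C i <= _); first by apply: (hC i).2.
by rewrite (bigD1 i)//= lerDl sumr_ge0// => j _; apply: ltW; case: (hC j).
Qed.

Let luF i : locL1 (fun x => u x * F i x).
Proof. exact: locL1M. Qed.

(** With U = mol u e + dl, the ratio of the mollified u F_i to U is bounded by a local bound of
    |F_i|, because u >= 0. This holds whatever [e] and [dl] are, so the constant does not depend on
    them. *)
Lemma log_energy N : exists2 C, 0 <= C & forall e dl, 0 < e -> e <= 1 -> 0 < dl ->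
  energy (fun x => ln (mol u e x + dl)) N <= C.
Proof.
have [th [kth th01 th1 th0]] := smooth_cutoff N.
have [K K0 hK] := drift_bound (N + 4).
have cth : Cc th by apply: (@CcP _ _ _ (N + 3)); [exact: Ck_cont (kth 0%N)|].
pose Q i x := 5 * partial i th x ^+ 2 + 2 * (K ^+ 2 * th x ^+ 2).
have sq f : Cc f -> Cc (fun x => f x ^+ 2) by move=> cf; apply: CcMl => //; exact: cf.1.
have iQ i : intg (Q i).
  apply: Cc_intg; apply: CcD; apply: CcZ; last by apply: CcZ; exact: sq.
  by apply: sq; apply: Cc_partial.
exists (2 * \sum_(i < d) \int[mu]_x Q i x).
  rewrite mulr_ge0// sumr_ge0// => i _; apply: Int_ge0 => x.
  by rewrite addr_ge0// mulr_ge0 ?sqr_ge0// mulr_ge0 ?sqr_ge0.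
move=> e dl e0 e1 dl0; have e0' := ltW e0.
pose U x := mol u e x + dl.
have U0 x : 0 < U x by rewrite ltr_wpDl// mol_ge0.
have kU k : Ck k U by apply: CkD; [exact: Ck_mol|exact: Ck_cst].
have [kL pL] := Ck_ln U0 (kU 1%N).
have kI : Ck 1 (fun x => (U x)^-1) by exact: Ck_inv.
pose psi x := th x * th x * (U x)^-1.
have kpsi : Ck 1 psi by apply: CkM => //; apply: CkM.
have cpsi : Cc psi.
  apply: CcMr; last exact: Ck_cont kI.
  by apply: CcMl => //; exact: cth.1.
pose p i x := partial i U x / U x; pose c i x := mol (fun x => u x * F i x) e x / U x.
have pU i x : partial i (mol u e) x = partial i U x.
  rewrite (partialE (is_derive_add (Ck_derive i x (Ck_mol 1 e0' hu)) (is_derive_cst dl x (e_ i)))).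
  by rewrite addr0.
have ppsi i x : partial i psi x = (2 * th x * partial i th x - th x ^+ 2 * p i x) / U x.
  have D1 := is_derive_mul (Ck_derive i x (kth 1%N)) (Ck_derive i x (kth 1%N)).
  have pI : partial i (fun x => (U x)^-1) x = - ((U x)^-1 * (U x)^-1) * partial i U x.
    by apply: partialE; apply: is_derive_invf; [rewrite gt_eqF|exact: Ck_derive (kU 1%N)].
  rewrite (partialE (is_derive_mul D1 (Ck_derive i x kI))) pI /p.
  have := U0 x; move: (U x) (partial i U x) (th x) (partial i th x) => a b s q a0.
  by field; rewrite gt_eqF.
have W := weak_mollified eqn e0' kpsi cpsi.
have cb i x : `|x| <= N + 3 -> `|c i x| <= K.
  move=> xN; rewrite normrM normfV (gtr0_norm (U0 x)) ler_pdivrMr//.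
  apply: (@le_trans _ _ (K * mol u e x)); last by rewrite ler_wpM2l// lerDl ltW.
  apply: le_trans (norm_mol x e0' (luF i)) _; rewrite -molZ//.
  apply: le_mol => //; [exact: locL1_norm|exact: locL1Z|].
  move=> y yx; rewrite normrM (ger0_norm (u0 y)) mulrC ler_wpM2r//; apply: hK.
  by have := lerB_dist y x; lra.
pose G i x := th x ^+ 2 * p i x ^+ 2.
have cp i : continuous (p i).
  exact: (Ck_cont (CkM (Ck_partial i (kU 1%N) : Ck 0 _) (CkW kI))).
have iG i : intg (G i).
  by apply: Cc_intg; apply: CcMr; [exact: sq|exact: (Ck_cont (CkM (conj (cp i) I : Ck 0 _) (conj (cp i) I : Ck 0 _)))].
have ib i : continuous (fun x => partial i (conv (pairing u) (moll e)) x + conv (pairing (fun x => u x * F i x)) (moll e) x).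
  have := Ck_mol 1 e0' (luF i); have := Ck_mol 2 e0' hu; rewrite mol.unlock => h1 h2.
  exact: (Ck_cont (CkD (CkW (Ck_partial i h1)) (CkW h2))).
have main : \sum_(i < d) \int[mu]_x G i x <= 2 * \sum_(i < d) \int[mu]_x Q i x.
  have : 0 <= \sum_(i < d) \int[mu]_x ((- 2^-1) * G i x + Q i x).
    rewrite -[leLHS]W; apply: ler_sum => i _; apply: le_Int.
    - by apply: Cc_intg; apply: CcMl; [exact: ib|exact: Cc_partial].
    - by apply: intgD => //; exact: intgZ.
    - move=> x; have -> : partial i (conv (pairing u) (moll e)) x = p i x * U x.
        by rewrite /p divfK ?gt_eqF// -pU mol.unlock.
      have -> : conv (pairing (fun x => u x * F i x)) (moll e) x = c i x * U x.
        by rewrite /c divfK ?gt_eqF// mol.unlock.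
      rewrite ppsi -mulrDl mulrA mulrAC mulfK ?gt_eqF//.
      apply: le_trans (log_energy_pointwise _ _ _ _) _.
      apply: lerD; first by rewrite !mulNr [2^-1 * _]mulrC.
      rewrite lerD2l ler_pM2l// [leRHS]mulrC.
      have [xN|xN] := lerP `|x| (N + 3); last by rewrite th0// expr0n !mul0r.
      rewrite ler_wpM2l ?sqr_ge0// -real_normK ?num_real// lerXn2r ?nnegrE//.
      exact: cb.
  rewrite (eq_bigr (fun i => - 2^-1 * \int[mu]_x G i x + \int[mu]_x Q i x)); last first.
    by move=> i _; rewrite IntD ?(IntZ _ (iG i))//; exact: intgZ.
  rewrite big_split /= -mulr_sumr; move: (\sum_(i < d) _) (\sum_(i < d) _) => a b; lra.
apply: le_trans main; rewrite energyE//; apply: ler_sum => i _.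
have cl : Ck 0 (partial i (fun x => ln (U x))) := Ck_partial i kL.
apply: le_Int => //; first exact: (continuous_locL1 (Ck_cont (CkM cl cl))).2.
move=> x; have [xN|xN] := lerP `|x| N.
  by rewrite indic_cube_in// mulr1 /G th1// expr1n mul1r pL.
by rewrite indic_cube_out// mulr0 /G mulr_ge0 ?sqr_ge0.
Qed.

End positivity.

(** * Solutions are zero or positive almost everywhere *)

Section strong_positivity.
Context {R : realType} {d : nat}.
Notation V := 'rV[R]_d.
Notation mu := (@lebesgue_rV R d).
Notation e_ i := (delta_mx ord0 i : V).
Implicit Types (f g h u w phi psi : V -> R) (x y z v : V) (e r c s t M N L C : R) (A B : set V).

Lemma ln_le_sub1 s : 0 < s -> ln s <= s - 1.
Proof. by move=> s0; have := expR_ge1Dx (ln s); rewrite lnK// lerBrDl. Qed.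

Lemma ln_lipschitz (a b dl : R) : 0 <= a -> 0 <= b -> 0 < dl ->
  `|ln (a + dl) - ln (b + dl)| <= `|a - b| / dl.
Proof.
move=> a0 b0 dl0.
wlog ab : a b a0 b0 / b <= a => [H|].
  have [h|h] := leP b a; first exact: H.
  by rewrite distrC (distrC a); apply: H => //; exact: ltW.
have A0 : 0 < a + dl by rewrite ltr_wpDl.
have B0 : 0 < b + dl by rewrite ltr_wpDl.
rewrite (ger0_norm (_ : 0 <= a - b)) ?subr_ge0// ger0_norm; last first.
  by rewrite subr_ge0 ler_ln ?posrE// lerD2r.
rewrite -ln_div ?posrE//; apply: le_trans (ln_le_sub1 _) _; first exact: divr_gt0.
have -> : (a + dl) / (b + dl) - 1 = (a - b) / (b + dl) by field; rewrite gt_eqF.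
by rewrite ler_wpM2l ?subr_ge0// lef_pV2 ?posrE// lerDr.
Qed.

(* Tonelli for the correlation of two indicators. *)
Lemma indic_correlation0 A B : measurable A -> measurable B ->
  (forall z, \int[mu]_x (\1_A x * \1_B (x + z)) = 0) ->
  (forall z, intg (fun x => \1_A x * \1_B (x + z))) ->
  mu A = 0%E \/ mu B = 0%E.
Proof.
move=> mA mB h ih.
pose f (p : V * V) : \bar R := (\1_A p.2 * \1_B (p.2 + p.1))%:E.
have madd : measurable_fun setT (fun p : V * V => p.2 + p.1).
  apply: measurable_fun_rV => i.
  under eq_fun do rewrite mxE.
  apply: measurable_funD.
    exact: (measurableT_comp (measurable_coord i) measurable_snd).
  exact: (measurableT_comp (measurable_coord i) measurable_fst).
have mf : measurable_fun setT f.
  apply/measurable_EFinP; apply: measurable_funM.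
    exact: (measurableT_comp (measurable_indic mA) measurable_snd).
  exact: (measurableT_comp (measurable_indic mB) madd).
have f0 p : (0 <= f p)%E by rewrite lee_fin mulr_ge0.
have := @fubini_tonelli _ _ V V R (@lebesgue_rV R d) (@lebesgue_rV R d) f mf f0.
rewrite (eq_integral (fun=> 0%E)); last by move=> z _; rewrite /f /= (IntE (ih z)) h.
rewrite integral0 => /esym.
have -> : (\int[mu]_x \int[mu]_z f (z, x) = \int[mu]_x ((\1_A x)%:E * mu B))%E.
  apply: eq_integral => x _; rewrite /f /=.
  under eq_integral do rewrite EFinM.
  have mBx : measurable_fun setT (fun z : V => (\1_B (x + z)%R : R)%:E).
    apply/measurable_EFinP.
    exact: (measurableT_comp (measurable_indic mB) (measurableT_comp madd (measurable_pair2 x))).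
  rewrite ge0_integralZl ?lee_fin//.
  congr (_ * _)%E.
  under eq_integral do rewrite addrC.
  rewrite (@ge0_integral_addr R d x (fun y => (\1_B y)%:E)) ?integral_indic ?setIT//.
  exact/measurable_EFinP/measurable_indic.
rewrite ge0_integralZr ?integral_indic ?setIT//; last exact/measurable_EFinP/measurable_indic.
by move=> /eqP; rewrite mule_eq0 => /orP[] /eqP; [left|right].
Qed.

Variables (u : V -> R) (F : 'I_d -> V -> R).
Hypotheses (hu : locL1 u) (u0 : forall x, 0 <= u x) (cF : forall i, continuous (F i)).
Hypothesis eqn : fp_functional (pairing u) (fun i => pairing (fun x => u x * F i x)).

Let lnmeas w dl : measurable_fun setT w -> measurable_fun setT (fun x => ln (w x + dl)).
Proof.
move=> mw; apply: (measurableT_comp (@measurable_ln R)).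
by apply: measurable_funD.
Qed.

Let intg_ln w dl z M : locL1 w -> (forall x, 0 <= w x) -> 0 < dl ->
  intg (fun x => `|ln (w (x + z) + dl) - ln (w x + dl)| * window M z x).
Proof.
move=> [mw hw] w0 dl0.
have mwz : measurable_fun setT (fun x => w (x + z)) := measurableT_comp mw (measurable_addr_rV z).
apply: (@le_intg _ _ _ (fun x => dl^-1 * ((fun y => w y * \1_(cube M) y) (x + z) + w x * \1_(cube M) x))).
- apply: measurable_funM; last exact: measurable_window.
  by apply: measurableT_comp => //; apply: measurable_funB; exact: lnmeas.
- move=> x; rewrite normrM normr_id (ger0_norm (window_ge0 _ _ _)).
  have := ln_lipschitz (w0 (x + z)) (w0 x) dl0; rewrite mulrC => h.
  rewrite mulrDr /=; have [xM|xM] := lerP `|x| M; last first.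
    by rewrite window_out// mulr0 addr_ge0// mulr_ge0 ?invr_ge0 ?(ltW dl0)// mulr_ge0.
  have [yM|yM] := lerP `|x + z| M; last first.
    rewrite /window (indic_cube_out yM) !mulr0 add0r.
    by rewrite mulr_ge0 ?invr_ge0 ?(ltW dl0)// mulr_ge0.
  rewrite /window !indic_cube_in// !mulr1; apply: le_trans h _.
  rewrite -mulrDr ler_wpM2l ?invr_ge0 ?(ltW dl0)//.
  by apply: le_trans (ler_normB _ _) _; rewrite !ger0_norm.
- apply: intgZ; apply: intgD; last exact: hw.
  exact: (@intg_addr R d z (fun y => w y * \1_(cube M) y) (hw M)).
Qed.

(** The point is that [C] does not depend on [dl]. The energy of the mollified logarithms controls a
    square integral, and |t| <= 1 + t^2 turns it into a first power. For fixed [dl] the logarithm is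
    Lipschitz with constant 1/dl, which lets [e] tend to 0. *)
Lemma log_translation N : 0 <= N -> exists C, forall dl z, 0 < dl -> `|z| <= 2 * N ->
  \int[mu]_x (`|ln (u (x + z) + dl) - ln (u x + dl)| * window N z x) <= C.
Proof.
move=> N0; have [C C0 hC] := log_energy hu u0 cF eqn N.
set K := \int[mu]_x (\1_(@cube R d N) x : R).
exists (K + d%:R * (2 * N) ^+ 2 * C) => dl z dl0 zN.
apply/ler_addgt0Pr => c c0.
have c2 : 0 < c / 2 * dl by rewrite mulr_gt0// divr_gt0.
have [e0 e00 he0] := mol_cvg_L1 N hu c2.
pose e := Num.min e0 1 / 2.
have m0 : 0 < Num.min e0 1 by rewrite lt_min e00 ltr01.
have e_0 : 0 < e by rewrite divr_gt0.
have : e < Num.min e0 1 by rewrite /e; lra.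
rewrite lt_min => /andP[ee0 e1].
have hc := he0 e e_0 ee0; have hL := hC e dl e_0 (ltW e1) dl0.
pose w := mol u e.
have lw : locL1 w := continuous_locL1 (mol_continuous (ltW e_0) hu).
have w0 x : 0 <= w x by exact: mol_ge0.
have W0 x : 0 < w x + dl by rewrite ltr_wpDl.
have kW : Ck 1 (fun x => w x + dl) by apply: CkD; [exact: Ck_mol (ltW e_0) hu|exact: Ck_cst].
have [kl _] := Ck_ln W0 kW.
have T := translation_estimate N kl zN.
have lD : locL1 (fun y => w y - u y).
  have h := locL1D lw (locL1Z (-1) hu).
  by rewrite (_ : (fun x => _) = fun x => w x + -1 * u x)//; apply/funext => y; rewrite mulN1r.
have iD := (locL1_norm lD).2 N.
have iDz := @intg_addr R d z (fun x => `|w x - u x| * \1_(cube N) x) iD.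
pose D x := `|w x - u x| * \1_(cube N) x.
have i1 := intg_diff_sqr N z (Ck_cont kl).
have i2 := @intg_indic_cube R d N.
have i3 : intg (fun x => dl^-1 * (D (x + z) + D x)) by apply: intgZ; exact: intgD.
apply: (@le_trans _ _ (\int[mu]_x ((\1_(cube N) x + (ln (w (x + z) + dl) - ln (w x + dl)) ^+ 2 * window N z x)
   + dl^-1 * (D (x + z) + D x)))).
  apply: le_Int; [exact: intg_ln|by apply: intgD => //; exact: intgD|].
  move=> x; have D0 y : 0 <= D y by rewrite mulr_ge0.
  have R0 : 0 <= \1_(cube N) x + (ln (w (x + z) + dl) - ln (w x + dl)) ^+ 2 * window N z x.
    by rewrite addr_ge0// mulr_ge0 ?sqr_ge0 ?window_ge0.
  have R1 : 0 <= dl^-1 * (D (x + z) + D x).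
    by rewrite mulr_ge0 ?invr_ge0 ?(ltW dl0)// addr_ge0.
  have [xM|xM] := lerP `|x| N; last first.
    rewrite [X in X <= _](_ : _ = 0); first exact: addr_ge0.
    by rewrite (window_out z xM) mulr0.
  have [yM|yM] := lerP `|x + z| N; last first.
    rewrite [X in X <= _](_ : _ = 0); first exact: addr_ge0.
    by rewrite /window (indic_cube_out yM) !mulr0.
  rewrite /D /window !indic_cube_in// !mulr1.
  have a1 := ln_lipschitz (w0 (x + z)) (u0 (x + z)) dl0.
  have a2 := ln_lipschitz (w0 x) (u0 x) dl0.
  move: a1 a2; move: (ln (w (x + z) + dl)) (ln (w x + dl)) (ln (u (x + z) + dl)) (ln (u x + dl)) => p q p' q'.
  move: `|w (x + z) - u (x + z)| `|w x - u x| => a b; rewrite !(mulrC _ dl^-1) => a1 a2.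
  have -> : p' - q' = (p - q) - (p - p') + (q - q') by ring.
  apply: le_trans (ler_normD _ _) _; rewrite mulrDr addrA; apply: lerD => //.
  apply: le_trans (ler_normB _ _) _; apply: lerD => //.
  have h : 0 <= (`|p - q| - 1) ^+ 2 by exact: sqr_ge0.
  by rewrite -(real_normK (num_real (p - q))); move: h (normr_ge0 (p - q)); rewrite sqrrB1 expr2; move: `|p - q| => t; rewrite mulr2n; nra.
rewrite IntD//; last exact: intgD.
rewrite IntD// IntZ; last exact: intgD.
rewrite IntD// (@Int_addr R d z D); last exact: intg_meas iD.
apply: lerD.
  rewrite -/K lerD2l; apply: le_trans T _.
  by rewrite ler_wpM2l// mulr_ge0// sqr_ge0.
rewrite -mulr2n -mulr_natl ler_pdivrMl//.
have -> : dl * c = 2 * (c / 2 * dl) by field.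
by rewrite ler_pM2l.
Qed.

(* If u vanishes on a set of positive measure, letting dl -> 0 in the previous
   estimate makes log(u + dl) incompatible with positive values elsewhere. *)
Theorem solution_positive : {ae mu, forall x, u x = 0} \/ {ae mu, forall x, 0 < u x}.
Proof.
have [mu_ _] := hu.
have mgt e : measurable [set x | e <= u x].
  have := mu_ measurableT (`[e, +oo[%classic) (measurable_itv _); rewrite setTI.
  rewrite (_ : u @^-1` _ = [set x | e <= u x])//; by apply/seteqP; split => x /=; rewrite in_itv/= andbT.
have mz : measurable [set x | u x = 0].
  have := mu_ measurableT [set 0] (measurable_set1 _); rewrite setTI.
  by rewrite (_ : u @^-1` _ = [set x | u x = 0]).
pose Z (n : nat) := [set x | u x = 0] `&` cube n%:R.
pose P (n : nat) (a : R) := [set x | a <= u x] `&` cube n%:R.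
have mZ n : measurable (Z n) by apply: measurableI => //; exact: measurable_cube.
have mP n (a : R) : measurable (P n a).
  by rewrite /P; apply: measurableI; [exact: mgt|exact: measurable_cube].
have key n eps : 0 < eps -> mu (Z n) = 0%E \/ mu (P n eps) = 0%E.
  move=> e0.
  have iC z : intg (fun x => \1_(Z n) x * \1_(P n eps) (x + z)).
    apply: le_intg (@intg_indic_cube R d n%:R).
      apply: measurable_funM; first exact: measurable_indic.
      exact: (measurableT_comp (measurable_indic (mP n eps)) (measurable_addr_rV z)).
    move=> x; rewrite !indicE /Z in_setI; case: (x \in cube n%:R); rewrite ?andbF ?mul0r ?normr0// andbT.
    by do 2 case: (_ \in _); rewrite ?mulr1 ?mulr0 ?normr0 ?normr1.
  apply: (indic_correlation0 (mZ n) (mP n eps) _ iC) => z.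
  have [zn|zn] := lerP `|z| (2 * n%:R); last first.
    rewrite (@eq_Int _ _ _ (fun=> 0)) ?Int0// => x.
    rewrite !indicE; case: (boolP (x \in Z n)); rewrite ?mul0r// inE => -[_ xn].
    case: (boolP (x + z \in P n eps)); rewrite ?mulr0// inE => -[_ yn].
    have := ler_normB (x + z) x; rewrite addrAC subrr add0r => h; exfalso.
    by move: xn yn; rewrite /cube /=; lra.
  have [C hC] := log_translation (ler0n R n).
  set I := \int[mu]_x _.
  have I0 : 0 <= I by apply: Int_ge0 => x; rewrite mulr_ge0.
  have bd t : 0 < t -> t * I <= C.
    (* This value makes ln (eps + dl) - ln dl = t, so each pair of points counted by [I] contributes
       at least t; hence t I <= C for every t > 0. *)
    move=> t0; pose dl := eps / (expR t - 1).
    have et : 0 < expR t - 1 by rewrite subr_gt0 expR_gt1.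
    have dl0 : 0 < dl by rewrite divr_gt0.
    apply: le_trans (hC dl z dl0 zn); rewrite -IntZ//.
    apply: le_Int; [exact: intgZ|exact: intg_ln|].
    move=> x; rewrite !indicE; case: (boolP (x \in Z n)); last first.
      by rewrite mul0r mulr0 mulr_ge0// window_ge0.
    rewrite inE => -[ux xn]; case: (boolP (x + z \in P n eps)); last first.
      by rewrite !mulr0 mulr_ge0// window_ge0.
    rewrite inE => -[uz yn]; rewrite /window !indic_cube_in// !mulr1 ux add0r.
    apply: le_trans (ler_norm _); rewrite -ln_div ?posrE//; last by rewrite ltr_wpDl.
    rewrite -[leLHS]expRK ler_ln ?posrE ?expR_gt0//; last by rewrite divr_gt0// ltr_wpDl.
    rewrite ler_pdivlMr// -[expR t](subrK 1) mulrDl mul1r lerD2r.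
    by rewrite /dl mulrC divfK// gt_eqF.
  apply/eqP; rewrite eq_le I0 andbT leNgt; apply/negP => Ipos.
  have C0 : 0 <= `|C| + 1 by rewrite addr_ge0.
  have := bd ((`|C| + 1) / I); rewrite divfK ?gt_eqF// divr_gt0 ?ltr_wpDl// => /(_ isT).
  by have := ler_norm C; lra.
(* Either all truncated superlevel sets are null, or one of them is not, and then [key] makes the
   zero set null in every cube. *)
have [H|H] := pselect (forall n m, mu (P n m.+1%:R^-1) = 0%E); [left|right].
  have h n m : {ae mu, forall x, ~ P n m.+1%:R^-1 x}.
    exists (P n m.+1%:R^-1); split; [exact: mP|exact: H|by move=> x; exact: contrapT].
  have h2 : {ae mu, forall x, forall n m, ~ P n m.+1%:R^-1 x}.
    by apply: ae_foralln => n; apply: ae_foralln => m; exact: h.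
  apply: filterS h2 => x hx; apply/eqP; rewrite eq_le u0 andbT leNgt; apply/negP => ux.
  apply: (hx (Num.bound `|x|) (Num.bound (u x)^-1)); split => /=.
    rewrite invf_ple ?posrE//; apply: le_trans (ltW (archi_boundP _)) _; first by rewrite invr_ge0 ltW.
    by rewrite ler_nat.
  by rewrite /cube /=; exact: ltW (archi_boundP _).
have [n [m hnm]] : exists n m, mu (P n m.+1%:R^-1) <> 0%E.
  apply: contrapT => h; apply: H => n m; apply: contrapT => h'; apply: h.
  by exists n, m.
have zero k : mu (Z k) = 0%E.
  have m0 : 0 < m.+1%:R^-1 :> R by rewrite invr_gt0.
  have null (A B : set V) : measurable A -> measurable B -> A `<=` B -> mu B = 0%E -> mu A = 0%E.
    move=> mA mB AB B0; apply/eqP; rewrite eq_le measure_ge0 andbT -B0.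
    by apply: le_measure; rewrite ?inE.
  have mono i : (i <= maxn n k)%N -> cube i%:R `<=` @cube R d (maxn n k)%:R.
    by move=> ik x; rewrite /cube /= => h; apply: le_trans h _; rewrite ler_nat.
  have [h|h] := key (maxn n k) _ m0.
    apply: (null _ (Z (maxn n k)) (mZ k) (mZ _) _ h).
    by move=> x [ux xk]; split => //; exact: (mono k (leq_maxr _ _)).
  exfalso; apply: hnm; apply: (null _ (P (maxn n k) m.+1%:R^-1) (mP _ _) (mP _ _) _ h) => x [ux xk]; split => //.
  exact: (mono n (leq_maxl _ _)).
have h2 : {ae mu, forall x, forall n, ~ Z n x}.
  apply: ae_foralln => k; exists (Z k); split; [exact: mZ|exact: zero|by move=> x; exact: contrapT].
apply: filterS h2 => x hx; rewrite lt0r u0 andbT; apply/eqP => ux.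
by apply: (hx (Num.bound `|x|)); split => //; rewrite /cube /=; exact: ltW (archi_boundP _).
Qed.

End strong_positivity.

(** * Kato's inequality *)

Section kato.
Context {R : realType} {d : nat}.
Notation V := 'rV[R]_d.
Notation mu := (@lebesgue_rV R d).
Notation e_ i := (delta_mx ord0 i : V).
Implicit Types (f g h u w phi psi : V -> R) (x y z v : V) (e r c s t M N L C : R) (A B : set V).

Lemma Ck_sqrt f : (forall x, 0 < f x) -> Ck 1 f ->
  Ck 1 (fun x => Num.sqrt (f x)) /\
  forall i x, partial i (fun x => Num.sqrt (f x)) x = partial i f x / (2 * Num.sqrt (f x)).
Proof.
move=> f0 hf.
have s0 x : 0 < Num.sqrt (f x) by rewrite sqrtr_gt0.
have D i x : is_derive x (e_ i) (fun x => Num.sqrt (f x)) (partial i f x / (2 * Num.sqrt (f x))).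
  rewrite mulrC; exact: is_derive_chain (is_derive1_sqrt (f0 x)) (Ck_derive i x hf).
have cs : continuous (fun x => Num.sqrt (f x)).
  have cf := Ck_cont hf.
  move=> x; apply: (@continuous_comp _ _ _ f (@Num.sqrt R)); first exact: cf.
  exact: sqrt_continuous.
split; last by move=> i x; apply: partialE; exact: D.
apply: (Ck_of_derive cs D) => i.
apply: CkM; first exact: Ck_partial.
apply: Ck_inv; first by move=> x; rewrite mulr_gt0.
by apply: CkZ; exact: (conj cs I).
Qed.

Lemma commutator_mol w f e x c : 0 <= e -> locL1 w -> continuous f ->
  (forall y, `|y - x| <= e -> `|f y - f x| <= c) ->
  `|mol (fun y => w y * f y) e x - f x * mol w e x| <= c * mol (fun y => `|w y|) e x.
Proof.
move=> e0 hw cf hc.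
have hf : locL1 (fun y => w y * f y) by exact: locL1M.
have -> : mol (fun y => w y * f y) e x - f x * mol w e x =
    mol (fun y => w y * f y + (- f x) * w y) e x.
  by rewrite (molD x e0 hf (locL1Z (- f x) hw)) (molZ _ x e0 hw) mulNr.
have hl := locL1D hf (locL1Z (- f x) hw).
apply: le_trans (norm_mol x e0 hl) _; rewrite -(molZ c x e0 (locL1_norm hw)).
apply: le_mol => //; [exact: locL1_norm|by apply: locL1Z; exact: locL1_norm|].
move=> y yx; rewrite mulNr [f x * _]mulrC -mulrBr normrM mulrC ler_wpM2r//; exact: hc.
Qed.

(** Jensen's inequality: the mollification of (w - c)^2 is nonnegative for c = mol w e x. *)
Lemma mol_sqr_le w e x : 0 < e -> locL1 w -> locL1 (fun y => w y ^+ 2) ->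
  mol w e x ^+ 2 <= mol (fun y => w y ^+ 2) e x.
Proof.
move=> e0 hw hw2; have e0' := ltW e0; set c := mol w e x.
have h1 := locL1Z (- 2 * c) hw.
have h2 : locL1 (fun _ : V => c ^+ 2) by exact: continuous_locL1 (Ck_cont (@Ck_cst R d 0 _)).
have : 0 <= mol (fun y => (w y ^+ 2 + (- 2 * c) * w y) + c ^+ 2) e x.
  apply: mol_ge0 => y; have := sqr_ge0 (w y - c).
  by move: (w y) => a; rewrite (_ : a ^+ 2 + _ + _ = (a - c) ^+ 2)//; ring.
rewrite (molD x e0' (locL1D hw2 h1) h2) (molD x e0' hw2 h1) (molZ _ x e0' hw) (mol_cst _ x e0) -/c.
by clear h1 h2; clearbody c; move: (mol (fun y => w y ^+ 2) e x) => a; nra.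
Qed.

(** Here s = mol w e x, p and q are the derivatives of s and chi, and r is the commutator of the
    drift. The derivative of (s / U) chi contains p e^2 / U^3, so p^2 appears with the nonnegative
    coefficient b chi, where b = e^2 / U^3, and absorbs its cross terms. Since b s^2 <= e and b e <=
    1, what remains is O(e). *)
Lemma kato_pointwise (p F s r q chi U e K X m L : R) : 0 < e -> 0 < U -> U ^+ 2 = s ^+ 2 + e ^+ 2 ->
  0 <= K -> 0 <= X -> 0 <= chi -> chi <= X -> `|F| <= K -> `|q| <= X -> `|r| <= L * e * m ->
  s / U * p * q + `|s| * (F * q) - e * (X * K ^+ 2 + K * X + X * (L * m) ^+ 2 + X * (L * m))
  <= (p + (F * s + r)) * (p * (e ^+ 2 / U ^+ 3) * chi + s / U * q).
Proof.
move=> e0 U0 UE K0 X0 chi0 chiX FK qX rL.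
set b := e ^+ 2 / U ^+ 3; set a := s / U.
have sqle (t1 t2 : R) : 0 <= t2 -> t1 ^+ 2 <= t2 ^+ 2 -> t1 <= t2.
  by move=> h1 h2; rewrite leNgt; apply/negP => h3; move: h2; nra.
have eU : e <= U by apply: sqle; [exact: ltW|rewrite UE lerDr sqr_ge0].
have sU : `|s| <= U.
  by apply: sqle; [exact: ltW|rewrite UE real_normK ?num_real// lerDl sqr_ge0].
have b0 : 0 <= b by rewrite divr_ge0 ?sqr_ge0// exprn_ge0// ltW.
have U3 : 0 < U ^+ 3 by rewrite exprn_gt0.
have s2U : s ^+ 2 <= U ^+ 2 by rewrite UE lerDl sqr_ge0.
have bs : b * s ^+ 2 <= e.
  rewrite /b mulrAC ler_pdivrMr//.
  have h1 : e * s ^+ 2 <= U * U ^+ 2 by apply: ler_pM => //; [exact: ltW|exact: sqr_ge0].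
  have -> : e ^+ 2 * s ^+ 2 = e * (e * s ^+ 2) by ring.
  have -> : U ^+ 3 = U * U ^+ 2 by ring.
  by rewrite ler_wpM2l// ltW.
have be : b * e <= 1.
  rewrite /b mulrAC ler_pdivrMr// mul1r -exprSr.
  by rewrite lerXn2r ?nnegrE// ltW.
have a1 : `|a| <= 1 by rewrite normrM normfV (gtr0_norm U0) ler_pdivrMr// mul1r.
have as_ : `|a * s - `|s| | <= e.
  have -> : a * s - `|s| = - (`|s| * (U - `|s|) / U).
    rewrite /a mulrAC -expr2 -(real_normK (num_real s)).
    by move: (`|s|) U0 => t U0; field; rewrite gt_eqF.
  have h : 0 <= U - `|s| by rewrite subr_ge0.
  have he : U - `|s| <= e.
    rewrite lerBlDr; apply: sqle; [by rewrite addr_ge0// ltW|rewrite UE sqrrD real_normK ?num_real//].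
    by rewrite addrAC [e ^+ 2 + s ^+ 2]addrC lerDl mulrn_wge0// mulr_ge0// ltW.
  rewrite normrN ger0_norm; last by rewrite divr_ge0 ?mulr_ge0// ltW.
  rewrite ler_pdivrMr// [leRHS]mulrC ler_pM//.
have eL0 : 0 <= e * (L * m) ^+ 2 by apply: mulr_ge0; [exact: ltW|exact: sqr_ge0].
have rr : r ^+ 2 <= e ^+ 2 * (L * m) ^+ 2.
  rewrite -(real_normK (num_real r)) (_ : e ^+ 2 * _ = (L * e * m) ^+ 2); last by ring.
  by rewrite lerXn2r// nnegrE// (le_trans _ rL).
have FF : F ^+ 2 <= K ^+ 2 by rewrite -(real_normK (num_real F)) lerXn2r// nnegrE.
have H1 : - (chi * (K ^+ 2 * e + e * (L * m) ^+ 2)) <= (p + (F * s + r)) * (p * b * chi).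
  have h : - (b * (F ^+ 2 * s ^+ 2 + r ^+ 2)) <= b * (p * (p + (F * s + r))).
    rewrite -mulrN ler_wpM2l//.
    have g1 := sqr_ge0 (p + (F * s + r) / 2); have g2 := sqr_ge0 (F * s - r).
    have g3 : 0 <= p ^+ 2 + p * (F * s + r) + (F * s + r) ^+ 2 / 4.
      have -> : p ^+ 2 + p * (F * s + r) + (F * s + r) ^+ 2 / 4 = (p + (F * s + r) / 2) ^+ 2 by field.
      exact: g1.
    have g4 : (F * s + r) ^+ 2 + (F * s - r) ^+ 2 = 2 * (F ^+ 2 * s ^+ 2 + r ^+ 2) by ring.
    have g5 : p * (p + (F * s + r)) = p ^+ 2 + p * (F * s + r) by ring.
    have g6 : 0 <= F ^+ 2 * s ^+ 2 + r ^+ 2 by apply: addr_ge0; [apply: mulr_ge0|]; exact: sqr_ge0.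
    lra.
  have h2 : b * (F ^+ 2 * s ^+ 2 + r ^+ 2) <= K ^+ 2 * e + e * (L * m) ^+ 2.
    rewrite mulrDr; apply: lerD.
      by rewrite mulrCA; apply: ler_pM => //; [exact: sqr_ge0|apply: mulr_ge0 => //; exact: sqr_ge0].
    apply: le_trans (ler_wpM2l b0 rr) _.
    rewrite (_ : b * (e ^+ 2 * _) = (b * e) * (e * (L * m) ^+ 2)); last by ring.
    by rewrite ler_piMl.
  rewrite (_ : (p + _) * (p * b * chi) = chi * (b * (p * (p + (F * s + r))))); last by ring.
  by rewrite -mulrN ler_wpM2l//; apply: le_trans h; rewrite lerN2.
have H2 : `|s| * (F * q) - e * (K * X) - X * (L * m) * e <= a * (F * s + r) * q.
  have h1 : `|(a * s - `|s|) * (F * q)| <= e * (K * X).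
    by rewrite normrM ler_pM// normrM ler_pM.
  have h2 : `|a * r * q| <= X * (L * m) * e.
    rewrite normrM [leRHS](_ : _ = (L * e * m) * X); last by ring.
    rewrite ler_pM// normrM; apply: le_trans _ rL.
    by rewrite ler_piMl.
  have e1 : a * (F * s + r) * q = (a * s - `|s|) * (F * q) + `|s| * (F * q) + a * r * q by ring.
  rewrite e1; move: h1 h2; rewrite !ler_norml => /andP[h1 _] /andP[h2 _]; lra.
have H3 : chi * (K ^+ 2 * e + e * (L * m) ^+ 2) <= X * (K ^+ 2 * e + e * (L * m) ^+ 2).
  apply: ler_wpM2r => //; apply: addr_ge0 => //.
  by apply: mulr_ge0; [exact: sqr_ge0|exact: ltW].
have e2 : (p + (F * s + r)) * (p * b * chi + a * q) =
   (p + (F * s + r)) * (p * b * chi) + a * p * q + a * (F * s + r) * q by ring.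
rewrite e2; move: H1 H2 H3.
have -> : e * (X * K ^+ 2 + K * X + X * (L * m) ^+ 2 + X * (L * m)) =
  X * (K ^+ 2 * e + e * (L * m) ^+ 2) + e * (K * X) + X * (L * m) * e by ring.
move: (X * (K ^+ 2 * e + _)) (chi * _) ((p + _) * (p * b * chi)) (a * (F * s + r) * q) (a * p * q) => *; lra.
Qed.

Lemma sqrt_regularized s e : 0 < e ->
  [/\ 0 < Num.sqrt (s ^+ 2 + e ^+ 2), Num.sqrt (s ^+ 2 + e ^+ 2) ^+ 2 = s ^+ 2 + e ^+ 2,
   `|s| <= Num.sqrt (s ^+ 2 + e ^+ 2) & Num.sqrt (s ^+ 2 + e ^+ 2) <= `|s| + e].
Proof.
move=> e0; set U := Num.sqrt _.
have p0 : 0 < s ^+ 2 + e ^+ 2 by rewrite ltr_wpDl ?sqr_ge0// exprn_gt0.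
have U0 : 0 < U by rewrite sqrtr_gt0.
have UE : U ^+ 2 = s ^+ 2 + e ^+ 2 by rewrite sqr_sqrtr// ltW.
have sE := real_normK (num_real s); have s0 := normr_ge0 s.
split => //; rewrite leNgt; apply/negP => h; move: UE; rewrite -sE; move: (`|s|) s0 h => t; nra.
Qed.

(* The formal adjoint of u |-> div (grad u + u F). *)
Definition adjoint (F : 'I_d -> V -> R) phi x : R :=
  \sum_(i < d) (partial i (partial i phi) x - F i x * partial i phi x).

Lemma Cc_adjoint (F : 'I_d -> V -> R) phi : (forall i, continuous (F i)) -> Ck 2 phi -> Cc phi ->
  Cc (adjoint F phi).
Proof.
move=> cF h2 hc; apply: Cc_sum => i.
have h1 := Cc_partial i (CkW h2) hc.
apply: CcD; first exact: (Cc_partial i (Ck_partial i h2) h1).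
have := CcZ (-1) (CcMl (cF i) h1).
by under eq_fun do rewrite mulN1r.
Qed.

Variables (w : V -> R) (F : 'I_d -> V -> R).
Hypotheses (hw : locL1 w) (hw2 : intg (fun x => w x ^+ 2)) (lF : forall i, liploc (F i)).
Hypothesis eqn : fp_functional (pairing w) (fun i => pairing (fun x => w x * F i x)).

Let cF i : continuous (F i).
Proof. exact: liploc_continuous. Qed.

Let lwF i : locL1 (fun x => w x * F i x).
Proof. exact: locL1M. Qed.

Let uniform_bounds N : exists L K, [/\ 0 <= L, 0 <= K,
  forall i x y, `|x| <= N -> `|y| <= N -> `|F i x - F i y| <= L * `|x - y| &
  forall i x, `|x| <= N -> `|F i x| <= K].
Proof.
have h1 i : exists C, 0 <= C /\ forall x y, `|x| <= N -> `|y| <= N -> `|F i x - F i y| <= C * `|x - y|.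
  by have [C C0 hC] := @lF i N; exists C.
have h2 i : exists C, 0 < C /\ forall x, `|x| <= N -> `|F i x| <= C.
  by have [C C0 hC] := continuous_bounded_cube N (@cF i); exists C.
have [C hC] := choice h1; have [D hD] := choice h2.
have C0 i : 0 <= C i by case: (hC i).
have D0 i : 0 <= D i by apply: ltW; case: (hD i).
have le_sum (f : 'I_d -> R) i : (forall i, 0 <= f i) -> f i <= \sum_j f j.
  by move=> f0; rewrite (bigD1 i)//= lerDl sumr_ge0.
exists (\sum_i C i), (\sum_i D i); split; try by apply: sumr_ge0.
  move=> i x y xN yN; apply: le_trans ((hC i).2 x y xN yN) _.
  by rewrite ler_wpM2r// le_sum.
by move=> i x xN; apply: le_trans ((hD i).2 x xN) _; rewrite le_sum.
Qed.

Let kato_mol chi : Ck 2 chi -> Cc chi -> (forall x, 0 <= chi x) -> exists2 C, 0 <= C &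
  forall e, 0 < e -> e <= 1 -> - (e * C) <= \int[mu]_x (`|mol w e x| * adjoint F chi x).
Proof.
move=> chi2 cchi chi0.
have chi1 := CkW chi2.
have [M hM] := cchi.2; have [X1 X10 hX1] := Cc_bounded cchi.
have hq i : Cc (partial i chi) by apply: Cc_partial.
have hqq i : Cc (partial i (partial i chi)) by apply: Cc_partial => //; exact: Ck_partial.
have hq' i : exists C, 0 < C /\ forall x, `|partial i chi x| <= C.
  by have [C C0 hC] := Cc_bounded (hq i); exists C.
have [X2 hX2] := choice hq'.
have X20 i : 0 <= X2 i by apply: ltW; case: (hX2 i).
pose X := X1 + \sum_i X2 i.
have sX0 : 0 <= \sum_i X2 i by apply: sumr_ge0.
have X0 : 0 <= X by rewrite addr_ge0// ltW.
have chiX x : chi x <= X.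
  by apply: le_trans (ler_norm _) _; apply: le_trans (hX1 x) _; rewrite /X lerDl.
have qX i x : `|partial i chi x| <= X.
  apply: le_trans ((hX2 i).2 x) _; apply: (@le_trans _ _ (\sum_i X2 i)); last by rewrite /X lerDr ltW.
  by rewrite (bigD1 i)//= lerDl sumr_ge0.
have [L [K [L0 K0 hL hK]]] := uniform_bounds (`|M| + 1).
have MM : M <= `|M| := ler_norm M.
have hM' i x : `|M| < `|x| -> partial i chi x = 0.
  by move=> xM; apply: (@partial_out _ _ _ M) => //; apply: le_lt_trans xM.
set c0 := X * K ^+ 2 + K * X.
have c00 : 0 <= c0 by rewrite addr_ge0// mulr_ge0// sqr_ge0.
pose J := \int[mu]_x (\1_(cube `|M|) x : R).
pose Y i := \int[mu]_x `|partial i (partial i chi) x|.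
(* Bounds the integral of [Err] below for every e <= 1. The middle term comes from the squared
   commutator, and it is where w in L^2 enters. *)
pose Z := c0 * J + X * L ^+ 2 * \int[mu]_x `|w x ^+ 2| +
   X * L * (\int[mu]_x `|w x * \1_(cube (`|M| + 1)) x|).
have J0 : 0 <= J by exact: Int_indic_cube_ge0.
have Y0 i : 0 <= Y i by apply: Int_ge0.
have Z0 : 0 <= Z.
  have h1 := mulr_ge0 c00 J0.
  have h2 : 0 <= X * L ^+ 2 * \int[mu]_x `|w x ^+ 2|.
    by apply: mulr_ge0; [apply: mulr_ge0 => //; exact: sqr_ge0|apply: Int_ge0].
  have h3 : 0 <= X * L * \int[mu]_x `|w x * \1_(cube (`|M| + 1)) x|.
    by apply: mulr_ge0; [exact: mulr_ge0|apply: Int_ge0].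
  exact: addr_ge0 (addr_ge0 h1 h2) h3.
exists (\sum_(i < d) (Y i + Z)); first by apply: sumr_ge0 => i _; exact: addr_ge0.
move=> e e0 e1; have e0' := ltW e0.
pose s := mol w e.
have ks n : Ck n s by exact: Ck_mol.
have kw : Ck 1 (fun x => s x ^+ 2 + e ^+ 2).
  by apply: CkD; [exact: (CkM (ks 1%N) (ks 1%N))|exact: Ck_cst].
have w0 x : 0 < s x ^+ 2 + e ^+ 2 by rewrite ltr_wpDl ?sqr_ge0// exprn_gt0.
have [kU pU] := Ck_sqrt w0 kw.
pose U x := Num.sqrt (s x ^+ 2 + e ^+ 2).
have HU x := sqrt_regularized (s x) e0.
have U0 x : 0 < U x by case: (HU x).
have UE x : U x ^+ 2 = s x ^+ 2 + e ^+ 2 by case: (HU x).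
have kI : Ck 1 (fun x => (U x)^-1) by exact: Ck_inv.
have pUE i x : partial i U x = s x / U x * partial i s x.
  rewrite pU; have -> : partial i (fun x => s x ^+ 2 + e ^+ 2) x = 2 * s x * partial i s x.
    have D1 := is_derive_mul (Ck_derive i x (ks 1%N)) (Ck_derive i x (ks 1%N)).
    rewrite (partialE (is_derive_add D1 (is_derive_cst (e ^+ 2) x (e_ i)))).
    by move: (partial i s x) (s x) => a b; ring.
  rewrite -/(U x); have := U0 x; move: (U x) (partial i s x) (s x) => a b c a0.
  by field; rewrite gt_eqF.
pose psi x := s x * (U x)^-1 * chi x.
have kpsi : Ck 1 psi by apply: CkM => //; apply: CkM.
have cpsi : Cc psi by apply: CcMl => //; exact: Ck_cont (CkM (ks 1%N) kI).
have ppsi i x : partial i psi x = partial i s x * (e ^+ 2 / U x ^+ 3) * chi x + s x / U x * partial i chi x.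
  have D1 := is_derive_mul (Ck_derive i x (ks 1%N)) (Ck_derive i x kI).
  have pI : partial i (fun x => (U x)^-1) x = - ((U x)^-1 * (U x)^-1) * partial i U x.
    by apply: partialE; apply: is_derive_invf; [rewrite gt_eqF|exact: Ck_derive kU].
  rewrite (partialE (is_derive_mul D1 (Ck_derive i x chi1))) pI pUE.
  have -> : e ^+ 2 = U x ^+ 2 - s x ^+ 2 by rewrite UE; move: (s x) => a; ring.
  have := U0 x; move: (U x) (partial i s x) (s x) (chi x) (partial i chi x) => a b c q q' a0.
  by field; rewrite gt_eqF.
have W := weak_mollified eqn e0' kpsi cpsi.
have lw2 := intg_locL1 hw2.
pose m2 := mol (fun y => w y ^+ 2) e; pose m := mol (fun y => `|w y|) e.
have cm : continuous m by exact: (mol_continuous e0' (locL1_norm hw)).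
have cm2 : continuous m2 by exact: (mol_continuous e0' lw2).
have m0 x : 0 <= m x by apply: mol_ge0.
have mm x : m x ^+ 2 <= m2 x.
  have lw2' : locL1 (fun y => `|w y| ^+ 2).
    by under eq_fun do rewrite (real_normK (num_real _)).
  apply: le_trans (mol_sqr_le x e0 (locL1_norm hw) lw2') _.
  by rewrite /m2; under eq_fun do rewrite (real_normK (num_real _)).
pose Err x := c0 + X * L ^+ 2 * m2 x + X * L * m x.
have cErr : continuous Err.
  have k1 : Ck 0 (fun x => X * L ^+ 2 * m2 x) by apply: CkZ; exact: (conj cm2 I).
  have k2 : Ck 0 (fun x => X * L * m x) by apply: CkZ; exact: (conj cm I).
  exact: (Ck_cont (CkD (CkD (@Ck_cst R d 0 c0) k1) k2)).
have iErr : intg (fun x => Err x * \1_(cube `|M|) x) := (continuous_locL1 cErr).2 _.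
have IErr : \int[mu]_x (Err x * \1_(cube `|M|) x) <= Z.
  have i1 := @intg_indic_cube R d `|M|.
  have i2 : intg (fun x => m2 x * \1_(cube `|M|) x) := (continuous_locL1 cm2).2 _.
  have i3 : intg (fun x => m x * \1_(cube `|M|) x) := (continuous_locL1 cm).2 _.
  rewrite (@eq_Int _ _ _ (fun x => c0 * \1_(cube `|M|) x + X * L ^+ 2 * (m2 x * \1_(cube `|M|) x) +
     X * L * (m x * \1_(cube `|M|) x))); last first.
    by move=> x; rewrite /Err !mulrDl !mulrA.
  have j1 := intgZ c0 i1; have j2 := intgZ (X * L ^+ 2) i2; have j3 := intgZ (X * L) i3.
  rewrite (IntD (intgD j1 j2) j3) (IntD j1 j2) (IntZ _ i1) (IntZ _ i2) (IntZ _ i3).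
  apply: lerD; first apply: lerD => //.
    apply: ler_wpM2l; first by apply: mulr_ge0 => //; exact: sqr_ge0.
    apply: le_trans (Int_norm_mol_le `|M| e0 hw2); apply: le_Int => //.
      have cn : continuous (fun x => `|m2 x|).
        by move=> x; apply: (@continuous_comp _ _ _ m2 (@Num.norm R R)); [exact: cm2|exact: norm_continuous].
      exact: (continuous_locL1 cn).2.
    by move=> x; rewrite ler_wpM2r// ler_norm.
  apply: ler_wpM2l; first exact: mulr_ge0.
  have hi := intg_norm (hw.2 (`|M| + 1)).
  apply: le_trans (_ : \int[mu]_x (`|mol (fun x => `|w x * \1_(cube (`|M| + 1)) x|) e x| * \1_(cube `|M|) x) <= _).
    apply: le_Int => //.
      have cn : continuous (fun x => `|mol (fun x => `|w x * \1_(cube (`|M| + 1)) x|) e x|).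
        move=> x; apply: (@continuous_comp _ _ _ _ (@Num.norm R R)); last exact: norm_continuous.
        exact: (mol_continuous e0' (intg_locL1 hi)).
      exact: (continuous_locL1 cn).2.
    move=> x; have [xM|xM] := lerP `|x| `|M|; last by rewrite indic_cube_out// !mulr0.
    rewrite ler_wpM2r//; apply: le_trans (ler_norm _); rewrite le_eqVlt; apply/orP; left; apply/eqP.
    apply: eq_mol => // y yx; rewrite indic_cube_in ?mulr1//.
    by have := lerB_dist y x; lra.
  apply: le_trans (Int_norm_mol_le `|M| e0 hi) _; apply: le_Int; [exact: intg_norm|by []|].
  by move=> x; rewrite normr_id.
have cs : continuous s := Ck_cont (ks 0%N).
have cns : continuous (fun x => `|s x|).
  by move=> x; apply: (@continuous_comp _ _ _ s (@Num.norm R R)); [exact: cs|exact: norm_continuous].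
have iA i : Cc (fun x => partial i U x * partial i chi x).
  by apply: CcMl => //; exact: Ck_cont (Ck_partial i kU).
have iN i : Cc (fun x => `|s x| * (F i x * partial i chi x)).
  by apply: CcMl => //; apply: CcMl.
have iS i : Cc (fun x => `|s x| * partial i (partial i chi) x) by apply: CcMl.
have step i : - (\int[mu]_x (`|s x| * partial i (partial i chi) x)) - e * Y i +
    \int[mu]_x (`|s x| * (F i x * partial i chi x)) - e * Z <=
   \int[mu]_x ((partial i (conv (pairing w) (moll e)) x + conv (pairing (fun x => w x * F i x)) (moll e) x) * partial i psi x).
  have ib : continuous (fun x => partial i (conv (pairing w) (moll e)) x + conv (pairing (fun x => w x * F i x)) (moll e) x).
    have := Ck_mol 1 e0' (lwF i); have := Ck_mol 2 e0' hw; rewrite mol.unlock => h1 h2.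
    exact: (Ck_cont (CkD (CkW (Ck_partial i h1)) (CkW h2))).
  have g1 : \int[mu]_x (partial i U x * partial i chi x + `|s x| * (F i x * partial i chi x) + (- e) * (Err x * \1_(cube `|M|) x)) <=
     \int[mu]_x ((partial i (conv (pairing w) (moll e)) x + conv (pairing (fun x => w x * F i x)) (moll e) x) * partial i psi x).
    apply: le_Int.
    - by apply: intgD; [apply: intgD; exact: Cc_intg|exact: intgZ].
    - by apply: Cc_intg; apply: CcMl; [exact: ib|exact: Cc_partial].
    - move=> x; have -> : partial i (conv (pairing w) (moll e)) x = partial i s x by rewrite /s mol.unlock.
      have -> : conv (pairing (fun x => w x * F i x)) (moll e) x = mol (fun x => w x * F i x) e x by rewrite mol.unlock.
      have [xM|xM] := lerP `|x| `|M|; last first.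
        rewrite hM'// indic_cube_out// !mulr0 addr0 addr0 ppsi hM'// mulr0 addr0.
        by rewrite hM ?mulr0//; apply: le_lt_trans xM.
      rewrite indic_cube_in// mulr1 ppsi pUE.
      set r := mol (fun x => w x * F i x) e x - F i x * s x.
      have rL : `|r| <= L * e * m x.
        apply: commutator_mol => // y yx.
        have yM : `|y| <= `|M| + 1 by have := lerB_dist y x; lra.
        by apply: le_trans (hL i y x yM _) _; [lra|rewrite ler_wpM2l].
      have -> : mol (fun x => w x * F i x) e x = F i x * s x + r by rewrite addrCA subrr addr0.
      have Kx : `|F i x| <= K by apply: hK; lra.
      apply: le_trans _ (kato_pointwise (partial i s x) e0 (U0 x) (UE x) K0 X0 (chi0 x) (chiX x) Kx (qX i x) rL).
      rewrite lerD2l mulNr lerN2 ler_wpM2l// /Err -/c0.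
      apply: lerD; last by rewrite mulrA.
      by rewrite lerD2l exprMn mulrA; apply: ler_wpM2l => //; apply: mulr_ge0 => //; exact: sqr_ge0.
  apply: le_trans g1.
  have iAi := Cc_intg (iA i); have iNi := Cc_intg (iN i).
  rewrite (IntD (intgD iAi iNi) (intgZ _ iErr)) (IntD iAi iNi) (IntZ _ iErr).
  (* Integration by parts brings in U times the second derivative of chi, and 0 <= U - |s| <= e
     replaces U by |s|. *)
  have g2 : - (\int[mu]_x (`|s x| * partial i (partial i chi) x)) - e * Y i <= \int[mu]_x (partial i U x * partial i chi x).
    have := Int_by_parts i kU (Ck_partial i chi2) (hq i) => /(congr1 (fun a => - a)); rewrite opprK => <-.
    rewrite -opprD lerN2; have iY := intg_norm (Cc_intg (hqq i)).
    rewrite /Y -(IntZ e iY) -(IntD (Cc_intg (iS i)) (intgZ e iY)).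
    apply: le_Int; [|by apply: intgD; [exact: Cc_intg|exact: intgZ]|].
      by apply: Cc_intg; apply: CcMl => //; exact: Ck_cont kU.
    move=> x; have [_ _ h1 h2] := HU x; rewrite -/(U x) in h1 h2.
    have h3 : `|U x - `|s x| | <= e by rewrite ger0_norm; lra.
    rewrite -lerBlDl -mulrBl; apply: le_trans (ler_norm _) _.
    by rewrite normrM ler_wpM2r.
  have g3 : - e * \int[mu]_x (Err x * \1_(cube `|M|) x) >= - (e * Z).
    by rewrite mulNr lerN2 ler_wpM2l.
  apply: lerD => //; exact: lerD.
have main : \sum_(i < d) (- (\int[mu]_x (`|s x| * partial i (partial i chi) x)) - e * Y i +
    \int[mu]_x (`|s x| * (F i x * partial i chi x)) - e * Z) <= 0.
  by rewrite -[leRHS]W; apply: ler_sum.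
rewrite (@eq_Int _ _ _ (fun x => \sum_(i < d) (`|s x| * partial i (partial i chi) x - `|s x| * (F i x * partial i chi x)))); last first.
  by move=> x; rewrite /adjoint mulr_sumr; apply: eq_bigr => i _; rewrite mulrBr.
rewrite Int_sum; last by move=> i; apply: intgB; exact: Cc_intg.
rewrite -subr_ge0 opprK mulr_sumr -big_split /=.
move: main; rewrite -oppr_ge0 -sumrN => main; apply: le_trans main _.
apply: ler_sum => i _; rewrite (IntB (Cc_intg (iS i)) (Cc_intg (iN i))).
set a := \int[mu]_x _; set b := \int[mu]_x _; clear -a b; clearbody a b; move: (Y i) Z => y z; rewrite mulrDr; lra.
Qed.


(* Test the mollified equation with chi times the derivative of sqrt(s^2 + e^2),
   where e is also the mollification radius: the commutator of F with the
   mollification is O(e), and all errors are O(e). *)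
Theorem kato chi : Ck 2 chi -> Cc chi -> (forall x, 0 <= chi x) ->
  0 <= \int[mu]_x (`|w x| * adjoint F chi x).
Proof.
move=> chi2 cchi chi0; have [C C0 hC] := kato_mol chi2 cchi chi0.
have cA := Cc_adjoint cF chi2 cchi.
have [M hM] := cA.2; have [B B0 hB] := Cc_bounded cA.
apply/ler_addgt0Pr => c c0; rewrite addrC -lerBlDr sub0r.
have c4 : 0 < c / 2 / B by rewrite !divr_gt0.
have [e1 e10 he1] := mol_cvg_L1 M hw c4.
pose e := Num.min (Num.min 1 (e1 / 2)) (c / 2 / (C + 1)).
have C1 : 0 < C + 1 by rewrite ltr_wpDl.
have e0 : 0 < e by rewrite !lt_min ltr01/= !divr_gt0.
have ee1 : e <= 1 by rewrite !ge_min lexx.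
have ee2 : e < e1.
  by apply: (@le_lt_trans _ _ (e1 / 2)); [rewrite !ge_min lexx !orbT|lra].
have eC : e * C <= c / 2.
  apply: (@le_trans _ _ (c / 2 / (C + 1) * (C + 1))); last by rewrite divfK ?gt_eqF.
  apply: ler_pM => //; [exact: ltW|by rewrite !ge_min lexx !orbT|by rewrite lerDl].
have h1 := hC e e0 ee1; have h2 := he1 e e0 ee2.
have i1 : intg (fun x => `|mol w e x| * adjoint F chi x).
  by apply: locL1_Cc => //; apply: locL1_norm; apply: continuous_locL1; apply: mol_continuous => //; exact: ltW.
have i2 : intg (fun x => `|w x| * adjoint F chi x) by apply: locL1_Cc => //; exact: locL1_norm.
have i3 : intg (fun x => `|mol w e x - w x| * \1_(cube M) x).
  have l1 : locL1 (mol w e) by apply: continuous_locL1; apply: mol_continuous => //; exact: ltW.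
  have l2 := locL1_norm (locL1D l1 (locL1Z (-1) hw)).
  by apply: eq_intg (l2.2 M) => x /=; rewrite mulN1r.
have h3 : \int[mu]_x (`|mol w e x| * adjoint F chi x) - \int[mu]_x (`|w x| * adjoint F chi x) <= B * (c / 2 / B).
  rewrite -(IntB i1 i2); apply: le_trans (_ : \int[mu]_x (B * (`|mol w e x - w x| * \1_(cube M) x)) <= _).
    apply: le_Int; [exact: intgB|exact: intgZ|] => x.
    have [xM|xM] := lerP `|x| M; last by rewrite hM// indic_cube_out// !mulr0 subrr.
    rewrite indic_cube_in// mulr1 -mulrBl; apply: le_trans (ler_norm _) _.
    rewrite normrM mulrC ler_pM//; exact: ler_dist_dist.
  by rewrite (IntZ _ i3) ler_wpM2l// ltW.
move: h3; rewrite mulrC divfK ?gt_eqF//.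
move: h1 eC; move: (\int[mu]_x _) (\int[mu]_x _) (e * C) => a b y; lra.
Qed.

End kato.

(** * Barriers and solutions of mean zero *)

Section uniqueness.
Context {R : realType} {d : nat}.
Notation V := 'rV[R]_d.
Notation mu := (@lebesgue_rV R d).
Notation e_ i := (delta_mx ord0 i : V).
Implicit Types (F : 'I_d -> V -> R) (f g h u w phi psi : V -> R) (x y z v : V) (e r c s t M N L C : R) (A B : set V).

Lemma test_Ck_Cc phi : test_function phi -> (forall n, Ck n phi) /\ Cc phi.
Proof.
move=> [sphi cphi]; split; first exact: smooth_Ck.
split; first exact: (sphi [::]).1.
have [M [_ hM]] := compact_bounded cphi.
exists (Num.max M 0 + 1) => x xM; apply/eqP; apply: contraTT xM => px; rewrite -leNgt.
apply: (hM (Num.max M 0 + 1)); first by rewrite ltr_pwDr// le_max lexx.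
exact: subset_closure.
Qed.

Lemma adjointD F phi psi x : Ck 2 phi -> Ck 2 psi ->
  adjoint F (fun x => phi x + psi x) x = adjoint F phi x + adjoint F psi x.
Proof.
move=> h1 h2; rewrite /adjoint -big_split /=; apply: eq_bigr => i _.
have -> : partial i (fun x => phi x + psi x) = fun x => partial i phi x + partial i psi x.
  apply/funext => y; apply: partialE; apply: is_derive_add.
    exact: (Ck_derive i y (CkW h1)).
  exact: (Ck_derive i y (CkW h2)).
have -> : partial i (fun x => partial i phi x + partial i psi x) x =
    partial i (partial i phi) x + partial i (partial i psi) x.
  apply: partialE; apply: is_derive_add.
    exact: (Ck_derive i x (Ck_partial i h1)).
  exact: (Ck_derive i x (Ck_partial i h2)).
by ring.
Qed.

Lemma adjointZ F c phi x : Ck 2 phi -> adjoint F (fun x => c * phi x) x = c * adjoint F phi x.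
Proof.
move=> h1; rewrite /adjoint mulr_sumr; apply: eq_bigr => i _.
have -> : partial i (fun x => c * phi x) = fun x => c * partial i phi x.
  by apply/funext => y; apply: partialE; apply: is_derive_scale; exact: (Ck_derive i y (CkW h1)).
have -> : partial i (fun x => c * partial i phi x) x = c * partial i (partial i phi) x.
  by apply: partialE; apply: is_derive_scale; exact: (Ck_derive i x (Ck_partial i h1)).
by ring.
Qed.

Lemma fp_pairingP u F : locL1 u -> (forall i, continuous (F i)) ->
  fp_functional (pairing u) (fun i => pairing (fun x => u x * F i x)) <->
  forall phi, test_function phi -> \int[mu]_x (u x * adjoint F phi x) = 0.
Proof.
move=> hu cF.
have huF i : locL1 (fun x => u x * F i x) by exact: locL1M.
have E phi : test_function phi -> \int[mu]_x (u x * adjoint F phi x) =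
    pairing u (laplacian phi) - \sum_(i < d) pairing (fun x => u x * F i x) (partial i phi).
  move=> /test_Ck_Cc[kp cp].
  have cp1 i : Cc (partial i phi) by apply: Cc_partial.
  have cl : Cc (laplacian phi).
    by apply: Cc_sum => i; apply: Cc_partial => //; apply: Ck_partial.
  have i1 : intg (fun x => u x * laplacian phi x) by exact: locL1_Cc.
  have i2 i : intg (fun x => u x * F i x * partial i phi x) by exact: locL1_Cc.
  rewrite /pairing -Int_sum// -IntB//; last exact: intg_sum.
  apply: eq_Int => x; rewrite /adjoint sumrB mulrBr; congr (_ - _).
  by rewrite mulr_sumr; apply: eq_bigr => i _; rewrite mulrA.
split=> [[_ _ h] phi tp|h].
  by rewrite E// h// subrr.
split; [exact: locfun_pairing|by move=> i; exact: locfun_pairing|] => phi tp.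
by apply/eqP; rewrite -subr_eq0 -E// h.
Qed.

Lemma flat_bound n : exists2 K, 0 <= K & forall s : R, s <= 1 -> 0 <= flat n s <= K.
Proof.
exists (n.+2%:R ^+ n.+2); first exact: exprn_ge0.
move=> s s1; rewrite flat_ge0/=; have [s0|s0] := lerP s 0; first by rewrite flat_le0// exprn_ge0.
apply: le_trans (flat_sqr n s) _; rewrite ler_piMr ?exprn_ge0//.
by rewrite expr2; have := ler_pM (ltW s0) (ltW s0) s1 s1; rewrite mulr1.
Qed.

(* A cutoff at scale r^(-1/2). Its adjoint image has a nonpositive limit because
   the radial part of F grows at most quadratically. *)
Definition barrier r x : R := flat 0 (1 - r * nsq x).

Lemma is_derive_flat_nsq n r x i : is_derive x (e_ i) (fun x => flat n (1 - r * nsq x))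
  ((flat n.+2 (1 - r * nsq x) - n%:R * flat n.+1 (1 - r * nsq x)) * (- (2 * r * x ord0 i))).
Proof.
apply: (@is_derive_chain _ _ (fun x => 1 - r * nsq x) x (e_ i) _ (flat n)).
  exact: is_derive_flat.
have D := is_derive_add (is_derive_cst (1 : R) x (e_ i)) (is_derive_scale (- r) (is_derive_nsq x i)).
have -> : (fun x => 1 - r * nsq x) = (fun x => 1 + - r * nsq x) by apply/funext => y; rewrite mulNr.
by apply: is_derive_eq D _; ring.
Qed.

Lemma Ck_flat_nsq k n r : Ck k (fun x => flat n (1 - r * nsq x)).
Proof.
elim: k n => [|k ih] n.
  split => //; have cn : continuous (fun x : V => 1 - r * nsq x).
    exact: (Ck_cont (CkD (Ck_cst 0 1) (CkN (CkZ r (Ck_nsq 0))))).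
  by move=> x; apply: (@continuous_comp _ _ _ (fun x : V => 1 - r * nsq x) (@flat R n)); [exact: cn|exact: continuous_flat].
apply: (Ck_of_derive _ (fun i x => is_derive_flat_nsq n r x i)).
  exact: Ck_cont (ih n).
move=> i; apply: CkM; first by apply: CkD; [exact: ih|apply: CkN; apply: CkZ; exact: ih].
by apply: CkN; apply: CkZ; exact: Ck_coord.
Qed.

Lemma Cc_barrier r : 0 < r -> Cc (barrier r).
Proof.
move=> r0; apply: (@CcP _ _ _ (1 + r^-1)); first exact: Ck_cont (Ck_flat_nsq 0 0 r).
move=> x xr; rewrite /barrier flat_le0// subr_le0 mulrC -ler_pdivrMr// mul1r.
have ri : 0 < r^-1 by rewrite invr_gt0.
have := norm_sqr_le x; move: (r^-1) (nsq x) (`|x|) xr ri => a b c; nra.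
Qed.

Lemma barrier_adjoint F r x : adjoint F (barrier r) x =
  (flat 4 (1 - r * nsq x) - 2 * flat 3 (1 - r * nsq x)) * (4 * r ^+ 2 * nsq x)
  + 2 * r * flat 2 (1 - r * nsq x) * (radial F x - d%:R).
Proof.
have p1 i : partial i (barrier r) = fun x => flat 2 (1 - r * nsq x) * (- (2 * r * x ord0 i)).
  apply/funext => y; rewrite (partialE (is_derive_flat_nsq 0 r y i)).
  by rewrite mul0r subr0.
have p2 i : partial i (partial i (barrier r)) x = (flat 4 (1 - r * nsq x) - 2 * flat 3 (1 - r * nsq x)) * (4 * r ^+ 2 * (x ord0 i * x ord0 i)) - 2 * r * flat 2 (1 - r * nsq x).
  rewrite p1; apply: partialE.
  have D := is_derive_mul (is_derive_flat_nsq 2 r x i) (is_derive_scale (- (2 * r)) (is_derive_coord x i i)).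
  rewrite eqxx (_ : true%:R = 1 :> R)// in D.
  have -> : (fun x => flat 2 (1 - r * nsq x) * (- (2 * r * x ord0 i))) = (fun x => flat 2 (1 - r * nsq x) * (- (2 * r) * x ord0 i)).
    by apply/funext => y; rewrite mulNr.
  apply: is_derive_eq D _.
  move: (flat 2 _) (flat 4 _) (flat 3 _) (x ord0 i) => f2 f4 f3 t; ring.
rewrite /adjoint (eq_bigr (fun i => (flat 4 (1 - r * nsq x) - 2 * flat 3 (1 - r * nsq x)) * (4 * r ^+ 2) * (x ord0 i * x ord0 i) + 2 * r * flat 2 (1 - r * nsq x) * (x ord0 i * F i x) - 2 * r * flat 2 (1 - r * nsq x))); last first.
  move=> i _; rewrite p2 p1 /=.
  set q := 1 - r * nsq x; clearbody q.
  move: (flat 2 q) (flat 4 q) (flat 3 q) (x ord0 i) (F i x) => f2 f4 f3 t a; ring.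
rewrite sumrB big_split /= -!mulr_sumr sumr_const card_ord -/(radial F x) -/(dotp x x) -/(nsq x) -mulr_natr.
move: (flat 2 (1 - r * nsq x)) (flat 4 (1 - r * nsq x)) (flat 3 (1 - r * nsq x)) (radial F x) (nsq x) => f2 f4 f3 a b; ring.
Qed.

(** The barrier vanishes where r |x|^2 >= 1, and elsewhere r (1 + |x|^2) <= 2. The minimum with 2
    gives an integrable majorant against |w|, while r (1 + |x|^2) tends to 0 at each point. *)
Lemma barrier_adjoint_le F (a : R) : 0 <= a -> (forall x, radial F x <= a * (1 + nsq x)) ->
  exists2 C, 0 <= C & forall r x, 0 < r -> r <= 1 ->
    adjoint F (barrier r) x <= C * Num.min 2 (r * (1 + nsq x)).
Proof.
move=> a0 hA; have [K4 K40 h4] := flat_bound 4; have [K3 K30 h3] := flat_bound 3.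
have [K2 K20 h2] := flat_bound 2.
exists (4 * K4 + 2 * K2 * a); first by rewrite addr_ge0// !mulr_ge0.
move=> r x r0 r1; rewrite barrier_adjoint.
have q0 := nsq_ge0 x; have rq : 0 <= r * nsq x by rewrite mulr_ge0// ltW.
have s1 : 1 - r * nsq x <= 1 by rewrite gerBl.
have C0 : 0 <= 4 * K4 + 2 * K2 * a by rewrite addr_ge0// !mulr_ge0.
have [h|h] := lerP (r * nsq x) 1; last first.
  have s0 : 1 - r * nsq x <= 0 by rewrite subr_le0 ltW.
  rewrite !flat_le0// !mulr0 subr0 !mul0r addr0.
  by apply: mulr_ge0 => //; rewrite le_min ler0n/= mulr_ge0 ?addr_ge0// ltW.
have [] := (h4 _ s1, h3 _ s1); have := h2 _ s1.
have -> : Num.min 2 (r * (1 + nsq x)) = r * (1 + nsq x).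
  by apply/min_idPr; rewrite mulrDr mulr1; lra.
move: (flat 2 (1 - r * nsq x)) (flat 4 (1 - r * nsq x)) (flat 3 (1 - r * nsq x)) (hA x) => f2 f4 f3 hx /andP[f20 f21] /andP[f40 f41] /andP[f30 f31].
have g1 : (f4 - 2 * f3) * (4 * r ^+ 2 * nsq x) <= 4 * K4 * (r * (1 + nsq x)).
  have p0 : 0 <= 4 * r ^+ 2 * nsq x by apply: mulr_ge0 => //; apply: mulr_ge0 => //; exact: sqr_ge0.
  apply: (@le_trans _ _ (K4 * (4 * r ^+ 2 * nsq x))); first by rewrite ler_wpM2r//; lra.
  rewrite (_ : 4 * r ^+ 2 * nsq x = 4 * r * (r * nsq x)); last by ring.
  rewrite (_ : 4 * K4 * _ = K4 * (4 * r * (1 + nsq x))); last by ring.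
  rewrite ler_wpM2l// ler_wpM2l ?mulr_ge0//; [exact: ltW|lra].
have g2 : 2 * r * f2 * (radial F x - d%:R) <= 2 * K2 * a * (r * (1 + nsq x)).
  have d0 : 0 <= d%:R :> R by [].
  apply: (@le_trans _ _ (2 * r * f2 * (a * (1 + nsq x)))).
    by rewrite ler_wpM2l ?mulr_ge0//; [exact: ltW|lra].
  rewrite (_ : 2 * r * f2 * _ = f2 * (2 * a * (r * (1 + nsq x)))); last by ring.
  rewrite (_ : 2 * K2 * a * _ = K2 * (2 * a * (r * (1 + nsq x)))); last by ring.
  by rewrite ler_wpM2r// !mulr_ge0// ?addr_ge0// ltW.
by rewrite [leRHS]mulrDl lerD.
Qed.


Variables (w : V -> R) (F : 'I_d -> V -> R) (a : R).
Hypotheses (iw : intg w) (iw2 : intg (fun x => w x ^+ 2)) (lF : forall i, liploc (F i)).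
Hypotheses (a0 : 0 <= a) (hA : forall x, radial F x <= a * (1 + nsq x)).
Hypothesis eqn : fp_functional (pairing w) (fun i => pairing (fun x => w x * F i x)).

Let cF i : continuous (F i).
Proof. exact: liploc_continuous. Qed.

Let lw : locL1 (fun x => `|w x|).
Proof. by apply: locL1_norm; exact: intg_locL1. Qed.

(** Dominated convergence along r = 1/(n+1); the majorant is nondecreasing in r, which covers all
    smaller r. *)
Let barrier_small c : 0 < c -> exists r0, 0 < r0 /\ forall r, 0 < r -> r < r0 ->
  \int[mu]_x (`|w x| * adjoint F (barrier r) x) <= c.
Proof.
move=> c0; have [C C0 hC] := barrier_adjoint_le a0 hA.
pose h r x := C * Num.min 2 (r * (1 + nsq x)).
have h0 r x : 0 <= r -> 0 <= h r x.
  by move=> r0; apply: mulr_ge0 => //; rewrite le_min ler0n/= mulr_ge0// ltW// nsq1_gt0.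
have mh r : measurable_fun setT (h r).
  apply: measurable_funM => //; apply: measurable_minr => //.
  apply: measurable_funM => //; apply: continuous_measurable_rV.
  exact: (Ck_cont (CkD (Ck_cst 0 1) (Ck_nsq 0))).
have hle r x : 0 <= r -> `|h r x| <= C * 2.
  by move=> r0; rewrite ger0_norm ?h0// /h ler_wpM2l// ge_min lexx.
have mw : measurable_fun setT (fun x => `|w x|) := lw.1.
have ih r : 0 <= r -> intg (fun x => `|w x| * h r x).
  move=> r0; apply: (@le_intg _ _ _ (fun x => C * 2 * `|w x|)).
  - exact: measurable_funM.
  - by move=> x; rewrite normrM normr_id mulrC ler_wpM2r// hle.
  - by apply: intgZ; exact: intg_norm.
have [|x|n x||_ H] := @Int_dct R d (fun n x => `|w x| * h n.+1%:R^-1 x) (fun=> 0) (fun x => C * 2 * `|w x|).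
- by move=> n; exact: measurable_funM.
- have cvg0 : (fun n => `|w x| * C * (1 + nsq x) * n.+1%:R^-1 : R) @ \oo --> (0 : R).
    rewrite -[X in _ --> X](mulr0 (`|w x| * C * (1 + nsq x))); apply: cvgMr; exact: cvg_harmonic.
  apply: (squeeze_cvgr _ (cvg_cst 0) cvg0); apply: nearW => n /=.
  have r0 : 0 <= n.+1%:R^-1 :> R by rewrite invr_ge0.
  apply/andP; split; first by rewrite mulr_ge0// h0.
  rewrite -!mulrA ler_wpM2l// /h ler_wpM2l// [leRHS]mulrC ge_min lexx orbT//.
- have r0 : 0 <= n.+1%:R^-1 :> R by rewrite invr_ge0.
  by rewrite normrM normr_id mulrC ler_wpM2r// hle.
- by apply: intgZ; exact: intg_norm.
rewrite Int0 in H; move/cvgrPdist_lt : H => /(_ _ c0)[N _ /(_ N (leqnn N))] /=.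
rewrite sub0r normrN => HN.
exists N.+1%:R^-1; split; first by rewrite invr_gt0.
move=> r r0 rN; have rN' := ltW rN.
have N1 : N.+1%:R^-1 <= 1 :> R by rewrite invf_le1// ler1n.
have r1 : r <= 1 by exact: le_trans rN' N1.
apply: le_trans (ltW HN); apply: le_trans (ler_norm _).
have N0 : 0 <= N.+1%:R^-1 :> R by rewrite invr_ge0.
apply: le_Int; [|exact: ih|].
  by apply: locL1_Cc => //; apply: Cc_adjoint => //; [exact: Ck_flat_nsq|exact: Cc_barrier].
move=> x; rewrite ler_wpM2l//; apply: le_trans (hC r x r0 r1) _.
rewrite /h; apply: ler_wpM2l => //; rewrite le_min ge_min lexx/= ge_min; apply/orP; right.
by apply: ler_wpM2r => //; apply: ltW; exact: nsq1_gt0.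
Qed.

(** Kato's inequality gives one sign. For the other it is applied to the barrier minus (f0 / B) chi,
    nonnegative for small r because the barrier is then at least f0 on the support of chi; the
    contribution of the barrier lies below any given positive number. *)
Let abs_eq_ge0 chi : Ck 2 chi -> Cc chi -> (forall x, 0 <= chi x) ->
  \int[mu]_x (`|w x| * adjoint F chi x) = 0.
Proof.
move=> k2 cchi chi0; apply/eqP; rewrite eq_le; apply/andP; split; last first.
  exact: (kato (intg_locL1 iw) iw2 lF eqn).
have [M hM] := cchi.2; have [B B0 hB] := Cc_bounded cchi.
pose f0 : R := flat 0 2^-1; have f00 : 0 < f0 by apply: flat0_gt0; rewrite invr_gt0.
apply/ler_addgt0Pr => c c0; rewrite add0r.
have c1 : 0 < f0 / B * c by rewrite mulr_gt0// divr_gt0.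
have [r0 [r00 hr0]] := barrier_small c1.
(* The second bound keeps r |x|^2 <= 1/2 in the Euclidean norm on the cube of radius M, outside of
   which chi vanishes. *)
pose r := Num.min (r0 / 2) (2 * (1 + d%:R * M ^+ 2))^-1.
have q0 : 0 < 2 * (1 + d%:R * M ^+ 2) by rewrite mulr_gt0// ltr_pwDl// mulr_ge0// sqr_ge0.
have rr : 0 < r by rewrite lt_min divr_gt0//= invr_gt0.
have r1 : r < r0 by apply: (@le_lt_trans _ _ (r0 / 2)); [rewrite ge_min lexx|lra].
have r2 : r * (2 * (1 + d%:R * M ^+ 2)) <= 1.
  by rewrite -ler_pdivlMr// mul1r ge_min lexx orbT.
have hr := hr0 r rr r1.
have kb : Ck 2 (barrier r) := Ck_flat_nsq 2 0 r.
have cb := Cc_barrier rr.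
pose g := fun x => barrier r x + (- (f0 / B)) * chi x.
have kg : Ck 2 g := CkD kb (CkZ (- (f0 / B)) k2).
have cg : Cc g := CcD cb (CcZ (- (f0 / B)) cchi).
have g0 x : 0 <= g x.
  rewrite /g mulNr subr_ge0; have [xM|xM] := lerP `|x| M; last by rewrite hM// mulr0 flat_ge0.
  apply: (@le_trans _ _ f0).
    rewrite -mulrA ler_piMr ?(ltW f00)// mulrC ler_pdivrMr// mul1r.
    by apply: le_trans (ler_norm _) _; exact: hB.
  have hn : r * nsq x <= 2^-1.
    have h1 : nsq x <= d%:R * M ^+ 2.
      apply: le_trans (nsq_le x) _; rewrite ler_wpM2l// lerXn2r// nnegrE//.
      exact: le_trans xM.
    have := ler_wpM2l (ltW rr) h1; move: r2; rewrite mulrCA mulrDr mulr1.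
    by move: (r * (d%:R * M ^+ 2)) (r * nsq x) rr => p q; lra.
  have flat_mono (p q : R) : 0 < p -> p <= q -> flat 0 p <= flat 0 q.
    move=> p0 pq; rewrite /flat p0 (lt_le_trans p0 pq) !expr0 !mul1r ler_expR lerN2.
    by rewrite lef_pV2// posrE// (lt_le_trans p0 pq).
  by apply: flat_mono; [rewrite invr_gt0|lra].
have := kato (intg_locL1 iw) iw2 lF eqn kg cg g0.
have -> : \int[mu]_x (`|w x| * adjoint F g x) = \int[mu]_x (`|w x| * adjoint F (barrier r) x) +
   (- (f0 / B)) * \int[mu]_x (`|w x| * adjoint F chi x).
  have j1 : intg (fun x => `|w x| * adjoint F (barrier r) x).
    by apply: locL1_Cc => //; exact: Cc_adjoint.
  have j2 : intg (fun x => `|w x| * adjoint F chi x).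
    by apply: locL1_Cc => //; exact: Cc_adjoint.
  rewrite -(IntZ _ j2) -(IntD j1 (intgZ _ j2)); apply: eq_Int => x.
  rewrite (adjointD F x kb (CkZ (- (f0 / B)) k2)) (adjointZ F (- (f0 / B)) x k2).
  by rewrite mulrDr [X in _ + X]mulrCA.
rewrite mulNr subr_ge0 => h.
by have := le_trans h hr; rewrite ler_pM2l// divr_gt0.
Qed.

(* By Kato and the barriers |w| is again a solution, hence so is |w| + w >= 0,
   to which the positivity dichotomy applies. *)
Theorem mean_zero_solution : \int[mu]_x w x = 0 -> {ae mu, forall x, w x = 0}.
Proof.
move=> w0; have hw := intg_locL1 iw.
have eqn' : forall phi, test_function phi -> \int[mu]_x (`|w x| * adjoint F phi x) = 0.
  move=> phi /test_Ck_Cc[kp cp]; have [M hM] := cp.2; have [B B0 hB] := Cc_bounded cp.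
  (* A signed [phi] is the difference of phi + B th and B th, both nonnegative. *)
  have [th [kth th01 th1 th0]] := @smooth_cutoff R d M.
  have cth : Cc th by apply: (@CcP _ _ _ (M + 3)) => //; exact: Ck_cont (kth 0%N).
  have i1 f : Ck 2 f -> Cc f -> intg (fun x => `|w x| * adjoint F f x).
    by move=> *; apply: locL1_Cc => //; exact: Cc_adjoint.
  have kB := CkZ B (kth 2%N); have cB := CcZ B cth.
  have e1 : \int[mu]_x (`|w x| * adjoint F (fun x => phi x + B * th x) x) =
      \int[mu]_x (`|w x| * adjoint F phi x) + \int[mu]_x (`|w x| * adjoint F (fun x => B * th x) x).
    rewrite -(IntD (i1 _ (kp 2%N) cp) (i1 _ kB cB)); apply: eq_Int => x.
    by rewrite (adjointD F x (kp 2%N) kB) mulrDr.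
  rewrite (abs_eq_ge0 (CkD (kp 2%N) kB) (CcD cp cB)) in e1; last first.
    move=> x; have [xM|xM] := lerP `|x| M.
      by rewrite th1// mulr1; have := hB x; rewrite ler_norml => /andP[]; lra.
    by rewrite hM// add0r mulr_ge0//; [exact: ltW|case/andP: (th01 x)].
  rewrite (abs_eq_ge0 kB cB) ?addr0 in e1; last first.
    by move=> x; rewrite mulr_ge0//; [exact: ltW|case/andP: (th01 x)].
  by rewrite -e1.
have eqw := (fp_pairingP hw cF).1 eqn.
pose u x := `|w x| + w x.
have hu : locL1 u by exact: locL1D.
have u0 x : 0 <= u x by rewrite /u; have := lerNnormlW (lexx `|w x|); lra.
have eqnu : fp_functional (pairing u) (fun i => pairing (fun x => u x * F i x)).
  apply/(fp_pairingP hu cF) => phi tp; have [kp cp] := test_Ck_Cc tp.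
  have cA := Cc_adjoint cF (kp 2%N) cp.
  rewrite -[RHS](addr0 0) -{1}(eqn' phi tp) -(eqw phi tp).
  by rewrite -IntD; [apply: eq_Int => x; rewrite mulrDl|exact: locL1_Cc|exact: locL1_Cc].
have mw := intg_meas iw; have mnw := intg_meas (intg_norm iw).
have done_ : \int[mu]_x `|w x| = 0 -> {ae mu, forall x, w x = 0}.
  move=> h; have := Int_eq0_ae (intg_norm iw) (fun x => normr_ge0 (w x)) h.
  by apply: filterS => x /eqP; rewrite normr_eq0 => /eqP.
(* If u = 0 then |w| = - w, and if u > 0 then |w| = w; in both cases |w| has integral 0. *)
have [h|h] := solution_positive hu u0 cF eqnu; apply: done_.
  rewrite (@eq_Int_ae _ _ _ (fun x => - w x)) ?IntN ?w0 ?oppr0//.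
    exact: measurableT_comp.
  by apply: filterS h => x /eqP; rewrite addr_eq0 => /eqP.
rewrite (@eq_Int_ae _ _ _ w)//; apply: filterS h => x; rewrite /u.
by have [//|x0] := ger0P (w x); rewrite addNr ltxx.
Qed.

End uniqueness.

(** * Positive functionals from maximal cones *)

Section positive_functional.
Context {R : realType} {T : Type}.
Implicit Types (f g : T -> R) (C P : set (T -> R)).

Definition convex_cone C := (forall f g, C f -> C g -> C (fun x => f x + g x)) /\
  (forall t f, 0 <= t -> C f -> C (fun x => t * f x)).

(* Zorn; for f outside a maximal cone C, the cone generated by C and f contains 1. *)
Lemma maximal_cone P : convex_cone P -> P (fun=> 0) -> ~ P (fun=> 1) -> exists C,
  [/\ convex_cone C, P `<=` C, ~ C (fun=> 1) &
   forall f, ~ C f -> exists2 e, 0 < e & C (fun x => e - f x)].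
Proof.
move=> [PD PZ] P0 P1; pose good C := convex_cone C /\ ~ C (fun=> 1).
(* Taking the union with [P] makes the chain condition hold for the empty chain as well. *)
have [A [[[CD CZ] C1] maxA]] : exists A, good (A `|` P) /\ forall B, A `<` B -> ~ good (B `|` P).
  apply: (@Zorn_bigcup _ (fun X => good (X `|` P))) => F FQ Ftot.
  split; last by move=> [[X FX X1]|//]; apply: (FQ X FX).2; left.
  split=> [f g|t f t0].
    have key X : F X -> (X `|` P) f -> (X `|` P) g ->
        (\bigcup_(X in F) X `|` P) (fun x => f x + g x).
      by move=> FX fX gX; have [h|h] := (FQ X FX).1.1 f g fX gX; [left; exists X|right].
    move=> [[X FX Xf]|Pf] [[Y FY Yg]|Pg].
    - have [XY|YX] := Ftot X Y FX FY.
        by apply: (key Y FY); left => //; exact: XY.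
      by apply: (key X FX); left => //; exact: YX.
    - by apply: (key X FX); [left|right].
    - by apply: (key Y FY); [right|left].
    - by right; exact: PD.
  move=> [[X FX Xf]|Pf]; last by right; exact: PZ.
  by have [h|h] := (FQ X FX).1.2 t f t0 (or_introl Xf); [left; exists X|right].
exists (A `|` P); split; [by split|by move=> f; right|exact: C1|].
move=> f Cf; pose C := A `|` P.
pose B := [set h | exists g t, [/\ C g, 0 <= t & h = fun x => g x + t * f x]].
have CB : C `<=` B.
  by move=> g Cg; exists g, 0; split => //; apply/funext => x; rewrite mul0r addr0.
have AB : A `<` B.
  split; first by move=> g Ag; apply: CB; left.
  move=> /(_ f) h; apply: Cf; left; apply: h.
  exists (fun=> 0), 1; split => //; first by right.
  by apply/funext => x; rewrite mul1r add0r.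
have BP : B `|` P = B by apply/setUidPl => g Pg; apply: CB; right.
have coneB : convex_cone B.
  split=> [_ _ [g [t [Cg t0 ->]]] [h [s [Ch s0 ->]]]|s _ s0 [g [t [Cg t0 ->]]]].
    exists (fun x => g x + h x), (t + s); split; [exact: CD|exact: addr_ge0|].
    by apply/funext => x; rewrite mulrDl addrACA.
  exists (fun x => s * g x), (s * t); split; [exact: CZ|exact: mulr_ge0|].
  by apply/funext => x; rewrite mulrDr mulrA.
(* By maximality the enlarged cone contains 1 = g + t f. Here t > 0 since 1 is not in C, and so 1/t
   - f = g / t belongs to C. *)
have : B (fun=> 1).
  by apply: contrapT => B1; apply: (maxA _ AB); rewrite BP.
move=> [g [t [Cg t0 gE]]].
have {}t0 : 0 < t.
  rewrite lt0r t0 andbT; apply/eqP => tE; apply: C1; rewrite gE tE.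
  by rewrite (_ : (fun x => g x + 0 * f x) = g)//; apply/funext => x; rewrite mul0r addr0.
exists t^-1; first by rewrite invr_gt0.
have := CZ t^-1 g; rewrite invr_ge0 ltW// => /(_ isT Cg).
rewrite (_ : (fun x => t^-1 * g x) = fun x => t^-1 - f x)//; apply/funext => x.
have := congr1 (fun h => h x) gE => /= /esym /(canRL (addrK _)) ->.
by rewrite mulrBr mulr1 mulrA mulVf ?gt_eqF// mul1r.
Qed.

Definition bnd f := exists M : R, forall x, `|f x| <= M.

Lemma positive_functional P : convex_cone P -> (forall f, (forall x, f x <= 0) -> P f) ->
  ~ P (fun=> 1) -> exists L : (T -> R) -> R,
  [/\ forall a f g, bnd f -> bnd g -> L (fun x => a * f x + g x) = a * L f + L g,
     forall f, bnd f -> (forall x, 0 <= f x) -> 0 <= L f, L (fun=> 1) = 1 &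
     forall f, bnd f -> P f -> L f <= 0].
Proof.
move=> cP Pn P1; have P0 : P (fun=> 0) by apply: Pn.
have [C [[CD CZ] PC C1 Cmax]] := maximal_cone cP P0 P1.
have Cn f : (forall x, f x <= 0) -> C f by move=> h; apply: PC; exact: Pn.
have Cle f g : (forall x, f x <= g x) -> C g -> C f.
  move=> fg Cg; have h : C (fun x => f x - g x) by apply: Cn => x; rewrite subr_le0.
  by have := CD _ _ h Cg; rewrite (_ : (fun x => _) = f)//; apply/funext => x; rewrite subrK.
have Cpos c : 0 < c -> ~ C (fun=> c).
  move=> c0 Cc_; apply: C1; have := CZ c^-1 _ _ Cc_; rewrite invr_ge0 ltW// => /(_ isT).
  by rewrite (_ : (fun x => _) = fun=> 1)//; apply/funext => x; rewrite mulVf ?gt_eqF.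
pose S f := [set c : R | C (fun x => f x - c)].
have Sup f c c' : S f c -> c <= c' -> S f c'.
  by move=> h cc; apply: Cle h => x; rewrite lerD2l lerN2.
have Slb f B : (forall x, `|f x| <= B) -> lbound (S f) (- B).
  move=> hB c Sc; rewrite leNgt; apply/negP => cB; apply: (Cpos (- B - c)); first by rewrite subr_gt0.
  by apply: Cle Sc => x; rewrite lerD2r; have := hB x; rewrite ler_norml => /andP[].
have Sne f B : (forall x, `|f x| <= B) -> S f B.
  by move=> hB; apply: Cn => x; rewrite subr_le0 (le_trans (ler_norm _)).
have Sinf f : bnd f -> has_inf (S f).
  by move=> [B hB]; split; [exists B; exact: Sne|exists (- B); exact: Slb].
pose L f := inf (S f).
have Lle f c : bnd f -> S f c -> L f <= c by move=> /Sinf[_ h] Sc; exact: ge_inf.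
have Lgt f c : bnd f -> L f < c -> S f c.
  move=> bf Lc; have d0 : 0 < c - L f by rewrite subr_gt0.
  have [c' Sc' c'c] := inf_adherent d0 (Sinf f bf).
  by apply: Sup Sc' _; apply: ltW; rewrite addrCA subrr addr0 in c'c.
have bD f g : bnd f -> bnd g -> bnd (fun x => f x + g x).
  move=> [B hB] [D hD]; exists (B + D) => x.
  by apply: le_trans (ler_normD _ _) _; exact: lerD.
have bZ a f : bnd f -> bnd (fun x => a * f x).
  by move=> [B hB]; exists (`|a| * B) => x; rewrite normrM ler_wpM2l.
have LD_le f g : bnd f -> bnd g -> L (fun x => f x + g x) <= L f + L g.
  move=> bf bg; apply/ler_addgt0Pr => e e0; have e2 : 0 < e / 2 by rewrite divr_gt0.
  have h1 : S f (L f + e / 2) by apply: Lgt => //; rewrite ltrDl.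
  have h2 : S g (L g + e / 2) by apply: Lgt => //; rewrite ltrDl.
  apply: Lle; first exact: bD.
  by apply: Cle (CD _ _ h1 h2) => x; lra.
have LZ_le t f : 0 < t -> bnd f -> L (fun x => t * f x) <= t * L f.
  move=> t0 bf; apply/ler_addgt0Pr => e e0.
  have h1 : S f (L f + e / t) by apply: Lgt => //; rewrite ltrDl divr_gt0.
  apply: Lle; first exact: bZ.
  apply: Cle (CZ t _ (ltW t0) h1) => x; rewrite mulrBr lerD2l lerN2.
  by rewrite mulrDr mulrCA divff ?gt_eqF// mulr1.
have bN f : bnd f -> bnd (fun x => - f x) by move=> [B hB]; exists B => x; rewrite normrN.
have L0 : L (fun=> 0) = 0.
  have b0 : bnd (fun=> 0) by exists 0 => x; rewrite normr0.
  apply/eqP; rewrite eq_le; apply/andP; split.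
    by apply: Lle => //; apply: Cn => x; rewrite subrr.
  have h : lbound (S (fun=> 0)) (- 0) by apply: Slb => x; rewrite normr0.
  by rewrite oppr0 in h; apply: lb_le_inf => //; exists 0; apply: Cn => x; rewrite subrr.
have LN f : bnd f -> L (fun x => - f x) = - L f.
  move=> bf; apply/eqP; rewrite eq_le; apply/andP; split.
    apply/ler_addgt0Pr => e e0.
    (* As f - (L f - e) is outside C, maximality puts its negative plus a positive constant in C,
       hence also the smaller negative itself. *)
    have nS : ~ S f (L f - e) by move=> /(Lle _ _ bf); rewrite leNgt ltrBlDr ltrDl e0.
    have [c c0 Cc_] := Cmax _ nS; apply: Lle; first exact: bN.
    by apply: Cle Cc_ => x; lra.
  have e0 : (fun x => f x + - f x) = fun=> 0 by apply/funext => x; rewrite subrr.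
  by have /= := LD_le _ _ bf (bN f bf); rewrite e0 L0 -lerBlDl sub0r.
have LD f g : bnd f -> bnd g -> L (fun x => f x + g x) = L f + L g.
  move=> bf bg; apply/eqP; rewrite eq_le LD_le//=.
  have /= := LD_le _ _ (bN _ bf) (bN _ bg); rewrite (LN f bf) (LN g bg).
  have -> : (fun x => - f x - g x) = fun x => - (f x + g x) by apply/funext => x; rewrite opprD.
  by rewrite (LN _ (bD _ _ bf bg)) -opprD lerN2.
have LZp t f : 0 < t -> bnd f -> L (fun x => t * f x) = t * L f.
  move=> t0 bf; apply/eqP; rewrite eq_le LZ_le//=.
  have /= := LZ_le _ _ t0 (bN _ bf); rewrite (LN f bf).
  have -> : (fun x => t * - f x) = fun x => - (t * f x) by apply/funext => x; rewrite mulrN.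
  by rewrite (LN _ (bZ t _ bf)) mulrN lerN2.
have LZ t f : bnd f -> L (fun x => t * f x) = t * L f.
  move=> bf; have [t0|t0|<-] := ltgtP 0 t; first exact: LZp.
    have Nt : 0 < - t by rewrite oppr_gt0.
    have := LN _ (bZ t _ bf); have -> : (fun x => - (t * f x)) = fun x => (- t) * f x.
      by apply/funext => x; rewrite mulNr.
    by rewrite (LZp _ f Nt bf) mulNr => /oppr_inj.
  by rewrite (_ : (fun x => _) = fun=> 0) ?L0 ?mul0r//; apply/funext => x; rewrite mul0r.
exists L; split.
- by move=> a f g bf bg; rewrite LD ?LZ//; exact: bZ.
- move=> f bf f0; have := Lle _ 0 (bN _ bf); rewrite LN// oppr_le0; apply.
  by apply: Cn => x; rewrite subr0 oppr_le0.
- have b1 : bnd (fun=> 1) by exists 1 => x; rewrite normr1.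
  apply/eqP; rewrite eq_le Lle//=; last by apply: Cn => x; rewrite subrr.
  have := Lle _ (- 1) (bN _ b1); rewrite LN// lerN2; apply.
  by apply: Cn => x; rewrite opprK addNr.
- move=> f bf Pf; apply: Lle => //; apply: PC.
  by rewrite (_ : (fun x => _) = f)//; apply/funext => x; rewrite subr0.
Qed.

End positive_functional.

(** * Lyapunov functions and the invariant functional *)

Section invariant_functional.
Context {R : realType} {d : nat}.
Notation V := 'rV[R]_d.
Notation mu := (@lebesgue_rV R d).
Notation e_ i := (delta_mx ord0 i : V).
Implicit Types (F : 'I_d -> V -> R) (f g h u w phi psi : V -> R) (x y z v : V) (e r c s t M N L C : R) (A B : set V).

Lemma is_derive_pow n f x v l : is_derive x v f l ->
  is_derive x v (fun y => f y ^+ n.+1) (n.+1%:R * f x ^+ n * l).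
Proof.
move=> df; elim: n => [|n ih].
  by rewrite expr0 mulr1 mul1r; under eq_fun do rewrite expr1.
have D := is_derive_mul df ih.
have -> : (fun y => f y ^+ n.+2) = (fun y => f y * f y ^+ n.+1) by apply/funext => y; rewrite exprS.
apply: is_derive_eq D _; rewrite -[n.+2%:R]natr1 !exprS; move: (n.+1%:R) (f x ^+ n) (f x) => a b c; ring.
Qed.

Lemma Ck_pow k n f : Ck k f -> Ck k (fun x => f x ^+ n).
Proof.
move=> hf; elim: n => [|n ih]; first by under eq_fun do rewrite expr0; exact: Ck_cst.
by under eq_fun do rewrite exprS; exact: CkM.
Qed.

Definition weight (n : nat) x : R := (1 + nsq x) ^+ n.

Lemma Ck_weight k n : Ck k (weight n).
Proof. by apply: Ck_pow; apply: CkD; [exact: Ck_cst|exact: Ck_nsq]. Qed.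

Lemma weight_gt0 n x : 0 < weight n x.
Proof. by rewrite exprn_gt0// nsq1_gt0. Qed.

Lemma weight_ge1 n x : 1 <= weight n x.
Proof. by rewrite exprn_ege1// lerDl nsq_ge0. Qed.

Lemma partial_weight n i x : partial i (weight n.+1) x = 2 * n.+1%:R * (weight n x * x ord0 i).
Proof.
have D := is_derive_pow n (is_derive_add (is_derive_cst (1 : R) x (e_ i)) (is_derive_nsq x i)).
rewrite (partialE D) /weight add0r; move: ((1 + nsq x) ^+ n) (x ord0 i) (n.+1%:R) => a b c; ring.
Qed.

Lemma adjoint_weight F n x : adjoint F (weight n.+2) x =
  2 * n.+2%:R * (weight n.+1 x * (d%:R - radial F x) + 2 * n.+1%:R * (weight n x * nsq x)).
Proof.
have p2 i : partial i (partial i (weight n.+2)) x = 2 * n.+2%:R * (weight n.+1 x + 2 * n.+1%:R * (weight n x * (x ord0 i * x ord0 i))).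
  have -> : partial i (weight n.+2) = fun x => 2 * n.+2%:R * (weight n.+1 x * x ord0 i).
    by apply/funext => y; exact: partial_weight.
  apply: partialE.
  have D := is_derive_mul (Ck_derive i x (Ck_weight 1 n.+1)) (is_derive_coord x i i).
  apply: is_derive_eq (is_derive_scale (2 * n.+2%:R) D) _.
  rewrite partial_weight eqxx (_ : true%:R = 1 :> R)//.
  by move: (weight n x) (weight n.+1 x) (x ord0 i) (n.+1%:R) (n.+2%:R) => a b c p q; ring.
rewrite /adjoint (eq_bigr (fun i => 2 * n.+2%:R * weight n.+1 x + 4 * n.+2%:R * n.+1%:R * weight n x * (x ord0 i * x ord0 i) - 2 * n.+2%:R * weight n.+1 x * (x ord0 i * F i x))); last first.
  move=> i _; rewrite p2 partial_weight.
  by move: (weight n x) (weight n.+1 x) (x ord0 i) (n.+1%:R) (n.+2%:R) (F i x) => a b c p q r; ring.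
rewrite sumrB big_split /= -!mulr_sumr sumr_const card_ord -/(radial F x) -/(dotp x x) -/(nsq x) -mulr_natr.
move: (weight n x) (weight n.+1 x) (nsq x) (n.+1%:R) (n.+2%:R) (radial F x) => a b c p q r; ring.
Qed.

(** Far out the radial part exceeds d + 2 (n+1) + 1: the first two summands cancel the second-order
    terms, and the last leaves minus [weight n.+1], multiplied by 2 (n+2) >= 1. *)
Lemma lyapunov F n : (forall i, continuous (F i)) ->
  (forall K : R, exists rho : R, forall x, rho <= `|x| -> K <= radial F x) ->
  exists2 C, 0 <= C & forall x, weight n.+1 x + adjoint F (weight n.+2) x <= C.
Proof.
move=> cF hF; have [rho hrho] := hF (d%:R + 2 * n.+1%:R + 1).
have cA : continuous (fun x => weight n.+1 x + adjoint F (weight n.+2) x).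
  apply: (@Ck_cont _ _ 0); apply: CkD; first exact: Ck_weight.
  apply: Ck_sum => i; apply: CkD.
    exact: (Ck_partial i (Ck_partial i (Ck_weight 2 n.+2))).
  by apply: CkN; apply: CkM; [exact: (conj (@cF i) I)|exact: (Ck_partial i (Ck_weight 1 n.+2))].
have [C C0 hC] := continuous_bounded_cube rho cA.
exists C; first exact: ltW.
move=> x; have [xr|xr] := lerP `|x| rho.
  by apply: le_trans (ler_norm _) _; exact: hC.
apply: le_trans (ltW C0); rewrite adjoint_weight.
have w0 := weight_gt0 n x.
have ws : weight n.+1 x = (1 + nsq x) * weight n x by rewrite /weight exprS.
have h1 : weight n x * nsq x <= weight n.+1 x by rewrite ws mulrDl mul1r mulrC lerDr ltW.
have h2 := hrho x (ltW xr).
have W0 := weight_gt0 n.+1 x.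
have h3 : weight n.+1 x * (d%:R - radial F x) <= weight n.+1 x * (- (2 * n.+1%:R + 1)).
  by rewrite ler_pM2l//; lra.
have h4 : 2 * n.+1%:R * (weight n x * nsq x) <= 2 * n.+1%:R * weight n.+1 x.
  by rewrite ler_wpM2l.
have n2 : 1 <= 2 * n.+2%:R :> R by rewrite -natrM ler1n muln_gt0.
set q := weight n.+1 x in h3 h4 W0 *.
have h5 : q * (d%:R - radial F x) + 2 * n.+1%:R * (weight n x * nsq x) <= - q.
  by apply: le_trans (lerD h3 h4) _; rewrite le_eqVlt; apply/orP; left; apply/eqP; ring.
have h6 : 2 * n.+2%:R * (q * (d%:R - radial F x) + 2 * n.+1%:R * (weight n x * nsq x)) <= 2 * n.+2%:R * - q.
  by rewrite ler_wpM2l// mulr_ge0.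
apply: le_trans (lerD (lexx q) h6) _; rewrite mulrN subr_le0; apply: ler_peMl => //; exact: ltW.
Qed.

(** Outside the support only t times [weight n] remains. Shrinking a far point to norm M + 1, where
    [phi] still vanishes, does not increase the weight, so a minimum over the compact cube is
    global. *)
Lemma global_min t n phi : 0 <= t -> continuous phi -> Cc phi -> (0 < d)%N ->
  exists x0, forall x, t * weight n x0 + phi x0 <= t * weight n x + phi x.
Proof.
move=> t0 cphi [_ [M0 hM0]] d0; pose M := Num.max M0 0.
have M00 : 0 <= M by rewrite le_max lexx orbT.
have hM x : M < `|x| -> phi x = 0 by rewrite gt_max => /andP[h _]; exact: hM0.
pose h x := t * weight n x + phi x.
have ch : continuous h := Ck_cont (CkD (CkZ t (Ck_weight 0 n)) (conj cphi I : Ck 0 phi)).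
have [|x0 x0M hx0] := @EVT_min_rV R d h (cube (M + 1)) _ (@compact_cube R d (M + 1)) (continuous_subspaceT ch).
  by exists 0; rewrite /cube /= normr0 addr_ge0.
exists x0 => x; have [xM|xM] := lerP `|x| (M + 1); first by apply: hx0; rewrite inE.
have x0' : 0 < `|x| by apply: le_lt_trans xM; rewrite addr_ge0.
pose l := (M + 1) / `|x|.
have l0 : 0 <= l by rewrite divr_ge0// addr_ge0.
have l1 : l <= 1 by rewrite ler_pdivrMr// mul1r ltW.
have ly : `|l *: x| = M + 1 by rewrite normrZ ger0_norm// divfK// gt_eqF.
apply: le_trans (hx0 (l *: x) _) _; first by rewrite inE /cube /= ly.
rewrite /h (hM (l *: x)) ?ly ?ltrDl// (hM x) ?(lt_trans _ xM) ?ltrDl// !addr0 ler_wpM2l//.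
apply: lerXn2r; [by rewrite nnegrE ltW// nsq1_gt0|by rewrite nnegrE ltW// nsq1_gt0|].
rewrite lerD2l.
have -> : nsq (l *: x) = l ^+ 2 * nsq x.
  by rewrite /nsq /dotp mulr_sumr; apply: eq_bigr => i _; rewrite mxE; ring.
by rewrite ler_piMl ?nsq_ge0// exprn_ile1.
Qed.

Lemma adjoint_min_ge0 F f x0 : (forall i, continuous (F i)) -> Ck 2 f ->
  (forall x, f x0 <= f x) -> 0 <= adjoint F f x0.
Proof.
move=> cF hf hx0; apply: sumr_ge0 => i _.
have [p0 pp0] := min_line_derivatives hx0 (fun y => Ck_derive i y (CkW hf))
  (fun y => Ck_derive i y (Ck_partial i hf)) (Ck_cont (Ck_partial i (Ck_partial i hf))).
by rewrite p0 mulr0 subr0.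
Qed.

(* The cone of the f with f + t L*V + L*phi <= 0, where L* is the adjoint and
   V = weight n.+2, does not contain 1: look at a minimum of t V + phi. *)
Theorem invariant_functional F n : (0 < d)%N -> (forall i, continuous (F i)) ->
  (forall K : R, exists rho : R, forall x, rho <= `|x| -> K <= radial F x) ->
  exists (T : (V -> R) -> R) (C : R),
  [/\ forall a f g, bnd f -> bnd g -> T (fun x => a * f x + g x) = a * T f + T g,
     forall f, bnd f -> (forall x, 0 <= f x) -> 0 <= T f, T (fun=> 1) = 1,
     forall phi, Ck 2 phi -> Cc phi -> T (adjoint F phi) = 0 &
     0 <= C /\ forall f c, 0 <= c -> bnd f -> (forall x, f x <= c * weight n.+1 x) -> T f <= c * C].
Proof.
move=> d0 cF hF; have [C C0 hC] := lyapunov n cF hF.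
pose P := [set f : V -> R | exists t phi, [/\ 0 <= t, Ck 2 phi, Cc phi &
  forall x, f x + (t * adjoint F (weight n.+2) x + adjoint F phi x) <= 0]].
have cP : convex_cone P.
  split=> [f g [t [phi [t0 k2 cc h]]] [s [psi [s0 k2' cc' h']]]|s f s0 [t [phi [t0 k2 cc h]]]].
    exists (t + s), (fun x => phi x + psi x); split; [exact: addr_ge0|exact: CkD|exact: CcD|].
    move=> x; rewrite (adjointD F x k2 k2'); apply: le_trans (_ : 0 + 0 <= _); last by rewrite addr0.
    apply: le_trans (lerD (h x) (h' x)); rewrite le_eqVlt; apply/orP; left; apply/eqP.
    by move: (f x) (g x) (adjoint F (weight n.+2) x) (adjoint F phi x) (adjoint F psi x) => *; ring.
  exists (s * t), (fun x => s * phi x); split; [exact: mulr_ge0|exact: CkZ|exact: CcZ|].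
  move=> x; rewrite (adjointZ F s x k2) -mulrA -mulrDr -mulrDr; exact: mulr_ge0_le0.
have kz k : Ck k (fun _ : V => 0 : R) by exact: Ck_cst.
have Cz : Cc (fun _ : V => 0 : R) by split; [exact: Ck_cont (kz 0%N)|exists 0].
have az x : adjoint F (fun=> 0) x = 0.
  have pz i : partial i (fun _ : V => 0 : R) = fun=> 0.
    by apply/funext => y; apply: partialE; exact: is_derive_cst.
  by rewrite /adjoint big1// => i _; rewrite !pz mulr0 subrr.
have Pn f : (forall x, f x <= 0) -> P f.
  by move=> h; exists 0, (fun=> 0); split => // x; rewrite az mul0r !addr0.
have P1 : ~ P (fun=> 1).
  move=> [t [phi [t0 k2 cc h]]]; have [x0 hx0] := global_min n.+2 t0 (Ck_cont k2) cc d0.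
  have kf : Ck 2 (fun x => t * weight n.+2 x + phi x) := CkD (CkZ t (Ck_weight 2 n.+2)) k2.
  have := adjoint_min_ge0 cF kf hx0.
  rewrite (adjointD F x0 (CkZ t (Ck_weight 2 n.+2)) k2) (adjointZ F t x0 (Ck_weight 2 n.+2)) => h0.
  by have := h x0; lra.
have [T [TL Tp T1 TP]] := positive_functional cP Pn P1.
have bC f : Cc f -> bnd f by move=> /Cc_bounded[B _ hB]; exists B.
exists T, C; split => //.
(* Both [adjoint F phi] and its negative belong to the cone. *)
- move=> phi k2 cc; have cA := bC _ (Cc_adjoint cF k2 cc).
  have h1 : T (adjoint F phi) <= 0.
    apply: TP => //; exists 0, (fun x => - 1 * phi x); split; [by []|exact: CkZ|exact: CcZ|].
    by move=> x; rewrite (adjointZ F (- 1) x k2) mul0r add0r mulN1r subrr.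
  have b0 : bnd (fun _ : V => 0 : R) by exists 0 => x; rewrite normr0.
  have T0 : T (fun=> 0) = 0.
    have /= := TL 1 (fun=> 0) (fun=> 0) b0 b0.
    have -> : (fun _ : V => 1 * 0 + 0 : R) = fun=> 0 by apply/funext => x; rewrite mul1r addr0.
    by move: (T (fun=> 0)) => q; lra.
  apply/eqP; rewrite eq_le h1/=.
  have := TL (- 1) _ _ cA b0; rewrite T0 addr0 mulN1r => e1.
  rewrite -oppr_le0 -e1; apply: TP.
    by have [B hB] := cA; exists B => x; rewrite mulN1r addr0 normrN.
  exists 0, phi; split => // x; rewrite mul0r add0r addr0 mulN1r addNr//.
(* By [lyapunov] the function f - c C belongs to the cone, with t = c and phi = 0. *)
- split => // f c c0 bf hf.
  have b1 : bnd (fun _ : V => 1 : R) by exists 1 => x; rewrite normr1.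
  have := TL (- (c * C)) _ _ b1 bf; rewrite T1 mulr1 => e1.
  rewrite -subr_le0 addrC -e1; apply: TP.
    have [B hB] := bf; exists (`|c * C| + B) => x /=; rewrite ?mulr1.
    by apply: le_trans (ler_normD _ _) _; rewrite normrN lerD2l.
  exists c, (fun=> 0); split => // x /=; rewrite az ?mulr1 addr0.
  have := ler_wpM2l c0 (hC x); rewrite mulrDr; have := hf x.
  by move: (f x) (c * weight n.+1 x) (c * adjoint F (weight n.+2) x) (c * C) => *; lra.
Qed.

End invariant_functional.

(** * Mollified densities of the invariant functional *)

Section invariant_density.
Context {R : realType} {d : nat}.
Notation V := 'rV[R]_d.
Notation mu := (@lebesgue_rV R d).
Notation e_ i := (delta_mx ord0 i : V).
Implicit Types (f g h u w phi psi : V -> R) (x y z v : V) (e r c s t N L C : R) (A B : set V).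

Lemma Cc_bnd f : Cc f -> bnd f.
Proof. by move=> /Cc_bounded[B _ hB]; exists B. Qed.

(** In Euclidean norms, |y|^2 <= 2 |x|^2 + 2 |y - x|^2, and a sup-norm distance of at most 1 gives
    |y - x|^2 <= d. *)
Lemma weight_near n x y : `|y - x| <= 1 -> weight n y <= (2 * (1 + d%:R)) ^+ n * weight n x.
Proof.
move=> yx; rewrite /weight -exprMn; apply: lerXn2r; rewrite ?nnegrE; [exact: ltW (nsq1_gt0 _)| |].
  by apply: mulr_ge0; [apply: mulr_ge0 => //; exact: addr_ge0|exact: ltW (nsq1_gt0 _)].
have h1 : nsq y <= 2 * nsq x + 2 * nsq (y - x).
  rewrite /nsq /dotp !mulr_sumr -big_split /=; apply: ler_sum => i _; rewrite !mxE.
  by have := sqr_ge0 (y ord0 i - 2 * x ord0 i); move: (y ord0 i) (x ord0 i) => a b; nra.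
have h2 : nsq (y - x) <= d%:R.
  by apply: le_trans (nsq_le _) _; rewrite ler_piMr// exprn_ile1.
have := nsq_ge0 x; have : 0 <= d%:R :> R by [].
by move: h1 h2; move: (nsq x) (nsq y) (nsq (y - x)) (d%:R) => a b c q *; nra.
Qed.

Variables (F : 'I_d -> V -> R) (n : nat) (T : (V -> R) -> R) (C : R).
Hypothesis lF : forall i, liploc (F i).
Hypothesis TL : forall a f g, bnd f -> bnd g -> T (fun x => a * f x + g x) = a * T f + T g.
Hypothesis Tp : forall f, bnd f -> (forall x, 0 <= f x) -> 0 <= T f.
Hypothesis T1 : T (fun=> 1) = 1.
Hypothesis Tadj : forall phi, Ck 2 phi -> Cc phi -> T (adjoint F phi) = 0.
Hypothesis C0 : 0 <= C.
Hypothesis Tw : forall f c, 0 <= c -> bnd f -> (forall x, f x <= c * weight n.+1 x) -> T f <= c * C.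

Let cF i : continuous (F i).
Proof. exact: liploc_continuous. Qed.

Let b1 : bnd (fun _ : V => 1 : R).
Proof. by exists 1 => x; rewrite normr1. Qed.

Let T_le f g : bnd f -> bnd g -> (forall x, f x <= g x) -> T f <= T g.
Proof.
move=> bf bg fg; rewrite -subr_ge0 -mulN1r addrC -TL//; apply: Tp.
  have [B hB] := bf; have [D hD] := bg; exists (B + D) => x.
  by apply: le_trans (ler_normD _ _) _; rewrite mulN1r normrN lerD.
by move=> x; rewrite mulN1r addrC subr_ge0.
Qed.

Let T0 : T (fun=> 0) = 0.
Proof.
have b0 : bnd (fun _ : V => 0 : R) by exists 0 => x; rewrite normr0.
have /= := TL 1 b0 b0.
have -> : (fun _ : V => 1 * 0 + 0 : R) = fun=> 0 by apply/funext => x; rewrite mul1r addr0.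
by move: (T (fun=> 0)) => q; lra.
Qed.

Let TZ a f : bnd f -> T (fun x => a * f x) = a * T f.
Proof.
move=> bf; have b0 : bnd (fun _ : V => 0 : R) by exists 0 => x; rewrite normr0.
have /= := TL a bf b0; rewrite T0 addr0 => <-; congr T; apply/funext => x.
by rewrite addr0.
Qed.

Let T_bound f K : bnd f -> (forall x, `|f x| <= K) -> `|T f| <= K.
Proof.
move=> bf hK; have TK a : T (fun=> a) = a.
  rewrite -[RHS]mulr1 -T1 -TZ//; congr T; apply/funext => x; by rewrite mulr1.
have bk a : bnd (fun _ : V => a : R) by exists `|a|.
rewrite ler_norml -{1}(TK (- K)) -{2}(TK K); apply/andP; split; apply: T_le => // x.
  by have := hK x; rewrite ler_norml => /andP[].
by have := hK x; rewrite ler_norml => /andP[].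
Qed.

(** The functional F_i T, in the role of the drift term u F_i of a density u. *)
Let S (i : 'I_d) f := T (fun x => F i x * f x).

Lemma locfun_invariant : locfun T.
Proof.
split=> [a f g cf cg|M]; first by apply: TL; exact: Cc_bnd.
by exists 1 => // f K cf _ hK; rewrite mul1r; apply: T_bound => //; exact: Cc_bnd.
Qed.

Lemma fp_invariant : fp_functional T S.
Proof.
have cFf i f : Cc f -> Cc (fun x => F i x * f x) by move=> cf; exact: CcMl.
have hS i : locfun (S i).
  split=> [a f g cf cg|M].
    rewrite /S -TL; [|exact: Cc_bnd (cFf i f cf)|exact: Cc_bnd (cFf i g cg)].
    by congr T; apply/funext => x; rewrite mulrDr mulrCA.
  have [B B0 hB] := continuous_bounded_cube M (@cF i).
  exists B; first exact: ltW.
  move=> f K cf fM hK; have K0 : 0 <= K := le_trans (normr_ge0 _) (hK 0).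
  apply: T_bound; first exact: Cc_bnd (cFf i f cf).
  move=> x; have [xM|xM] := lerP `|x| M; last by rewrite fM// mulr0 normr0 mulr_ge0// ltW.
  by rewrite normrM ler_pM// hB.
split; [exact: locfun_invariant|exact: hS|] => phi /test_Ck_Cc[kp cp].
have cp1 i : Cc (partial i phi) by apply: Cc_partial.
have cl : Cc (laplacian phi) by apply: Cc_sum => i; apply: Cc_partial => //; apply: Ck_partial.
have -> : \sum_(i < d) S i (partial i phi) = T (fun x => \sum_(i < d) F i x * partial i phi x).
  by rewrite (@locfun_sum _ _ T _ _ (fun i x => F i x * partial i phi x) locfun_invariant)// => i; exact: cFf.
have cs : Cc (fun x => \sum_(i < d) F i x * partial i phi x) by apply: Cc_sum => i; exact: cFf.
apply/eqP; rewrite -subr_eq0; apply/eqP; apply: etrans (Tadj (kp 2%N) cp).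
rewrite -(locfunB locfun_invariant cl cs); apply: (congr1 T); apply/funext => x.
by rewrite /adjoint /laplacian sumrB.
Qed.

Let density e := conv T (moll e).

Lemma Ck_density k e : 0 <= e -> Ck k (density e).
Proof. by move=> e0; apply: Ck_conv; [exact: locfun_invariant|exact: Cc_moll|move=> j; exact: Ck_moll]. Qed.

Lemma density_ge0 e x : 0 <= e -> 0 <= density e x.
Proof.
move=> e0; apply: (Tp (f := fun y => moll e (y - x))) => [|y]; last exact: moll_ge0.
by apply: Cc_bnd; exact: Cc_moll_shift.
Qed.

(** Positivity of [T] bounds the commutator by a small multiple of the density at the same point,
    and not merely by a constant; this is the form that [caccioppoli] can absorb. *)
Lemma density_commutator M : exists2 L, 0 <= L & forall e x i, 0 < e -> e <= 1 -> `|x| <= M ->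
  `|conv (S i) (moll e) x - F i x * density e x| <= L * e * density e x.
Proof.
have h i : exists L, 0 <= L /\ forall x y, `|x| <= M + 1 -> `|y| <= M + 1 -> `|F i x - F i y| <= L * `|x - y|.
  by have [L L0 hL] := lF i (M + 1); exists L.
have [L hL] := choice h; have L0 i : 0 <= L i by case: (hL i).
exists (\sum_i L i); first by apply: sumr_ge0.
move=> e x i e0 e1 xM; have e0' := ltW e0.
have cm : Cc (fun y => moll e (y - x)) by exact: Cc_moll_shift.
have bm := Cc_bnd cm; have bFm := Cc_bnd (CcMl (@cF i) cm).
have -> : conv (S i) (moll e) x - F i x * density e x = T (fun y => (- F i x) * moll e (y - x) + F i y * moll e (y - x)).
  by rewrite TL// mulNr addrC.
have hb y : `|(- F i x) * moll e (y - x) + F i y * moll e (y - x)| <= (\sum_i L i) * e * moll e (y - x).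
  rewrite -mulrDl normrM (ger0_norm (moll_ge0 _ _)); have [yx|yx] := lerP `|y - x| e; last first.
    by rewrite moll_out// !mulr0.
  rewrite ler_wpM2r ?moll_ge0// addrC; apply: le_trans ((hL i).2 y x _ _) _; [|lra|].
    by have := lerB_dist y x; lra.
  apply: ler_pM => //.
  by rewrite (bigD1 i)//= lerDl sumr_ge0.
have -> : (\sum_i L i) * e * density e x = T (fun y => (\sum_i L i) * e * moll e (y - x)) by rewrite TZ.
have bL : bnd (fun y => (\sum_i L i) * e * moll e (y - x)) by exact: Cc_bnd (CcZ _ cm).
have bc : bnd (fun y => (- F i x) * moll e (y - x) + F i y * moll e (y - x)).
  exact: Cc_bnd (CcD (CcZ _ cm) (CcMl (@cF i) cm)).
rewrite ler_norml; apply/andP; split; last first.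
  by apply: T_le => // y; apply: le_trans (hb y); exact: ler_norm.
rewrite -mulN1r -TZ//; apply: T_le => //; first exact: Cc_bnd (CcZ _ (CcZ _ cm)).
by move=> y; have := hb y; rewrite ler_norml => /andP[h1 _]; rewrite mulN1r.
Qed.

Lemma Int_density e f : 0 <= e -> Cc f -> \int[mu]_x (density e x * f x) = T (mol f e).
Proof.
move=> e0 cf; rewrite (conv_Fubini locfun_invariant (Cc_moll e0) (Cc_moll e0) _ cf); first by rewrite mol.unlock.
by move=> x; rewrite mollN.
Qed.

(** Mollifying [f] raises its bound by at most the factor of [weight_near], so the moment is uniform
    in [e]. *)
Lemma density_moment : exists2 K, 0 <= K & forall e f c, 0 < e -> e <= 1 -> 0 <= c -> Cc f ->
  (forall x, f x <= c * weight n.+1 x) -> \int[mu]_x (density e x * f x) <= c * K.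
Proof.
exists ((2 * (1 + d%:R)) ^+ n.+1 * C); first by rewrite mulr_ge0// exprn_ge0// mulr_ge0// addr_ge0.
move=> e f c e0 e1 c0 cf hf; have e0' := ltW e0.
rewrite (Int_density e0' cf) mulrA; apply: Tw.
- by rewrite mulr_ge0// exprn_ge0// mulr_ge0// addr_ge0.
- by apply: Cc_bnd; exact: Cc_mol.
- move=> x; rewrite -(mol_cst (c * (2 * (1 + d%:R)) ^+ n.+1 * weight n.+1 x) x e0).
  apply: le_mol => //.
  + exact: continuous_locL1 cf.1.
  + by apply: continuous_locL1; exact: Ck_cont (@Ck_cst R d 0 _).
  + move=> y yx; apply: le_trans (hf y) _; rewrite -mulrA ler_wpM2l// weight_near//.
    exact: le_trans e1.
Qed.

Lemma density_limit f c : Cc f -> 0 < c -> exists2 e0, 0 < e0 & forall e, 0 < e -> e < e0 ->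
  `|\int[mu]_x (density e x * f x) - T f| <= c.
Proof.
move=> cf c0; have [M hM] := cf.2.
have [e0 e00 he] := mol_cvg_unif (M + 1) cf.1 c0.
exists (Num.min e0 1); first by rewrite lt_min e00 ltr01.
move=> e ep; rewrite lt_min => /andP[ee0 e1]; have ep' := ltW ep.
have cm := Cc_mol ep' cf.
rewrite (Int_density ep' cf) -(locfunB locfun_invariant cm cf); apply: T_bound.
  have := Cc_bnd (CcD cm (CcZ (-1) cf)); have -> // : (fun x => mol f e x + -1 * f x) = fun x => mol f e x - f x.
  by apply/funext => x; rewrite mulN1r.
move=> x; have [xM|xM] := lerP `|x| (M + 1); first exact: he.
rewrite (eq_mol (v := fun=> 0)) ?mol_cst//; last first.
  by move=> y yx; rewrite hM//; have := lerB_dist x y; rewrite distrC; lra.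
by rewrite hM ?subrr ?normr0 ?ltW//; lra.
Qed.

(** Tightness: 1 minus the cutoff is at most the weight divided by M, so the moment bound limits the
    mass far away. *)
Lemma mass_bound M : 1 <= M -> 1 - C / M <= T (cutoff M 1).
Proof.
move=> M1; have M0 : 0 < M by lra.
have bc : bnd (@cutoff R d M 1) by apply: Cc_bnd; exact: Cc_cutoff.
have : T (fun x => (-1) * cutoff M 1 x + 1) <= M^-1 * C.
  apply: Tw; first by rewrite invr_ge0 ltW.
    have [B hB] := bc; exists (B + 1) => x; apply: le_trans (ler_normD _ _) _.
    by rewrite normr1 mulN1r normrN lerD2r.
  move=> x; have [xM|xM] := lerP `|x| M.
    by rewrite cutoff_in// mulr1 addNr mulr_ge0 ?invr_ge0 ?ltW// weight_gt0.
  apply: (@le_trans _ _ 1); first by have /andP[] := cutoff01 M 1 x; lra.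
  rewrite mulrC ler_pdivlMr// mul1r.
  apply: (@le_trans _ _ (1 + nsq x)).
    have := norm_sqr_le x; move: (nsq x) (`|x|) xM => p q; nra.
  by rewrite /weight exprS; apply: ler_peMr; [exact: ltW (nsq1_gt0 x)|exact: weight_ge1 n x].
by rewrite TL// T1 mulN1r mulrC; lra.
Qed.

End invariant_density.

(** * Weighted energy estimate *)

Section caccioppoli.
Context {R : realType} {d : nat}.
Notation V := 'rV[R]_d.
Notation mu := (@lebesgue_rV R d).
Notation e_ i := (delta_mx ord0 i : V).
Implicit Types (F : 'I_d -> V -> R) (f g h u w phi psi theta : V -> R) (x y z v : V) (e r c s t M N L C : R) (A B : set V).

(** Here g = u, p and q are the derivatives of u and th, r is the commutator and Fd the mollified
    drift. The term with Fd is kept for an integration by parts, as only the mollified drift has a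
    classical divergence. Replacing F by Fd there costs at most |g th| times the derivative of u th,
    since |Fd - F| <= 1. *)
Lemma caccioppoli_pointwise (p q g th F Fd r : R) : `|Fd - F| <= 1 -> `|r| <= `|g| ->
  2^-1 * (th * p + g * q) ^+ 2 + Fd * (g * th) * (th * p + g * q) + F * g ^+ 2 * (th * q)
   - (3 / 2 * (g ^+ 2 * q ^+ 2) + 5 / 2 * (g ^+ 2 * th ^+ 2)) <=
  (p + (F * g + r)) * (th ^+ 2 * p + 2 * g * th * q).
Proof.
move=> h1 h2; set k := th * p + g * q; set h := g * th; set D := Fd - F.
have r2 : r ^+ 2 <= g ^+ 2.
  by rewrite -(real_normK (num_real r)) -(real_normK (num_real g)) lerXn2r// nnegrE.
have D2 : D ^+ 2 <= 1.
  by rewrite -(real_normK (num_real D)) -[leRHS](expr1n _ 2) lerXn2r// nnegrE.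
have E1 : (p + (F * g + r)) * (th ^+ 2 * p + 2 * g * th * q) =
  k ^+ 2 - g ^+ 2 * q ^+ 2 + Fd * h * k - D * h * k + F * g ^+ 2 * (th * q) + r * th * k + (r * th) * (g * q).
  by rewrite /k /h /D; ring.
have a1 : D * h * k <= 4^-1 * k ^+ 2 + h ^+ 2.
  have := sqr_ge0 (k / 2 - D * h); have : D ^+ 2 * h ^+ 2 <= h ^+ 2 by rewrite ler_piMl// sqr_ge0.
  have -> : (k / 2 - D * h) ^+ 2 = 4^-1 * k ^+ 2 - D * h * k + D ^+ 2 * h ^+ 2 by field.
  by lra.
have rt : (r * th) ^+ 2 <= h ^+ 2 by rewrite /h !exprMn ler_wpM2r// sqr_ge0.
have a2 : - (4^-1 * k ^+ 2 + h ^+ 2) <= r * th * k.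
  have := sqr_ge0 (k / 2 + r * th).
  have -> : (k / 2 + r * th) ^+ 2 = 4^-1 * k ^+ 2 + r * th * k + (r * th) ^+ 2 by field.
  by lra.
have a3 : - (2^-1 * h ^+ 2 + 2^-1 * (g ^+ 2 * q ^+ 2)) <= (r * th) * (g * q).
  have := sqr_ge0 (r * th + g * q).
  have -> : (r * th + g * q) ^+ 2 = (r * th) ^+ 2 + 2 * ((r * th) * (g * q)) + g ^+ 2 * q ^+ 2 by ring.
  by lra.
have hh : h ^+ 2 = g ^+ 2 * th ^+ 2 by rewrite exprMn.
rewrite E1 -hh; lra.
Qed.

(** The coefficient of u^2 left after testing with u theta^2 and integrating the drift term by
    parts. The first two summands are those that (ii) balances. *)
Definition caccioppoli_weight F dl theta x : R :=
  2^-1 * (theta x ^+ 2 * \sum_(i < d) partial i (mol (F i) dl) x)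
  - theta x * (\sum_(i < d) F i x * partial i theta x)
  + 3 / 2 * (\sum_(i < d) partial i theta x ^+ 2) + 5 / 2 * (d%:R * theta x ^+ 2).

Lemma continuous_caccioppoli_weight F dl theta : (forall i, continuous (F i)) -> 0 <= dl ->
  Ck 1 theta -> continuous (caccioppoli_weight F dl theta).
Proof.
move=> cF dl0 kt; apply: (@Ck_cont _ _ 0).
have k0 : Ck 0 theta := CkW kt.
have kp i : Ck 0 (partial i theta) := Ck_partial i kt.
have t2 : Ck 0 (fun x => theta x ^+ 2) := CkM k0 k0.
have kq i : Ck 0 (fun x => partial i theta x ^+ 2) := CkM (kp i) (kp i).
have km i : Ck 0 (partial i (mol (F i) dl)) := Ck_partial i (Ck_mol 1 dl0 (continuous_locL1 (@cF i))).
have kF i : Ck 0 (F i) := conj (@cF i) I.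
apply: CkD; first apply: CkD; first apply: CkD.
- apply: CkZ; apply: (CkM t2); exact: (Ck_sum _ km).
- by apply: CkN; apply: (CkM k0); apply: Ck_sum => i; exact: CkM (kF i) (kp i).
- by apply: CkZ; exact: (Ck_sum _ kq).
- by apply: CkZ; apply: CkZ.
Qed.

(* Test function u theta^2. With theta = <x>^(k/2) times a cutoff, the drift terms
   of the weight cancel exactly against hypothesis (ii). *)
Theorem caccioppoli T S F e dl theta M : fp_functional T S -> (forall i, continuous (F i)) ->
  0 <= e -> 0 <= dl -> Ck 1 theta -> (forall x, M < `|x| -> theta x = 0) ->
  (forall x i, `|x| <= M -> `|conv (S i) (moll e) x - F i x * conv T (moll e) x| <= `|conv T (moll e) x|) ->
  (forall x i, `|x| <= M -> `|mol (F i) dl x - F i x| <= 1) ->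
  energy (fun x => conv T (moll e) x * theta x) M <=
  2 * \int[mu]_x (conv T (moll e) x ^+ 2 * caccioppoli_weight F dl theta x).
Proof.
move=> eqn cF e0 dl0 kt tM hr hd.
have [hT hS _] := eqn.
pose u := conv T (moll e).
have ku k : Ck k u by apply: Ck_conv => //; [exact: Cc_moll|move=> j; exact: Ck_moll].
have ct : Cc theta by apply: (@CcP _ _ _ M) => //; exact: Ck_cont kt.
have cpt i : Cc (partial i theta) by exact: Cc_partial.
pose h x := u x * theta x.
have kh : Ck 1 h by exact: CkM (ku 1%N) kt.
have ch : Cc h := CcMl (Ck_cont (ku 0%N)) ct.
have cph i : Cc (partial i h) by exact: Cc_partial.
pose psi x := h x * theta x.
have kpsi : Ck 1 psi by exact: CkM kh kt.
have cpsi : Cc psi := CcMr ch (Ck_cont kt).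
have ph i x : partial i h x = theta x * partial i u x + u x * partial i theta x.
  rewrite (partialE (is_derive_mul (Ck_derive i x (ku 1%N)) (Ck_derive i x kt))).
  by rewrite addrC mulrC.
have ppsi i x : partial i psi x = theta x ^+ 2 * partial i u x + 2 * u x * theta x * partial i theta x.
  rewrite (partialE (is_derive_mul (Ck_derive i x kh) (Ck_derive i x kt))) ph /h.
  by move: (u x) (theta x) (partial i u x) (partial i theta x) => a b c p; ring.
have W := weak_mollified eqn e0 kpsi cpsi.
pose Fd i := mol (F i) dl.
have kFd i : Ck 1 (Fd i) := Ck_mol 1 dl0 (continuous_locL1 (@cF i)).
pose I1 i := \int[mu]_x (partial i h x ^+ 2).
pose b i x := - 2^-1 * (partial i (Fd i) x * h x ^+ 2) + F i x * u x ^+ 2 * (theta x * partial i theta x)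
   - (3 / 2 * (u x ^+ 2 * partial i theta x ^+ 2) + 5 / 2 * (u x ^+ 2 * theta x ^+ 2)).
have csq f : Cc f -> Cc (fun x => f x ^+ 2) by move=> cf; apply: CcMl => //; exact: cf.1.
have cu2 : continuous (fun x => u x ^+ 2) := Ck_cont (CkM (ku 0%N) (ku 0%N)).
have c1 i : Cc (fun x => partial i h x ^+ 2) := csq _ (cph i).
have c2 i : Cc (fun x => partial i (Fd i) x * h x ^+ 2) := CcMl (Ck_cont (Ck_partial i (kFd i))) (csq _ ch).
have c3 i : Cc (fun x => F i x * u x ^+ 2 * (theta x * partial i theta x)).
  apply: CcMl; last exact: CcMr ct (cpt i).1.
  exact: Ck_cont (CkM (conj (@cF i) I : Ck 0 (F i)) (conj cu2 I : Ck 0 _)).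
have c4 i : Cc (fun x => 3 / 2 * (u x ^+ 2 * partial i theta x ^+ 2) + 5 / 2 * (u x ^+ 2 * theta x ^+ 2)).
  exact: CcD (CcZ _ (CcMl cu2 (csq _ (cpt i)))) (CcZ _ (CcMl cu2 (csq _ ct))).
have c5 i : Cc (fun x => Fd i x * h x * partial i h x) := CcMl (Ck_cont (CkM (kFd i) kh)) (cph i).
(* The integrand is half of Fd times the derivative of h^2, so the derivative falls on Fd. *)
have ibp i : \int[mu]_x (Fd i x * h x * partial i h x) = - 2^-1 * \int[mu]_x (partial i (Fd i) x * h x ^+ 2).
  have := Int_by_parts i (CkM (kFd i) kh) kh ch.
  rewrite (@eq_Int _ _ (fun x => partial i (fun x => Fd i x * h x) x * h x)
    (fun x => Fd i x * h x * partial i h x + partial i (Fd i) x * h x ^+ 2)); last first.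
    move=> x; rewrite (partialE (is_derive_mul (Ck_derive i x (kFd i)) (Ck_derive i x kh))).
    by move: (Fd i x) (h x) (partial i h x) (partial i (Fd i) x) => p q r s; ring.
  rewrite (IntD (Cc_intg (c5 i)) (Cc_intg (c2 i))).
  by set a1 := \int[mu]_x _; set a2 := \int[mu]_x _; clearbody a1 a2; lra.
have lower i : 2^-1 * I1 i + \int[mu]_x b i x <= \int[mu]_x ((partial i (conv T (moll e)) x + conv (S i) (moll e) x) * partial i psi x).
  have -> : 2^-1 * I1 i + \int[mu]_x b i x = \int[mu]_x (2^-1 * partial i h x ^+ 2 + Fd i x * h x * partial i h x +
      F i x * u x ^+ 2 * (theta x * partial i theta x)
      - (3 / 2 * (u x ^+ 2 * partial i theta x ^+ 2) + 5 / 2 * (u x ^+ 2 * theta x ^+ 2))).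
    have i1 := Cc_intg (c1 i); have i2 := Cc_intg (c2 i); have i3 := Cc_intg (c3 i).
    have i4 := Cc_intg (c4 i); have i5 := Cc_intg (c5 i).
    rewrite /b (IntB (intgD (intgZ _ i2) i3) i4) (IntD (intgZ _ i2) i3) (IntZ _ i2).
    rewrite (IntB (intgD (intgD (intgZ _ i1) i5) i3) i4) (IntD (intgD (intgZ _ i1) i5) i3).
    by rewrite (IntD (intgZ _ i1) i5) (IntZ _ i1) ibp !addrA.
  apply: le_Int.
  - exact: Cc_intg (CcD (CcD (CcD (CcZ _ (c1 i)) (c5 i)) (c3 i)) (eq_ind _ Cc (CcZ (-1) (c4 i)) _ (funext (fun x => mulN1r _)))).
  - apply: Cc_intg; apply: CcMl; last exact: Cc_partial.
    have kS : Ck 0 (conv (S i) (moll e)) by apply: Ck_conv => //; [exact: Cc_moll|move=> j; exact: Ck_moll].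
    exact: Ck_cont (CkD (Ck_partial i (ku 1%N)) kS).
  - move=> x; rewrite -/u ppsi ph.
    have [xM|xM] := lerP `|x| M; last first.
      have pt : partial i theta x = 0 by exact: partial_out xM.
      rewrite /h (tM x xM) pt le_eqVlt; apply/orP; left; apply/eqP.
      move: (u x) (partial i u x) (F i x) (Fd i x) (conv (S i) (moll e) x) => p q r t s; ring.
    have h1 := hd x i xM; have h2 := hr x i xM; rewrite -/u in h2.
    have := caccioppoli_pointwise (partial i u x) (partial i theta x) (theta x) h1 h2.
    have -> : F i x * u x + (conv (S i) (moll e) x - F i x * u x) = conv (S i) (moll e) x.
      by rewrite addrCA subrr addr0.
    by [].
have main : \sum_(i < d) (2^-1 * I1 i + \int[mu]_x b i x) <= 0.
  by rewrite -[leRHS]W; apply: ler_sum => i _; exact: lower.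
have ib i : intg (b i).
  apply: intgB; last exact: Cc_intg (c4 i).
  by apply: intgD; [apply: intgZ; exact: Cc_intg|exact: Cc_intg].
have sb : \sum_(i < d) \int[mu]_x b i x = - \int[mu]_x (u x ^+ 2 * caccioppoli_weight F dl theta x).
  rewrite -(Int_sum _ ib) -IntN; last first.
    apply: locL1_Cc; first exact: continuous_locL1.
    apply: (@CcP _ _ _ M); first exact: continuous_caccioppoli_weight.
    move=> x xM; rewrite /caccioppoli_weight tM//.
    rewrite [X in 3 / 2 * X]big1 => [|i _]; last by rewrite (partial_out i tM xM) expr0n.
    by rewrite !(expr0n, mul0r, mulr0)/= !(mul0r, mulr0, addr0, subr0).
  apply: eq_Int => x; rewrite /b /caccioppoli_weight sumrB big_split /= big_split /= -!mulr_sumr.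
  rewrite sumr_const card_ord.
  have e1 : \sum_(i < d) partial i (Fd i) x * h x ^+ 2 = u x ^+ 2 * (theta x ^+ 2 * \sum_(i < d) partial i (mol (F i) dl) x).
    by rewrite -mulr_suml /h exprMn mulrC mulrA.
  have e2 : \sum_(i < d) F i x * u x ^+ 2 * (theta x * partial i theta x) = u x ^+ 2 * (theta x * \sum_(i < d) F i x * partial i theta x).
    by rewrite !mulr_sumr; apply: eq_bigr => i _; move: (F i x) (u x) (theta x) (partial i theta x) => p q r t; ring.
  rewrite e1 e2 -[theta x *+ d]mulr_natl.
  set a1 := \sum_(i < d) _; set a2 := \sum_(i < d) _; set a3 := \sum_(i < d) _.
  by move: (u x) (theta x) a1 a2 a3 (d%:R) => p q b1 b2 b3 n; ring.
rewrite big_split /= -mulr_sumr sb in main.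
have eE : energy h M <= \sum_(i < d) I1 i.
  rewrite energyE//; apply: ler_sum => i _; apply: le_Int.
  - exact: (continuous_locL1 (c1 i).1).2.
  - exact: Cc_intg (c1 i).
  - by move=> x; rewrite ler_piMr ?sqr_ge0// indicE; case: (_ \in _).
apply: le_trans eE _; move: main.
by set a1 := \sum_(i < d) _; set a2 := \int[mu]_x _; clearbody a1 a2; lra.
Qed.

End caccioppoli.

(** * Weighted cutoff functions *)

Section weighted_cutoff.
Context {R : realType} {d : nat}.
Notation V := 'rV[R]_d.
Notation mu := (@lebesgue_rV R d).
Notation e_ i := (delta_mx ord0 i : V).
Implicit Types (F : 'I_d -> V -> R) (f g h u w phi psi theta : V -> R) (x y z v : V) (e r c s t M N L C k : R) (A B : set V).

Definition pos2 t : R := Num.max 0 t ^+ 2.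

Lemma is_derive_pos2 t : is_derive t (1 : R) pos2 (2 * Num.max 0 t).
Proof.
apply: is_derive_estimate => e e0; exists e => // h he.
have key : `|pos2 (h + t) - pos2 t - h * (2 * Num.max 0 t)| <= h ^+ 2.
  rewrite /pos2; have h0 := sqr_ge0 h.
  have [t0|t0] := lerP 0 t; have [ht|ht] := lerP 0 (h + t); rewrite ler_norml.
  - by rewrite (_ : (h + t) ^+ 2 - t ^+ 2 - h * (2 * t) = h ^+ 2); [rewrite lexx andbT; lra|ring].
  - have q1 : 0 <= t * (- (h + t)) by rewrite mulr_ge0//; lra.
    have q2 := sqr_ge0 (t + h); have q3 := sqr_ge0 t.
    by apply/andP; split; lra.
  - have q1 : (h + t) ^+ 2 <= h ^+ 2 by rewrite lerXn2r// ?nnegrE//; lra.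
    have q2 := sqr_ge0 (h + t).
    by apply/andP; split; lra.
  - by apply/andP; split; lra.
rewrite [h *: 1]mulr1; apply: le_trans key _.
by rewrite -(real_normK (num_real h)) expr2 ler_wpM2r// ltW.
Qed.

Lemma continuous_pos2 : continuous pos2.
Proof.
move=> t; apply: differentiable_continuous; apply/derivable1_diffP.
by have [] := is_derive_pos2 t.
Qed.

Lemma continuous_max0 : continuous (fun t : R => 2 * Num.max 0 t).
Proof.
move=> t; apply: cvgMr; apply: continuous_max; [exact: cvg_cst|exact: cvg_id].
Qed.

(** This is <x>^(k/2), since 1 + |x|^2 = <x>^2; its square is the weight of L^2_k. *)
Definition rho k x : R := expR (k / 4 * ln (1 + nsq x)).

Lemma rho_gt0 k x : 0 < rho k x. Proof. exact: expR_gt0. Qed.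

Lemma Ck_rho k : Ck 1 (rho k) /\
  forall i x, partial i (rho k) x = rho k x * (k / 2 * (x ord0 i / (1 + nsq x))).
Proof.
have k1 : Ck 1 (fun x => 1 + nsq x) by apply: CkD; [exact: Ck_cst|exact: Ck_nsq].
have [kl pl] := Ck_ln (@nsq1_gt0 R d) k1.
have kk := CkZ (k / 4) kl.
split.
  exact: (Ck_comp1 (@is_derive_expR R) (@continuous_expR R) (@continuous_expR R) kk).
move=> i x; have D := is_derive_chain (is_derive_expR (k / 4 * ln (1 + nsq x))) (is_derive_scale (k / 4) (Ck_derive i x kl)).
rewrite (partialE D) pl; congr (_ * _).
have -> : partial i (fun x => 1 + nsq x) x = 2 * x ord0 i.
  by rewrite (partialE (is_derive_add (is_derive_cst (1 : R) x (e_ i)) (is_derive_nsq x i))) add0r.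
by have := nsq1_gt0 x; move: (1 + nsq x) (x ord0 i) => p q p0; field; rewrite gt_eqF.
Qed.

Lemma rho_sqr k x : rho k x ^+ 2 = bracket x `^ k.
Proof.
have b0 : 0 < bracket x by rewrite sqrtr_gt0 enorm_sqr nsq1_gt0.
rewrite /powR gt_eqF// /rho -expRM_natl; congr expR.
have -> : 1 + nsq x = bracket x ^+ 2 by rewrite sqr_sqrtr ?enorm_sqr// ltW// nsq1_gt0.
by rewrite lnXn// -mulr_natl; field.
Qed.

Lemma rho_le_weight k (n : nat) x : k <= n%:R -> rho k x <= weight n x.
Proof.
move=> kn; have q1 := nsq1_gt0 x.
have -> : weight n x = expR (n%:R * ln (1 + nsq x)) by rewrite expRM_natl lnK.
rewrite ler_expR ler_wpM2r//; first by rewrite ln_ge0// lerDl nsq_ge0.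
have : 0 <= n%:R :> R by [].
by lra.
Qed.

(* Squared positive parts are only C^1, which suffices; being equal to 1 on
   the inner set is replaced by the lower bound (s - r |x|^2)^2. *)
Definition chi r s x : R := pos2 (s - r * nsq x).

Lemma Ck_chi r s : Ck 1 (chi r s) /\
  forall i x, partial i (chi r s) x = 2 * Num.max 0 (s - r * nsq x) * (- (2 * r * x ord0 i)).
Proof.
have k1 : Ck 1 (fun x => s + - r * nsq x) by apply: CkD; [exact: Ck_cst|exact: (CkZ _ (Ck_nsq 1))].
have E : chi r s = fun x => pos2 (s + - r * nsq x) by apply/funext => x; rewrite /chi mulNr.
split.
  by rewrite E; exact: (Ck_comp1 is_derive_pos2 continuous_pos2 continuous_max0 k1).
move=> i x; rewrite E.
have D := is_derive_chain (is_derive_pos2 (s + - r * nsq x))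
  (is_derive_add (is_derive_cst s x (e_ i)) (is_derive_scale (- r) (is_derive_nsq x i))).
by rewrite (partialE D) add0r mulNr; congr (_ * _); ring.
Qed.

Lemma chi_out r s x : s <= r * nsq x -> chi r s x = 0.
Proof. by move=> h; rewrite /chi /pos2 max_l ?expr0n// subr_le0. Qed.

Lemma chi_bound r s x : 0 <= r -> s <= 2 -> 0 <= chi r s x <= 4.
Proof.
move=> r0 s2; rewrite /chi /pos2 sqr_ge0/=.
have m0 : 0 <= Num.max 0 (s - r * nsq x) by rewrite le_max lexx.
have m2 : Num.max 0 (s - r * nsq x) <= 2.
  by rewrite ge_max ler0n/=; have := mulr_ge0 r0 (nsq_ge0 x); lra.
by move: (Num.max _ _) m0 m2 => m m0 m2; nra.
Qed.

Definition theta k r s x : R := rho k x * chi r s x.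

Lemma partial_theta k r s i x : partial i (theta k r s) x =
  rho k x * (x ord0 i * (chi r s x * (k / 2 / (1 + nsq x)) - 4 * r * Num.max 0 (s - r * nsq x))).
Proof.
have [k1 p1] := Ck_rho k; have [k2 p2] := Ck_chi r s.
rewrite (partialE (is_derive_mul (Ck_derive i x k1) (Ck_derive i x k2))) p1 p2.
move: (rho k x) (chi r s x) (Num.max _ _) (x ord0 i) ((1 + nsq x)^-1) => p q m t j; ring.
Qed.

Lemma Ck_theta k r s : Ck 1 (theta k r s).
Proof. exact: CkM (Ck_rho k).1 (Ck_chi r s).1. Qed.

Lemma theta_out k r s x : s <= r * nsq x -> theta k r s x = 0.
Proof. by move=> h; rewrite /theta chi_out// mulr0. Qed.

(** The gradient of [rho] contributes (k/2) theta^2 radial F / (1 + |x|^2) to theta F . grad theta,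
    which cancels against half of the divergence bound. The drift survives only in the gradient of
    [chi], where r radial F <= 3 a on the support. With chi <= 4 and positive part at most 2, the
    constants are 8 = 16 / 2, 96 = 4 x 8 x 3 and 40 = 16 x 5 / 2. *)
Lemma caccioppoli_weight_le F k (B0 a : R) dl r s x : 0 <= k -> 0 <= a -> radial F x <= a * (1 + nsq x) ->
  \sum_(i < d) partial i (mol (F i) dl) x <= k * (radial F x / (1 + nsq x)) + B0 ->
  0 < r -> r <= 1 -> s <= 2 -> r * nsq x <= s ->
  caccioppoli_weight F dl (theta k r s) x <=
  (8 * `|B0| + 96 * a + 3 / 2 * (256 + 8 * k ^+ 2) + 40 * d%:R) * rho k x ^+ 2.
Proof.
move=> k0 a0 ha hdiv r0 r1 s2 rs.
have q0 := nsq_ge0 x; have q1 := nsq1_gt0 x.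
have rq0 : 0 <= r * nsq x by rewrite mulr_ge0// ltW.
pose m := Num.max 0 (s - r * nsq x); pose X := chi r s x; pose P := rho k x; pose j := (1 + nsq x)^-1.
have /andP[X0 X4] := chi_bound x (ltW r0) s2; rewrite -/X in X0 X4.
have m0 : 0 <= m by rewrite le_max lexx.
have m2 : m <= 2 by rewrite ge_max ler0n/=; lra.
have j0 : 0 < j by rewrite invr_gt0.
have j1 : j <= 1 by rewrite invf_le1// lerDl.
have jq : j * nsq x <= 1 by rewrite mulrC ler_pdivrMr// mul1r lerDr.
have E2 : \sum_(i < d) F i x * partial i (theta k r s) x = P * (radial F x * (X * (k / 2 * j) - 4 * r * m)).
  rewrite /radial mulr_suml mulr_sumr; apply: eq_bigr => i _; rewrite partial_theta -/m -/X -/P -/j.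
  by move: (F i x) (x ord0 i) => f y; ring.
have E3 : \sum_(i < d) partial i (theta k r s) x ^+ 2 = P ^+ 2 * (nsq x * (X * (k / 2 * j) - 4 * r * m) ^+ 2).
  rewrite /nsq /dotp mulr_suml mulr_sumr; apply: eq_bigr => i _; rewrite partial_theta -/m -/X -/P -/j.
  by move: (x ord0 i) => y; ring.
rewrite /caccioppoli_weight E2 E3 (_ : theta k r s x = P * X)//.
have P0 : 0 <= P ^+ 2 by exact: sqr_ge0.
have XX : X ^+ 2 <= 16 by nra.
have X2 : 0 <= X ^+ 2 by exact: sqr_ge0.
set D := \sum_(i < d) _ in hdiv *; set f := radial F x in ha hdiv *.
have -> : 2^-1 * ((P * X) ^+ 2 * D) - P * X * (P * (f * (X * (k / 2 * j) - 4 * r * m)))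
   + 3 / 2 * (P ^+ 2 * (nsq x * (X * (k / 2 * j) - 4 * r * m) ^+ 2)) + 5 / 2 * (d%:R * (P * X) ^+ 2) =
  (2^-1 * (X ^+ 2 * (D - k * (f * j))) + 4 * (X * m) * (r * f) +
     3 / 2 * (nsq x * (X * (k / 2 * j) - 4 * r * m) ^+ 2) + 5 / 2 * d%:R * X ^+ 2) * P ^+ 2 by field.
apply: ler_wpM2r => //; apply: lerD; last first.
  have : 0 <= d%:R :> R by []; move: (d%:R) => n n0.
  by have := ler_wpM2l n0 XX; lra.
apply: lerD; first apply: lerD.
- have h : D - k * (f * j) <= `|B0|.
    by rewrite lerBlDl; apply: le_trans hdiv _; rewrite lerD2l ler_norm.
  have b0 := normr_ge0 B0; move: (`|B0|) (D - _) h b0 => b q h b0.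
  have h1 : X ^+ 2 * q <= X ^+ 2 * b by rewrite ler_wpM2l.
  have h2 : X ^+ 2 * b <= 16 * b by rewrite ler_wpM2r.
  by lra.
- have h1 : r * f <= 3 * a.
    apply: (@le_trans _ _ (a * (r + r * nsq x))).
      by have := ler_wpM2l (ltW r0) ha; rewrite (_ : r * (a * (1 + nsq x)) = a * (r + r * nsq x))//; ring.
    by rewrite mulrC ler_wpM2r//; lra.
  have h2 : 0 <= X * m by rewrite mulr_ge0.
  have h3 : X * m <= 8 by rewrite (_ : 8 = 4 * 2 :> R) ?ler_pM//; ring.
  have h4 : X * m * (r * f) <= X * m * (3 * a) by rewrite ler_wpM2l.
  have h5 : X * m * (3 * a) <= 8 * (3 * a) by rewrite ler_wpM2r// mulr_ge0.
  by rewrite -mulrA; lra.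
- rewrite ler_wpM2l//.
  have h1 : (X * (k / 2 * j) - 4 * r * m) ^+ 2 <= 8 * k ^+ 2 * j ^+ 2 + 128 * r ^+ 2.
    have g1 := sqr_ge0 (X * (k / 2 * j) + 4 * r * m).
    have g2 : (X * (k / 2 * j)) ^+ 2 <= 4 * (k ^+ 2 * j ^+ 2).
      rewrite (_ : (X * (k / 2 * j)) ^+ 2 = X ^+ 2 * (k ^+ 2 * j ^+ 2 / 4)); last by field.
      have : 0 <= k ^+ 2 * j ^+ 2 by rewrite -exprMn sqr_ge0.
      by move: (k ^+ 2 * j ^+ 2) => p p0; have := ler_wpM2r p0 XX; lra.
    have g3 : (4 * r * m) ^+ 2 <= 64 * r ^+ 2.
      rewrite (_ : (4 * r * m) ^+ 2 = (16 * r ^+ 2) * m ^+ 2); last by ring.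
      have m4 : m ^+ 2 <= 4 by nra.
      have r20 : 0 <= 16 * r ^+ 2 by rewrite mulr_ge0// sqr_ge0.
      by have := ler_wpM2l r20 m4; lra.
    have g4 : (X * (k / 2 * j) - 4 * r * m) ^+ 2 + (X * (k / 2 * j) + 4 * r * m) ^+ 2 =
      2 * (X * (k / 2 * j)) ^+ 2 + 2 * (4 * r * m) ^+ 2 by ring.
    by lra.
  apply: le_trans (ler_wpM2l q0 h1) _.
  rewrite (_ : nsq x * (8 * k ^+ 2 * j ^+ 2 + 128 * r ^+ 2) = 8 * k ^+ 2 * (j * (j * nsq x)) + 128 * (r * (r * nsq x))); last by ring.
  rewrite addrC; apply: lerD.
    have : r * (r * nsq x) <= 1 * 2 by rewrite ler_pM//; [exact: ltW|lra].
    by lra.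
  rewrite -[leRHS]mulr1 ler_wpM2l//; first by rewrite mulr_ge0// sqr_ge0.
  by rewrite -[leRHS]mulr1 ler_pM//; [exact: ltW|rewrite mulr_ge0// ltW].
Qed.

End weighted_cutoff.

(** * Uniform weighted L^2 bound *)

Section uniform_L2.
Context {R : realType} {d : nat}.
Notation V := 'rV[R]_d.
Notation mu := (@lebesgue_rV R d).
Notation e_ i := (delta_mx ord0 i : V).
Implicit Types (f g h u w phi psi : V -> R) (x y z v : V) (e r c s t N L M : R) (A B : set V).

Lemma measurable_sublevel f c : continuous f -> measurable [set x | f x <= c].
Proof.
move=> /continuous_measurable_rV mf.
have := mf measurableT (`]-oo, c]%classic) (measurable_itv _); rewrite setTI; have -> // : f @^-1` `]-oo, c]%classic = [set x | f x <= c].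
by apply/seteqP; split => x /=; rewrite in_itv.
Qed.

(** Each iteration halves the contribution of K, and s -> (2 + s) / 2 stays below 2. In the limit K
    disappears from the bound: a finite K is enough. *)
Lemma contraction_iterate (phi : R -> R) (B K : R) : 0 <= K -> 0 <= B ->
  (forall s, 1 <= s -> s < 2 -> phi s <= K) ->
  (forall s, 1 <= s -> s < 2 -> phi s <= 2^-1 * phi ((2 + s) / 2) + B) -> phi 1 <= 2 * B.
Proof.
move=> K0 B0 hK hB.
have it (j : nat) : forall s, 1 <= s -> s < 2 -> phi s <= (2 ^+ j)^-1 * K + 2 * B.
  elim: j => [|j ih] s s1 s2.
    by rewrite expr0 invr1 mul1r; have := hK s s1 s2; lra.
  apply: le_trans (hB s s1 s2) _; have h := ih ((2 + s) / 2) _ _.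
  have {h} : phi ((2 + s) / 2) <= (2 ^+ j)^-1 * K + 2 * B by apply: h; lra.
  rewrite exprS invfM -mulrA; move: ((2 ^+ j)^-1 * K) (phi _) => p q; lra.
apply/ler_addgt0Pr => e e0.
have [j hj] : exists j : nat, K / e <= 2 ^+ j.
  exists (Num.bound (K / e)); apply: le_trans (ltW (archi_boundP _)) _; first by rewrite divr_ge0// ltW.
  by rewrite -natrX ler_nat ltnW// ltn_expl.
have p0 : 0 < 2 ^+ j :> R by rewrite exprn_gt0.
have : (2 ^+ j)^-1 * K <= e by rewrite mulrC ler_pdivrMr// mulrC -ler_pdivrMr.
have := it j 1 (lexx _) _; move: ((2 ^+ j)^-1 * K) => q /(_ _)/[!ltr1n]/(_ isT); lra.
Qed.

Lemma sublevel_cube r s x : 0 < r -> s <= 2 -> r * nsq x <= s -> `|x| <= 1 + 2 / r.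
Proof.
move=> r0 s2 h; have h1 : nsq x <= 2 / r by rewrite ler_pdivlMr// mulrC; exact: le_trans s2.
have := norm_sqr_le x; move: (nsq x) (`|x|) (2 / r) h1 => p q c h1 h2.
by have := sqr_ge0 (q - 1); nra.
Qed.

Lemma intg_sublevel f r s : continuous f -> 0 < r -> s <= 2 ->
  intg (fun x => f x * \1_[set x | r * nsq x <= s] x).
Proof.
move=> cf r0 s2; apply: (@locL1_bounded _ _ _ _ (1 + 2 / r) 1).
- exact: continuous_locL1.
- by apply: measurable_indic; apply: measurable_sublevel; exact: Ck_cont (CkZ r (Ck_nsq 0)).
- by move=> x; rewrite indicE; case: (_ \in _); rewrite ?normr1 ?normr0.
- move=> x xM; rewrite indicE memNset// => h.
  by have := sublevel_cube r0 s2 h; rewrite leNgt xM.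
Qed.

Variables (F : 'I_d -> V -> R) (T : (V -> R) -> R) (S : 'I_d -> (V -> R) -> R).
Variables (n : nat) (k B0 a K : R).
Hypotheses (k0 : 0 <= k) (kn : k <= n%:R) (a0 : 0 <= a) (K0 : 0 <= K).
Hypotheses (cF : forall i, continuous (F i)) (hA : forall x, radial F x <= a * (1 + nsq x)).
Hypothesis hdiv : forall M, exists2 dl, 0 < dl & forall x, `|x| <= M ->
  \sum_(i < d) partial i (mol (F i) dl) x <= k * (radial F x / (1 + nsq x)) + B0 /\
  forall i, `|mol (F i) dl x - F i x| <= 1.
Hypothesis eqn : fp_functional T S.
Hypothesis T_ge0 : forall e x, 0 <= e -> 0 <= conv T (moll e) x.
Hypothesis comm : forall M, exists2 L, 0 <= L & forall e x i, 0 < e -> e <= 1 -> `|x| <= M ->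
  `|conv (S i) (moll e) x - F i x * conv T (moll e) x| <= L * e * conv T (moll e) x.
Hypothesis moment : forall e f c, 0 < e -> e <= 1 -> 0 <= c -> Cc f ->
  (forall x, f x <= c * weight n x) -> \int[mu]_x (conv T (moll e) x * f x) <= c * K.

Let dens e := conv T (moll e).
Let lev r s : set V := [set x | r * nsq x <= s].
Let mass r e s := \int[mu]_x (dens e x ^+ 2 * rho k x ^+ 2 * \1_(lev r s) x).
Let Cw := 8 * `|B0| + 96 * a + 3 / 2 * (256 + 8 * k ^+ 2) + 40 * d%:R.

Let Cw0 : 0 <= Cw.
Proof.
have k2 : 0 <= k ^+ 2 by exact: sqr_ge0.
rewrite /Cw; apply: addr_ge0; last by rewrite mulr_ge0.
by apply: addr_ge0; [apply: addr_ge0; rewrite mulr_ge0|lra].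
Qed.

Let kdens m e : 0 <= e -> Ck m (dens e).
Proof.
have [hT _ _] := eqn.
by move=> e0; apply: Ck_conv => //; [exact: Cc_moll|move=> j; exact: Ck_moll].
Qed.

Let imass r e s : 0 < r -> s <= 2 -> 0 <= e -> intg (fun x => dens e x ^+ 2 * rho k x ^+ 2 * \1_(lev r s) x).
Proof.
move=> r0 s2 e0; apply: intg_sublevel => //.
have k1 := kdens 0 e0; have k2 : Ck 0 (@rho R d k) := CkW (Ck_rho k).1.
have s1 : Ck 0 (fun x => dens e x ^+ 2) := CkM k1 k1.
have s2' : Ck 0 (fun x => rho k x ^+ 2) := CkM k2 k2.
exact: (Ck_cont (CkM s1 s2')).
Qed.

Let mass_integrand_ge0 e A x : 0 <= dens e x ^+ 2 * rho k x ^+ 2 * \1_A x.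
Proof. by apply: mulr_ge0; [apply: mulr_ge0; exact: sqr_ge0|rewrite indicE]. Qed.

(** [caccioppoli] with a cutoff living on r |x|^2 <= s + t, then [nash] at scale q. Where r |x|^2 <=
    s the cutoff is at least t^2, which gives t^4 after squaring. The mass of u theta is at most 4
    K, by chi <= 4 and [rho_le_weight]. *)
Let step r : 0 < r -> r <= 1 -> exists2 e0, 0 < e0 & forall e s t q, 0 < e -> e < e0 ->
  0 < t -> t <= 1 -> 0 < s -> s + t <= 2 -> 0 < q -> q <= 1 ->
  t ^+ 4 * mass r e s <= d%:R * q ^+ 2 * Cw * mass r e (s + t) + (q ^+ d)^-1 * (4 * K) ^+ 2.
Proof.
(* The cutoff vanishes beyond 1 + 2/r; the additional 1 is the margin that [nash] requires for q <=
   1. *)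
move=> r0 r1; pose M := 1 + 2 / r + 1.
have [dl dl0 hdl] := hdiv M; have [L L0 hL] := comm M.
have L1 : 0 < L + 1 by lra.
exists (Num.min 1 (L + 1)^-1); first by rewrite lt_min ltr01 invr_gt0.
move=> e s t q e0; rewrite lt_min => /andP[e1 eL] t0 t1 s0 st2 q0 q1.
have e0' := ltW e0; have e1' := ltW e1.
have Le : L * e <= 1.
  have : (L + 1) * e <= 1 by rewrite mulrC -ler_pdivlMr// mul1r ltW.
  by rewrite mulrDl mul1r; lra.
pose th := @theta R d k r (s + t); have kth : Ck 1 th := Ck_theta k r (s + t).
have thout x : 1 + 2 / r < `|x| -> th x = 0.
  move=> xr; apply: theta_out; rewrite leNgt; apply/negP => h.
  by have := sublevel_cube r0 st2 (ltW h); rewrite leNgt xr.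
have thM x : M < `|x| -> th x = 0 by move=> xM; apply: thout; apply: lt_trans xM; rewrite /M ltrDl.
have chi0 x : 0 <= chi r (s + t) x <= 4 := chi_bound x (ltW r0) st2.
have th0 x : 0 <= th x by rewrite /th /theta mulr_ge0 ?(ltW (rho_gt0 k x))//; case/andP: (chi0 x).
have cth : Cc th by apply: (@CcP _ _ _ M) => //; exact: Ck_cont kth.
pose h x := dens e x * th x.
have kh : Ck 1 h by exact: CkM (kdens 1 e0') kth.
have h0 x : 0 <= h x by rewrite mulr_ge0// T_ge0.
have ch : Cc h := CcMl (Ck_cont (kdens 0 e0')) cth.
have E : energy h M <= 2 * (Cw * mass r e (s + t)).
  apply: le_trans (caccioppoli eqn cF e0' (ltW dl0) kth thM _ _) _.
  - move=> x i xM; apply: le_trans (hL e x i e0 e1' xM) _.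
    by rewrite (ger0_norm (T_ge0 x e0')) ler_piMl// T_ge0.
  - by move=> x i xM; have [_] := hdl x xM; apply.
  rewrite ler_wpM2l// -(IntZ _ (imass r0 st2 e0')).
  have out x : s + t < r * nsq x -> caccioppoli_weight F dl th x = 0.
    move=> hx; have pz i : partial i th x = 0.
      rewrite /th partial_theta chi_out ?(ltW hx)// max_l ?subr_le0 ?(ltW hx)//.
      by rewrite mul0r mulr0 subrr !mulr0.
    rewrite /caccioppoli_weight /th theta_out ?(ltW hx)//.
    rewrite [X in 3 / 2 * X]big1 => [|i _]; last by rewrite -/th pz expr0n.
    by rewrite !(expr0n, mul0r, mulr0)/= !(mul0r, mulr0, addr0, subr0).
  apply: le_Int.
  - apply: locL1_Cc; first by apply: continuous_locL1; exact: (Ck_cont (CkM (kdens 0 e0') (kdens 0 e0'))).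
    apply: (@CcP _ _ _ M); first exact: continuous_caccioppoli_weight (ltW dl0) kth.
    move=> x xM; apply: out; rewrite ltNge; apply/negP => hx.
    by have := sublevel_cube r0 st2 hx; move: xM; rewrite /M; lra.
  - exact: intgZ (imass r0 st2 e0').
  - move=> x; have [hx|hx] := lerP (r * nsq x) (s + t); last first.
      by rewrite out// mulr0 mulr_ge0.
    rewrite indicE mem_set// mulr1 mulrCA ler_wpM2l ?sqr_ge0//.
    have [d1 _] : \sum_(i < d) partial i (mol (F i) dl) x <= k * (radial F x / (1 + nsq x)) + B0 /\ True.
      split => //; have [] := hdl x _; last by [].
      by have := sublevel_cube r0 st2 hx; rewrite /M; lra.
    exact: (caccioppoli_weight_le k0 a0 (hA x) d1 r0 r1 st2 hx).
have Ih : \int[mu]_x h x <= 4 * K.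
  apply: moment => // x; rewrite /th /theta mulrC.
  case/andP: (chi0 x) => c0 c4; apply: ler_pM => //; first exact: ltW (rho_gt0 k x).
  exact: rho_le_weight.
have Ih0 : 0 <= \int[mu]_x h x by exact: Int_ge0.
have nsh := @nash R d h q M kh h0 _ q0.
have {nsh} : \int[mu]_x h x ^+ 2 <= d%:R * q ^+ 2 / 2 * energy h M + (q ^+ d)^-1 * (\int[mu]_x h x) ^+ 2.
  by apply: nsh => x xM; rewrite /h thout ?mulr0//; move: xM; rewrite /M; lra.
have low : t ^+ 4 * mass r e s <= \int[mu]_x h x ^+ 2.
  have s2 : s <= 2 by lra.
  rewrite -(IntZ _ (imass r0 s2 e0')); apply: le_Int.
  - exact: intgZ (imass r0 s2 e0').
  - by apply: Cc_intg; apply: CcMl => //; exact: ch.1.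
  - move=> x; rewrite indicE; case: (boolP (x \in lev r s)); last by rewrite !mulr0 sqr_ge0.
    rewrite inE /lev /= => hx; rewrite mulr1 /h /th /theta.
    rewrite (_ : (dens e x * (rho k x * chi r (s + t) x)) ^+ 2 = chi r (s + t) x ^+ 2 * (dens e x ^+ 2 * rho k x ^+ 2)); last first.
      by move: (dens e x) (rho k x) (chi r (s + t) x) => p1 p2 p3; ring.
    apply: ler_wpM2r; first by apply: mulr_ge0; exact: sqr_ge0.
    have -> : t ^+ 4 = (t ^+ 2) ^+ 2 by rewrite -exprM.
    apply: lerXn2r; rewrite ?nnegrE ?sqr_ge0//.
    rewrite /chi /pos2; apply: lerXn2r; rewrite ?nnegrE ?(ltW t0) ?le_max ?lexx//.
    by apply/orP; right; lra.
move=> H; apply: le_trans low _; apply: le_trans H _; apply: lerD.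
  have -> : d%:R * q ^+ 2 * Cw * mass r e (s + t) = d%:R * q ^+ 2 / 2 * (2 * (Cw * mass r e (s + t))) by field.
  by apply: ler_wpM2l E; rewrite mulr_ge0// mulr_ge0// sqr_ge0.
apply: ler_wpM2l; first by rewrite invr_ge0 exprn_ge0// ltW.
by rewrite lerXn2r// nnegrE// mulr_ge0.
Qed.

(* Nash's inequality at scale c t^2 absorbs the energy up to a small multiple of
   the mass on a larger sublevel set; iterate with t = (2 - s) / 2. *)
Theorem uniform_L2 : exists2 C, 0 <= C & forall r, 0 < r -> r <= 1 -> exists2 e0, 0 < e0 &
  forall e, 0 < e -> e < e0 -> mass r e 1 <= C.
Proof.
(* With q = c t^2 the step has t^4 on the left and (c t^2)^(-d) in the constant term. Multiplying by
   t^(2d) clears the latter, and N = 2 d + 4 is the resulting power of t. *)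
pose N := (d + d + 4)%N.
have p0 : 0 < 2 ^+ N.+1 :> R by rewrite exprn_gt0.
have D0 : 0 <= d%:R * Cw by rewrite mulr_ge0.
(* So small that the energy term becomes at most half of the next value, even after the factor 2^N
   coming from 2 - s = 2 t. *)
pose c := Num.min 1 (2 ^+ N.+1 * (d%:R * Cw + 1))^-1.
have q0 : 0 < 2 ^+ N.+1 * (d%:R * Cw + 1) by rewrite mulr_gt0//; lra.
have c0 : 0 < c by rewrite lt_min ltr01 invr_gt0.
have c1 : c <= 1 by rewrite ge_min lexx.
have hc : 2 ^+ N.+1 * (d%:R * Cw * c) <= 1.
  have : c * (2 ^+ N.+1 * (d%:R * Cw + 1)) <= 1 by rewrite -ler_pdivlMr// mul1r ge_min lexx orbT.
  by rewrite mulrDr mulr1 mulrDr; have := mulr_gt0 c0 p0; move: (2 ^+ N.+1) (d%:R * Cw) => *; lra.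
pose C2 := (c ^+ d)^-1 * (4 * K) ^+ 2.
have C20 : 0 <= C2 by rewrite mulr_ge0 ?sqr_ge0// invr_ge0 exprn_ge0// ltW.
exists (2 * (2 ^+ N * C2)); first by rewrite mulr_ge0// mulr_ge0// exprn_ge0.
move=> r r0 r1; have [e0 e00 he] := step r0 r1.
exists e0 => // e ep ee; have ep' := ltW ep.
have m0 s : 0 <= mass r e s.
  by apply: Int_ge0 => x.
pose phi s := (2 - s) ^+ N * mass r e s.
have mono s : s <= 2 -> mass r e s <= mass r e 2.
  move=> s2; apply: le_Int; [exact: imass|exact: imass|] => x.
  apply: ler_wpM2l; first by apply: mulr_ge0; exact: sqr_ge0.
  rewrite !indicE ler_nat; case: (boolP (x \in lev r s)) => //; rewrite inE /= => h.
  by rewrite mem_set//=; exact: le_trans s2.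
have -> : mass r e 1 = phi 1 by rewrite /phi (_ : 2 - 1 = 1 :> R) ?expr1n ?mul1r//; ring.
apply: (@contraction_iterate phi (2 ^+ N * C2) (mass r e 2)) => //.
- by rewrite mulr_ge0// exprn_ge0.
- move=> s s1 s2; apply: le_trans (mono s (ltW s2)); rewrite ler_piMl// exprn_ile1//; lra.
- move=> s s1 s2; pose t := (2 - s) / 2.
  have t0 : 0 < t by rewrite divr_gt0//; lra.
  have t1 : t <= 1 by rewrite /t; lra.
  have st : s + t = (2 + s) / 2 by rewrite /t; field.
  have st2 : s + t <= 2 by rewrite st; lra.
  have s0 : 0 < s by lra.
  have q1 : 0 < c * t ^+ 2 by rewrite mulr_gt0// exprn_gt0.
  have q2 : c * t ^+ 2 <= 1.
    by rewrite -[leRHS]mulr1 ler_pM ?exprn_ile1 ?exprn_ge0 ?(ltW c0)// ltW.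
  have := he e s t _ ep ee t0 t1 s0 st2 q1 q2.
  rewrite /phi -st; have -> : 2 - (s + t) = t by rewrite /t; field.
  have -> : 2 - s = 2 * t by rewrite /t; field.
  have tN : 0 <= t ^+ (d + d) by rewrite exprn_ge0// ltW.
  move=> /(ler_wpM2l tN); set m1 := mass r e s; set m2 := mass r e (s + t).
  have -> : t ^+ (d + d) * (t ^+ 4 * m1) = t ^+ N * m1 by rewrite mulrA -exprD.
  have -> : t ^+ (d + d) * (d%:R * (c * t ^+ 2) ^+ 2 * Cw * m2 + ((c * t ^+ 2) ^+ d)^-1 * (4 * K) ^+ 2) =
     d%:R * Cw * c * c * (t ^+ N * m2) + C2.
    have eN : t ^+ N = t ^+ (d + d) * t ^+ 4 by rewrite -exprD.
    have eq2 : (c * t ^+ 2) ^+ 2 = c * c * t ^+ 4 by ring.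
    have eqd : (c * t ^+ 2) ^+ d = c ^+ d * t ^+ (d + d) by rewrite exprMn -exprM mul2n -addnn.
    rewrite mulrDr /C2 eN eq2 eqd; congr (_ + _).
      by move: (t ^+ (d + d)) (t ^+ 4) (d%:R) Cw => *; ring.
    have t00 : t ^+ (d + d) != 0 by rewrite expf_neq0// gt_eqF.
    have c00 : c ^+ d != 0 by rewrite expf_neq0// gt_eqF.
    by move: (t ^+ (d + d)) (c ^+ d) t00 c00 => p q t00 c00; field; rewrite t00 c00.
  move=> H; rewrite exprMn -mulrA -[X in 2^-1 * X]/(t ^+ N * m2).
  have tm2 : 0 <= t ^+ N * m2 by rewrite mulr_ge0 ?m0// exprn_ge0// ltW.
  have pN : 0 <= 2 ^+ N :> R by rewrite exprn_ge0.
  apply: le_trans (ler_wpM2l pN H) _; rewrite mulrDr lerD2r.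
  have cc : 2 ^+ N.+1 * (d%:R * Cw * c * c) <= 1.
    rewrite mulrA -[leRHS]mulr1; apply: ler_pM => //; last exact: ltW.
    by apply: mulr_ge0; [exact: ltW|apply: mulr_ge0 => //; exact: ltW].
  have := ler_wpM2r tm2 cc; rewrite exprS -!mulrA mul1r.
  by move: (t ^+ N * m2) => p; lra.
Qed.

End uniform_L2.

(** * Representation of functionals bounded in a weighted L^2 norm *)

Section riesz.
Context {R : realType} {d : nat}.
Notation V := 'rV[R]_d.
Notation mu := (@lebesgue_rV R d).
Implicit Types (f g h u w phi psi : V -> R) (x y z v : V) (e r c s t N L M K : R) (A : set V).

(** The sum of all [a n] has a finite integral, so it is finite almost everywhere and serves as
    [H]. *)
Lemma summable_majorant (a : nat -> V -> R) K : (forall n, intg (a n)) -> (forall n x, 0 <= a n x) ->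
  (forall N : nat, \sum_(0 <= n < N) \int[mu]_x a n x <= K) ->
  exists H, [/\ intg H, forall x, 0 <= H x & {ae mu, forall x, forall n, a n x <= H x}].
Proof.
move=> ia a0 aK; pose S x := (\sum_(0 <= n <oo) (a n x)%:E)%E.
have mE n : measurable_fun setT (fun x => (a n x)%:E) by apply/measurable_EFinP; exact: intg_meas.
have E0 n x : setT x -> (0 <= (a n x)%:E)%E by rewrite lee_fin.
have mS : measurable_fun setT S.
  have := @ge0_emeasurable_sum _ _ R setT (fun n x => (a n x)%:E) xpredT.
  by apply=> [k x _ _|k _]; [rewrite lee_fin|exact: mE].
have S0 x : (0 <= S x)%E by apply: nneseries_ge0 => n _ _; rewrite lee_fin.
have IS : (\int[mu]_x S x <= K%:E)%E.
  rewrite /S (integral_nneseries mu measurableT mE E0); apply: lime_le.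
    by apply: is_cvg_nneseries => n _ _; apply: integral_ge0 => x _; rewrite lee_fin.
  apply: nearW => N; rewrite (eq_bigr (fun n => (\int[mu]_x a n x)%:E)); last by move=> n _; rewrite IntE.
  by rewrite sumEFin lee_fin.
have iS : mu.-integrable setT S.
  apply/integrableP; split => //.
  rewrite (eq_integral S) => [|x _]; last by rewrite gee0_abs.
  by apply: le_lt_trans IS _; rewrite ltry.
exists (fun x => fine (S x)); split.
- apply: (le_integrable measurableT _ _ iS).
    apply/measurable_EFinP; exact: (measurableT_comp (fine_measurable measurableT) mS).
  by move=> x _ /=; case: (S x) (S0 x) => [r| |]//= _; rewrite ?lee_fin// leey.
- by move=> x; exact: fine_ge0.
- have := integrable_ae measurableT iS; apply: filterS => x /(_ Logic.I) fS n.
  rewrite -lee_fin fineK//; apply: le_trans (nneseries_lim_ge n.+1 (fun i _ _ => E0 i x Logic.I)).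
  by rewrite big_nat_recr//= leeDr// sume_ge0// => i _; rewrite lee_fin.
Qed.

Lemma inv_pow_cvg0 (b : nat) : (1 < b)%N -> (fun n => (b%:R ^+ n)^-1 : R) @ \oo --> (0 : R).
Proof.
move=> b1; have b0 : 0 < b%:R :> R by rewrite ltr0n ltnW.
have h : `|b%:R^-1| < 1 :> R by rewrite ger0_norm ?invr_ge0 ?(ltW b0)// invf_lt1// ltr1n.
have -> : (fun n => (b%:R ^+ n)^-1 : R) = GRing.exp (b%:R^-1) by apply/funext => n; rewrite exprVn.
exact: cvg_expr.
Qed.

(** The sequence a n + 2 K / 2^n is nonincreasing and bounded below. *)
Lemma geometric_cvg (a : nat -> R) K : 0 <= K ->
  (forall n, `|a n.+1 - a n| <= K * (2 ^+ n)^-1) ->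
  cvgn a /\ forall n, `|a n - a 0%N| <= 2 * K.
Proof.
move=> K0 ha.
have p0 n : 0 < (2 ^+ n)^-1 :> R by rewrite invr_gt0 exprn_gt0.
have pS n : (2 ^+ n.+1)^-1 = (2 ^+ n)^-1 / 2 :> R by rewrite exprS invfM mulrC.
have bd n : `|a n - a 0%N| <= 2 * K - 2 * K * (2 ^+ n)^-1.
  elim: n => [|n ih]; first by rewrite subrr normr0 expr0 invr1 mulr1 subrr.
  have -> : a n.+1 - a 0%N = (a n.+1 - a n) + (a n - a 0%N) by rewrite addrA subrK.
  apply: le_trans (ler_normD _ _) _; have := ha n; rewrite pS; move: ((2 ^+ n)^-1) ih => q; lra.
have bd' n : `|a n - a 0%N| <= 2 * K.
  by apply: le_trans (bd n) _; rewrite gerBl mulr_ge0// ?mulr_ge0// ltW.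
split => //.
pose b n := a n + 2 * K * (2 ^+ n)^-1.
have cb : cvgn b.
  apply: nonincreasing_is_cvgn.
    apply/nonincreasing_seqP => n; rewrite /b pS; have := ha n; rewrite ler_norml => /andP[_].
    by move: ((2 ^+ n)^-1) => q; lra.
  exists (a 0%N - 2 * K) => _ [n _ <-]; have := bd' n; rewrite ler_norml => /andP[h _].
  have : 0 <= 2 * K * (2 ^+ n)^-1 by rewrite mulr_ge0 ?mulr_ge0// ltW.
  by rewrite /b; lra.
have cp : (fun n => 2 * K * (2 ^+ n)^-1 : R) @ \oo --> (0 : R).
  rewrite -[X in _ --> X](mulr0 (2 * K)); apply: cvgMr.
  exact: (@inv_pow_cvg0 2).
have -> : a = (fun n => b n - 2 * K * (2 ^+ n)^-1) by apply/funext => n; rewrite /b addrK.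
by apply: is_cvgB => //; apply/cvg_ex; exists 0.
Qed.

Variables (wt : V -> R) (T : (V -> R) -> R) (B : R).
Hypotheses (cwt : continuous wt) (wt0 : forall x, 0 < wt x) (hT : locfun T).
Hypothesis TB : forall f, Cc f -> T f <= B + 2^-1 * \int[mu]_x (f x ^+ 2 * wt x).

(** The minimizer of this functional represents [T]; the hypothesis [TB] bounds it from below by -
    B. *)
Let J f := 2^-1 * \int[mu]_x (f x ^+ 2 * wt x) - T f.

Let cprod f g : Cc f -> Cc g -> Cc (fun x => f x * g x * wt x).
Proof. by move=> cf cg; apply: CcMr => //; exact: CcMl cf.1 cg. Qed.

Let csqr f : Cc f -> Cc (fun x => f x ^+ 2 * wt x).
Proof. by move=> cf; exact: cprod. Qed.

Let Int_sqr_add f g t : Cc f -> Cc g -> \int[mu]_x ((f x + t * g x) ^+ 2 * wt x) =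
  \int[mu]_x (f x ^+ 2 * wt x) + 2 * t * \int[mu]_x (f x * g x * wt x) + t ^+ 2 * \int[mu]_x (g x ^+ 2 * wt x).
Proof.
move=> cf cg; have i1 := Cc_intg (csqr cf); have i2 := Cc_intg (cprod cf cg); have i3 := Cc_intg (csqr cg).
rewrite -(IntZ _ i2) -(IntZ _ i3) -(IntD i1 (intgZ _ i2)) -(IntD (intgD i1 (intgZ _ i2)) (intgZ _ i3)).
by apply: eq_Int => x; move: (f x) (g x) (wt x) => p q r; ring.
Qed.

Let J_add f g t : Cc f -> Cc g -> J (fun x => f x + t * g x) =
  J f + t * (\int[mu]_x (f x * g x * wt x) - T g) + t ^+ 2 / 2 * \int[mu]_x (g x ^+ 2 * wt x).
Proof.
move=> cf cg; rewrite /J (Int_sqr_add t cf cg) (locfunD hT cf (CcZ t cg)) (locfunZ t hT cg).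
by set i1 := \int[mu]_x _; set i2 := \int[mu]_x _; set i3 := \int[mu]_x _;
  clearbody i1 i2 i3; move: (T f) (T g) => p q; field.
Qed.

Let Jset : set R := [set a | exists2 f, Cc f & a = J f].

Let Jinf : has_inf Jset.
Proof.
split.
  exists (J (fun=> 0)), (fun=> 0) => //; split; last by exists 0.
  exact: Ck_cont (@Ck_cst R d 0 0).
exists (- B) => _ [f cf ->]; have := TB cf; rewrite /J.
by set i1 := \int[mu]_x _; clearbody i1; move: (T f) => p; lra.
Qed.

Let m := inf Jset.

Let J_ge f : Cc f -> m <= J f.
Proof. by move=> cf; apply: ge_inf; [exact: Jinf.2|exists f]. Qed.

Let parallelogram f g : Cc f -> Cc g ->
  \int[mu]_x ((f x - g x) ^+ 2 * wt x) <= 4 * (J f + J g - 2 * m).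
Proof.
move=> cf cg; pose h x := f x + (-1) * g x.
have ch : Cc h := CcD cf (CcZ (-1) cg).
have := J_ge (CcD cf (CcZ (- 2^-1) ch)); rewrite (J_add (- 2^-1) cf ch).
have E : J g = J (fun x => f x + (-1) * h x).
  by congr J; apply/funext => x; rewrite /h; ring.
rewrite E (J_add (-1) cf ch) (@eq_Int _ _ (fun x => (f x - g x) ^+ 2 * wt x) (fun x => h x ^+ 2 * wt x)).
  set i1 := \int[mu]_x _; set i2 := \int[mu]_x (_ ^+ 2 * _); clearbody i1 i2; move: (T h) (J f) m => p q r; lra.
by move=> x; rewrite /h mulN1r.
Qed.

(** By the parallelogram bound the squared increments have integrals of order 8^(-n). Multiplied by
    4^n they are still summable, and a finite majorant of these products gives pointwise increments
    of order 2^(-n). *)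
Let dl (n : nat) : R := (8 ^+ n)^-1.

Let minimizing : exists f : nat -> V -> R, forall n, Cc (f n) /\ J (f n) <= m + dl n.
Proof.
have h n : exists f, Cc f /\ J f <= m + dl n.
  have d0 : 0 < dl n by rewrite invr_gt0 exprn_gt0.
  have [_ [f cf ->] h] := inf_adherent d0 Jinf.
  by exists f; split => //; exact: ltW.
by have [f hf] := choice h; exists f.
Qed.

(* The minimizers of J form a Cauchy sequence by the parallelogram identity. *)
Theorem riesz_representation : exists G : V -> R, [/\ measurable_fun setT G, intg (fun x => G x ^+ 2 / wt x) &
  forall g, Cc g -> intg (fun x => G x * g x) /\ \int[mu]_x (G x * g x) = T g].
Proof.
have [f hf] := minimizing; have cf n := (hf n).1.
have dl0 n : 0 < dl n by rewrite invr_gt0 exprn_gt0.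
have dlS n : dl n.+1 = dl n / 8 by rewrite /dl exprS invfM mulrC.
pose a n x := 4 ^+ n * ((f n.+1 x - f n x) ^+ 2 * wt x).
have cD n : Cc (fun x => f n.+1 x - f n x).
  by have := CcD (cf n.+1) (CcZ (-1) (cf n)); under eq_fun do rewrite mulN1r.
have ia n : intg (a n) by apply: intgZ; apply: Cc_intg; exact: (csqr (cD n)).
have a0 n x : 0 <= a n x.
  by apply: mulr_ge0; [exact: exprn_ge0|apply: mulr_ge0; [exact: sqr_ge0|exact: ltW]].
have Ia n : \int[mu]_x a n x <= 8 * (2 ^+ n)^-1.
  rewrite /a (IntZ _ (Cc_intg (csqr (cD n)))).
  have h := parallelogram (cf n.+1) (cf n).
  have {h} : \int[mu]_x ((f n.+1 x - f n x) ^+ 2 * wt x) <= 8 * dl n.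
    apply: le_trans h _; have := (hf n).2; have := (hf n.+1).2; rewrite dlS; have := dl0 n.
    by move: (J _) (J _) (dl n) m => p q r s; lra.
  have p4 : 0 <= 4 ^+ n :> R by exact: exprn_ge0.
  move=> /(ler_wpM2l p4) h; apply: le_trans h _; rewrite mulrCA ler_wpM2l// /dl.
  by rewrite (_ : 8 = 4 * 2 :> R) ?exprMn ?invfM ?mulrA ?divff ?mul1r ?expf_neq0//; ring.
have SIa (N : nat) : \sum_(0 <= n < N) \int[mu]_x a n x <= 16.
  suff : \sum_(0 <= n < N) \int[mu]_x a n x <= 16 - 16 * (2 ^+ N)^-1.
    by move=> h; apply: le_trans h _; rewrite gerBl mulr_ge0// invr_ge0 exprn_ge0.
  elim: N => [|N ih]; first by rewrite big_nil expr0 invr1 mulr1 subrr.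
  rewrite big_nat_recr//=; have := Ia N; rewrite exprS invfM.
  by move: ih; set i1 := \sum_(0 <= n < N) _; set i2 := \int[mu]_x _; clearbody i1 i2; move: ((2 ^+ N)^-1) => q; lra.
have [H [iH H0 aH]] := summable_majorant ia a0 SIa.
pose A := [set x | forall n, a n x <= H x].
have mA : measurable A.
  have -> : A = \bigcap_n [set x | a n x - H x <= 0].
    by apply/seteqP; split => x h n => [_ /=|]; [rewrite subr_le0; exact: h|rewrite -subr_le0; exact: h].
  apply: bigcapT_measurable => n.
  have mf : measurable_fun setT (fun x => a n x - H x) by apply: measurable_funB; exact: intg_meas.
  have := mf measurableT (`]-oo, 0]%classic) (measurable_itv _); rewrite setTI.
  have -> // : (fun x => a n x - H x) @^-1` `]-oo, 0]%classic = [set x | a n x - H x <= 0].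
  by apply/seteqP; split => x /=; rewrite in_itv.
(* Cutting to the set [A] of full measure makes the sequence converge at every point. *)
pose g n x := f n x * \1_A x.
have mg n : measurable_fun setT (g n).
  apply: measurable_funM; last exact: measurable_indic.
  exact: continuous_measurable_rV (cf n).1.
pose K x := Num.sqrt (H x / wt x).
have K0 x : 0 <= K x by exact: sqrtr_ge0.
have K2 x : K x ^+ 2 * wt x = H x by rewrite sqr_sqrtr ?divfK ?gt_eqF// divr_ge0// ltW.
have step x n : `|g n.+1 x - g n x| <= K x * (2 ^+ n)^-1.
  rewrite /g -mulrBl indicE; case: (boolP (x \in A)); last first.
    by rewrite mulr0 normr0 mulr_ge0// invr_ge0 exprn_ge0.
  rewrite inE mulr1 => /(_ n); rewrite /a -{1}(K2 x) mulrA ler_pM2r//.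
  have p2 : 0 < 2 ^+ n :> R by rewrite exprn_gt0.
  have -> : 4 ^+ n = (2 ^+ n) ^+ 2 :> R by rewrite -exprM mulnC exprM; congr (_ ^+ n); ring.
  rewrite -exprMn -(real_normK (num_real _)) => h.
  rewrite ler_pdivlMr//; have := h; rewrite normrM (ger0_norm (ltW p2)) mulrC.
  by rewrite ler_sqr ?nnegrE// mulr_ge0// ltW.
have gc x : cvgn (g ^~ x) /\ forall n, `|g n x - g 0%N x| <= 2 * K x := geometric_cvg (K0 x) (step x).
pose G0 x := limn (g ^~ x).
have gG x : g ^~ x @ \oo --> G0 x by exact: (gc x).1.
have mG0 : measurable_fun setT G0.
  by apply: (measurable_fun_cvg mg) => x _; exact: gG.
pose dom x := 2 * (f 0%N x ^+ 2 * wt x) + 8 * H x.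
have idom : intg dom by apply: intgD; apply: intgZ => //; apply: Cc_intg; exact: csqr.
have gdom n x : g n x ^+ 2 * wt x <= dom x.
  have h1 := (gc x).2 n.
  have h2 : g 0%N x ^+ 2 <= f 0%N x ^+ 2.
    rewrite /g exprMn indicE; case: (_ \in _); rewrite ?expr1n ?mulr1// expr0n mulr0 sqr_ge0//.
  have h3 : (g n x - g 0%N x) ^+ 2 <= (2 * K x) ^+ 2.
    by rewrite -(real_normK (num_real _)) lerXn2r// nnegrE// mulr_ge0.
  have h4 : g n x ^+ 2 <= 2 * f 0%N x ^+ 2 + 8 * K x ^+ 2.
    have := sqr_ge0 (g n x - 2 * g 0%N x); move: h2 h3.
    by move: (g n x) (g 0%N x) (f 0%N x) (K x) => p q r s; rewrite !expr2; lra.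
  rewrite /dom -K2; have := ler_wpM2r (ltW (wt0 x)) h4.
  by rewrite mulrDl !mulrA.
have Gdom x : G0 x ^+ 2 * wt x <= dom x.
  have cv : (fun n => g n x ^+ 2 * wt x) @ \oo --> G0 x ^+ 2 * wt x.
    by apply: cvgMl; rewrite expr2; under eq_fun do rewrite expr2; apply: cvgM; exact: gG.
  rewrite -(cvg_lim _ cv)//; apply: limr_le; first by apply/cvg_ex; exists (G0 x ^+ 2 * wt x).
  exact: nearW.
have mwt := continuous_measurable_rV cwt.
(* The limit [G0] represents [T] against the measure wt dx; the density with respect to dx carries
   the factor [wt]. *)
exists (fun x => G0 x * wt x); split.
- exact: measurable_funM.
- apply: (@eq_intg _ _ (fun x => G0 x ^+ 2 * wt x)).
    by move=> x; have := wt0 x; move: (G0 x) (wt x) => p q q0; field; rewrite gt_eqF.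
  apply: le_intg idom; first by apply: measurable_funM => //; exact: measurable_funX.
  by move=> x; rewrite ger0_norm// mulr_ge0 ?sqr_ge0// ltW.
move=> phi cphi.
pose Q := \int[mu]_x (phi x ^+ 2 * wt x).
have Q0 : 0 <= Q by apply: Int_ge0 => x; rewrite mulr_ge0 ?sqr_ge0// ltW.
have mphi := continuous_measurable_rV cphi.1.
have [|x|n x||iG cvG] := @Int_dct R d (fun n x => g n x * phi x * wt x) (fun x => G0 x * phi x * wt x)
   (fun x => dom x + phi x ^+ 2 * wt x).
- by move=> n; apply: measurable_funM => //; exact: measurable_funM.
- by apply: cvgMl; apply: cvgMl; exact: gG.
- have w0 := ltW (wt0 x); rewrite normrM (ger0_norm w0).
  apply: le_trans (lerD (gdom n x) (lexx _)); rewrite -mulrDl ler_wpM2r//.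
  have h1 := sqr_ge0 (`|g n x| - `|phi x|); rewrite normrM -(real_normK (num_real (g n x))) -(real_normK (num_real (phi x))).
  by have := normr_ge0 (g n x); have := normr_ge0 (phi x); move: (`|g n x|) (`|phi x|) h1 => p q; nra.
- by apply: intgD => //; apply: Cc_intg; exact: csqr.
have eG x : G0 x * wt x * phi x = G0 x * phi x * wt x by rewrite mulrAC.
split; first exact: eq_intg (fun x => esym (eG x)) iG.
rewrite (eq_Int eG).
set I0 := \int[mu]_x _ in cvG *.
have ef n : \int[mu]_x (g n x * phi x * wt x) = \int[mu]_x (f n x * phi x * wt x).
  apply: eq_Int_ae.
  - by apply: measurable_funM => //; exact: measurable_funM.
  - exact: continuous_measurable_rV (cprod (cf n) cphi).1.
  - apply: filterS aH => x hx; rewrite /g indicE mem_set ?mulr1//.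
(* The limit of J (f n + t phi) >= m: the first-order condition, without a minimum attained in
   [Cc]. *)
have ineq t : 0 <= t * (I0 - T phi) + t ^+ 2 / 2 * Q.
  have cv1 : (fun n => dl n + t * (\int[mu]_x (g n x * phi x * wt x) - T phi) + t ^+ 2 / 2 * Q) @ \oo -->
     0 + t * (I0 - T phi) + t ^+ 2 / 2 * Q.
    apply: cvgD; last exact: cvg_cst.
    apply: cvgD.
      exact: (@inv_pow_cvg0 8).
    by apply: cvgMr; apply: cvgB => //; exact: cvg_cst.
  rewrite add0r in cv1; rewrite -(cvg_lim _ cv1)//; apply: limr_ge.
    by apply/cvg_ex; eexists; exact: cv1.
  apply: nearW => n; rewrite ef.
  have := J_ge (CcD (cf n) (CcZ t cphi)); rewrite (J_add t (cf n) cphi) -/Q.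
  by have := (hf n).2; move: (J (f n)) (dl n) m (t * _) (t ^+ 2 / 2 * Q) => p q r s z; lra.
apply/eqP; rewrite -subr_eq0; apply/eqP; set X := I0 - T phi in ineq *.
have Q1 : 0 < Q + 1 by lra.
(* A value of t that makes the quadratic negative unless X = 0; the 1 in Q + 1 avoids dividing by Q
   = 0. *)
have := ineq (- (X / (Q + 1))).
have -> : - (X / (Q + 1)) * X + (- (X / (Q + 1))) ^+ 2 / 2 * Q = - (X ^+ 2 * (Q + 2) / (2 * (Q + 1) ^+ 2)).
  by field; rewrite gt_eqF.
rewrite oppr_ge0 => h.
have X2 : X ^+ 2 <= 0.
  have c0 : 0 < (Q + 2) / (2 * (Q + 1) ^+ 2).
    by apply: divr_gt0; [lra|apply: mulr_gt0 => //; exact: exprn_gt0].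
  by move: h; rewrite -mulrA; rewrite pmulr_lle0.
by apply/eqP; rewrite -sqrf_eq0 eq_le X2 sqr_ge0.
Qed.

End riesz.

(** * Existence of a positive stationary density *)

Section existence.
Context {R : realType} {d : nat}.
Notation V := 'rV[R]_d.
Notation mu := (@lebesgue_rV R d).
Implicit Types (f g h u w phi psi : V -> R) (x y z v : V) (e r c s t L M K : R) (A : set V).

Lemma intg_ae f g : intg f -> measurable_fun setT g -> {ae mu, forall x, f x = g x} -> intg g.
Proof.
move=> intf mg fg; have mf := intg_meas intf; move: intf => /integrableP[_ foo].
apply/integrableP; split; first exact/measurable_EFinP.
rewrite (ge0_ae_eq_integral (g := fun x => `|(f x)%:E|%E)) => //.
- by apply: measurableT_comp => //; exact/measurable_EFinP.
- by apply: measurableT_comp => //; exact/measurable_EFinP.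
- by apply: filterS fg => x h _ /=; rewrite h.
Qed.

Lemma intg_monotone u C : measurable_fun setT u -> (forall x, 0 <= u x) -> locL1 u ->
  (forall n : nat, \int[mu]_x (u x * \1_(cube n%:R) x) <= C) -> intg u.
Proof.
move=> mu_ u0 [_ lu] hC.
pose g (n : nat) x := (u x * \1_(cube n%:R) x)%:E.
have mg n : measurable_fun setT (g n).
  by apply/measurable_EFinP; apply: measurable_funM => //; exact: measurable_indic_cube.
have g0 n x : setT x -> (0 <= g n x)%E by move=> _; rewrite lee_fin mulr_ge0// indicE.
have gmono x : setT x -> {homo g ^~ x : n m / (n <= m)%N >-> (n <= m)%E}.
  move=> _ n p np; rewrite /g lee_fin ler_wpM2l//; apply: indic_cube_le; by rewrite ler_nat.
have gl x : limn (g ^~ x) = (u x)%:E.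
  apply: cvg_lim => //; apply: cvg_near_cst; exists (Num.bound `|x|) => // n /= hn.
  rewrite /g indic_cube_in ?mulr1//; apply: le_trans (ltW (archi_boundP (normr_ge0 x))) _.
  by rewrite ler_nat.
have MC := monotone_convergence mu measurableT mg g0 gmono.
apply/integrableP; split; first exact/measurable_EFinP.
rewrite (eq_integral (fun x => limn (g ^~ x))) => [|x _]; last by rewrite gl gee0_abs// lee_fin.
rewrite MC; apply: (@le_lt_trans _ _ C%:E); last by rewrite ltry.
apply: lime_le.
  apply: ereal_nondecreasing_is_cvgn => n p np.
  by apply: ge0_le_integral => // x _; first [exact: g0|exact: (gmono x Logic.I n p np)].
by apply: nearW => n; rewrite /g IntE// lee_fin.
Qed.

(** The negative part of [u] is at most |mol u e - u|, which tends to 0 in L^1 of every cube. *)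
Lemma mol_ge0_ae u : locL1 u -> (forall e x, 0 < e -> 0 <= mol u e x) ->
  {ae mu, forall x, 0 <= u x}.
Proof.
move=> hu hm.
have h n : {ae mu, forall x, Num.max 0 (- u x) * \1_(cube n%:R) x = 0}.
  have mneg : measurable_fun setT (fun x => Num.max 0 (- u x)).
    by apply: measurable_maxr => //; apply: measurableT_comp => //; exact: hu.1.
  have m0 x : 0 <= Num.max 0 (- u x) by rewrite le_max lexx.
  have in_ : intg (fun x => Num.max 0 (- u x) * \1_(cube n%:R) x).
    apply: le_intg (intg_norm (hu.2 n%:R)).
      by apply: measurable_funM => //; exact: measurable_indic_cube.
    move=> x; rewrite !normrM ler_wpM2r// (ger0_norm (m0 x)) ge_max normr_ge0/=.
    by rewrite -normrN ler_norm.
  have nn x : 0 <= Num.max 0 (- u x) * \1_(cube n%:R) x by apply: mulr_ge0.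
  apply: Int_eq0_ae => //; apply/eqP; rewrite eq_le Int_ge0// andbT.
  apply/ler_addgt0Pr => c c0; rewrite add0r; have [e0 e00 he] := mol_cvg_L1 n%:R hu c0.
  have e2 : 0 < e0 / 2 by rewrite divr_gt0.
  have e2' : e0 / 2 < e0 by lra.
  apply: le_trans (he _ e2 e2'); apply: le_Int => //.
    have l1 : locL1 (mol u (e0 / 2)) by apply: continuous_locL1; apply: mol_continuous => //; exact: ltW.
    have l2 := locL1_norm (locL1D l1 (locL1Z (-1) hu)).
    by apply: eq_intg (l2.2 n%:R) => x /=; rewrite mulN1r.
  move=> x; apply: ler_wpM2r => //.
  rewrite ge_max normr_ge0/=; apply: le_trans (ler_norm _).
  by have := hm (e0 / 2) x e2; lra.
have h2 : {ae mu, forall x, forall n : nat, Num.max 0 (- u x) * \1_(cube n%:R) x = 0}.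
  by apply: ae_foralln => n; exact: h.
apply: filterS h2 => x /(_ (Num.bound `|x|)); rewrite indic_cube_in ?mulr1; last exact: ltW (archi_boundP _).
by move=> hx; have : - u x <= Num.max 0 (- u x) by [rewrite le_max lexx orbT]; rewrite hx; lra.
Qed.

Theorem stationary_density k (B0 a : R) (F : 'I_d -> V -> R) : (0 < d)%N -> 0 <= k -> 0 <= a ->
  admissible_drift k B0 a F ->
  exists G : V -> R, [/\ forall x, 0 < G x, intg G, \int[mu]_x G x = 1,
    intg (fun x => G x ^+ 2 * rho k x ^+ 2) &
    forall phi, test_function phi -> \int[mu]_x (G x * adjoint F phi x) = 0].
Proof.
move=> d0 k0 a0 [lF hA hrad hdiv0].
have cF i : continuous (F i) by exact: liploc_continuous.
(* Then k <= n + 1, so [weight n.+1] dominates [rho k], as the L^2 estimate requires. *)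
pose n := Num.bound k.
have kn : k <= n.+1%:R by apply: le_trans (ltW (archi_boundP k0)) _; rewrite ler_nat leqnSn.
have [T [C [TL Tp T1 Tadj [C0 Tw]]]] := invariant_functional n d0 cF hrad.
have eqnT := fp_invariant lF TL Tp T1 Tadj.
have lT : locfun T by have [] := eqnT.
have [K K0 hK] := density_moment TL Tp T1 C0 Tw.
(* The slack eta = 1 in the divergence bound of the mollified drift is absorbed into B0 + 1. *)
have hdiv M : exists2 dl, 0 < dl & forall x, `|x| <= M ->
  \sum_(i < d) partial i (mol (F i) dl) x <= k * (radial F x / (1 + nsq x)) + (B0 + 1) /\
  forall i, `|mol (F i) dl x - F i x| <= 1.
  have [e0 e00 he] := hdiv0 M 1 ltr01.
  have h i : exists b : R, 0 < b /\ forall e x, 0 < e -> e < b -> `|x| <= M -> `|mol (F i) e x - F i x| <= 1.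
    by have [b b0 hb] := mol_cvg_unif M (@cF i) ltr01; exists b.
  have [b hb] := choice h.
  have b0 i : 0 < (b i)^-1 by rewrite invr_gt0; case: (hb i).
  (* 1/s lies below e0 and below every [b i], so a single radius serves all components. *)
  pose s := e0^-1 + \sum_i (b i)^-1 + 1.
  have S0 : 0 <= \sum_i (b i)^-1 by apply: sumr_ge0 => i _; exact: ltW.
  have e0i : 0 < e0^-1 by rewrite invr_gt0.
  have s0 : 0 < s by rewrite /s; lra.
  have si : 0 < s^-1 by rewrite invr_gt0.
  have lt_inv p : 0 < p -> p^-1 < s -> s^-1 < p.
    by move=> p0 ps; rewrite -[p]invrK ltf_pV2// posrE invr_gt0.
  exists s^-1 => // x xM; split.
    by have := he s^-1 x si (lt_inv _ e00 _) xM; rewrite addrA; apply; rewrite /s; lra.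
  move=> i; apply: (hb i).2 => //; apply: lt_inv; first by case: (hb i).
  have : (b i)^-1 <= \sum_i (b i)^-1.
    by rewrite (bigD1 i)//= lerDl sumr_ge0// => j _; exact: ltW.
  by rewrite /s; lra.
have [C1 C10 hC1] := uniform_L2 k0 kn a0 K0 cF hA hdiv eqnT (density_ge0 Tp) (density_commutator lF TL Tp) hK.
(* The dual weight: boundedness of [T] in this norm puts its density in L^2 with weight rho^2. *)
pose wt x := (rho k x ^+ 2)^-1.
have r2 x : 0 < rho k x ^+ 2 by rewrite exprn_gt0// rho_gt0.
have wt0 x : 0 < wt x by rewrite invr_gt0.
have crho : Ck 0 (@rho R d k) := CkW (Ck_rho k).1.
have krho2 : Ck 0 (fun x => rho k x ^+ 2) := CkM crho crho.
have cwt : continuous wt by exact: Ck_cont (Ck_inv r2 krho2).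
have TB f : Cc f -> T f <= 2^-1 * C1 + 2^-1 * \int[mu]_x (f x ^+ 2 * wt x).
  move=> cf; apply/ler_addgt0Pr => c c0.
  have [M hM] := cf.2.
  (* Small enough for the support of [f] to lie in r |x|^2 <= 1. *)
  pose r := (1 + d%:R * M ^+ 2)^-1.
  have q0 : 0 <= d%:R * M ^+ 2 by rewrite mulr_ge0// sqr_ge0.
  have r0 : 0 < r by rewrite invr_gt0; lra.
  have r1 : r <= 1 by rewrite invf_le1; lra.
  have [e1 e10 he1] := hC1 r r0 r1; have [e2 e20 he2] := density_limit TL Tp T1 cf c0.
  pose e := Num.min e1 e2 / 2.
  have em : 0 < Num.min e1 e2 by rewrite lt_min e10.
  have e0 : 0 < e by rewrite divr_gt0.
  have ee1 : e < e1 by apply: (@lt_le_trans _ _ (Num.min e1 e2)); [rewrite /e; lra|rewrite ge_min lexx].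
  have ee2 : e < e2 by apply: (@lt_le_trans _ _ (Num.min e1 e2)); [rewrite /e; lra|rewrite ge_min lexx orbT].
  have := he1 e e0 ee1; have := he2 e e0 ee2.
  rewrite ler_norml => /andP[+ _].
  pose u := conv T (moll e); rewrite -/u.
  have ku : Ck 0 u by apply: (Ck_density TL Tp T1) => //; exact: ltW.
  have ku2 : Ck 0 (fun x => u x ^+ 2) := CkM ku ku.
  have i1 : intg (fun x => u x ^+ 2 * rho k x ^+ 2 * \1_[set x0 | r * nsq x0 <= 1] x).
    by apply: intg_sublevel => //; [exact: Ck_cont (CkM ku2 krho2)|lra].
  have i2 : intg (fun x => f x ^+ 2 * wt x).
    by apply: Cc_intg; apply: CcMr cwt; exact: CcMl cf.1 cf.
  (* Pointwise 2 u f <= (u rho)^2 + (f / rho)^2, the first term being needed only on a sublevel set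
     that contains the support of [f]. *)
  have : \int[mu]_x (u x * f x) <= 2^-1 * \int[mu]_x (u x ^+ 2 * rho k x ^+ 2 * \1_[set x0 | r * nsq x0 <= 1] x) +
     2^-1 * \int[mu]_x (f x ^+ 2 * wt x).
    rewrite -(IntZ _ i1) -(IntZ _ i2) -(IntD (intgZ _ i1) (intgZ _ i2)).
    apply: le_Int; [by apply: Cc_intg; exact: CcMl (Ck_cont ku) cf|by apply: intgD; exact: intgZ|].
    move=> x; have [xM|xM] := lerP `|x| M; last first.
      rewrite hM// mulr0 expr0n mul0r mulr0 addr0; apply: mulr_ge0 => //; apply: mulr_ge0 => //.
      by apply: mulr_ge0; exact: sqr_ge0.
    rewrite indicE mem_set/=; last first.
      have h1 : nsq x <= d%:R * M ^+ 2.
        apply: le_trans (nsq_le x) _; rewrite ler_wpM2l// lerXn2r// nnegrE//.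
        exact: le_trans xM.
      by rewrite /r mulrC ler_pdivrMr ?mul1r; lra.
    rewrite mulr1 /wt; have h := sqr_ge0 (u x * rho k x - f x / rho k x).
    have := rho_gt0 k x; move: h; move: (u x) (f x) (rho k x) => p q s h s0.
    have -> : (s ^+ 2)^-1 = s^-1 ^+ 2 by rewrite exprVn.
    have e3 : (p * s) * (q / s) = p * q by field; rewrite gt_eqF.
    have e4 : (p * s - q / s) ^+ 2 = p ^+ 2 * s ^+ 2 - 2 * ((p * s) * (q / s)) + q ^+ 2 * s^-1 ^+ 2 by ring.
    by rewrite e4 e3 in h; lra.
  set j1 := \int[mu]_x _; set j2 := \int[mu]_x _; set j3 := \int[mu]_x _; clearbody j1 j2 j3.
  by move: (T f) => q; lra.
have [G0 [mG0 iG02 hG0]] := riesz_representation cwt wt0 lT TB.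
have lG0 : locL1 G0.
  split => // M; have cM := @Cc_cutoff R d M 0.
  apply: le_intg (intg_norm (hG0 _ cM).1).
    by apply: measurable_funM => //; exact: measurable_indic_cube.
  move=> x; rewrite !normrM ler_wpM2l//; have [xM|xM] := lerP `|x| M.
    by rewrite indic_cube_in// cutoff_in.
  by rewrite indic_cube_out// normr0.
have G0pos : {ae mu, forall x, 0 <= G0 x}.
  apply: mol_ge0_ae => // e x e0; have cm := Cc_moll_shift x (ltW e0).
  rewrite molE (hG0 _ cm).2; apply: Tp; first exact: Cc_bnd.
  by move=> y; exact: moll_ge0.
(* Turns nonnegativity almost everywhere into nonnegativity at every point, the form in which
   [solution_positive] takes it. *)
pose G1 x := `|G0 x|.
have G1E : {ae mu, forall x, G0 x = G1 x} by apply: filterS G0pos => x h; rewrite /G1 ger0_norm.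
have mG1 : measurable_fun setT G1 by exact: measurableT_comp.
have lG1 : locL1 G1 by exact: locL1_norm.
have hG1 g : Cc g -> \int[mu]_x (G1 x * g x) = T g.
  move=> cg; rewrite -(hG0 g cg).2; have mg := continuous_measurable_rV cg.1.
  apply: eq_Int_ae; [exact: measurable_funM|exact: measurable_funM|].
  by apply: filterS G1E => x ->.
have b1 : bnd (fun _ : V => 1 : R) by exists 1 => x; rewrite normr1.
have Tle1 g : Cc g -> (forall x, g x <= 1) -> T g <= 1.
  move=> cg g1; have := TL (-1) g (fun=> 1) (Cc_bnd cg) b1; rewrite T1 mulN1r => E.
  have : 0 <= T (fun x => -1 * g x + 1).
    apply: Tp; last by move=> x; have := g1 x; lra.
    have [B hB] := Cc_bnd cg; exists (B + 1) => x; apply: le_trans (ler_normD _ _) _.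
    by rewrite normr1 mulN1r normrN lerD2r.
  by rewrite E; lra.
have iG1 : intg G1.
  apply: (@intg_monotone G1 1 mG1 (fun x => normr_ge0 (G0 x)) lG1) => N.
  have cN := @Cc_cutoff R d N%:R 0.
  apply: le_trans (Tle1 _ cN _); last by move=> x; case/andP: (cutoff01 N%:R 1 x).
  rewrite -(hG1 _ cN); apply: le_Int; [exact: lG1.2|exact: locL1_Cc|].
  move=> x; apply: ler_wpM2l; first exact: normr_ge0.
  have [xM|xM] := lerP `|x| N%:R.
    by rewrite indic_cube_in// cutoff_in.
  by rewrite indic_cube_out//; case/andP: (cutoff01 N%:R 1 x).
pose I1 := \int[mu]_x G1 x.
have I10 : 0 < I1.
  (* With this M, C / M <= 1/2, so at least half of the mass stays under the cutoff. *)
  pose M := 2 * C + 1; have M1 : 1 <= M by rewrite /M; lra.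
  have M0 : 0 < M by lra.
  have := mass_bound TL T1 Tw M1; have cM := @Cc_cutoff R d M 0.
  rewrite -(hG1 _ cM) => h.
  have h2 : C / M <= 2^-1 by rewrite ler_pdivrMr// /M; lra.
  have h3 : \int[mu]_x (G1 x * cutoff M 1 x) <= I1.
    apply: le_Int => //; first exact: locL1_Cc.
    by move=> x; apply: ler_piMr; [exact: normr_ge0|case/andP: (cutoff01 M 1 x)].
  by move: h h3; set j1 := \int[mu]_x _; clearbody j1; lra.
(* The identity T g = int G1 g is known for compactly supported g only, so T 1 = 1 does not give G1
   mass 1; hence the normalization. *)
pose G2 x := I1^-1 * G1 x.
have iG2 : intg G2 by exact: intgZ.
have IG2 : \int[mu]_x G2 x = 1 by rewrite /G2 (IntZ _ iG1) mulVf// gt_eqF.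
have G20 x : 0 <= G2 x by apply: mulr_ge0; [rewrite invr_ge0 ltW|exact: normr_ge0].
have lG2 : locL1 G2 by exact: intg_locL1.
have eqG2 phi : test_function phi -> \int[mu]_x (G2 x * adjoint F phi x) = 0.
  move=> /test_Ck_Cc[kp cp]; have cA := Cc_adjoint cF (kp 2%N) cp.
  rewrite (@eq_Int _ _ _ (fun x => I1^-1 * (G1 x * adjoint F phi x))); last by move=> x; rewrite /G2 mulrA.
  rewrite (IntZ _ (locL1_Cc lG1 cA)) (hG1 _ cA) (Tadj _ (kp 2%N) cp) mulr0//.
have G2pos : {ae mu, forall x, 0 < G2 x}.
  have [h|//] := solution_positive lG2 G20 cF ((fp_pairingP lG2 cF).2 eqG2).
  exfalso; move: IG2; rewrite (@eq_Int_ae _ _ _ (fun=> 0)) ?Int0//; last exact: intg_meas.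
  by move/eqP; rewrite eq_sym oner_eq0.
have mG2 := intg_meas iG2.
(* A null set; adding its indicator makes the density positive at every point without changing any
   integral. *)
pose Z := [set x | G2 x = 0].
have mZ : measurable Z.
  have := mG2 measurableT [set 0] (measurable_set1 _); rewrite setTI.
  by have -> : G2 @^-1` [set 0] = Z.
pose G x := G2 x + \1_Z x.
have GE : {ae mu, forall x, G2 x = G x}.
  apply: filterS G2pos => x h; rewrite /G indicE memNset ?addr0// /Z /= => h0.
  by rewrite h0 ltxx in h.
have mG : measurable_fun setT G by apply: measurable_funD => //; exact: measurable_indic.
have mrho : measurable_fun setT (fun x => rho k x ^+ 2) by exact: continuous_measurable_rV (Ck_cont krho2).
exists G; split.
- move=> x; rewrite /G indicE; have [h|h] := eqVneq (G2 x) 0.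
    by rewrite mem_set// h add0r.
  have : 0 < G2 x by rewrite lt0r h G20.
  by move=> h'; rewrite ltr_wpDr//; case: (_ \in _).
- exact: intg_ae iG2 mG GE.
- by rewrite -IG2; apply: eq_Int_ae => //; apply: filterS GE => x ->.
- have i2 : intg (fun x => (I1^-1) ^+ 2 * (G0 x ^+ 2 / wt x)) by exact: intgZ.
  apply: intg_ae i2 _ _; first by apply: measurable_funM => //; exact: measurable_funX.
  apply: filterS GE => x <-; rewrite /G2 /G1 /wt invrK exprMn real_normK ?num_real//.
  by rewrite mulrA.
- move=> phi tp; rewrite -(eqG2 phi tp); have [kp cp] := test_Ck_Cc tp.
  have mA := continuous_measurable_rV (Cc_adjoint cF (kp 2%N) cp).1.
  apply: eq_Int_ae; [exact: measurable_funM|exact: measurable_funM|].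
  by apply: filterS GE => x ->.
Qed.

End existence.

(** * Passage to the space L^2_k and the operator of the statement *)

Section assembly.
Context {R : realType} {d : nat}.
Notation V := 'rV[R]_d.
Notation mu := (@lebesgue_rV R d).
Implicit Types (f g h u w phi : V -> R) (x : V) (k : R).

Lemma Lfun2P f : f \in Lfun mu 2%:E <-> measurable_fun setT f /\ intg (fun x => f x ^+ 2).
Proof.
split=> [hf|[mf intf]].
  split; last exact: Lfun2_integrable_sqr.
  by move: hf; rewrite inE => /andP[]; rewrite inE.
rewrite inE; apply/andP; split; first by rewrite inE.
rewrite inE /= /finite_norm unlock /Lnorm; apply: poweR_lty.
rewrite (eq_integral (fun x => (f x ^+ 2)%:E)) => [|x _]; last first.
  by rewrite /= powR_mulrn// real_normK// num_real.
by rewrite IntE// ltry.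
Qed.

Lemma rho_ge1 k x : 0 <= k -> 1 <= rho k x.
Proof.
move=> k0; apply: le_trans (expR_ge1Dx _); rewrite lerDl mulr_ge0 ?divr_ge0//.
by rewrite ln_ge0// lerDl nsq_ge0.
Qed.

Lemma L2k_weighted k f : 0 <= k -> measurable_fun setT f ->
  intg (fun x => f x ^+ 2 * rho k x ^+ 2) -> L2k k f.
Proof.
move=> k0 mf intf; split; last first.
  rewrite (eq_integral (fun x => (f x ^+ 2 * rho k x ^+ 2)%:E)) => [|x _]; last first.
    by rewrite rho_sqr real_normK// num_real.
  by rewrite IntE// ltry.
apply/Lfun2P; split => //; apply: le_intg intf; first exact: measurable_funX.
move=> x; rewrite ger0_norm ?sqr_ge0// ler_peMr ?sqr_ge0// exprn_ege1//; exact: rho_ge1.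
Qed.

Lemma FP_distributionP (E : V -> V) (F : 'I_d -> V -> R) u : (forall i, continuous (F i)) ->
  (forall i, measurable_fun setT (fun x => E x ord0 i)) ->
  {ae mu, forall x, forall i, E x ord0 i = F i x} -> measurable_fun setT u ->
  FP_distribution E u (cst 0) <-> forall phi, test_function phi -> \int[mu]_x (u x * adjoint F phi x) = 0.
Proof.
move=> cF mE EF mu_.
have key phi : test_function phi -> \int[mu]_x (u x * (laplacian phi x - dotp (E x) (grad phi x))) =
    \int[mu]_x (u x * adjoint F phi x).
  move=> /test_Ck_Cc[kp cp].
  have mp i : measurable_fun setT (partial i phi).
    exact: continuous_measurable_rV (Ck_cont (Ck_partial i (kp 1%N))).
  have ml : measurable_fun setT (laplacian phi).
    by apply: continuous_measurable_rV; exact: Ck_cont (Ck_sum _ (fun i => Ck_partial i (Ck_partial i (kp 2%N)))).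
  apply: eq_Int_ae.
  - apply: measurable_funM => //; apply: measurable_funB => //.
    rewrite /dotp /grad; under eq_fun do under eq_bigr do rewrite mxE.
    by apply: measurable_sum => i; exact: measurable_funM.
  - apply: measurable_funM => //; apply: continuous_measurable_rV.
    exact: (Cc_adjoint cF (kp 2%N) cp).1.
  - apply: filterS EF => x h; rewrite /adjoint sumrB /dotp /grad /laplacian.
    by under [X in _ * (_ - X) = _]eq_bigr do rewrite mxE h.
have z phi : \int[mu]_x (cst 0 x * phi x) = 0.
  by rewrite (@eq_Int _ _ _ (fun=> 0)) ?Int0// => x; rewrite mul0r.
by split=> h phi tp; have := h phi tp; rewrite key// z.
Qed.

Lemma intg_of_integral f : measurable_fun setT f -> {ae mu, forall x, 0 < f x} ->
  (\int[mu]_x (f x)%:E = 1)%E -> intg f.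
Proof.
move=> mf f0 f1; apply/integrableP; split; first exact/measurable_EFinP.
rewrite (ae_eq_integral (fun x => (f x)%:E)) ?f1 ?ltry//; last first.
- by apply: filterS f0 => x h _ /=; rewrite ger0_norm// ltW.
- exact/measurable_EFinP.
- by apply: measurableT_comp => //; exact/measurable_EFinP.
Qed.

End assembly.

Theorem theorem1p1 (R : realType) (d : nat) (E : 'rV[R]_d -> 'rV[R]_d)
    (divE : 'rV[R]_d -> R) (k alpha alpha2 beta beta2 gamma gamma2 beta0 : R)
    (d_gt0 : (0 < d)%N)
    (E_W1infty : loc_W1infty E)
    (divE_div : weak_divergence E divE)
    (k_gt0 : 0 < k)
    (alpha_gt0 : 0 < alpha) (alpha2_gt0 : 0 < alpha2)
    (gamma_gt1 : 1 < gamma) (gamma_le : gamma <= gamma2) (gamma2_le2 : gamma2 <= 2)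
    (E_growth : forall x, alpha * enorm x `^ gamma - beta <= dotp x (E x)
                       /\ dotp x (E x) <= alpha2 * enorm x `^ gamma2 + beta2)
    (divE_bound : {ae @lebesgue_rV R d, forall x,
       beta0 <= - divE x + k * dotp ((1 + enorm x ^+ 2)^-1 *: x) (E x)}) :
  exists G : 'rV[R]_d -> R,
    [/\ L2k k G, forall x, 0 < G x, FP_operator k E G (cst 0)
      & (\int[@lebesgue_rV R d]_x (G x)%:E = 1)%E]
    /\ forall H : 'rV[R]_d -> R,
      [/\ L2k k H, {ae @lebesgue_rV R d, forall x, 0 < H x},
          FP_operator k E H (cst 0)
        & (\int[@lebesgue_rV R d]_x (H x)%:E = 1)%E] ->
      {ae @lebesgue_rV R d, forall x, H x = G x}.
Proof.
have k0 := ltW k_gt0.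
have mE i : measurable_fun setT (fun x => E x ord0 i) by have [[]] := E_W1infty i.
have [A [F [A0 adm EF]]] := drift_version E_W1infty divE_div k_gt0 alpha_gt0 alpha2_gt0
  gamma_gt1 gamma_le gamma2_le2 E_growth divE_bound.
have [lF hA _ _] := adm.
have cF i : continuous (F i) by exact: liploc_continuous.
have [G [G0 iG IG iG2 eqG]] := stationary_density d_gt0 k0 A0 adm.
have mG := intg_meas iG.
have LG : L2k k G by exact: L2k_weighted.
have L0 : L2k k (cst (0 : R) : 'rV[R]_d -> R).
  apply: L2k_weighted => //; apply: (eq_intg _ (@intg0 R d)) => x.
  by rewrite expr0n mul0r.
exists G; split.
  split => //; last by rewrite IntE// IG.
  by split => //; apply/(FP_distributionP cF mE EF mG).
move=> H [LH H0 [_ _ eqH] IH].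
have [mH iH2] := (Lfun2P H).1 LH.1.
(* Drawn from the finite integral of a positive function, because for small k membership in L^2_k
   does not imply integrability. *)
have iH : intg H by exact: intg_of_integral.
have {}eqH := (FP_distributionP cF mE EF mH).1 eqH.
have IH' : \int[lebesgue_rV]_x H x = 1 by apply: EFin_inj; rewrite -IntE.
pose w x := H x - G x.
have iw : intg w by exact: intgB.
have iG2' := ((Lfun2P G).1 LG.1).2.
have iw2 : intg (fun x => w x ^+ 2).
  apply: (@le_intg _ _ _ (fun x => 2 * H x ^+ 2 + 2 * G x ^+ 2)).
  - by apply: measurable_funX; exact: intg_meas iw.
  - move=> x; rewrite ger0_norm ?sqr_ge0// /w; have := sqr_ge0 (H x + G x).
    by move: (H x) (G x) => p q; rewrite !expr2; lra.
  - by apply: intgD; exact: intgZ.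
have eqw : forall phi, test_function phi -> \int[lebesgue_rV]_x (w x * adjoint F phi x) = 0.
  move=> phi tp; have [kp cp] := test_Ck_Cc tp; have cA := Cc_adjoint cF (kp 2%N) cp.
  rewrite (@eq_Int _ _ _ (fun x => H x * adjoint F phi x - G x * adjoint F phi x)); last first.
    by move=> x; rewrite /w mulrBl.
  by rewrite IntB ?eqH ?eqG ?subrr//; apply: locL1_Cc => //; exact: intg_locL1.
have w0 : \int[lebesgue_rV]_x w x = 0 by rewrite /w IntB// IH' IG subrr.
have := mean_zero_solution iw iw2 lF A0 hA ((fp_pairingP (intg_locL1 iw) cF).2 eqw) w0.
by apply: filterS => x /eqP; rewrite subr_eq0 => /eqP.
Qed.
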